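(* Let $\mathcal A$ be the Airy$_2$ process, let $m\ge1$, and for $r_0,\dots,r_m\in\mathbb R$ and $y_1,\dots,y_m\in\mathbb R$ let $$H(y_1,\dots,y_m,r_0,\dots,r_m)=\mathbb P\big(\mathcal A(0)\le r_0,\ \mathcal A(y_1)\le r_1,\dots,\mathcal A(y_m)\le r_m\big),$$ $$\Psi=\mathcal D_r\log H,\qquad \psi=\mathcal D_r\Psi,\qquad \mathcal D_r=\partial_{r_0}+\partial_{r_1}+\cdots+\partial_{r_m}.$$ Then, for $0,y_1,\dots,y_m$ pairwise distinct, these logarithmic derivatives satisfy the PDE $$-\tfrac16\psi+\tfrac12\mathcal D_r(\psi^2)+\tfrac1{12}\mathcal D_r^3\psi-\tfrac13\sum_{a=0}^mr_a\partial_{r_a}\psi-\tfrac23\sum_{a=1}^my_a\partial_{y_a}\psi-\sum_{a=1}^m\ \sum_{\substack{b=0\\ b\ne a}}^m y_a^2\,\partial_{r_a}\partial_{r_b}\Psi+\sum_{\substack{a,b=1\\ a\ne b}}^m y_ay_b\,\partial_{r_a}\partial_{r_b}\Psi=0,$$ with boundary condition $\psi(0,\dots,0,r_0,\dots,r_m)=\psi^{\mathrm{nw}}(\min(r_0,\dots,r_m))$.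
   Context: The Airy$_2$ process $\mathcal A(x)$, $x\in\mathbb R$, is the stationary process $\mathcal A(x)=\mathfrak h(1,x;\mathfrak d_0)+x^2$, where $\mathfrak h(t,x;\mathfrak d_0)$ is the KPZ fixed point started from the narrow wedge $\mathfrak d_0(0)=0$, $\mathfrak d_0(x)=-\infty$ for $x\ne0$. Equivalently, for $x_0<\dots<x_m$, $\mathbb P(\mathcal A(x_i)\le r_i,\ i=0,\dots,m)=\det(\mathbf I-\mathbf K_{\mathrm{ext}})$ on $\bigoplus_{i}L^2([r_i,\infty))$, with the extended Airy kernel $\mathbf K_{\mathrm{ext}}(x,u;x',v)=\int_0^\infty e^{-\lambda(x-x')}\mathrm{Ai}(u+\lambda)\mathrm{Ai}(v+\lambda)\,d\lambda$ if $x\ge x'$ and $-\int_{-\infty}^0e^{-\lambda(x-x')}\mathrm{Ai}(u+\lambda)\mathrm{Ai}(v+\lambda)\,d\lambda$ if $x<x'$. $\psi^{\mathrm{nw}}=-\mathfrak q^2$, where $\mathfrak q$ is the Hastings--McLeod solution of Painlev\'e II, $\mathfrak q''=r\mathfrak q+2\mathfrak q^3$, $\mathfrak q(r)\sim-\mathrm{Ai}(r)$ as $r\to\infty$; it solves $(\psi^{\mathrm{nw}})'''+12\psi^{\mathrm{nw}}(\psi^{\mathrm{nw}})'-4r(\psi^{\mathrm{nw}})'-2\psi^{\mathrm{nw}}=0$, and $\psi^{\mathrm{nw}}=(\log F_{\mathrm{GUE}})''$ with $F_{\mathrm{GUE}}$ the GUE Tracy--Widom distribution function.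
   Formalization: Where min(r_0,…,r_m) is attained more than once, the partial derivatives in D_r do not exist at y=0; there the boundary condition is stated with D_r read as the derivative along (1,…,1); for the literal ψ it is stated wherever the minimum is attained once. *)

(* Defs.v *)
From HB Require Import structures.
From mathcomp Require Import all_boot all_order all_algebra.
From mathcomp Require Import all_classical all_reals all_analysis.
Set Implicit Arguments.
Unset Strict Implicit.
Unset Printing Implicit Defensive.
Import Order.TTheory GRing.Theory Num.Theory.
Import numFieldNormedType.Exports.
Local Open Scope classical_set_scope.
Local Open Scope ring_scope.

(* The integral of cos (t^3 / 3 + x t) over [0, +oo[ converges only
   conditionally, hence the limit of the integrals over [0, b]. *)
Definition airy {R : realType} (x : R) : R :=
  pi^-1 * lim ((\int[lebesgue_measure]_(t in `[0, b])
                  cos (t ^+ 3 / 3 + x * t)) @[b --> +oo]).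

Definition ext_airy_kernel {R : realType} (x u x' v : R) : R :=
  if x' <= x then
    \int[lebesgue_measure]_(l in `[0, +oo[)
      (expR (- l * (x - x')) * airy (u + l) * airy (v + l))
  else
    - \int[lebesgue_measure]_(l in `]-oo, 0])
      (expR (- l * (x - x')) * airy (u + l) * airy (v + l)).

(* The k-fold iterated integral of F over the disjoint union of the half-lines
   [r i, +oo[, whose points are the pairs (i, u) with r i <= u. *)
Fixpoint iter_integral {R : realType} n (r : 'I_n -> R) k :
    (k.-tuple ('I_n * R) -> R) -> R :=
  if k is k'.+1 then fun F =>
    \sum_(i < n) \int[lebesgue_measure]_(u in `[r i, +oo[)
      iter_integral r (fun z : k'.-tuple ('I_n * R) => F (cons_tuple (i, u) z))
  else fun F => F [tuple].

(* The Fredholm determinant det(I - K) on the direct sum over i < n of the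
   spaces L^2([r i, +oo[), given by its Fredholm series; (i, u), (j, v) |->
   K i u j v is the matrix kernel of the operator K. *)
Definition fredholm_det {R : realType} n (r : 'I_n -> R)
    (K : 'I_n -> R -> 'I_n -> R -> R) : R :=
  lim (series (fun k : nat =>
    (-1) ^+ k / k`!%:R *
    iter_integral r (fun z : k.-tuple ('I_n * R) =>
      \det (\matrix_(a < k, b < k)
              K (tnth z a).1 (tnth z a).2 (tnth z b).1 (tnth z b).2))) @ \oo).

(* The finite-dimensional distributions characterize the law of the process. *)
Definition is_airy2 {R : realType} d (T : measurableType d)
    (P : probability T R) (A : R -> {RV P >-> R}) : Prop :=
  forall (n : nat) (x r : 'I_n.+1 -> R),
    (forall i j : 'I_n.+1, (i < j)%N -> x i < x j) ->
    P [set w | forall i, A (x i) w <= r i] =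
    (fredholm_det r (fun i u j v => ext_airy_kernel (x i) u (x j) v))%:E.

Definition is_hastings_mcleod {R : realType} (q : R -> R) : Prop :=
  [/\ forall r : R, derivable q r 1,
      forall r : R, is_derive r 1 (q^`())%classic (r * q r + 2 * q r ^+ 3)
    & q r / - airy r @[r --> +oo] --> (1 : R)].

Definition partial {R : realType} {n} (a : 'I_n) (f : 'rV[R]_n -> R)
    (r : 'rV[R]_n) : R :=
  'D_(delta_mx 0 a) f r.

Definition has_partial {R : realType} {n} (a : 'I_n) (f : 'rV[R]_n -> R)
    (r : 'rV[R]_n) : Prop :=
  derivable f r (delta_mx 0 a).

Definition Dr {R : realType} {n} (f : 'rV[R]_n -> R) (r : 'rV[R]_n) : R :=
  \sum_(a < n) partial a f r.

(* The vector field Dr = sum_a d/dr_a as the derivative along (1, ..., 1). It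
   agrees with Dr f wherever f is differentiable, but it also makes sense for
   functions of min (r_0, ..., r_m) at points where the minimum is attained more
   than once, where the single partial derivatives do not exist. *)
Definition Ddiag {R : realType} {n} (f : 'rV[R]_n -> R) (r : 'rV[R]_n) : R :=
  'D_(const_mx 1) f r.

Section LogDerivatives.
Context {R : realType} {d : measure_display} {T : measurableType d}
  {P : probability T R}.
Variables (A : R -> {RV P >-> R}) (m : nat).

(* The coordinates r_0, r_1, ..., r_m are r 0 ord0 and r 0 (lift ord0 a) for
   a < m; the coordinates y_1, ..., y_m are y 0 a for a < m. *)
Definition joint_cdf (y : 'rV[R]_m) (r : 'rV[R]_m.+1) : R :=
  fine (P [set w | A 0 w <= r 0 ord0 /\
                   forall a : 'I_m, A (y 0 a) w <= r 0 (lift ord0 a)]).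

Definition log_cdf (y : 'rV[R]_m) (r : 'rV[R]_m.+1) : R := ln (joint_cdf y r).

Definition Psi (y : 'rV[R]_m) : 'rV[R]_m.+1 -> R := Dr (log_cdf y).

Definition psi (y : 'rV[R]_m) : 'rV[R]_m.+1 -> R := Dr (Psi y).

(* The derivatives occurring in the equation exist; needed because 'D_v f is a
   total operator. *)
Definition has_pde_derivatives (y : 'rV[R]_m) : Prop :=
  forall r : 'rV[R]_m.+1,
  [/\ forall a, [/\ has_partial a (log_cdf y) r, has_partial a (Psi y) r &
        forall b, has_partial a (partial b (Psi y)) r],
      forall a, [/\ has_partial a (psi y) r, has_partial a (Dr (psi y)) r
        & has_partial a (Dr (Dr (psi y))) r]
    & forall a, has_partial a (fun y' => psi y' r) y].

End LogDerivatives.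

(* Main.v *)
(* Idea. Put the point r_i + kappa o on the half-line [r_i, +oo[ and replace the Fredholm determinant by the
   determinant of 1 - h K on the grid of the o = j / N, j < N^2, with h = kappa / N. Hadamard's inequality makes the
   von Koch expansion of these determinants converge, with all derivatives in the y_i, r_i and kappa. Write D for the
   sum of the d/dr_i, X for the sum of the d/dy_i + 2 y_i d/dr_i and T for
   - (kappa d/dkappa + sum r_i d/dr_i + 2 sum y_i d/dy_i) / 3 - sum y_i^2 d/dr_i. After a conjugation, D K is of rank
   one and X K, T K are of rank two and three, already on the grid, so that phi = ln det (1 - h K) satisfies exactly
   D T phi + (D D phi)^2 / 2 + D^4 phi / 12 + X X phi / 4 = 0. In the limit phi does not depend on kappa and is
   invariant under translation of the y_i; applying D once more gives the equation.
   The distribution function is positive because along the diagonal it is analytic, monotone and not identically 0.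
   If all y_i vanish it is the one-point function at min (r_0, ..., r_m). There the equation has a first integral,
   which turns it into Painleve II for the square root of - psi. The traces of K on the grid give psi ~ - Ai^2 at +oo;
   this kills the constant of integration, and a Wronskian argument identifies the solution with that of Hastings and
   McLeod near +oo. Uniqueness for the third-order equation extends this to the whole line. *)
Require Import Defs.
From HB Require Import structures.
From mathcomp Require Import all_boot all_order all_algebra.
From mathcomp Require Import all_classical all_reals all_analysis.
Set Implicit Arguments.
Unset Strict Implicit.
Unset Printing Implicit Defensive.
Import Order.TTheory GRing.Theory Num.Theory.
Import numFieldNormedType.Exports.
Local Open Scope classical_set_scope.
Local Open Scope ring_scope.
From mathcomp Require Import measurable_realfun ring lra.

(** * Calculus on half-lines *)

Section DerivativeRules.
Context {R : realType}.
Implicit Types (f g : R -> R) (x a b : R).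

(** The difficulty is that the parameters move the kernel and the half-lines at the same time. On a
    grid everything is exact matrix calculus, provided that the vector fields move all grid points
    as they move the levels. T rescales the levels, so it has to rescale the spacing too: kappa is a
    coordinate for this reason only, and it is absent from the limit. The kernel has one branch for
    each order of two times; near pairwise distinct times the branch of every entry is constant, and
    there the entries are smooth. A derivative in kappa brings out the offset of the grid point,
    which is unbounded along the half-line, so bounds that include this direction hold with
    constants depending on the order. For directions that fix kappa the k-th derivatives are bounded
    by S k! rho^k, uniformly in N, and this is the analyticity behind positivity. The sign of Ai
    near +oo is not computed: the asymptotic condition on q already forces Ai to keep a sign
    there. *)

Lemma drv_eq f a b x : is_derive x 1 f a -> a = b -> is_derive x 1 f b.
Proof. by move=> + <-. Qed.

Lemma drv_cst a x : is_derive x 1 (fun=> a : R) 0.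
Proof. exact: is_derive_cst. Qed.

Lemma drv_id x : is_derive x 1 (fun y : R => y) 1.
Proof. exact: is_derive_id. Qed.

Lemma drvD f g a b x : is_derive x 1 f a -> is_derive x 1 g b ->
  is_derive x 1 (fun y => f y + g y) (a + b).
Proof. by move=> ? ?; exact: is_deriveD. Qed.

Lemma drvN f a x : is_derive x 1 f a -> is_derive x 1 (fun y => - f y) (- a).
Proof. by move=> ?; exact: is_deriveN. Qed.

Lemma drvM f g a b x : is_derive x 1 f a -> is_derive x 1 g b ->
  is_derive x 1 (fun y => f y * g y) (a * g x + f x * b).
Proof.
move=> Hf Hg; have H := @is_deriveM R _ f g x 1 a b Hf Hg.
apply: (drv_eq H); change (f x * b + g x * a = a * g x + f x * b).
by rewrite addrC mulrC.
Qed.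

Lemma drvX f a x n : is_derive x 1 f a ->
  is_derive x 1 (fun y => f y ^+ n.+1) (n.+1%:R * f x ^+ n * a).
Proof.
move=> Hf; elim: n => [|n IH].
  rewrite expr0 mul1r mul1r; have -> // : (fun y => f y ^+ 1) = f.
  by apply/funext => y; rewrite expr1.
have -> : (fun y => f y ^+ n.+2) = (fun y => f y * f y ^+ n.+1).
  by apply/funext => y; rewrite exprS.
apply: (drv_eq (drvM Hf IH)).
by rewrite [X in _ = X]mulrAC !exprS -[n.+2]addn1 natrD; ring.
Qed.

Lemma drv_comp f g a b x : is_derive x 1 f a -> is_derive (f x) 1 g b ->
  is_derive x 1 (fun y => g (f y)) (b * a).
Proof. by move=> ? ?; exact: is_derive1_comp. Qed.

Lemma drv_exp f a x : is_derive x 1 f a ->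
  is_derive x 1 (fun y => expR (f y)) (expR (f x) * a).
Proof. by move=> Hf; apply: drv_comp. Qed.

Lemma drv_cos f a x : is_derive x 1 f a ->
  is_derive x 1 (fun y => cos (f y)) (- sin (f x) * a).
Proof. by move=> Hf; apply: drv_comp. Qed.

Lemma drv_sin f a x : is_derive x 1 f a ->
  is_derive x 1 (fun y => sin (f y)) (cos (f x) * a).
Proof. by move=> Hf; apply: drv_comp. Qed.

Lemma drv_continuous f a x : is_derive x 1 f a -> {for x, continuous f}.
Proof. by move=> Hf; apply/differentiable_continuous/derivable1_diffP. Qed.

Lemma drv_ext f g a x : f =1 g -> is_derive x 1 f a -> is_derive x 1 g a.
Proof. by move=> /funext ->. Qed.

Lemma drv_sum (I : Type) (s : seq I) (f : I -> R -> R) (a : I -> R) x :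
  (forall i, is_derive x 1 (f i) (a i)) ->
  is_derive x 1 (fun y => \sum_(i <- s) f i y) (\sum_(i <- s) a i).
Proof.
move=> H; elim: s => [|i s IH].
  by rewrite big_nil; apply: drv_ext (drv_cst 0 x) => y; rewrite big_nil.
rewrite big_cons; apply: drv_ext (drvD (H i) IH) => y.
by rewrite big_cons.
Qed.
End DerivativeRules.

Ltac der_rules := repeat (first
  [ eassumption | apply: drv_cst | apply: drv_id
  | eapply drvD | eapply drvN | eapply drvX | eapply drvM
  | eapply drv_exp | eapply drv_cos | eapply drv_sin ]).
Ltac der := eapply drv_eq; [der_rules | idtac].

Section HalfLine.
Context {R : realType}.
Notation mu := (@lebesgue_measure R).
Implicit Types (f g F G : R -> R) (r c C : R).

(** Continuity and this bound give measurability, integrability and a dominating function at once;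
    the integrals defining Ai and its kernel are handled through it. *)
Definition exp_dominated r c C f :=
  continuous f /\ forall l, r <= l -> `|f l| <= C * expR (- c * l).

Lemma cvg_expRN c : 0 < c -> expR (- c * x) @[x --> +oo%R] --> (0 : R).
Proof.
move=> c0; rewrite (_ : (fun x => expR (- c * x)) =
  (fun z => expR (- z)) \o (fun z => c * z)); last first.
  by apply/funext => x /=; rewrite mulNr.
apply: (@cvg_comp _ _ _ _ _ _ (pinfty_nbhs R)); last exact: cvgr_expR.
exact: gt0_cvgMry.
Qed.

Lemma half_line_integral_ge0 f F r :
  (forall x, r <= x -> 0 <= f x) -> continuous f ->
  (forall x : R, is_derive x 1 F (f x)) -> F x @[x --> +oo%R] --> (0 : R) ->
  mu.-integrable `[r, +oo[ (EFin \o f) /\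
  \int[mu]_(x in `[r, +oo[) f x = - F r.
Proof.
move=> f0 cf dF F0.
have I : (\int[mu]_(x in `[r, +oo[) (f x)%:E = 0%:E - (F r)%:E)%E.
  apply: ge0_continuous_FTC2y => //.
  - exact: continuous_subspaceT.
  - by apply: cvg_at_right_filter; exact: (drv_continuous (dF r)).
  - by move=> x _; rewrite derive1E; have := dF x => ?; rewrite derive_val.
have mf : measurable_fun `[r, +oo[%classic f.
  by apply: measurable_funTS; exact: continuous_measurable_fun.
split; last by rewrite /Rintegral I /= sub0r.
apply/integrableP; split; first exact/measurable_EFinP.
under eq_integral => x.
  rewrite inE /= in_itv /= andbT => rx.
  rewrite ger0_norm ?f0//; over.
by rewrite I -EFinB ltry.
Qed.

Lemma expRN_integral r c : 0 < c ->
  mu.-integrable `[r, +oo[ (EFin \o (fun l => expR (- c * l))) /\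
  \int[mu]_(x in `[r, +oo[) expR (- c * x) = expR (- c * r) / c.
Proof.
move=> c0; have := @half_line_integral_ge0 (fun l => expR (- c * l))
  (fun l => - (c^-1 * expR (- c * l))) r.
case.
- by move=> x _; exact: expR_ge0.
- by move=> x; apply: drv_continuous; der_rules.
- by move=> x; der; rewrite /= mul0r add0r mulr1; field; rewrite gt_eqF.
- rewrite -[X in _ --> X](_ : - (c^-1 * 0) = 0); last by rewrite mulr0 oppr0.
  by apply: cvgN; apply: cvgMr; exact: cvg_expRN.
by move=> -> ->; rewrite opprK mulrC.
Qed.

Lemma expRN_integrableZ r c C : 0 < c ->
  mu.-integrable `[r, +oo[ (EFin \o (fun l => C * expR (- c * l))).
Proof.
move=> c0; have I := (expRN_integral r c0).1.
have : mu.-integrable `[r, +oo[ (fun x => C%:E * (expR (- c * x))%:E)%E.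
  exact: integrableZl.
by apply: eq_integrable.
Qed.

Lemma exp_dominated_integrable r c C f : 0 < c -> exp_dominated r c C f ->
  mu.-integrable `[r, +oo[ (EFin \o f).
Proof.
move=> c0 [cf fC].
have iC : mu.-integrable `[r, +oo[ (EFin \o (fun l => C * expR (- c * l))).
  exact: expRN_integrableZ.
apply: le_integrable iC => //.
  by apply/measurable_EFinP; apply: measurable_funTS; exact: continuous_measurable_fun.
move=> x /=; rewrite in_itv /= andbT => rx.
by rewrite lee_fin (le_trans (fC _ rx)) // ler_norm.
Qed.

Lemma exp_dominated_bound r c C f : 0 < c -> exp_dominated r c C f ->
  `|\int[mu]_(x in `[r, +oo[) f x| <= C * expR (- c * r) / c.
Proof.
move=> c0 df; have If := exp_dominated_integrable c0 df.
apply: le_trans (le_normr_Rintegral _ If) _ => //.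
rewrite -mulrA -(expRN_integral r c0).2 -RintegralZl //; last exact: (expRN_integral r c0).1.
apply: le_Rintegral => //.
- by apply: (@integrable_norm _ _ _ mu) => //.
- exact: expRN_integrableZ.
- by move=> x /=; rewrite in_itv /= andbT => rx; exact: df.2.
Qed.

Lemma half_line_FTC r c C f F : 0 < c -> exp_dominated r c C f ->
  (forall x : R, is_derive x 1 F (f x)) -> F x @[x --> +oo%R] --> (0 : R) ->
  \int[mu]_(x in `[r, +oo[) f x = - F r.
Proof.
move=> c0 df dF F0; have If := exp_dominated_integrable c0 df.
have [Ie Ee] := expRN_integral r c0.
have IC : mu.-integrable `[r, +oo[ (EFin \o (fun l => C * expR (- c * l))).
  exact: expRN_integrableZ.
(* Adding the dominating exponential makes the integrand nonnegative; its own integral is known and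
   is subtracted at the end. *)
have := @half_line_integral_ge0 (fun l => f l + C * expR (- c * l))
  (fun l => F l - C / c * expR (- c * l)) r.
case.
- move=> x rx; rewrite -lerBlDr sub0r; have := df.2 _ rx.
  by rewrite ler_norml => /andP[].
- move=> x; apply: (@continuousD R R R f); first exact: df.1.
  by apply: drv_continuous; der_rules.
- move=> x; have := dF x => dFx; der.
  by rewrite /= mul0r !add0r mulr1; field; rewrite gt_eqF.
- rewrite -[X in _ --> X](_ : 0 - C / c * 0 = 0); last by rewrite mulr0 subr0.
  by apply: cvgB => //; apply: cvgMr; exact: cvg_expRN.
move=> _; rewrite RintegralD // RintegralZl // Ee => E.
have -> : \int[mu]_(x in `[r, +oo[) f x =
  - (F r - C / c * expR (- c * r)) - C * (expR (- c * r) / c).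
  by rewrite -E addrK.
by rewrite opprB -addrA; ring.
Qed.

Lemma half_line_reflect c C f : 0 < c -> continuous f ->
  (forall l, 0 <= l -> `|f (- l)| <= C * expR (- c * l)) ->
  \int[mu]_(x in `]-oo, 0]) f x = \int[mu]_(x in `[0, +oo[) f (- x).
Proof.
move=> c0 cf fC.
have ce : continuous (fun x : R => C * expR (c * x)).
  by move=> x; apply: drv_continuous; der_rules.
have C0 : 0 <= C.
  by have := fC 0 (lexx _); rewrite mulr0 expR0 mulr1; apply: le_trans.
(* The substitution is made for nonnegative functions, then applied to [f] plus the dominating
   exponential and to that exponential alone. *)
have sub g : continuous g -> (forall x, x <= 0 -> 0 <= g x) ->
  (\int[mu]_(x in `]-oo, 0%R]) (g x)%:E = \int[mu]_(x in `[0%R, +oo[) (g (- x))%:E)%E.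
  move=> cg g0; rewrite -{1}oppr0 ge0_integration_by_substitutionNy //.
  - exact: continuous_subspaceT.
  - by move=> x; rewrite oppr0 in_itv /= => /ltW /g0.
have [Ie Ee] := expRN_integral 0 c0.
have cN g : continuous g -> continuous (fun x => g (- x)).
  by move=> cg x; apply: continuous_comp; [exact: opp_continuous|exact: cg].
have dNe : exp_dominated 0 c C (fun x => C * expR (c * - x)).
  split; first exact: (cN _ ce).
  by move=> l _; rewrite mulNr mulrN ger0_norm // mulr_ge0 // expR_ge0.
have dNf : exp_dominated 0 c C (fun x => f (- x)) by split; [exact: (cN _ cf)|].
have INe := exp_dominated_integrable c0 dNe.
have INf := exp_dominated_integrable c0 dNf.
have mg g : continuous g -> measurable_fun `]-oo, (0:R)]%classic (EFin \o g : R -> \bar R).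
  move=> cg; apply/measurable_EFinP; apply: measurable_funTS.
  exact: continuous_measurable_fun.
have Int g : continuous g -> (forall x, x <= 0 -> 0 <= g x) ->
  mu.-integrable `[0, +oo[ (EFin \o (fun x => g (- x))) ->
  mu.-integrable `]-oo, 0] (EFin \o g : R -> \bar R).
  move=> cg g0 /integrableP[_ h]; apply/integrableP; split; first exact: mg.
  under eq_integral => x.
    rewrite inE /= in_itv /= => rx; rewrite ger0_norm ?g0//; over.
  rewrite sub //; move: h; under eq_integral => x.
    rewrite inE /= in_itv /= andbT => rx.
    rewrite ger0_norm; last by apply: g0; rewrite oppr_le0.
    over.
  by [].
have e0 x : x <= 0 -> 0 <= C * expR (c * x) by move=> _; rewrite mulr_ge0 // expR_ge0.
have fe0 x : x <= 0 -> 0 <= f x + C * expR (c * x).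
  move=> x0; rewrite -lerBlDr sub0r; have := fC (- x); rewrite opprK oppr_ge0.
  by move=> /(_ x0); rewrite mulrN mulNr opprK ler_norml => /andP[].
have cfe : continuous (fun x => f x + C * expR (c * x)).
  by move=> x; apply: (@continuousD R R R f); [exact: cf|exact: ce].
have IC := Int _ ce e0 INe.
have ID : mu.-integrable `]-oo, 0] (EFin \o (fun x => f x + C * expR (c * x))).
  apply: Int => //; have := integrableD _ INf INe.
  move=> /(_ (measurable_itv _)); by apply: eq_integrable.
have If : mu.-integrable `]-oo, 0] (EFin \o f).
  have := integrableB _ ID IC.
  move=> /(_ (measurable_itv _)); by apply: eq_integrable => // x _ /=; rewrite -EFinB addrK.
have := congr1 fine (sub _ cfe fe0); rewrite -/(Rintegral _ _ _) -/(Rintegral _ _ _).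
rewrite !RintegralD //.
by have := congr1 fine (sub _ ce e0); rewrite -/(Rintegral _ _ _) -/(Rintegral _ _ _) => -> /addIr.
Qed.

Lemma half_line_derive (f f' : R -> R -> R) r a e c C : 0 < e -> 0 < c ->
  (forall s l : R, is_derive s 1 (fun s => f s l) (f' s l)) ->
  (forall s, `|s - a| < e -> exp_dominated r c C (f s)) ->
  (forall s, `|s - a| < e -> exp_dominated r c C (f' s)) ->
  is_derive a 1 (fun s => \int[mu]_(l in `[r, +oo[) f s l)
                (\int[mu]_(l in `[r, +oo[) f' a l).
Proof.
move=> e0 c0 df Ef Ef'.
have aI : `](a - e), (a + e)[%classic a.
  by rewrite /= in_itv /= ltrBlDr !ltrDl e0.
have sI s : `](a - e), (a + e)[%classic s -> `|s - a| < e.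
  by rewrite /= in_itv /= ltr_norml => /andP[? ?]; apply/andP; split; lra.
have intf s : `](a - e), (a + e)[%classic s -> mu.-integrable `[r, +oo[ (EFin \o f s).
  by move=> /sI /Ef; exact: exp_dominated_integrable.
have derf s l : `](a - e), (a + e)[%classic s -> `[r, +oo[%classic l -> derivable (f ^~ l) s 1.
  by move=> _ _; have := df s l => ?; exact: ex_derive.
have C0 : 0 <= C.
  have := (Ef _ (sI _ aI)).2 _ (lexx r) => /(le_trans (normr_ge0 _)).
  by rewrite pmulr_lge0 // expR_gt0.
have G0 l : 0 <= C * expR (- c * l) by rewrite mulr_ge0 // expR_ge0.
have iG : mu.-integrable `[r, +oo[ (EFin \o (fun l => C * expR (- c * l))).
  exact: expRN_integrableZ.
have ub s l : `](a - e), (a + e)[%classic s -> `[r, +oo[%classic l ->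
    `|partial1of2 f s l| <= C * expR (- c * l).
  move=> /sI /Ef' [_ H]; rewrite /= in_itv /= andbT => /H.
  by rewrite partial1of2E; have := df s l => ?; rewrite derive_val.
have D := @derivable_under_integral R _ _ mu f _ (measurable_itv `[r, +oo[) a _ _ aI intf derf _ G0 iG ub.
apply: DeriveDef => //; rewrite -derive1E.
rewrite (@differentiation_under_integral R _ _ mu f _ (measurable_itv `[r, +oo[) a _ _ aI intf derf _ G0 iG ub).
apply: eq_Rintegral => l _.
by rewrite partial1of2E; have := df a l => ?; rewrite derive_val.
Qed.
End HalfLine.

(** * The Airy function and the Airy kernel *)

Section Airy.
Context {R : realType}.
Notation mu := (@lebesgue_measure R).
Implicit Types (x t eta : R).

Lemma derive_le (f f' g g' : R -> R) (a b : R) : a <= b ->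
  (forall x : R, is_derive x 1 f (f' x)) -> (forall x : R, is_derive x 1 g (g' x)) ->
  (forall x, a <= x <= b -> `|f' x| <= g' x) -> `|f b - f a| <= g b - g a.
Proof.
move=> ab df dg le.
have mon (h h' : R -> R) : (forall x : R, is_derive x 1 h (h' x)) ->
    (forall x, a <= x <= b -> 0 <= h' x) -> h a <= h b.
  move=> dh h0; have cnt : {within `[a, b], continuous h}.
    by apply: continuous_subspaceT => x; exact: drv_continuous (dh x).
  have [c cab E] := MVT_segment ab (fun x _ => dh x) cnt.
  by move: cab; rewrite in_itv /= => cab; rewrite -subr_ge0 E mulr_ge0 ?subr_ge0 // h0.
rewrite ler_norml; apply/andP; split.
  have := mon (fun x => g x + f x) (fun x => g' x + f' x).
  move=> /(_ (fun x => drvD (dg x) (df x))) H.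
  have : g a + f a <= g b + f b.
    by apply: H => x /le; rewrite ler_norml => /andP[? _]; lra.
  lra.
have := mon (fun x => g x + - f x) (fun x => g' x + - f' x).
move=> /(_ (fun x => drvD (dg x) (drvN (df x)))) H.
have : g a + - f a <= g b + - f b.
  by apply: H => x /le; rewrite ler_norml => /andP[_ ?]; lra.
lra.
Qed.

Lemma expR_ge_pow x n : 0 <= x -> x ^+ n <= n`!%:R * expR x.
Proof.
elim: n x => [|n IH] x x0; first by rewrite mul1r expr0 -expR0 ler_expR.
have := @derive_le (fun y => y ^+ n.+1) (fun y => n.+1%:R * y ^+ n * 1)
  (fun y => n.+1`!%:R * expR y) (fun y => n.+1`!%:R * expR y) 0 x x0.
rewrite expr0n /= subr0 expR0 mulr1 => H.
have {H} : `|x ^+ n.+1| <= n.+1`!%:R * expR x - n.+1`!%:R.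
  apply: H => [y|y /andP[y0 _]].
  - by apply: (@drvX _ id); exact: drv_id.
  - rewrite mulr1 ger0_norm; last by rewrite mulr_ge0 // exprn_ge0.
    by rewrite factS natrM -mulrA ler_wpM2l // IH.
move=> /(le_trans (ler_norm _)) /le_trans; apply.
by rewrite lerBlDr lerDl.
Qed.

(** Modulus and phase of exp (i (z^3 / 3 + x z)) on the line z = t + i eta. For eta > 0 the modulus
    decays like exp (- eta t^2), so the integral converges absolutely, and it carries the factor exp
    (- eta x). *)
Definition airy_exp eta x t : R := expR (eta ^+ 3 * 3^-1 + - (eta * x) + - (eta * t ^+ 2)).
Definition airy_phase eta x t : R := t ^+ 3 * 3^-1 + (x + - (eta ^+ 2)) * t.

(* [airy_coef b] = (Re, - Im) of (i z)^b for z = t + i eta. *)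
Fixpoint airy_coef (b : nat) eta t : R * R := if b is b'.+1 then
  let: (p, q) := airy_coef b' eta t in (- eta * p + t * q, - eta * q + - (t * p))
  else (1, 0).

(* The integrand is the real part of (i z)^b exp (i (z^3 / 3 + x z)) at z = t + i eta. *)
Definition airy_integrand (b : nat) eta x t : R := airy_exp eta x t *
  ((airy_coef b eta t).1 * cos (airy_phase eta x t) +
   (airy_coef b eta t).2 * sin (airy_phase eta x t)).

Definition airy_int (b : nat) eta x : R :=
  pi^-1 * \int[mu]_(t in `[0, +oo[) airy_integrand b eta x t.

Lemma airy_integrand_derive b eta x t :
  is_derive x 1 (fun x => airy_integrand b eta x t) (airy_integrand b.+1 eta x t).
Proof.
rewrite /airy_integrand /=; case: (airy_coef b eta t) => p q /=.
rewrite /airy_exp /airy_phase; der.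
by rewrite /=; set e := expR _; set c := cos _; set s := sin _; ring.
Qed.

Lemma airy_coef_bound b eta t : 0 <= eta -> 0 <= t ->
  `|(airy_coef b eta t).1| + `|(airy_coef b eta t).2| <= (eta + t) ^+ b.
Proof.
move=> e0 t0; elim: b => [|b] /=; first by rewrite normr1 normr0 addr0 expr0.
case: (airy_coef b eta t) => p q /= IH; rewrite exprS.
apply: le_trans (ler_wpM2l (addr_ge0 e0 t0) IH).
apply: le_trans (lerD (ler_normD _ _) (ler_normD _ _)) _.
by rewrite !(mulNr, normrN, normrM) (ger0_norm e0) (ger0_norm t0); lra.
Qed.

Lemma airy_coef_continuous b eta : continuous (fun t => (airy_coef b eta t).1) /\
  continuous (fun t => (airy_coef b eta t).2).
Proof.
elim: b => [|b [IHp IHq]] /=; first by split; exact: cst_continuous.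
split.
- have -> : (fun t => (let: (p, q) := airy_coef b eta t in
      (- eta * p + t * q, - eta * q + - (t * p))).1) =
    (fun t => - eta * (airy_coef b eta t).1 + t * (airy_coef b eta t).2).
    by apply/funext => t; case: airy_coef.
  move=> t; apply: cvgD; first by apply: cvgMr; exact: IHp.
  by apply: cvgM; [exact: cvg_id|exact: IHq].
- have -> : (fun t => (let: (p, q) := airy_coef b eta t in
      (- eta * p + t * q, - eta * q + - (t * p))).2) =
    (fun t => - eta * (airy_coef b eta t).2 - t * (airy_coef b eta t).1).
    by apply/funext => t; case: airy_coef.
  move=> t; apply: cvgB; first by apply: cvgMr; exact: IHq.
  by apply: cvgM; [exact: cvg_id|exact: IHp].
Qed.

Lemma airy_integrand_continuous b eta x : continuous (airy_integrand b eta x).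
Proof.
have [cp cq] := airy_coef_continuous b eta.
move=> t; apply: cvgM.
  by apply: drv_continuous; rewrite /airy_exp; der_rules.
apply: cvgD; apply: cvgM; [exact: cp| |exact: cq|].
- by apply: (@drv_continuous R (fun t => cos (airy_phase eta x t))); rewrite /airy_phase; der_rules.
- by apply: (@drv_continuous R (fun t => sin (airy_phase eta x t))); rewrite /airy_phase; der_rules.
Qed.

Definition airy_const eta : R := expR (eta ^+ 3 / 3 + eta + eta^-1).

Lemma airy_exp_bound b eta x t : 0 < eta -> 0 <= t ->
  airy_exp eta x t * (eta + t) ^+ b <=
    b`!%:R * airy_const eta * expR (- eta * x) * expR (- 1 * t).
Proof.
move=> e0 t0; have := expR_ge_pow b (addr_ge0 (ltW e0) t0).
move=> /(ler_wpM2l (expR_ge0 (eta ^+ 3 * 3^-1 + - (eta * x) + - (eta * t ^+ 2)))).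
move=> /le_trans; apply; rewrite mulrCA -!mulrA ler_wpM2l // -!expRD ler_expR.
(* This says - eta t^2 <= - 2 t + eta^-1. One t pays for exp (eta + t), which bounds (eta + t)^b /
   b!, and the other remains as decay; [airy_const] collects the rest. *)
have : 0 <= eta^-1 * (eta * t - 1) ^+ 2 by rewrite mulr_ge0 ?sqr_ge0 // invr_ge0 ltW.
have -> : eta^-1 * (eta * t - 1) ^+ 2 = eta * t ^+ 2 - 2 * t + eta^-1.
  by field; rewrite gt_eqF.
lra.
Qed.

Lemma airy_trig_bound (p q : R) y : `|p * cos y + q * sin y| <= `|p| + `|q|.
Proof.
apply: le_trans (ler_normD _ _) _; rewrite !normrM.
by rewrite lerD // ler_piMr // ler_norml ?cos_geN1 ?cos_le1 ?sin_geN1 ?sin_le1.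
Qed.

Lemma airy_integrand_dominated b eta x : 0 < eta ->
  exp_dominated 0 1 (b`!%:R * airy_const eta * expR (- eta * x)) (airy_integrand b eta x).
Proof.
move=> e0; split; first exact: airy_integrand_continuous.
move=> t t0; apply: le_trans (airy_exp_bound b x e0 t0).
rewrite /airy_integrand normrM ger0_norm ?expR_ge0 // ler_wpM2l ?expR_ge0 //.
exact: le_trans (airy_trig_bound _ _ _) (airy_coef_bound _ (ltW e0) t0).
Qed.

Lemma airy_int_derive b eta x : 0 < eta ->
  is_derive x 1 (airy_int b eta) (airy_int b.+1 eta x).
Proof.
move=> e0; pose C := b.+1`!%:R * airy_const eta * expR (- eta * x + eta).
have dom c s : (c <= b.+1)%N -> `|s - x| < 1 -> exp_dominated 0 1 C (airy_integrand c eta s).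
  move=> cb; rewrite ltr_norml => /andP[sx _].
  have [cn dm] := airy_integrand_dominated c s e0; split=> // l l0.
  apply: le_trans (dm _ l0) _; rewrite ler_wpM2r ?expR_ge0 //.
  apply: ler_pM; rewrite ?mulr_ge0 ?expR_ge0 //.
    by rewrite ler_wpM2r ?expR_ge0 // ler_nat leq_fact.
  by rewrite ler_expR; nra.
have := @half_line_derive R (airy_integrand b eta) (airy_integrand b.+1 eta)
  0 x 1 1 C ltr01 ltr01 (fun s l => airy_integrand_derive b eta s l)
  (fun s => dom b s (leqnSn b)) (fun s => dom b.+1 s (leqnn _)) => H.
by rewrite /airy_int; der; rewrite mul0r add0r.
Qed.

Lemma airy_int_bound b eta x : 0 < eta ->
  `|airy_int b eta x| <= (pi^-1 * airy_const eta) * b`!%:R * expR (- eta * x).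
Proof.
move=> e0; rewrite /airy_int normrM ger0_norm ?invr_ge0 ?pi_ge0 //.
rewrite -!mulrA ler_wpM2l ?invr_ge0 ?pi_ge0 //.
apply: le_trans (exp_dominated_bound ltr01 (airy_integrand_dominated b x e0)) _.
by rewrite mulr0 expR0 mulr1 divr1 -mulrA mulrCA.
Qed.

(* Cauchy--Riemann: d/d eta of the real part is - d/dt of the imaginary part. *)
Definition airy_im eta x t : R := - (airy_exp eta x t * sin (airy_phase eta x t)).
Definition airy_im' eta x t : R := - (airy_exp eta x t *
  ((t ^+ 2 + x - eta ^+ 2) * cos (airy_phase eta x t)
   - 2 * eta * t * sin (airy_phase eta x t))).

Lemma airy_im_derive_t eta x t : is_derive t 1 (airy_im eta x) (airy_im' eta x t).
Proof.
rewrite /airy_im /airy_im' /airy_exp /airy_phase; der.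
by rewrite /=; set e := expR _; set c := cos _; set s := sin _; field.
Qed.

Lemma airy_integrand_derive_eta eta x t :
  is_derive eta 1 (fun eta => airy_integrand 0 eta x t) (airy_im' eta x t).
Proof.
rewrite /airy_im' /airy_integrand /airy_exp /airy_phase /=; der.
by rewrite /=; set e := expR _; set c := cos _; set s := sin _; field.
Qed.

(** The Airy equation holds for the integrand up to the exact derivative [airy_im'], whose primitive
    [airy_im] vanishes, for eta > 0, at both ends of the half-line. *)
Lemma airy_integrand2 eta x t :
  airy_integrand 2 eta x t = x * airy_integrand 0 eta x t + airy_im' eta x t.
Proof. by rewrite /airy_im' /airy_integrand /=; ring. Qed.

Lemma airy_im'_continuous eta x : continuous (airy_im' eta x).
Proof.
by move=> t; apply: drv_continuous; rewrite /airy_im' /airy_exp /airy_phase; der_rules.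
Qed.
End Airy.


(** * Shift of the contour and the Airy equation *)

Section AiryContour.
Context {R : realType}.
Notation mu := (@lebesgue_measure R).
Implicit Types (x t eta : R).

Lemma continuous_integrable_cc (f : R -> R) (b : R) : continuous f ->
  mu.-integrable `[0, b] (EFin \o f).
Proof.
move=> cf; apply: continuous_compact_integrable; first exact: segment_compact.
exact: continuous_subspaceT.
Qed.

Lemma segment_FTC (f F : R -> R) (b : R) : 0 < b -> continuous f ->
  (forall x : R, is_derive x 1 F (f x)) ->
  \int[mu]_(x in `[0, b]) f x = F b - F 0.
Proof.
move=> b0 cf dF; have := @continuous_FTC2 R f F 0 b b0.
rewrite /Rintegral => ->.
- by rewrite -EFinB.
- exact: continuous_subspaceT.
- split; first by move=> y _; have := dF y => ?; exact: ex_derive.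
  + by apply: cvg_at_right_filter; exact: drv_continuous (dF 0).
  + by apply: cvg_at_left_filter; exact: drv_continuous (dF b).
- by move=> y _; rewrite derive1E; have := dF y => ?; rewrite derive_val.
Qed.

Definition airy_segment x (b : R) eta : R :=
  \int[mu]_(t in `[0, b]) airy_integrand 0 eta x t.

(** Cauchy's theorem for a rectangle, read as a derivative in its height: the eta-derivative of the
    integrand is a t-derivative, so only the vertical edge at [b] is left. The edge at 0 gives sin
    0. *)
Lemma airy_segment_derive x (b : R) eta : 0 < b ->
  is_derive eta 1 (airy_segment x b) (airy_im eta x b).
Proof.
move=> b0; pose H := `|eta| + 1.
have aI : `](eta - 1), (eta + 1)[%classic eta.
  by rewrite /= in_itv /= ltrBlDr !ltrDl ltr01.
have sI s : `](eta - 1), (eta + 1)[%classic s -> `|s| <= H.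
  rewrite /= in_itv /= => /andP[s1 s2]; rewrite -lerBlDl.
  apply: le_trans (lerB_dist _ _) _; rewrite ler_norml; lra.
have H0 : 0 <= H by rewrite /H addr_ge0.
pose M := expR (H ^+ 3 + H * `|x| + H * b ^+ 2) * (b ^+ 2 + `|x| + H ^+ 2 + 2 * H * b).
have M0 : 0 <= M by rewrite mulr_ge0 ?expR_ge0 // !addr_ge0 ?mulr_ge0 ?sqr_ge0 // ltW.
have ub s t : `](eta - 1), (eta + 1)[%classic s -> `[0, b]%classic t ->
    `|partial1of2 (fun s t => airy_integrand 0 s x t) s t| <= M.
  move=> /sI sH; rewrite /= in_itv /= => /andP[t0 tb].
  rewrite partial1of2E; have := airy_integrand_derive_eta s x t => ?.
  rewrite derive_val /airy_im' normrN normrM ger0_norm ?expR_ge0 //.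
  have tb2 : t ^+ 2 <= b ^+ 2 by rewrite ler_sqr ?nnegrE // ltW.
  have s2 : s ^+ 2 <= H ^+ 2 by rewrite -real_normK ?num_real // ler_sqr ?nnegrE.
  apply: ler_pM; rewrite ?expR_ge0 ?normr_ge0 //.
    rewrite ler_expR lerD //; first apply: lerD.
    - apply: le_trans (ler_norm _) _; rewrite normrM normrX (@ger0_norm _ 3^-1) ?invr_ge0 //.
      apply: (@le_trans _ _ (`|s| ^+ 3)); last by rewrite lerXn2r ?nnegrE.
      by rewrite ler_piMr ?exprn_ge0 // invf_le1 // ler1n.
    - by apply: le_trans (ler_norm _) _; rewrite normrN normrM ler_wpM2r.
    - apply: le_trans (ler_norm _) _; rewrite normrN normrM [`|t ^+ 2|]ger0_norm ?sqr_ge0 //.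
      by apply: ler_pM => //; exact: sqr_ge0.
  rewrite -[- (2 * s * t * _)]mulNr; apply: le_trans (airy_trig_bound _ _ _) _.
  rewrite normrN !normrM [`|2|]ger0_norm // (ger0_norm t0); apply: lerD.
    apply: le_trans (ler_normB _ _) _; rewrite lerD //.
      by apply: le_trans (ler_normD _ _) _; rewrite lerD // ger0_norm ?sqr_ge0.
    by rewrite ger0_norm ?sqr_ge0.
  by rewrite -!mulrA ler_wpM2l // ler_pM.
have derf s t : `](eta - 1), (eta + 1)[%classic s -> `[0, b]%classic t ->
    derivable (fun s => airy_integrand 0 s x t) s 1.
  by move=> _ _; have := airy_integrand_derive_eta s x t => ?; exact: ex_derive.
have intf s : `](eta - 1), (eta + 1)[%classic s ->
    mu.-integrable `[0, b] (EFin \o airy_integrand 0 s x).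
  by move=> _; apply: continuous_integrable_cc; exact: airy_integrand_continuous.
have iG : mu.-integrable `[0, b] (EFin \o (fun=> M)).
  by apply: continuous_integrable_cc; exact: cst_continuous.
have D := @derivable_under_integral R _ _ mu (fun s t => airy_integrand 0 s x t) _
  (measurable_itv `[0, b]) eta _ _ aI intf derf _ (fun=> M0) iG ub.
apply: DeriveDef => //; rewrite -derive1E.
rewrite (@differentiation_under_integral R _ _ mu (fun s t => airy_integrand 0 s x t) _
  (measurable_itv `[0, b]) eta _ _ aI intf derf _ (fun=> M0) iG ub).
transitivity (\int[mu]_(t in `[0, b]) airy_im' eta x t).
  apply: eq_Rintegral => t _.
  by rewrite partial1of2E; have := airy_integrand_derive_eta eta x t => ?; rewrite derive_val.
rewrite (segment_FTC b0 (@airy_im'_continuous R eta x) (airy_im_derive_t eta x)).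
by rewrite {2}/airy_im /airy_phase expr0n /= mul0r mulr0 addr0 sin0 mulr0 oppr0 subr0.
Qed.

(** On the vertical edge the integrand is at most K exp (- b^2 s), and its integral over the height
    s is at most K / b^2. This compares height 0, where nothing decays absolutely, with height
    eta. *)
Lemma airy_segment_shift x (b : R) eta : 0 < b -> 0 < eta ->
  `|airy_segment x b eta - airy_segment x b 0| <= expR (eta ^+ 3 + eta * `|x|) * b ^- 2.
Proof.
move=> b0 e0; set K := expR _.
have := @derive_le R (airy_segment x b) (airy_im ^~ x ^~ b)
  (fun s => - (K * b ^- 2 * expR (- b ^+ 2 * s))) (fun s => K * expR (- b ^+ 2 * s)) 0 eta (ltW e0)
  (fun s => airy_segment_derive x s b0) => H.
have {H} : `|airy_segment x b eta - airy_segment x b 0| <=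
   - (K * b ^- 2 * expR (- b ^+ 2 * eta)) - - (K * b ^- 2 * expR (- b ^+ 2 * 0)).
  apply: H => [s|s /andP[s0 se]].
    by der; rewrite /= !mul0r !add0r mulr1; field; rewrite gt_eqF.
  rewrite /airy_im normrN normrM ger0_norm ?expR_ge0 // /airy_exp.
  rewrite -[X in _ <= X]mulr1; apply: ler_pM; rewrite ?expR_ge0 ?normr_ge0 //; last first.
    by rewrite ler_norml sin_geN1 sin_le1.
  rewrite /K -expRD ler_expR -mulrN mulNr -mulNr.
  have -> : - (s * b ^+ 2) = - b ^+ 2 * s by ring.
  rewrite lerD2r lerD //.
    apply: (@le_trans _ _ (s ^+ 3)); last by rewrite lerXn2r ?nnegrE // ltW.
    by rewrite ler_piMr ?exprn_ge0 // invf_le1 // ler1n.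
  apply: le_trans (ler_norm _) _; rewrite normrM normrN (ger0_norm s0) ler_wpM2r //.
move=> /le_trans; apply; rewrite mulr0 expR0 mulr1 opprK addrC lerBlDr lerDl.
by rewrite !mulr_ge0 ?expR_ge0 // invr_ge0 sqr_ge0.
Qed.

(** The only contact with the conditionally convergent definition of [airy]. The right side
    therefore does not depend on [eta], which later gives bounds at every exponential rate. *)
Lemma airy_intE x eta : 0 < eta -> airy x = airy_int 0 eta x.
Proof.
move=> e0; rewrite /airy /airy_int; congr (_ * _).
set L := (RHS); apply: cvg_lim => //.
have seg0 b : \int[mu]_(t in `[0, b]) cos (t ^+ 3 / 3 + x * t) = airy_segment x b 0.
  apply: eq_Rintegral => t _; rewrite /airy_integrand /airy_exp /airy_phase /=.
  by rewrite !expr0n /= !mul0r !subr0 expR0 !mul1r addr0.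
under eq_fun do rewrite seg0.
set K := expR (eta ^+ 3 + eta * `|x|).
have dom := airy_integrand_dominated 0 x e0; set C := _ * expR (- eta * x) in dom.
have I0 := exp_dominated_integrable ltr01 dom.
have bnd b : 0 < b -> `|L - airy_segment x b 0| <= C * expR (- 1 * b) + K * b ^- 2.
  move=> b0; rewrite -(subrKA (airy_segment x b eta)).
  apply: le_trans (ler_normD _ _) (lerD _ (airy_segment_shift x b0 e0)).
  rewrite /L /airy_segment (@Rintegral_itvB R _ (BLeft 0) +oo%O b) //; last by rewrite bnd_simp ltW.
  have domb : exp_dominated b 1 C (airy_integrand 0 eta x).
    split; first exact: airy_integrand_continuous.
    by move=> l bl; apply: dom.2; exact: le_trans (ltW b0) bl.
  rewrite Rintegral_itv_obnd_cbnd; last first.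
    apply: (@integrableS _ _ _ mu `[0, +oo[%classic) => //.
    by move=> y /=; rewrite !in_itv /= !andbT => /ltW; apply: le_trans; exact: ltW.
  by apply: le_trans (exp_dominated_bound ltr01 domb) _; rewrite divr1.
apply/cvgrPdist_le => e ep.
have lim0 : (C * expR (- 1 * b) + K * b ^- 2) @[b --> +oo%R] --> (0 : R).
  rewrite -[X in _ --> X](_ : C * 0 + K * 0 = 0); last by rewrite !mulr0 addr0.
  apply: cvgD; apply: cvgMr; first exact: cvg_expRN.
  apply/(gtr0_cvgV0 (f := fun b : R => b ^+ 2)).
    by near=> b; rewrite exprn_gt0 //; near: b; exact: nbhs_pinfty_gt.
  apply/cvgryPge => A; near=> b.
  have b1 : 1 <= b by near: b; exact: nbhs_pinfty_ge.
  have bA : A <= b by near: b; apply: nbhs_pinfty_ge; exact: num_real.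
  by rewrite (le_trans bA) // expr2 ler_peMl // (le_trans ler01).
near=> b; have b0 : 0 < b by near: b; exact: nbhs_pinfty_gt.
apply: le_trans (bnd b b0) _.
have : `|0 - (C * expR (- 1 * b) + K * b ^- 2)| <= e.
  by near: b; move/cvgrPdist_le : lim0; apply.
by rewrite sub0r normrN; apply: le_trans; exact: ler_norm.
Unshelve. all: by end_near. Qed.

Definition airyD (b : nat) x : R := airy_int b 1 x.

Lemma airyDE b x eta : 0 < eta -> airyD b x = airy_int b eta x.
Proof.
move=> e0; elim: b x => [|b IH] x; first by rewrite /airyD -!airy_intE.
have d1 := airy_int_derive b x (@ltr01 R); have d2 := airy_int_derive b x e0.
have E : airy_int b 1 = airy_int b eta by apply/funext => y; exact: IH.
rewrite E in d1; rewrite /airyD.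
by rewrite -(@derive_val _ _ _ _ _ _ _ d1) -(@derive_val _ _ _ _ _ _ _ d2).
Qed.

Lemma airyD0 x : airyD 0 x = airy x.
Proof. by rewrite (airy_intE x (@ltr01 R)). Qed.

Lemma airyD_derive b x : is_derive x 1 (airyD b) (airyD b.+1 x).
Proof. exact: airy_int_derive. Qed.

(** The rate is free because [airyD b] can be computed at any height. Large rates express the decay
    towards +oo, small ones the moderate growth towards -oo; the factorial in b is what analyticity
    needs. *)
Lemma airyD_bound eta : 0 < eta -> exists2 C : R, 0 <= C &
  forall b x, `|airyD b x| <= C * b`!%:R * expR (- eta * x).
Proof.
move=> e0; exists (pi^-1 * airy_const eta).
  by rewrite mulr_ge0 ?invr_ge0 ?pi_ge0 // expR_ge0.
by move=> b x; rewrite (airyDE _ _ e0); exact: airy_int_bound.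
Qed.

Lemma airyD2 x : airyD 2 x = x * airyD 0 x.
Proof.
have dom b := @airy_integrand_dominated R b 1 x ltr01.
rewrite /airyD /airy_int [x * _]mulrCA; congr (_ * _).
have I b := exp_dominated_integrable ltr01 (dom b).
rewrite -RintegralZl //; apply/eqP; rewrite -subr_eq0 -RintegralB //; last first.
  have : mu.-integrable `[0, +oo[ (fun t => x%:E * (airy_integrand 0 1 x t)%:E)%E.
    exact: integrableZl (I 0).
  by apply: eq_integrable.
have E t : airy_integrand 2 1 x t - x * airy_integrand 0 1 x t = airy_im' 1 x t.
  by rewrite airy_integrand2 addrC addKr.
under eq_Rintegral do rewrite E.
pose C := 2`!%:R * airy_const 1 * expR (- 1 * x) +
  `|x| * (0`!%:R * airy_const 1 * expR (- 1 * x)).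
have dim : exp_dominated 0 1 C (airy_im' 1 x).
  split; first exact: airy_im'_continuous.
  move=> l l0; rewrite -E mulrDl -[(`|x| * _) * _]mulrA.
  apply: le_trans (ler_normB _ _) _; rewrite lerD ?(dom _).2 //.
  by rewrite normrM ler_wpM2l // (dom _).2.
rewrite (half_line_FTC ltr01 dim (airy_im_derive_t 1 x)).
  by rewrite /airy_im /airy_phase expr0n /= mul0r mulr0 addr0 sin0 mulr0 !oppr0.
rewrite -[X in _ --> X]oppr0; apply: cvgN; apply/cvgr0Pnorm_le => e ep.
have : airy_const 1 * expR (- 1 * x) * expR (- 1 * t) @[t --> +oo%R] --> (0 : R).
  rewrite -[X in _ --> X](mulr0 (airy_const 1 * expR (- 1 * x))).
  by apply: cvgMr; exact: cvg_expRN.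
move=> /cvgr0Pnorm_le /(_ _ ep).
apply: filterS2 (nbhs_pinfty_ge (num_real 0)) => t t0; apply: le_trans.
rewrite normrM -[X in _ <= X]mulr1; apply: ler_pM; rewrite ?normr_ge0 //; last first.
  by rewrite ler_norml sin_geN1 sin_le1.
rewrite ger0_norm ?expR_ge0 //; apply: le_trans (ler_norm _).
have := @airy_exp_bound R 0 1 x t ltr01 t0.
by rewrite expr0 mulr1 mul1r.
Qed.

End AiryContour.


#[global] Opaque airyD.

(** * Moments of the extended Airy kernel *)

Section AiryKernel.
Context {R : realType}.
Notation mu := (@lebesgue_measure R).
Implicit Types (s dl u v l eta c : R) (a p q : nat).

(** With lambda = s l, [a] counts powers of lambda and [p], [q] derivatives of the two Airy factors.
    Differentiation in the time difference raises [a], in u and v it raises [p] and [q]: the family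
    is closed under derivatives. *)
Definition airyK_integrand s a p q dl u v l : R :=
  (s * l) ^+ a * expR (- (s * l * dl)) * airyD p (u + s * l) * airyD q (v + s * l).

(* The sign [s] is 1 or -1, and [l] runs through [0, +oo[: this is the integral over
   [0, +oo[ for s = 1, and minus the integral over ]-oo, 0] for s = -1. *)
Definition airyK s a p q dl u v : R :=
  s * \int[mu]_(l in `[0, +oo[) airyK_integrand s a p q dl u v l.

Lemma exp_dominatedD r c C C' (f g : R -> R) : exp_dominated r c C f ->
  exp_dominated r c C' g -> exp_dominated r c (C + C') (fun l => f l + g l).
Proof.
move=> [cf fC] [cg gC]; split.
  by move=> x; apply: (@continuousD R R R f g); [exact: cf|exact: cg].
by move=> l rl; rewrite mulrDl (le_trans (ler_normD _ _)) // lerD // ?fC ?gC.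
Qed.

Lemma exp_dominatedZ r c C k (f : R -> R) : exp_dominated r c C f ->
  exp_dominated r c (`|k| * C) (fun l => k * f l).
Proof.
move=> [cf fC]; split; first by move=> x; apply: cvgMr; exact: cf.
by move=> l rl; rewrite -mulrA normrM ler_wpM2l // fC.
Qed.

Lemma exp_dominatedW r c C C' (f : R -> R) : C <= C' -> exp_dominated r c C f ->
  exp_dominated r c C' f.
Proof.
move=> CC' [cf fC]; split=> // l rl; apply: le_trans (fC _ rl) _.
by rewrite ler_wpM2r // expR_ge0.
Qed.

Lemma exp_dominated_cvg0 r c C (f : R -> R) : 0 < c -> exp_dominated r c C f ->
  f t @[t --> +oo%R] --> (0 : R).
Proof.
move=> c0 [_ dm]; apply/cvgr0Pnorm_le => e ep.
have : C * expR (- c * t) @[t --> +oo%R] --> (0 : R).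
  by rewrite -[X in _ --> X](mulr0 C); apply: cvgMr; exact: cvg_expRN.
move=> /cvgr0Pnorm_le /(_ _ ep).
apply: filterS2 (nbhs_pinfty_ge (num_real r)) => t t0; apply: le_trans.
exact: le_trans (dm _ t0) (ler_norm _).
Qed.

Lemma airyD_shift_derive p u s l :
  is_derive l 1 (fun l => airyD p (u + s * l)) (airyD p.+1 (u + s * l) * s).
Proof.
apply: drv_comp (airyD_derive p _).
by der; rewrite mul0r mulr1 !add0r.
Qed.

Lemma airyK_integrand_derive s a p q dl u v l : s * s = 1 ->
  is_derive l 1 (airyK_integrand s a p q dl u v)
   (s * (a%:R * airyK_integrand s a.-1 p q dl u v l - dl * airyK_integrand s a p q dl u v l
     + airyK_integrand s a p.+1 q dl u v l + airyK_integrand s a p q.+1 dl u v l)).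
Proof.
move=> ss; rewrite /airyK_integrand.
have dp := airyD_shift_derive p u s l; have dq := airyD_shift_derive q v s l.
have da : is_derive l 1 (fun l => (s * l) ^+ a) (a%:R * (s * l) ^+ a.-1 * s).
  case: a => [|a]; first by rewrite !mul0r; exact: drv_cst.
  by der; rewrite /= mul0r add0r mulr1.
have de : is_derive l 1 (fun l => expR (- (s * l * dl))) (expR (- (s * l * dl)) * (- (s * dl))).
  by der; rewrite /= !mul0r mulr0 mulr1 add0r addr0.
apply: (drv_eq (drvM (drvM (drvM da de) dp) dq)).
by ring.
Qed.

Lemma airyK_integrand_continuous s a p q dl u v : s * s = 1 ->
  continuous (airyK_integrand s a p q dl u v).
Proof.
by move=> ss l; apply: drv_continuous; exact: airyK_integrand_derive.
Qed.

(** The price of bounding l^a by half of the decay exp (- c l). *)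
Definition airyK_const (a : nat) c : R := a`!%:R * (2 / c) ^+ a.

(** The exponential and the bounds for the two Airy factors decay together at rate s (dl + 2 eta).
    For s = 1 a large [eta] makes this positive; for s = -1 a negative [dl] and a small [eta] do. *)
Lemma airyK_dominated eta : 0 < eta -> exists2 C, 0 <= C &
  forall s a p q c dl u v, s * s = 1 -> 0 < c -> c <= s * (dl + 2 * eta) ->
    exp_dominated 0 (c / 2) (C * airyK_const a c * p`!%:R * q`!%:R * expR (- eta * (u + v)))
      (airyK_integrand s a p q dl u v).
Proof.
move=> e0; have [C C0 CP] := @airyD_bound R eta e0.
exists (C * C); first exact: mulr_ge0.
move=> s a p q c dl u v ss c0 cs; split; first exact: airyK_integrand_continuous.
move=> l l0; rewrite /airyK_integrand normrM normrM normrM.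
have s1 : `|s| = 1.
  by apply/eqP; rewrite -sqrp_eq1 // real_normK ?num_real // expr2 ss.
rewrite normrX normrM s1 mul1r (ger0_norm l0) [`|expR _|]ger0_norm ?expR_ge0 //.
have la : l ^+ a <= airyK_const a c * expR (c / 2 * l).
  have cl0 : 0 <= c / 2 * l by rewrite mulr_ge0 // divr_ge0 // ltW.
  have := expR_ge_pow a cl0; rewrite /airyK_const exprMn => H.
  have -> : l ^+ a = (2 / c) ^+ a * ((c / 2) ^+ a * l ^+ a).
    by rewrite mulrA -exprMn (_ : 2 / c * (c / 2) = 1) ?expr1n ?mul1r //; field; rewrite gt_eqF.
  by rewrite -[X in _ <= X]mulrA [X in _ <= X]mulrCA ler_wpM2l // exprn_ge0 // divr_ge0 // ltW.
have K0 : 0 <= airyK_const a c by rewrite mulr_ge0 // exprn_ge0 // divr_ge0 // ltW.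
have E0 := expR_ge0 (- (s * l * dl)).
have h1 := ler_wpM2r E0 la.
have h2 : l ^+ a * expR (- (s * l * dl)) * `|airyD p (u + s * l)| <=
   airyK_const a c * expR (c / 2 * l) * expR (- (s * l * dl)) * (C * p`!%:R * expR (- eta * (u + s * l))).
  by apply: ler_pM => //; rewrite mulr_ge0 // exprn_ge0.
have h3 : l ^+ a * expR (- (s * l * dl)) * `|airyD p (u + s * l)| * `|airyD q (v + s * l)| <=
   airyK_const a c * expR (c / 2 * l) * expR (- (s * l * dl)) * (C * p`!%:R * expR (- eta * (u + s * l)))
    * (C * q`!%:R * expR (- eta * (v + s * l))).
  by apply: ler_pM => //; rewrite !mulr_ge0 // exprn_ge0.
apply: le_trans h3 _.
set A := airyK_const a c.
have -> : A * expR (c / 2 * l) * expR (- (s * l * dl)) *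
  (C * p`!%:R * expR (- eta * (u + s * l))) * (C * q`!%:R * expR (- eta * (v + s * l))) =
  (C * C * A * p`!%:R * q`!%:R) * (expR (c / 2 * l) * expR (- (s * l * dl)) *
   expR (- eta * (u + s * l)) * expR (- eta * (v + s * l))) by ring.
have A0 : 0 <= A by [].
clearbody A; rewrite -[X in _ <= X]mulrA ler_wpM2l //; first by rewrite !mulr_ge0.
rewrite -!expRD ler_expR.
have : 0 <= l * (s * (dl + 2 * eta) - c) by rewrite mulr_ge0 // subr_ge0.
lra.
Qed.

Lemma airyK_bound eta : 0 < eta -> exists2 C, 0 <= C &
  forall s a p q c dl u v, s * s = 1 -> 0 < c -> c <= s * (dl + 2 * eta) ->
    `|airyK s a p q dl u v| <=
      C * airyK_const a c * (2 / c) * p`!%:R * q`!%:R * expR (- eta * (u + v)).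
Proof.
move=> e0; have [C C0 CP] := airyK_dominated e0; exists C => // s a p q c dl u v ss c0 cs.
have s1 : `|s| = 1.
  by apply/eqP; rewrite -sqrp_eq1 // real_normK ?num_real // expr2 ss.
rewrite /airyK normrM s1 mul1r.
have c20 : 0 < c / 2 by rewrite divr_gt0.
apply: le_trans (exp_dominated_bound c20 (CP s a p q c dl u v ss c0 cs)) _.
by rewrite mulr0 expR0 mulr1 invf_div le_eqVlt; apply/orP; left; apply/eqP; ring.
Qed.

Definition airyK_ok s dl := s * s = 1 /\ exists2 eta : R, 0 < eta & 0 < s * (dl + 2 * eta).

Lemma airyK_ok1 dl : airyK_ok 1 dl.
Proof.
split; first by rewrite mulr1.
exists (`|dl| + 1); first by rewrite ltr_wpDl.
have := ler_norm (- dl); rewrite normrN mul1r; have := normr_ge0 dl; lra.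
Qed.

Lemma airyK_okN1 dl : dl < 0 -> airyK_ok (-1) dl.
Proof.
move=> dl0; split; first by rewrite mulrNN mulr1.
by exists (- dl / 4); rewrite ?divr_gt0 ?oppr_gt0 //; lra.
Qed.

Lemma airyK_integrable s a p q dl u v : airyK_ok s dl ->
  mu.-integrable `[0, +oo[ (EFin \o airyK_integrand s a p q dl u v).
Proof.
move=> [ss [eta e0 c0]]; have [C _ CP] := airyK_dominated e0.
by apply: exp_dominated_integrable (CP s a p q _ dl u v ss c0 (lexx _)); rewrite divr_gt0.
Qed.

(** Integration of the l-derivative over the half-line. The boundary term at l = 0 survives only for
    a = 0 and is a function of u times a function of v: all finite rank statements about the kernel
    come from here. *)
Lemma airyK_FTC s a p q dl u v : airyK_ok s dl ->
  a%:R * airyK s a.-1 p q dl u v - dl * airyK s a p q dl u v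
   + airyK s a p.+1 q dl u v + airyK s a p q.+1 dl u v =
  - ((a == 0)%:R * airyD p u * airyD q v).
Proof.
move=> ok; have [ss [eta e0 c0]] := ok; have [C C0 CP] := airyK_dominated e0.
set c := s * _ in c0.
pose G l := s * (a%:R * airyK_integrand s a.-1 p q dl u v l + - dl * airyK_integrand s a p q dl u v l
     + airyK_integrand s a p.+1 q dl u v l + airyK_integrand s a p q.+1 dl u v l).
have dG l : is_derive l 1 (airyK_integrand s a p q dl u v) (G l).
  by apply: drv_eq (airyK_integrand_derive _ _ _ _ _ _ _ ss) _; rewrite /G mulNr.
have dom a' p' q' := CP s a' p' q' c dl u v ss c0 (lexx _).
have domG := exp_dominatedZ s (exp_dominatedD (exp_dominatedD (exp_dominatedD
  (exp_dominatedZ a%:R (dom a.-1 p q)) (exp_dominatedZ (- dl) (dom a p q)))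
  (dom a p.+1 q)) (dom a p q.+1)).
have c20 : 0 < c / 2 by rewrite divr_gt0.
have I a' p' q' := airyK_integrable a' p' q' u v ok.
have IZ k a' p' q' : mu.-integrable `[0, +oo[ (EFin \o (fun l => k * airyK_integrand s a' p' q' dl u v l)).
  exact: exp_dominated_integrable c20 (exp_dominatedZ k (dom a' p' q')).
have I2 := exp_dominated_integrable c20 (exp_dominatedD
  (exp_dominatedZ a%:R (dom a.-1 p q)) (exp_dominatedZ (- dl) (dom a p q))).
have I3 := exp_dominated_integrable c20 (exp_dominatedD (exp_dominatedD
  (exp_dominatedZ a%:R (dom a.-1 p q)) (exp_dominatedZ (- dl) (dom a p q))) (dom a p.+1 q)).
have I4 := exp_dominated_integrable c20 (exp_dominatedD (exp_dominatedD (exp_dominatedD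
  (exp_dominatedZ a%:R (dom a.-1 p q)) (exp_dominatedZ (- dl) (dom a p q)))
  (dom a p.+1 q)) (dom a p q.+1)).
have lim0 := exp_dominated_cvg0 c20 (dom a p q).
have := half_line_FTC c20 domG dG lim0.
rewrite RintegralZl // RintegralD // RintegralD // RintegralD // !RintegralZl //.
have -> : - ((a == 0)%:R * airyD p u * airyD q v) = - airyK_integrand s a p q dl u v 0.
  by rewrite /airyK_integrand mulr0 mul0r oppr0 expR0 expr0n mulr1 !addr0.
rewrite /airyK; move: (Rintegral _ _ _) (Rintegral _ _ _) (Rintegral _ _ _) (Rintegral _ _ _).
by clear => w x y z <-; ring.
Qed.

Lemma airyK_lin2 s dl u v a p q a' p' q' b p2 q2 k k' : airyK_ok s dl ->
  (forall l, airyK_integrand s a p q dl u v l =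
     k * airyK_integrand s a' p' q' dl u v l + k' * airyK_integrand s b p2 q2 dl u v l) ->
  airyK s a p q dl u v = k * airyK s a' p' q' dl u v + k' * airyK s b p2 q2 dl u v.
Proof.
move=> ok E; rewrite /airyK; under eq_Rintegral do rewrite E.
have [ss [eta e0 c0]] := ok; have [C C0 CP] := airyK_dominated e0.
have dom a' p' q' := CP s a' p' q' _ dl u v ss c0 (lexx _).
have c20 : 0 < s * (dl + 2 * eta) / 2 by rewrite divr_gt0.
rewrite RintegralD //; last 2 first.
- exact: exp_dominated_integrable c20 (exp_dominatedZ _ (dom _ _ _)).
- exact: exp_dominated_integrable c20 (exp_dominatedZ _ (dom _ _ _)).
rewrite RintegralZl ?RintegralZl //; [|exact: airyK_integrable..].
by move: (Rintegral _ _ _) (Rintegral _ _ _); clear => x y; ring.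
Qed.

Lemma airyK_ode2l s q dl u v : airyK_ok s dl ->
  airyK s 0 2 q dl u v = u * airyK s 0 0 q dl u v + 1 * airyK s 1 0 q dl u v.
Proof.
by move=> ok; apply: airyK_lin2 ok _ => l; rewrite /airyK_integrand airyD2 expr0 expr1; ring.
Qed.

Lemma airyK_ode2r s p dl u v : airyK_ok s dl ->
  airyK s 0 p 2 dl u v = v * airyK s 0 p 0 dl u v + 1 * airyK s 1 p 0 dl u v.
Proof.
by move=> ok; apply: airyK_lin2 ok _ => l; rewrite /airyK_integrand airyD2 expr0 expr1; ring.
Qed.

Lemma airyK_derive s a p q dl u v ddl du dv : airyK_ok s dl ->
  is_derive (0 : R) 1 (fun t => airyK s a p q (dl + t * ddl) (u + t * du) (v + t * dv))
   (- ddl * airyK s a.+1 p q dl u v + du * airyK s a p.+1 q dl u v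
    + dv * airyK s a p q.+1 dl u v).
Proof.
move=> ok; have [ss [eta e0 c0]] := ok; have [C C0 CP] := airyK_dominated e0.
set c := s * _ in c0; pose c' := c / 2; have c'0 : 0 < c' by rewrite divr_gt0.
have s1 : `|s| = 1.
  by apply/eqP; rewrite -sqrp_eq1 // real_normK ?num_real // expr2 ss.
pose f t l := airyK_integrand s a p q (dl + t * ddl) (u + t * du) (v + t * dv) l.
pose f' t l := - ddl * airyK_integrand s a.+1 p q (dl + t * ddl) (u + t * du) (v + t * dv) l +
  du * airyK_integrand s a p.+1 q (dl + t * ddl) (u + t * du) (v + t * dv) l +
  dv * airyK_integrand s a p q.+1 (dl + t * ddl) (u + t * du) (v + t * dv) l.
have df (t l : R) : is_derive t 1 (fun t => f t l) (f' t l).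
  rewrite /f /f' /airyK_integrand.
  have dA p' w dw : is_derive t 1 (fun t => airyD p' (w + t * dw + s * l))
      (airyD p'.+1 (w + t * dw + s * l) * dw).
    apply: drv_comp (airyD_derive p' _).
    by apply: drv_eq (drvD (drvD (drv_cst w t) (drvM (drv_id t) (drv_cst dw t))) (drv_cst (s * l) t)) _;
      rewrite mulr0 mul1r !addr0 add0r.
  have de : is_derive t 1 (fun t => expR (- (s * l * (dl + t * ddl))))
      (expR (- (s * l * (dl + t * ddl))) * (- (s * l * ddl))).
    by der; rewrite /= !mul0r mulr0 mul1r !add0r addr0.
  apply: (drv_eq (drvM (drvM (drvM (drv_cst ((s * l) ^+ a) t) de) (dA p u du)) (dA q v dv))).
  by rewrite exprS; ring.
(* Within this radius the time difference moves by at most c / 2, so half of the decay rate survives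
   for all such t, while u and v move by at most [|du|] and [|dv|]. *)
pose e := Num.min 1 (c' / (`|ddl| + 1)).
have ep : 0 < e by rewrite lt_min ltr01 divr_gt0 // ltr_wpDl.
pose B := expR (- eta * (u + v) + eta * (`|du| + `|dv|)).
have dom a' p' q' t : `|t - 0| < e -> exp_dominated 0 (c' / 2)
   (C * airyK_const a' c' * p'`!%:R * q'`!%:R * B)
   (airyK_integrand s a' p' q' (dl + t * ddl) (u + t * du) (v + t * dv)).
  rewrite subr0 lt_min => /andP[t1 tc].
  have tdl : `|t * ddl| <= c'.
    rewrite normrM; apply: le_trans (_ : c' / (`|ddl| + 1) * `|ddl| <= _).
      by rewrite ler_wpM2r // ltW.
    rewrite mulrAC -mulrA ler_piMr ?ltW // ltr_pdivrMr ?ltr_wpDl //; lra.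
  have := CP s a' p' q' c' (dl + t * ddl) (u + t * du) (v + t * dv) ss c'0 => H.
  apply: exp_dominatedW (H _).
    rewrite ler_wpM2l //.
      by rewrite !mulr_ge0 // exprn_ge0 // divr_ge0 // ltW.
    rewrite ler_expR.
    have tw w : - (t * w) <= `|w|.
      apply: le_trans (ler_norm _) _; rewrite normrN normrM ler_piMl // ltW //.
    have := tw du; have := tw dv; nra.
  have -> : s * (dl + t * ddl + 2 * eta) = c + s * (t * ddl) by rewrite /c; ring.
  have : - (s * (t * ddl)) <= c'.
    by apply: le_trans (ler_norm _) _; rewrite normrN normrM s1 mul1r.
  rewrite /c'; lra.
have dom' t te := exp_dominatedD (exp_dominatedD (exp_dominatedZ (- ddl) (dom a.+1 p q t te))
  (exp_dominatedZ du (dom a p.+1 q t te))) (exp_dominatedZ dv (dom a p q.+1 t te)).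
have c20 : 0 < c' / 2 by rewrite divr_gt0.
set C1 := C * _ * _ * _ * B in dom'; set C2 := C * _ * _ * _ * B in dom'.
set C3 := C * _ * _ * _ * B in dom'.
pose C4 := C * airyK_const a c' * p`!%:R * q`!%:R * B.
have H := @half_line_derive R f f' 0 0 e (c' / 2)
  (Num.max C4 (`|- ddl| * C1 + `|du| * C2 + `|dv| * C3)) ep c20 df.
rewrite /airyK.
have {}H : is_derive (0 : R) 1 (fun s => \int[mu]_(l in `[0, +oo[) f s l)
    (\int[mu]_(l in `[0, +oo[) f' 0 l).
  apply: H => t te.
    by apply: exp_dominatedW (dom a p q t te); rewrite le_max lexx.
  by apply: exp_dominatedW (dom' t te); rewrite le_max lexx orbT.
apply: (drv_eq (drvM (drv_cst s 0) H)); rewrite mul0r add0r /f'.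
under eq_Rintegral do rewrite !mul0r !addr0.
have I a' p' q' := airyK_integrable a' p' q' u v ok.
have domd a' p' q' := CP s a' p' q' c dl u v ss c0 (lexx _).
have cc0 : 0 < c / 2 by rewrite divr_gt0.
have IZ k a' p' q' := exp_dominated_integrable cc0 (exp_dominatedZ k (domd a' p' q')).
have I2 := exp_dominated_integrable cc0 (exp_dominatedD (exp_dominatedZ (- ddl) (domd a.+1 p q))
  (exp_dominatedZ du (domd a p.+1 q))).
rewrite RintegralD // RintegralD // !RintegralZl //.
by move: (Rintegral _ _ _) (Rintegral _ _ _) (Rintegral _ _ _); clear => x y z; ring.
Qed.

Lemma ext_airy_kernelE x u x' v :
  ext_airy_kernel x u x' v = airyK (if x' <= x then 1 else -1) 0 0 0 (x - x') u v.
Proof.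
rewrite /ext_airy_kernel /airyK; case: (leP x' x) => xx'.
  rewrite mul1r; apply: eq_Rintegral => l _.
  by rewrite /airyK_integrand expr0 !mul1r -!airyD0 mulNr.
rewrite mulN1r; congr (- _).
have ok : airyK_ok (-1) (x - x') by apply: airyK_okN1; rewrite subr_lt0.
have [ss [eta e0 c0]] := ok; have [C C0 CP] := airyK_dominated e0.
have c20 : 0 < -1 * (x - x' + 2 * eta) / 2 by rewrite divr_gt0.
have [cn dm] := CP (-1) 0 0 0 _ (x - x') u v ss c0 (lexx _).
have E l : airyK_integrand (-1) 0 0 0 (x - x') u v l =
   expR (- - l * (x - x')) * airy (u - l) * airy (v - l).
  by rewrite /airyK_integrand expr0 !mul1r -!airyD0 !mulN1r !mulNr.
pose F l := expR (- l * (x - x')) * airy (u + l) * airy (v + l).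
have cF : continuous F.
  have FE : F = (airyK_integrand (-1) 0 0 0 (x - x') u v) \o -%R.
    by apply/funext => z; rewrite /= E !opprK /F.
  by rewrite FE => l; apply: continuous_comp; [exact: opp_continuous|exact: cn].
have FN l : F (- l) = airyK_integrand (-1) 0 0 0 (x - x') u v l by rewrite E.
pose K := C * airyK_const 0 (-1 * (x - x' + 2 * eta)) * 0`!%:R * 0`!%:R * expR (- eta * (u + v)).
have fC l : 0 <= l -> `|F (- l)| <= K * expR (- (-1 * (x - x' + 2 * eta) / 2) * l).
  by move=> /dm; rewrite FN.
rewrite (half_line_reflect c20 cF fC).
by apply: eq_Rintegral => l _; rewrite FN.
Qed.
End AiryKernel.

(** * Fredholm determinants as limits of matrix determinants *)

Section Determinants.
Context {R : realType}.

Lemma sylvester_det n k (X : 'M[R]_(n, k)) (Y : 'M[R]_(k, n)) :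
  \det (1%:M + X *m Y) = \det (1%:M + Y *m X).
Proof.
have E1 : block_mx 1%:M (- X) Y 1%:M *m block_mx 1%:M X 0 1%:M =
    block_mx 1%:M 0 Y (1%:M + Y *m X).
  by rewrite mulmx_block !mul1mx !mulmx1 !mulmx0 !addr0 subrr addrC.
have E2 : block_mx 1%:M X 0 1%:M *m block_mx 1%:M (- X) Y 1%:M =
    block_mx (1%:M + X *m Y) 0 Y 1%:M.
  by rewrite mulmx_block !mul1mx !mulmx1 !mul0mx !add0r addNr.
have := congr1 determinant E1; have := congr1 determinant E2.
by rewrite !det_mulmx !det_lblock !det_ublock !det1 !mul1r !mulr1 => -> ->.
Qed.

(** With P the matrix that selects the rows of [z], the left matrix is 1 + P^T P (X - 1) and the
    right one is 1 + P (X - 1) P^T; [sylvester_det] equates their determinants. *)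
Lemma det_rows_select n (X : 'M[R]_n) k (z : 'I_k -> 'I_n) : injective z ->
  \det (\matrix_(i, j) if i \in codom z then X i j else (i == j)%:R) =
  \det (\matrix_(a, b) X (z a) (z b)).
Proof.
move=> zI; pose P : 'M[R]_(k, n) := \matrix_(a, j) (z a == j)%:R.
have PM m (Y : 'M[R]_(n, m)) a b : (P *m Y) a b = Y (z a) b.
  rewrite mxE (bigD1 (z a)) //= mxE eqxx mul1r big1 ?addr0 // => j jz.
  by rewrite mxE eq_sym (negbTE jz) mul0r.
have MP m (Y : 'M[R]_(m, n)) a b : (Y *m P^T) a b = Y a (z b).
  rewrite mxE (bigD1 (z b)) //= !mxE eqxx mulr1 big1 ?addr0 // => j jz.
  by rewrite !mxE eq_sym (negbTE jz) mulr0.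
have -> : \matrix_(a, b) X (z a) (z b) = 1%:M + (P *m (X - 1%:M)) *m P^T.
  apply/matrixP => a b; rewrite mxE [RHS]mxE MP PM !mxE (inj_eq zI).
  by rewrite addrC subrK.
rewrite -sylvester_det; congr (\det _); apply/matrixP => i j; rewrite mxE [RHS]mxE mxE [X in _ + X]mxE.
case: (boolP (i \in codom z)) => [/codomP[a ->]|iz].
  rewrite (bigD1 a) //= PM big1 ?addr0; first by rewrite !mxE eqxx mul1r addrC subrK.
  by move=> b ba; rewrite PM [P^T _ _]mxE [P _ _]mxE (inj_eq zI) (negbTE ba) mul0r.
rewrite big1 ?addr0 ?mxE // => a _; rewrite [P^T _ _]mxE [P _ _]mxE.
case: eqP => [E|]; last by rewrite mul0r.
by move/negP: iz; case; rewrite -E codom_f.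
Qed.

Lemma det_rows_eq0 n (X : 'M[R]_n) k (z : 'I_k -> 'I_n) : ~~ injectiveb z ->
  \det (\matrix_(a, b) X (z a) (z b)) = 0.
Proof.
move=> /injectivePn [a [b ab zab]]; apply: (determinant_alternate ab).
by move=> c; rewrite !mxE zab.
Qed.

Lemma det_1D_subsets n (X : 'M[R]_n) : \det (1%:M + X) =
  \sum_(S : {set 'I_n}) \det (\matrix_(i, j) if i \in S then X i j else (i == j)%:R).
Proof.
rewrite /determinant exchange_big; apply: eq_bigr => s _ /=; rewrite -mulr_sumr; congr (_ * _).
under eq_bigr do rewrite !mxE addrC.
rewrite bigA_distr /=; apply: eq_bigr => S _.
by apply: eq_bigr => i iS; rewrite mxE.
Qed.

(** A map that is not injective repeats a row, and each set of k indices is the image of k!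
    injective maps. *)
Lemma sum_ffun_minors n (X : 'M[R]_n) k :
  \sum_(z : {ffun 'I_k -> 'I_n}) \det (\matrix_(a, b) X (z a) (z b)) =
  k`!%:R * \sum_(S : {set 'I_n} | #|S| == k)
    \det (\matrix_(i, j) if i \in S then X i j else (i == j)%:R).
Proof.
rewrite (bigID (fun z : {ffun 'I_k -> 'I_n} => injectiveb z)) /= [X in _ + X]big1 ?addr0; last first.
  by move=> z; exact: det_rows_eq0.
have im (z : {ffun 'I_k -> 'I_n}) : injectiveb z -> #|[set x in codom z]| == k :> nat.
  by move=> /injectiveP zI; rewrite cardsE card_codom // card_ord.
rewrite (partition_big (fun z : {ffun 'I_k -> 'I_n} => [set x in codom z])
  (fun S : {set 'I_n} => #|S| == k)) /=; last by move=> z; exact: im.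
rewrite mulr_sumr; apply: eq_bigr => S /eqP Sk.
rewrite (eq_bigr (fun=> \det (\matrix_(i, j) if i \in S then X i j else (i == j)%:R))); last first.
  move=> z /andP[/injectiveP zI /eqP <-]; rewrite -(det_rows_select X zI); congr (\det _).
  by apply/matrixP => i j; rewrite !mxE inE.
set dS := \det _.
transitivity ((\sum_(z : {ffun 'I_k -> 'I_n} | injectiveb z && ([set x in codom z] == S)) 1%N)%:R * dS).
  by rewrite natr_sum mulr_suml; apply: eq_bigr => z _; rewrite mul1r.
congr (_%:R * _).
have := card_inj_ffuns_on 'I_k [in S]; rewrite card_ord Sk ffactnn => <-.
rewrite -sum1_card; apply: eq_bigl => z; rewrite !inE.
rewrite andbC; case zI : (injectiveb z); rewrite ?andbF ?andbT //=.
apply/eqP/ffun_onP => [<- a|zS]; first by rewrite inE codom_f.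
apply/eqP; rewrite eqEcard Sk (eqP (im z zI)) leqnn andbT.
by apply/fintype.subsetP => x; rewrite inE => /codomP[a ->]; exact: zS.
Qed.

(** Any cut-off above the size is allowed, because larger minors vanish; the terms can then be
    compared with those of an infinite series while the size grows. *)
Lemma von_Koch n (X : 'M[R]_n) K : (n < K)%N -> \det (1%:M + X) =
  \sum_(k < K) (k`!%:R)^-1 *
    \sum_(z : {ffun 'I_k -> 'I_n}) \det (\matrix_(a, b) X (z a) (z b)).
Proof.
move=> nK; rewrite det_1D_subsets.
rewrite (partition_big (fun S : {set 'I_n} => inord #|S| : 'I_K.-1.+1) predT) //=.
case: K nK => // K nK /=; apply: eq_bigr => k _.
rewrite sum_ffun_minors mulKf ?pnatr_eq0 -?lt0n ?fact_gt0 //.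
apply: eq_bigl => S; rewrite -val_eqE /= inordK // ltnS.
by apply: leq_trans (max_card _) _; rewrite card_ord.
Qed.

(** Induction on the size. An orthogonal factor on the right keeps the row norms and the squared
    determinant, and it can turn the first row into a multiple of the first basis vector; expansion
    along that row leaves a smaller minor. *)
Lemma hadamard n (A : 'M[R]_n) :
  (\det A) ^+ 2 <= \prod_i \sum_j A i j ^+ 2.
Proof.
elim: n A => [|n IH] A; first by rewrite det_mx00 big_ord0 expr1n.
pose N (a : 'rV[R]_n.+1) := (a *m a^T) 0 0.
have NE a : N a = \sum_j a 0 j ^+ 2.
  by rewrite /N mxE; apply: eq_bigr => j _; rewrite mxE expr2.
have N0 a : 0 <= N a by rewrite NE sumr_ge0 // => j _; exact: sqr_ge0.
pose a := row 0 A.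
have [Q QQ aQ] : exists2 Q : 'M[R]_n.+1, Q *m Q^T = 1%:M &
    a *m Q = Num.sqrt (N a) *: delta_mx 0 0.
  pose v := a - Num.sqrt (N a) *: delta_mx 0 0.
  have [v0|vN0] := eqVneq (N v) 0.
    exists 1%:M; first by rewrite trmx1 mulmx1.
    rewrite mulmx1; apply/eqP; rewrite -subr_eq0; apply/eqP/rowP => j.
    have := v0; rewrite NE => /psumr_eq0P H.
    have /H /(_ j isT) /eqP : forall i, true -> 0 <= v 0 i ^+ 2 by move=> i _; exact: sqr_ge0.
    by rewrite sqrf_eq0 => /eqP -> ; rewrite mxE.
  (* Householder reflection in the hyperplane orthogonal to [v]; it exchanges the two vectors of
     equal length whose difference is [v]. *)
  pose Q := 1%:M - (2 / N v) *: (v^T *m v).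
  have QT : Q^T = Q by rewrite linearB linearZ /= trmx1 trmx_mul trmxK.
  have vv : v *m v^T = (N v)%:M by rewrite [LHS]mx11_scalar.
  exists Q.
    have H (W : 'M[R]_n.+1) (c k : R) : W *m W = k *: W -> c * c * k = c + c ->
        (1%:M - c *: W) *m (1%:M - c *: W) = 1%:M.
      move=> WW ck; rewrite mulmxBl mul1mx mulmxBr mulmx1 -scalemxAl -scalemxAr WW.
      by rewrite !scalerA ck scalerDl opprB addrK subrK.
    rewrite QT; apply: (H _ _ (N v)); last by field.
    by rewrite mulmxA -[v^T *m v *m v^T]mulmxA vv mul_mx_scalar -scalemxAl.
  have av : a *m v^T = (N v / 2)%:M.
    rewrite [LHS]mx11_scalar; congr (_%:M).
    have s2 : Num.sqrt (N a) * Num.sqrt (N a) = N a by rewrite -expr2 sqr_sqrtr.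
    have e1 : (a *m v^T) 0 0 = N a - Num.sqrt (N a) * a 0 0.
      rewrite linearB linearZ /= mulmxBr -scalemxAr trmx_delta -colE.
      rewrite [X in _ = X - _]/N; set Z := a *m a^T; set s := Num.sqrt _.
      by rewrite mxE [X in _ + X]mxE [X in - X]mxE [X in _ - _ * X]mxE.
    have e2 : N v = (a *m v^T) 0 0 - Num.sqrt (N a) * a 0 0 + N a.
      rewrite /N {1}/v mulmxBl mxE [X in _ + X]mxE -scalemxAl mxE -rowE mxE.
      rewrite -addrA; congr (_ + _).
      have -> : row 0 v^T 0 0 = a 0 0 - Num.sqrt (N a).
        rewrite mxE mxE /v mxE; congr (_ + _).
        by rewrite mxE [X in - X]mxE [X in _ * X]mxE !eqxx mulr1.
      by rewrite -/(N a) mulrBr s2 opprB addrC.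
    by rewrite e2 e1; field.
  rewrite mulmxBr mulmx1 -scalemxAr mulmxA av mul_scalar_mx scalerA.
  have -> : 2 / N v * (N v / 2) = 1 by field.
  by rewrite scale1r opprB addrC subrK.
pose B := A *m Q.
have dQ : (\det Q) ^+ 2 = 1 by rewrite expr2 -{2}det_tr -det_mulmx QQ det1.
have dB : (\det A) ^+ 2 = (\det B) ^+ 2 by rewrite det_mulmx exprMn dQ mulr1.
have rB i : \sum_j A i j ^+ 2 = \sum_j B i j ^+ 2.
  have E (M : 'M[R]_n.+1) : \sum_j M i j ^+ 2 = (M *m M^T) i i.
    by rewrite mxE; apply: eq_bigr => j _; rewrite mxE expr2.
  by rewrite !E /B trmx_mul mulmxA -(mulmxA A) QQ mulmx1.
have B0 : row 0 B = Num.sqrt (N a) *: delta_mx 0 0 by rewrite /B row_mul aQ.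
have B0j j : B 0 j = Num.sqrt (N a) * (j == 0)%:R.
  by have := congr1 (fun M : 'rV_n.+1 => M 0 j) B0; rewrite !mxE eqxx.
rewrite dB; under eq_bigr do rewrite rB.
rewrite (expand_det_row _ 0) (bigD1 0) //= big1 ?addr0; last first.
  by move=> j j0; rewrite B0j (negbTE j0) mulr0 mul0r.
rewrite big_ord_recl exprMn; apply: ler_pM; rewrite ?sqr_ge0 //.
  by rewrite (bigD1 0) //= lerDl sumr_ge0 // => j _; exact: sqr_ge0.
rewrite /cofactor addn0 expr0 mul1r; apply: le_trans (IH _) _.
apply: ler_prod => i _; rewrite sumr_ge0 /=; last by move=> j _; exact: sqr_ge0.
rewrite [X in _ <= X]big_ord_recl ler_wpDl ?sqr_ge0 //.
by apply: ler_sum => j _; rewrite !mxE.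
Qed.

(** k^(k/2), Hadamard's bound for a matrix of size k with entries of modulus at most 1. *)
Definition had (k : nat) : R := Num.sqrt (k%:R ^+ k).

Lemma had_ge0 k : 0 <= had k. Proof. exact: sqrtr_ge0. Qed.

Lemma hadamard_weighted k (A : 'M[R]_k) (r w : 'I_k -> R) :
  (forall a, 0 <= r a) -> (forall a, 0 < w a) ->
  (forall a b, `|A a b| <= r a * (w a * w b)) ->
  `|\det A| <= had k * \prod_a r a * \prod_a w a ^+ 2.
Proof.
move=> r0 w0 Aw; pose B : 'M[R]_k := \matrix_(a, b) (A a b / (w a * w b)).
have Bb a b : `|B a b| <= r a.
  have ww : 0 < w a * w b by rewrite mulr_gt0.
  by rewrite mxE normrM [`|_^-1|]ger0_norm ?ler_pdivrMr // invr_ge0 ltW.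
pose D := diag_mx (\row_a w a).
have AE : A = D *m B *m D.
  apply/matrixP => a b; rewrite mul_mx_diag mxE mul_diag_mx mxE !mxE.
  by field; rewrite !gt_eqF.
have dD : \det D = \prod_a w a.
  by rewrite det_diag; apply: eq_bigr => a _; rewrite mxE.
have dA : `|\det A| = `|\det B| * \prod_a w a ^+ 2.
  rewrite AE !det_mulmx dD !normrM ger0_norm; last first.
    by rewrite prodr_ge0 // => a _; exact: ltW.
  by rewrite [X in X * _]mulrC -mulrA -expr2 prodrXl.
rewrite dA ler_wpM2r //; first by rewrite prodr_ge0 // => a _; exact: sqr_ge0.
rewrite -ler_sqr ?nnegrE ?normr_ge0 ?mulr_ge0 ?had_ge0 ?prodr_ge0 //.
rewrite real_normK ?num_real // exprMn sqr_sqrtr ?exprn_ge0 //.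
apply: le_trans (hadamard B) _.
apply: (@le_trans _ _ (\prod_(a < k) (k%:R * r a ^+ 2))).
  apply: ler_prod => a _; rewrite sumr_ge0 /=; last by move=> j _; exact: sqr_ge0.
  apply: (@le_trans _ _ (\sum_(j < k) r a ^+ 2)).
    apply: ler_sum => j _; rewrite -real_normK ?num_real // ler_sqr ?nnegrE //.
  by rewrite sumr_const card_ord mulr_natl.
by rewrite big_split /= prodr_const card_ord prodrXl.
Qed.

Lemma had_summable (Y : R) : 0 <= Y -> exists2 M : nat -> R, cvgn (series M) &
  forall k, had k * Y ^+ k / k`!%:R <= M k.
Proof.
(* Since k^k <= k! e^k, the square of the k-th term is at most (e Y^2)^k / k!, the product of a term
   of the series for exp X and of 4^-k; the square root of a product is at most the sum. *)
move=> Y0; pose X := 4 * expR 1 * Y ^+ 2.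
exists (exp_coeff X \+ geometric 1 4^-1).
  rewrite seriesD; apply: is_cvgD; first exact: is_cvg_series_exp_coeff.
  by apply: is_cvg_geometric_series; rewrite ger0_norm ?invr_ge0 // invf_lt1 // ltr1n.
move=> k; rewrite /exp_coeff /geometric /= mul1r; set f := k`!%:R.
have f0 : 0 < f by rewrite ltr0n fact_gt0.
have X0 : 0 <= X by rewrite !mulr_ge0 ?expR_ge0 ?sqr_ge0.
set a := X ^+ k / f; set b := 4^-1 ^+ k.
have a0 : 0 <= a by rewrite divr_ge0 ?exprn_ge0 // ltW.
have b0 : 0 <= b by rewrite exprn_ge0 // invr_ge0.
have h0 : 0 <= had k * Y ^+ k / f by rewrite divr_ge0 ?mulr_ge0 ?had_ge0 ?exprn_ge0 // ltW.
rewrite -ler_sqr ?nnegrE ?addr_ge0 //.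
apply: (@le_trans _ _ (a * b)); last by rewrite sqrrD; nra.
have kk : k%:R ^+ k <= f * expR 1 ^+ k.
  by rewrite -expRM_natl mulr1; apply: expR_ge_pow.
rewrite !exprMn sqr_sqrtr ?exprn_ge0 //.
have -> : a * b = (expR 1 ^+ k * (Y ^+ k) ^+ 2) / f.
  rewrite /a /b mulrAC -exprMn (_ : X * 4^-1 = expR 1 * Y ^+ 2); last by rewrite /X; field.
  by rewrite exprMn [(Y ^+ k) ^+ 2]exprAC.
apply: (@le_trans _ _ (f * expR 1 ^+ k * (Y ^+ k) ^+ 2 * f^-1 ^+ 2)).
  by rewrite !ler_wpM2r ?sqr_ge0.
by rewrite le_eqVlt; apply/orP; left; apply/eqP; field; rewrite gt_eqF.
Qed.
End Determinants.


Section Limits.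
Context {R : realType}.

Lemma cvgn_sum (I : Type) (s : seq I) (P : pred I) (f : I -> nat -> R) (l : I -> R) :
  (forall i, f i N @[N --> \oo] --> l i) ->
  (\sum_(i <- s | P i) f i N) @[N --> \oo] --> \sum_(i <- s | P i) l i.
Proof.
move=> H; elim: s => [|i s IH].
  by rewrite big_nil; under eq_fun do rewrite big_nil; exact: cvg_cst.
rewrite big_cons; under eq_fun do rewrite big_cons.
by case: ifP => // _; apply: cvgD.
Qed.

Lemma cvgn_prod (I : Type) (s : seq I) (P : pred I) (f : I -> nat -> R) (l : I -> R) :
  (forall i, f i N @[N --> \oo] --> l i) ->
  (\prod_(i <- s | P i) f i N) @[N --> \oo] --> \prod_(i <- s | P i) l i.
Proof.
move=> H; elim: s => [|i s IH].
  by rewrite big_nil; under eq_fun do rewrite big_nil; exact: cvg_cst.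
rewrite big_cons; under eq_fun do rewrite big_cons.
by case: ifP => // _; apply: cvgM.
Qed.

Lemma cvgn_det k (M : nat -> 'M[R]_k) (M0 : 'M[R]_k) :
  (forall i j, M N i j @[N --> \oo] --> M0 i j) ->
  \det (M N) @[N --> \oo] --> \det M0.
Proof.
move=> H; rewrite /determinant; apply: cvgn_sum => s; apply: cvgMr.
by apply: cvgn_prod => i.
Qed.

Lemma cvgn_le_norm (u : nat -> R) l C : u N @[N --> \oo] --> l ->
  (\forall N \near \oo, `|u N| <= C) -> `|l| <= C.
Proof.
move=> ul uC; have /cvg_norm nl := ul.
by rewrite -(cvg_lim _ nl) //; apply: limr_le => //; apply/cvg_ex; exists `|l|.
Qed.

Lemma tannery (u : nat -> nat -> R) (u0 : nat -> R) (M s : nat -> R) :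
  cvgn (series M) -> (forall N k, `|u N k| <= M k) ->
  (forall k, u N k @[N --> \oo] --> u0 k) ->
  (forall N, series (u N) k @[k --> \oo] --> s N) ->
  cvgn (series u0) /\ s N @[N --> \oo] --> limn (series u0).
Proof.
move=> cM uM uu us.
have M0 k : 0 <= M k by apply: le_trans (uM 0 k).
have u0M k : `|u0 k| <= M k.
  by apply: (cvgn_le_norm (uu k)); near=> N; exact: uM.
have mM : {homo series M : n m / (n <= m)%N >-> n <= m}.
  by apply: nondecreasing_series => n _ _; exact: M0.
have tail (v : nat -> R) l K : (forall k, `|v k| <= M k) -> series v k @[k --> \oo] --> l ->
    `|l - series v K| <= limn (series M) - series M K.
  move=> vM vl.
  have H : (series v k - series v K) @[k --> \oo] --> l - series v K.
    by apply: cvgB => //; exact: cvg_cst.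
  apply: (cvgn_le_norm H); near=> k.
  have Kk : (K <= k)%N by near: k; exact: nbhs_infty_ge.
  apply: le_trans (_ : series M k - series M K <= _); last first.
    by rewrite lerD2r; exact: nondecreasing_cvgn_le.
  rewrite !sub_series Kk; apply: le_trans (ler_norm_sum _ _ _) _.
  by apply: ler_sum.
have cu0 : cvgn (series u0).
  apply: normed_cvg; apply: (series_le_cvg _ M0) => // n.
  exact: normr_ge0.
split=> //; apply/cvgrPdist_le => e e0.
have e3 : 0 < e / 3 by rewrite divr_gt0.
have [K _ HK] : \forall K \near \oo, `|limn (series M) - series M K| <= e / 3.
  by move/cvgrPdist_le : (cM) => /(_ _ e3).
have := HK K (leqnn K); rewrite ger0_norm ?subr_ge0; last exact: nondecreasing_cvgn_le.
move=> {}HK.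
have : series (u N) K @[N --> \oo] --> series u0 K.
  by rewrite /series /=; apply: cvgn_sum.
move=> /cvgrPdist_le /(_ _ e3) HN; near=> N.
have h1 := tail _ _ K u0M cu0; have h2 := tail _ _ K (uM N) (us N).
have h3 : `|series u0 K - series (u N) K| <= e / 3 by near: N.
have -> : limn (series u0) - s N = (limn (series u0) - series u0 K) +
  (series u0 K - series (u N) K) - (s N - series (u N) K) by ring.
apply: le_trans (ler_normB _ _) _; have := ler_normD (limn (series u0) - series u0 K) (series u0 K - series (u N) K).
lra.
Unshelve. all: by end_near. Qed.
End Limits.

(** * Riemann sums over half-lines *)

Section RiemannSums.
Context {R : realType}.
Notation mu := (@lebesgue_measure R).

Definition mesh (kap : R) (N : nat) : R := kap / N.+1%:R.

Lemma mesh_gt0 kap N : 0 < kap -> 0 < mesh kap N.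
Proof. by move=> k0; rewrite divr_gt0. Qed.

Lemma mesh_le kap N : 0 < kap -> mesh kap N <= kap.
Proof. by move=> k0; rewrite /mesh ler_piMr //; [exact: ltW|rewrite invf_le1 // ler1n]. Qed.

Lemma cvg_mesh kap : mesh kap N @[N --> \oo] --> (0 : R).
Proof.
rewrite /mesh -[X in _ --> X](mulr0 kap); apply: cvgMr; exact: cvg_harmonic.
Qed.

Definition cell (r h : R) (a : nat) : set R := `[r + a%:R * h, r + a.+1%:R * h[.

Lemma cellP r h a u : 0 < h -> r <= u ->
  cell r h a u <-> Num.truncn ((u - r) / h) = a.
Proof.
move=> h0 ru; have q0 : 0 <= (u - r) / h by rewrite divr_ge0 ?subr_ge0 // ltW.
rewrite /cell /= in_itv /= addrC -lerBrDr [r + _]addrC -ltrBlDr -ler_pdivlMr // -ltr_pdivrMr //.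
by rewrite -truncn_eq //; split=> /eqP.
Qed.

Definition step_fun (r h : R) L (g : R -> R) (u : R) : R :=
  \sum_(a < L) g (r + a%:R * h) * \1_(cell r h a) u.

Lemma step_funE r h L g u : 0 < h -> r <= u ->
  step_fun r h L g u = if (Num.truncn ((u - r) / h) < L)%N then
    g (r + (Num.truncn ((u - r) / h))%:R * h) else 0.
Proof.
move=> h0 ru; set a := Num.truncn _; rewrite /step_fun; case: ifP => aL.
  rewrite (bigD1 (Ordinal aL)) //= big1 => [|b /negP ba].
    by rewrite addr0 indicE mem_set ?mulr1 //; exact/cellP.
  rewrite indicE memNset ?mulr0 // => /cellP -/(_ h0 ru) ab.
  by case: ba; apply/eqP/val_inj; rewrite /= -ab.
rewrite big1 // => b _; rewrite indicE memNset ?mulr0 // => /cellP -/(_ h0 ru) ab.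
by have := ltn_ord b; rewrite -ab aL.
Qed.

Lemma measurable_cell r h a : measurable (cell r h a).
Proof. exact: measurable_itv. Qed.

Lemma step_fun_integral r h L g : 0 < h ->
  mu.-integrable `[r, +oo[ (EFin \o step_fun r h L g) /\
  \int[mu]_(u in `[r, +oo[) step_fun r h L g u = h * \sum_(a < L) g (r + a%:R * h).
Proof.
move=> h0.
have cellI a : mu.-integrable `[r, +oo[ (EFin \o \1_(cell r h a)) /\
    \int[mu]_(u in `[r, +oo[) \1_(cell r h a) u = h.
  have sub : cell r h a `&` `[r, +oo[%classic = cell r h a.
    apply/setIidPl => u; rewrite /cell /= !in_itv /= andbT => /andP[+ _].
    by apply: le_trans; rewrite lerDl mulr_ge0 // ltW.
  have E : (\int[mu]_(u in `[r, +oo[) (\1_(cell r h a) u)%:E = h%:E)%E.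
    rewrite integral_indic //=; [|exact: measurable_cell].
    rewrite sub /cell lebesgue_measure_itv /= lte_fin ltrD2l ltr_pM2r // ltr_nat ltnSn.
    by rewrite -EFinB; congr (_%:E); rewrite opprD addrACA subrr add0r -mulrBl -natrB // subSnn mul1r.
  split; last by rewrite /Rintegral E.
  apply/integrableP; split.
    by apply/measurable_EFinP; apply: measurable_indic; exact: measurable_cell.
  under eq_integral => u _ do rewrite /= ger0_norm //.
  by rewrite E ltry.
rewrite /step_fun; elim: L => [|L [IH1 IH2]].
  split.
    have -> : (EFin \o fun u : R => \sum_(a < 0) g (r + a%:R * h) * \1_(cell r h a) u) = cst 0%E.
      by apply/funext => u /=; rewrite big_ord0.
    exact: integrable0.
  rewrite big_ord0 mulr0; under eq_Rintegral do rewrite big_ord0.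
  by rewrite Rintegral_cst //= mul0r.
have [cI cE] := cellI L.
have cIZ : mu.-integrable `[r, +oo[ (EFin \o (fun u => g (r + L%:R * h) * \1_(cell r h L) u)).
  have : mu.-integrable `[r, +oo[ (fun u => (g (r + L%:R * h))%:E * (\1_(cell r h L) u)%:E)%E.
    exact: integrableZl.
  by apply: eq_integrable.
split.
  have : mu.-integrable `[r, +oo[ (fun u => (\sum_(a < L) g (r + a%:R * h) * \1_(cell r h a) u)%:E +
     (g (r + L%:R * h) * \1_(cell r h L) u)%:E)%E by exact: integrableD.
  by apply: eq_integrable => // u _ /=; rewrite big_ord_recr.
rewrite big_ord_recr /= mulrDr -IH2.
have -> : \int[mu]_(u in `[r, +oo[) \sum_(a < L.+1) g (r + a%:R * h) * \1_(cell r h a) u =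
  \int[mu]_(u in `[r, +oo[) (\sum_(a < L) g (r + a%:R * h) * \1_(cell r h a) u +
    g (r + L%:R * h) * \1_(cell r h L) u).
  by apply: eq_Rintegral => u _; rewrite big_ord_recr.
by rewrite RintegralD // RintegralZl // cE [X in _ + X]mulrC.
Qed.

(** The sum is the integral of a step function, to which dominated convergence applies. The step
    function evaluates [g N] at a grid point that moves with N, hence the hypothesis on sequences.
    The (N + 1)^2 points of spacing kap / (N + 1) reach distance kap (N + 1), so they exhaust the
    half-line. *)
Lemma riemann_sum_cvg (g : nat -> R -> R) (g0 : R -> R) r kap c C :
  0 < kap -> 0 < c -> (forall N u, r <= u -> `|g N u| <= C * expR (- c * u)) ->
  (forall u (v : nat -> R), r <= u -> (forall N, r <= v N) -> v N @[N --> \oo] --> u ->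
     g N (v N) @[N --> \oo] --> g0 u) ->
  mesh kap N * (\sum_(a < N.+1 ^ 2) g N (r + a%:R * mesh kap N)) @[N --> \oo]
    --> \int[mu]_(u in `[r, +oo[) g0 u.
Proof.
move=> k0 c0 gC gg.
have C0 : 0 <= C.
  by have := le_trans (normr_ge0 _) (gC 0 r (lexx r)); rewrite pmulr_lge0 // expR_gt0.
pose f N := step_fun r (mesh kap N) (N.+1 ^ 2) (g N).
have fI N := step_fun_integral r (N.+1 ^ 2) (g N) (mesh_gt0 N k0).
pose tr N u := r + (Num.truncn ((u - r) / mesh kap N))%:R * mesh kap N.
have trP N u : r <= u -> [/\ r <= tr N u, tr N u <= u & u < tr N u + mesh kap N].
  move=> ru; have h0 := mesh_gt0 N k0.
  have /(cellP _ h0 ru) : Num.truncn ((u - r) / mesh kap N) = Num.truncn ((u - r) / mesh kap N) by [].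
  rewrite /cell /= in_itv /= => /andP[h1 h2]; split=> //.
    by rewrite /tr lerDl mulr_ge0 // ltW.
  by move: h2; rewrite /tr -natr1 mulrDl mul1r addrA.
have fg u : `[r, +oo[%classic u -> (f N u)%:E @[N --> \oo] --> (g0 u)%:E.
  rewrite /= in_itv /= andbT => ru.
  have tru : tr N u @[N --> \oo] --> u.
    apply/cvgrPdist_le => e e0.
    have /cvgrPdist_le /(_ _ e0) := @cvg_mesh kap.
    apply: filterS => N; rewrite sub0r normrN ger0_norm; last exact: ltW (mesh_gt0 N k0).
    have [_ t1 t2] := trP N u ru; rewrite ger0_norm ?subr_ge0 //; lra.
  have := gg u (tr ^~ u) ru (fun N => let: And3 h _ _ := trP N u ru in h) tru.
  move=> H; apply/fine_cvgP; split; first exact: nearW.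
  apply: cvg_trans H; apply: near_eq_cvg; near=> N.
  rewrite /= /f step_funE ?mesh_gt0 // ifT //.
  rewrite -(ltr_nat R) (@le_lt_trans _ _ ((u - r) / mesh kap N)) //.
    have q0 : 0 <= (u - r) / mesh kap N by rewrite divr_ge0 ?subr_ge0 // ltW // mesh_gt0.
    by have /andP[] := truncn_itv q0.
  rewrite /mesh invf_div mulrA natrX expr2 mulrAC ltr_pM2r ?ltr0n //.
  near: N; apply: filterS (nbhs_infty_gtr ((u - r) / kap)) => N /lt_le_trans; apply.
  by rewrite ler_nat.
have bnd N u : `[r, +oo[%classic u -> (`|(f N u)%:E| <= (C * expR (c * kap) * expR (- c * u))%:E)%E.
  rewrite /= in_itv /= andbT => ru; rewrite lee_fin /f step_funE ?mesh_gt0 //.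
  case: ifP => _; last by rewrite normr0 !mulr_ge0 ?expR_ge0.
  have [t0 _ t1] := trP N u ru; apply: le_trans (gC N _ t0) _.
  rewrite -mulrA ler_wpM2l // -expRD ler_expR.
  have := mesh_le N k0; rewrite -/(tr N u); nra.
have iC := expRN_integrableZ r (C * expR (c * kap)) c0.
have := @dominated_cvg _ _ _ mu `[r, +oo[%classic (measurable_itv _)
  (fun N u => (f N u)%:E) (fun u => (g0 u)%:E)
  (fun u => (C * expR (c * kap) * expR (- c * u))%:E).
have mf N : measurable_fun `[r, +oo[%classic (fun u : measurableTypeR R => (f N u)%:E).
  by have [/integrableP[]] := fI N.
move=> /(_ mf fg (fun _ _ => isT) iC bnd) H.
have g0I : mu.-integrable `[r, +oo[ (EFin \o g0).
  apply: le_integrable iC => //; first exact: emeasurable_fun_cvg mf fg.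
  move=> u ru; rewrite [X in (_ <= X)%E]gee0_abs ?lee_fin ?mulr_ge0 ?expR_ge0 //.
  apply: (@cvgn_le_norm R (fun N => f N u)); last by near=> N; have := bnd N u ru; rewrite lee_fin.
  by have /fine_cvgP[] := fg u ru.
have : fine (\int[mu]_(u in `[r, +oo[) (f N u)%:E)%E @[N --> \oo] -->
   fine (\int[mu]_(u in `[r, +oo[) (g0 u)%:E)%E.
  by apply: fine_cvg; rewrite fineK //; exact: integrable_fin_num.
apply: cvg_trans; apply: near_eq_cvg; near=> N.
by have [_ <-] := fI N.
Unshelve. all: by end_near. Qed.
End RiemannSums.


(** * Discretized Fredholm series *)

Section FredholmDiscretization.
Context {R : realType}.
Notation mu := (@lebesgue_measure R).
Variables (n : nat).
Implicit Types (r : 'I_n -> R) (h c C kap : R).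

Fixpoint multi_riemann r h L k : (k.-tuple ('I_n * R) -> R) -> R :=
  if k is k'.+1 then fun F =>
    \sum_(i < n) h * \sum_(a < L)
      multi_riemann r h L (fun z : k'.-tuple ('I_n * R) => F (cons_tuple (i, r i + a%:R * h) z))
  else fun F => F [tuple].

Definition in_domain r k (z : k.-tuple ('I_n * R)) := forall a, r (tnth z a).1 <= (tnth z a).2.

Definition exp_weight c k (z : k.-tuple ('I_n * R)) : R := \prod_(a < k) expR (- c * (tnth z a).2).

Definition cvg_points k (zs : nat -> k.-tuple ('I_n * R)) (z : k.-tuple ('I_n * R)) :=
  forall a, (forall N, (tnth (zs N) a).1 = (tnth z a).1) /\
    (tnth (zs N) a).2 @[N --> \oo] --> (tnth z a).2.

Lemma in_domain_cons r k i u (z : k.-tuple ('I_n * R)) : r i <= u -> in_domain r z ->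
  in_domain r (cons_tuple (i, u) z).
Proof.
move=> ru rz a; case: (unliftP ord0 a) => [j|] ->; last by rewrite tnth0.
by rewrite tnthS.
Qed.

Lemma exp_weight_cons c k i u (z : k.-tuple ('I_n * R)) :
  exp_weight c (cons_tuple (i, u) z) = expR (- c * u) * exp_weight c z.
Proof.
rewrite /exp_weight big_ord_recl tnth0; congr (_ * _).
by apply: eq_bigr => a _; rewrite tnthS.
Qed.

Lemma cvg_points_cons k i (v : nat -> R) u (zs : nat -> k.-tuple ('I_n * R)) z :
  v N @[N --> \oo] --> u -> cvg_points zs z ->
  cvg_points (fun N => cons_tuple (i, v N) (zs N)) (cons_tuple (i, u) z).
Proof.
move=> vu zz a; case: (unliftP ord0 a) => [j|] ->.
  have [z1 z2] := zz j; split=> [N|]; first by rewrite !tnthS.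
  by rewrite tnthS; under eq_fun do rewrite tnthS.
by split=> [N|]; [rewrite !tnth0|rewrite tnth0; under eq_fun do rewrite tnth0].
Qed.

Definition mass_bound r c kap : R := \sum_(i < n) expR (- c * r i) * (c^-1 + kap).

Lemma exp_riemann_bound x c h L : 0 < c -> 0 < h ->
  h * \sum_(a < L) expR (- c * (x + a%:R * h)) <= expR (- c * x) * (c^-1 + h).
Proof.
move=> c0 h0; set q := expR (- c * h).
have q1 : q < 1 by rewrite -expR0 ltr_expR mulNr oppr_lt0 mulr_gt0.
have -> : \sum_(a < L) expR (- c * (x + a%:R * h)) = expR (- c * x) * \sum_(a < L) q ^+ a.
  rewrite mulr_sumr; apply: eq_bigr => a _.
  by rewrite /q -expRM_natl -expRD; congr expR; ring.
rewrite mulrCA ler_wpM2l ?expR_ge0 //.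
have S : (1 - q) * \sum_(a < L) q ^+ a = 1 - q ^+ L by apply: oppr_inj; rewrite -mulNr !opprB subrX1.
have q0 : 0 <= q by exact: expR_ge0.
(* From exp (c h) >= 1 + c h; it keeps h times the geometric series bounded as [h] tends to 0. *)
have qe : 1 - q >= h / (c^-1 + h).
  have : q <= (1 + c * h)^-1.
    rewrite /q mulNr expRN lef_pV2 ?posrE ?expR_gt0 //; last by rewrite ltr_wpDr ?mulr_ge0 ?ltW.
    exact: expR_ge1Dx.
  have -> : h / (c^-1 + h) = 1 - (1 + c * h)^-1.
    by field; rewrite !gt_eqF ?addr_gt0 ?mulr_gt0.
  lra.
have ch : 0 < c^-1 + h by rewrite addr_gt0 // invr_gt0.
have s0 : 0 <= \sum_(a < L) q ^+ a by apply: sumr_ge0 => a _; exact: exprn_ge0.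
have : h / (c^-1 + h) * \sum_(a < L) q ^+ a <= 1.
  apply: le_trans (ler_wpM2r s0 qe) _; rewrite S lerBlDr lerDl; exact: exprn_ge0.
by rewrite mulrAC ler_pdivrMr // mul1r.
Qed.

Lemma multi_riemann_bound r h L k c C kap (F : k.-tuple ('I_n * R) -> R) :
  0 < c -> 0 < h -> h <= kap -> 0 <= C ->
  (forall z, in_domain r z -> `|F z| <= C * exp_weight c z) ->
  `|multi_riemann r h L F| <= C * mass_bound r c kap ^+ k.
Proof.
move=> c0 h0 hk; elim: k C F => [|k IH] C F C0 FC /=.
  rewrite expr0; apply: le_trans (FC _ _) _; first by case.
  by rewrite /exp_weight big_ord0.
set B := mass_bound r c kap.
have step i (a : 'I_L) : `|multi_riemann r h L (fun z : k.-tuple ('I_n * R) =>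
    F (cons_tuple (i, r i + a%:R * h) z))| <= C * expR (- c * (r i + a%:R * h)) * B ^+ k.
  apply: IH => [|z dz]; first by rewrite mulr_ge0 // expR_ge0.
  rewrite -mulrA -(exp_weight_cons c i); apply: FC.
  by apply: in_domain_cons => //; rewrite lerDl mulr_ge0 // ltW.
apply: (@le_trans _ _ (\sum_(i < n) C * (expR (- c * r i) * (c^-1 + kap)) * B ^+ k)).
  apply: le_trans (ler_norm_sum _ _ _) (ler_sum _ _) => i _.
  rewrite normrM ger0_norm ?(ltW h0) //.
  apply: (@le_trans _ _ (h * \sum_(a < L) C * expR (- c * (r i + a%:R * h)) * B ^+ k)).
    rewrite ler_wpM2l ?(ltW h0) //; apply: le_trans (ler_norm_sum _ _ _) (ler_sum _ _) => a _.
    exact: step.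
  rewrite -mulr_suml -mulr_sumr mulrA ler_wpM2r //.
    by rewrite exprn_ge0 // sumr_ge0 // => j _; rewrite mulr_ge0 ?expR_ge0 // addr_ge0 ?invr_ge0 ?ltW // (lt_le_trans h0).
  rewrite mulrCA ler_wpM2l //; apply: le_trans (exp_riemann_bound _ _ c0 h0) _.
  by rewrite ler_wpM2l ?expR_ge0 // lerD2l.
by rewrite -mulr_suml -mulr_sumr -/(mass_bound r c kap) -/B -mulrA -exprS.
Qed.

(** The integrand has to vary with N for the induction: peeling off one variable leaves functions
    evaluated at a moving grid point of that variable. *)
Lemma multi_riemann_cvg r c kap k C (F : nat -> k.-tuple ('I_n * R) -> R)
    (F0 : k.-tuple ('I_n * R) -> R) : 0 < c -> 0 < kap -> 0 <= C ->
  (forall N z, in_domain r z -> `|F N z| <= C * exp_weight c z) ->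
  (forall zs z, in_domain r z -> (forall N, in_domain r (zs N)) -> cvg_points zs z ->
     F N (zs N) @[N --> \oo] --> F0 z) ->
  multi_riemann r (mesh kap N) (N.+1 ^ 2) (F N) @[N --> \oo] --> iter_integral r F0.
Proof.
move=> c0 k0; elim: k C F F0 => [|k IH] C F F0 C0 FC FF /=.
  by apply: (FF (fun=> [tuple])) => [|N|]; case.
apply: cvgn_sum => i.
apply: (@riemann_sum_cvg R (fun N u => multi_riemann r (mesh kap N) (N.+1 ^ 2)
  (fun z : k.-tuple ('I_n * R) => F N (cons_tuple (i, u) z)))
  (fun u => iter_integral r (fun z : k.-tuple ('I_n * R) => F0 (cons_tuple (i, u) z)))
  (r i) kap c (C * mass_bound r c kap ^+ k)) => //.
  move=> N u ru; rewrite mulrAC.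
  apply: multi_riemann_bound; rewrite ?mesh_gt0 ?mesh_le ?mulr_ge0 ?expR_ge0 //.
  move=> z dz; rewrite -mulrA -(exp_weight_cons c i); apply: FC.
  exact: in_domain_cons.
move=> u v ru rv vu.
apply: (IH (C * expR (- c * r i))); first by rewrite mulr_ge0 // expR_ge0.
  move=> N z dz; apply: le_trans (FC _ _ (in_domain_cons (rv N) dz)) _.
  rewrite exp_weight_cons mulrA ler_wpM2r //.
    by apply: prodr_ge0 => a _; exact: expR_ge0.
  by rewrite ler_wpM2l // ler_expR; have := rv N; nra.
move=> zs z dz dzs zz; apply: FF; [exact: in_domain_cons|move=> N; exact: in_domain_cons|].
exact: cvg_points_cons.
Qed.

Definition grid L : finType := ('I_n * 'I_L)%type.
Definition grid_pt r h L (g : grid L) : 'I_n * R := (g.1, r g.1 + (g.2 : nat)%:R * h).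

Lemma sum_tuple_recl (I : finType) k (f : k.+1.-tuple I -> R) :
  \sum_(t : k.+1.-tuple I) f t = \sum_(i : I) \sum_(t : k.-tuple I) f (cons_tuple i t).
Proof.
rewrite pair_big /=.
rewrite (reindex (fun p : I * k.-tuple I => cons_tuple p.1 p.2)) /=.
  by apply: eq_bigr => -[i t].
exists (fun t : k.+1.-tuple I => (thead t, [tuple of behead t])) => [[i t]|t] _ /=.
  by congr (_, _); apply: val_inj.
by rewrite [in RHS](tuple_eta t); apply: val_inj.
Qed.

Lemma multi_riemannE r h L k (F : k.-tuple ('I_n * R) -> R) :
  multi_riemann r h L F =
    h ^+ k * \sum_(t : k.-tuple (grid L)) F (map_tuple (@grid_pt r h L) t).
Proof.
elim: k F => [|k IH] F /=.
  rewrite expr0 mul1r (bigD1 [tuple]) //= big1 ?addr0; last by move=> t /negP[]; apply/eqP; rewrite tuple0.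
  by congr F; apply: val_inj.
rewrite sum_tuple_recl exprS -mulrA.
under eq_bigr => i _.
  under eq_bigr do rewrite IH.
  rewrite -mulr_sumr; over.
rewrite -!mulr_sumr pair_bigA /=; congr (_ * (_ * _)).
apply: eq_bigr => -[i a] _; apply: eq_bigr => t _; congr F.
by apply: val_inj.
Qed.

Definition grid_kernel r h L (K : 'I_n -> R -> 'I_n -> R -> R) : 'M[R]_#|grid L| :=
  \matrix_(a, b) let p := grid_pt r h (enum_val a) in let q := grid_pt r h (enum_val b) in
    K p.1 p.2 q.1 q.2.

Definition kernel_det (K : 'I_n -> R -> 'I_n -> R -> R) k (z : k.-tuple ('I_n * R)) : R :=
  \det (\matrix_(a < k, b < k) K (tnth z a).1 (tnth z a).2 (tnth z b).1 (tnth z b).2).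

Lemma sum_grid_minors r h L K k :
  \sum_(z : {ffun 'I_k -> 'I_#|grid L|})
    \det (\matrix_(a, b) ((- h) *: grid_kernel r h L K) (z a) (z b)) =
  (-1) ^+ k * multi_riemann r h L (@kernel_det K k).
Proof.
rewrite multi_riemannE mulrA -exprMn mulN1r mulr_sumr.
rewrite (reindex (fun t : k.-tuple (grid L) => [ffun a => enum_rank (tnth t a)])) /=.
  apply: eq_bigr => t _; rewrite -[LHS]mul1r -detZ mul1r; congr (\det _).
  apply/matrixP => a b; rewrite !mxE !ffunE !enum_rankK !tnth_map.
  by [].
exists (fun z => [tuple enum_val (z a) | a < k]) => [t|z] _.
  by apply: eq_from_tnth => a; rewrite tnth_mktuple ffunE enum_rankK.
by apply/ffunP => a; rewrite ffunE tnth_mktuple enum_valK.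
Qed.

Lemma det_grid_series r h L K :
  series (fun k => (-1) ^+ k / k`!%:R * multi_riemann r h L (@kernel_det K k)) N
    @[N --> \oo] --> \det (1%:M + (- h) *: grid_kernel r h L K).
Proof.
apply: (@cvg_near_cst _ _ _ _ \oo); near=> N.
have LN : (#|grid L| < N)%N by near: N; exact: nbhs_infty_gt.
rewrite (von_Koch _ LN) /series /= big_mkord; apply: eq_bigr => k _.
by rewrite sum_grid_minors; ring.
Unshelve. all: by end_near. Qed.

Lemma kernel_det_bound (K : 'I_n -> R -> 'I_n -> R -> R) r c C k z : 0 <= C ->
  (forall i u j v, r i <= u -> r j <= v -> `|K i u j v| <= C * (expR (- c * u) * expR (- c * v))) ->
  in_domain r z -> `|@kernel_det K k z| <= had k * C ^+ k * exp_weight (2 * c) z.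
Proof.
move=> C0 KC dz.
have := @hadamard_weighted R k (\matrix_(a < k, b < k) K (tnth z a).1 (tnth z a).2 (tnth z b).1 (tnth z b).2)
  (fun=> C) (fun a => expR (- c * (tnth z a).2)).
rewrite prodr_const card_ord => H.
rewrite /exp_weight (eq_bigr (fun a => expR (- c * (tnth z a).2) ^+ 2)).
  by apply: H => [//|a|a b]; rewrite ?expR_gt0 // mxE; exact: KC.
by move=> a _; rewrite -expRM_natl; congr expR; ring.
Qed.

Lemma mass_bound_ge0 r c kap : 0 < c -> 0 < kap -> 0 <= mass_bound r c kap.
Proof.
move=> c0 k0; apply: sumr_ge0 => i _; rewrite mulr_ge0 ?expR_ge0 //.
by rewrite addr_ge0 ?invr_ge0 // ltW.
Qed.

Theorem fredholm_discrete r (K : 'I_n -> R -> 'I_n -> R -> R) c C kap :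
  0 < c -> 0 < kap -> 0 <= C ->
  (forall i u j v, r i <= u -> r j <= v -> `|K i u j v| <= C * (expR (- c * u) * expR (- c * v))) ->
  (forall i j u v (us vs : nat -> R), us N @[N --> \oo] --> u -> vs N @[N --> \oo] --> v ->
     K i (us N) j (vs N) @[N --> \oo] --> K i u j v) ->
  \det (1%:M + (- mesh kap N) *: grid_kernel r (mesh kap N) (N.+1 ^ 2) K) @[N --> \oo]
    --> fredholm_det r K.
Proof.
move=> c0 k0 C0 KC Kc; have c20 : 0 < 2 * c by rewrite mulr_gt0.
set B := mass_bound r (2 * c) kap; have B0 : 0 <= B by exact: mass_bound_ge0.
have [M cM MP] := @had_summable R (C * B) (mulr_ge0 C0 B0).
have T := @tannery R (fun N k => (-1) ^+ k / k`!%:R *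
   multi_riemann r (mesh kap N) (N.+1 ^ 2) (@kernel_det K k))
   (fun k => (-1) ^+ k / k`!%:R * iter_integral r (@kernel_det K k)) M
   (fun N => \det (1%:M + (- mesh kap N) *: grid_kernel r (mesh kap N) (N.+1 ^ 2) K)) cM.
apply: (T _ _ _).2 => {T}.
- move=> N k; apply: le_trans (MP k).
  rewrite normrM normrM normrX normrN1 expr1n mul1r ger0_norm ?invr_ge0 //.
  rewrite mulrC ler_wpM2r ?invr_ge0 // exprMn mulrA.
  apply: (multi_riemann_bound _ c20); rewrite ?mesh_gt0 ?mesh_le ?mulr_ge0 ?had_ge0 ?exprn_ge0 //.
  by move=> z; exact: kernel_det_bound.
- move=> k; apply: cvgMr.
  apply: (@multi_riemann_cvg r (2 * c) kap k (had k * C ^+ k)) => //.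
  + by rewrite mulr_ge0 ?had_ge0 ?exprn_ge0.
  + by move=> N z; exact: kernel_det_bound.
  + move=> zs z _ _ zz; apply: cvgn_det => a b; rewrite mxE; under eq_fun do rewrite mxE.
    have [a1 a2] := zz a; have [b1 b2] := zz b.
    by under eq_fun do rewrite a1 b1; exact: Kc.
- by move=> N; exact: det_grid_series.
Qed.
End FredholmDiscretization.

(** * Derivatives along lines with uniform bounds *)

Section LineDerivatives.
Context {R : realType} {V : lmodType R}.
Implicit Types (F G : V -> R) (x v : V).

(** [V] is a bare module: derivatives are one-variable derivatives along lines, and smoothness in
    several variables is expressed by bounds on iterated line derivatives. *)
Definition is_ld v F x d := is_derive (0 : R) 1 (fun t : R => F (x + t *: v)) d.
Definition ld v F x : R := 'D_1 (fun t : R => F (x + t *: v)) (0 : R).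

Lemma is_ldE v F x d : is_ld v F x d -> ld v F x = d.
Proof. by rewrite /is_ld /ld => H; rewrite derive_val. Qed.

Lemma is_ld_ld v F x d : is_ld v F x d -> is_ld v F x (ld v F x).
Proof. by move=> H; rewrite (is_ldE H). Qed.

Lemma is_ld_eq v F x d d' : is_ld v F x d -> d = d' -> is_ld v F x d'.
Proof. by move=> + <-. Qed.

Lemma is_ld_at v F x (t : R) d : is_ld v F (x + t *: v) d <->
  is_derive t 1 (fun s : R => F (x + s *: v)) d.
Proof.
have shift (f : R -> R) (a b e : R) : is_derive (a + b) 1 f e -> is_derive a 1 (fun s => f (s + b)) e.
  move=> H; have := @drv_comp R (fun s => s + b) f 1 e a.
  rewrite mulr1; apply=> //.
  by have := drvD (drv_id a) (drv_cst b a); rewrite addr0.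
split=> H.
  have := shift _ t (- t) d; rewrite subrr => /(_ _ H).
  apply: drv_ext => s; rewrite -addrA -scalerDl; congr (F (_ + _ *: _)); ring.
have := shift (fun s : R => F (x + s *: v)) 0 t d; rewrite add0r => /(_ H).
by apply: drv_ext => s; rewrite -addrA -scalerDl addrC [t + s]addrC addrC.
Qed.

Lemma is_ld_near v F G x d : (\forall t \near (0 : R), F (x + t *: v) = G (x + t *: v)) ->
  is_ld v F x d -> is_ld v G x d.
Proof.
move=> FG [dF E]; apply: DeriveDef.
  by move: dF; apply: near_eq_derivable FG; rewrite oner_neq0.
by rewrite -E; apply/esym; apply: near_eq_derive FG; rewrite oner_neq0.
Qed.

Lemma is_ld_cst v c x : is_ld v (fun=> c) x 0.
Proof. exact: drv_cst. Qed.

Lemma is_ldD v F G x a b : is_ld v F x a -> is_ld v G x b -> is_ld v (fun x => F x + G x) x (a + b).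
Proof. exact: drvD. Qed.

Lemma is_ldN v F x a : is_ld v F x a -> is_ld v (fun x => - F x) x (- a).
Proof. exact: drvN. Qed.

Lemma is_ldM v F G x a b : is_ld v F x a -> is_ld v G x b ->
  is_ld v (fun x => F x * G x) x (a * G x + F x * b).
Proof. by move=> Ha Hb; apply: (is_ld_eq (drvM Ha Hb)); rewrite !scale0r !addr0. Qed.

Lemma is_ldV v F x a : F x != 0 -> is_ld v F x a ->
  is_ld v (fun x => (F x)^-1) x (- a * ((F x)^-1 * (F x)^-1)).
Proof.
move=> F0 H; have F0' : F (x + 0 *: v) != 0 by rewrite scale0r addr0.
apply: (drv_eq (is_deriveV F0' H)); rewrite scale0r addr0 /GRing.scale /=.
by rewrite expr2 invfM !mulNr mulrC.
Qed.

Lemma is_ld_ln v F x a : 0 < F x -> is_ld v F x a ->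
  is_ld v (fun x => ln (F x)) x (a * (F x)^-1).
Proof.
move=> F0 H; have F0' : 0 < F (x + 0 *: v) by rewrite scale0r addr0.
have D := is_derive1_ln F0'.
have := @drv_comp R (fun t : R => F (x + t *: v)) (@ln R) a _ 0 H D.
by rewrite scale0r addr0 mulrC.
Qed.

Lemma is_ld_sum v (I : Type) (s : seq I) (F : I -> V -> R) (a : I -> R) x :
  (forall i, is_ld v (F i) x (a i)) ->
  is_ld v (fun x => \sum_(i <- s) F i x) x (\sum_(i <- s) a i).
Proof. by move=> H; exact: (drv_sum s H). Qed.

Lemma drv_prod (I : eqType) (s : seq I) (f : I -> R -> R) (a : I -> R) (x : R) : uniq s ->
  (forall i, is_derive x 1 (f i) (a i)) ->
  is_derive x 1 (fun y => \prod_(i <- s) f i y)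
    (\sum_(i <- s) \prod_(j <- s) (if j == i then a i else f j x)).
Proof.
move=> us H; elim: s us => [|i s IH] /=.
  by move=> _; rewrite big_nil; apply: drv_ext (drv_cst 1 x) => y; rewrite big_nil.
move=> /andP[nis /IH {}IH]; apply: drv_ext (drv_eq (drvM (H i) IH) _).
  by move=> y; rewrite big_cons.
rewrite big_cons big_cons eqxx; congr (_ * _ + _).
  apply: eq_big_seq => j js; case: eqP => // E; by rewrite -E js in nis.
rewrite mulr_sumr; apply: eq_big_seq => j js; rewrite big_cons.
by case: eqP => // E; rewrite E js in nis.
Qed.

Lemma drv_det k (M : R -> 'M[R]_k) (M' : 'M[R]_k) (x : R) :
  (forall i j, is_derive x 1 (fun t => M t i j) (M' i j)) ->
  is_derive x 1 (fun t => \det (M t))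
   (\sum_a \det (\matrix_(i, j) if i == a then M' i j else M x i j)).
Proof.
move=> H; rewrite /determinant exchange_big /=.
apply: drv_sum => s; rewrite -mulr_sumr.
have := @drv_prod _ (index_enum 'I_k) (fun i t => M t i (perm.fun_of_perm s i))
  (fun i => M' i (perm.fun_of_perm s i)) x (index_enum_uniq _) (fun i => H i _) => D.
apply: (drv_eq (drvM (drv_cst _ _) D)); rewrite mul0r add0r; congr (_ * _).
apply: eq_bigr => a _; apply: eq_bigr => j _; rewrite mxE.
by case: eqP => // ->.
Qed.
End LineDerivatives.

(** * Uniform bounds on iterated derivatives *)

Section SmoothBounds.
Context {R : realType} {V : lmodType R} {I : finType} (v : I -> V).
Implicit Types (F G : V -> R) (U : V -> Prop) (b : nat -> R).

Definition line_open U := forall x i, U x -> \forall t \near (0 : R), U (x + t *: v i).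

Definition shiftb b : nat -> R := fun n => b n.+1.

(* [b n] bounds all derivatives of order n <= q along the directions v i on U. *)
Fixpoint smooth_bound q U b F : Prop :=
  (forall x, U x -> `|F x| <= b 0) /\
  if q is q'.+1 then forall i, exists2 G, forall x, U x -> is_ld (v i) F x (G x)
    & smooth_bound q' U (shiftb b) G
  else True.

Lemma smooth_boundW q U U' b b' F : (forall x, U' x -> U x) -> (forall n, (n <= q)%N -> b n <= b' n) ->
  smooth_bound q U b F -> smooth_bound q U' b' F.
Proof.
move=> UU; elim: q b b' F => [|q IH] b b' F bb [F0 FS]; split=> //.
- by move=> x /UU /F0 h; apply: le_trans h (bb _ _).
- by move=> x /UU /F0 h; apply: le_trans h (bb _ _).
- move=> i; have [G FG GS] := FS i; exists G; first by move=> x /UU; exact: FG.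
  by apply: IH GS => n nq; exact: bb.
Qed.

Lemma smooth_bound_le q q' U b F : (q' <= q)%N -> smooth_bound q U b F -> smooth_bound q' U b F.
Proof.
elim: q q' b F => [|q IH] [|q'] b F // qq [F0 FS]; split=> // i.
by have [G FG GS] := FS i; exists G => //; exact: IH GS.
Qed.

Lemma smooth_bound_ext q U b F G : line_open U -> (forall x, U x -> F x = G x) ->
  smooth_bound q U b F -> smooth_bound q U b G.
Proof.
move=> lo FG; case: q => [|q] [F0 FS]; split=> //.
- by move=> x Ux; rewrite -FG //; exact: F0.
- by move=> x Ux; rewrite -FG //; exact: F0.
- move=> i; have [H FH HS] := FS i; exists H => // x Ux.
  by apply: is_ld_near (FH x Ux); apply: filterS (lo x i Ux) => t; exact: FG.
Qed.

Lemma smooth_bound_ld q U b F i : line_open U -> smooth_bound q.+1 U b F ->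
  (forall x, U x -> is_ld (v i) F x (ld (v i) F x)) /\ smooth_bound q U (shiftb b) (ld (v i) F).
Proof.
move=> lo [_ /(_ i) [G FG GS]]; split.
  by move=> x /FG; exact: is_ld_ld.
by apply: smooth_bound_ext GS => // x /FG /is_ldE ->.
Qed.

Lemma smooth_boundD q U b b' F G : smooth_bound q U b F -> smooth_bound q U b' G ->
  smooth_bound q U (fun n => b n + b' n) (fun x => F x + G x).
Proof.
elim: q b b' F G => [|q IH] b b' F G [F0 FS] [G0 GS]; split=> //.
- by move=> x Ux; apply: le_trans (ler_normD _ _) (lerD (F0 x Ux) (G0 x Ux)).
- by move=> x Ux; apply: le_trans (ler_normD _ _) (lerD (F0 x Ux) (G0 x Ux)).
- move=> i; have [F' FF' F'S] := FS i; have [G' GG' G'S] := GS i.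
  exists (fun x => F' x + G' x); last exact: IH F'S G'S.
  by move=> x Ux; apply: is_ldD; [exact: FF'|exact: GG'].
Qed.

Lemma smooth_bound0 q U b : (forall n, 0 <= b n) -> smooth_bound q U b (fun=> 0).
Proof.
elim: q b => [|q IH] b b0; split=> //.
- by move=> x _; rewrite normr0.
- by move=> x _; rewrite normr0.
- move=> i; exists (fun=> 0); first by move=> x _; exact: is_ld_cst.
  by apply: IH => n; exact: b0.
Qed.

Lemma smooth_bound_cst q U c : smooth_bound q U (fun=> `|c|) (fun=> c).
Proof.
case: q => [|q]; split=> // i; exists (fun=> 0); first by move=> x _; exact: is_ld_cst.
by apply: smooth_bound0 => n; rewrite /shiftb.
Qed.

Lemma smooth_bound_sum (J : Type) (s : seq J) (P : pred J) q U (b : J -> nat -> R) (F : J -> V -> R) :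
  (forall j, P j -> smooth_bound q U (b j) (F j)) ->
  smooth_bound q U (fun n => \sum_(j <- s | P j) b j n) (fun x => \sum_(j <- s | P j) F j x).
Proof.
move=> H; elim: s => [|j s IH].
  have -> : (fun x => \sum_(j <- [::] | P j) F j x) = (fun=> 0).
    by apply/funext => x; rewrite big_nil.
  by apply: smooth_bound0 => n; rewrite big_nil.
case Pj : (P j).
  have -> : (fun x => \sum_(j <- j :: s | P j) F j x) = (fun x => F j x + \sum_(j <- s | P j) F j x).
    by apply/funext => x; rewrite big_cons Pj.
  have -> : (fun n => \sum_(j <- j :: s | P j) b j n) = (fun n => b j n + \sum_(j <- s | P j) b j n).
    by apply/funext => x; rewrite big_cons Pj.
  exact: smooth_boundD (H j Pj) IH.
have -> : (fun x => \sum_(j <- j :: s | P j) F j x) = (fun x => \sum_(j <- s | P j) F j x).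
  by apply/funext => x; rewrite big_cons Pj.
by have -> : (fun n => \sum_(j <- j :: s | P j) b j n) = (fun n => \sum_(j <- s | P j) b j n)
  by apply/funext => x; rewrite big_cons Pj.
Qed.

(** The Leibniz rule on the level of bounds: each derivative falls on one of the two factors. *)
Fixpoint mulb n b b' : R :=
  if n is n'.+1 then mulb n' (shiftb b) b' + mulb n' b (shiftb b') else b 0 * b' 0.

Lemma smooth_boundM q U b b' F G : smooth_bound q U b F -> smooth_bound q U b' G ->
  smooth_bound q U (fun n => mulb n b b') (fun x => F x * G x).
Proof.
elim: q b b' F G => [|q IH] b b' F G SF SG.
  by split=> // x Ux; rewrite normrM ler_pM // ?SF.1 ?SG.1.
split=> [x Ux|i]; first by rewrite normrM ler_pM // ?SF.1 ?SG.1.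
have [F' FF' F'S] := SF.2 i; have [G' GG' G'S] := SG.2 i.
exists (fun x => F' x * G x + F x * G' x).
  by move=> x Ux; apply: is_ldM; [exact: FF'|exact: GG'].
apply: smooth_boundD (IH _ _ _ _ F'S _) (IH _ _ _ _ _ G'S).
  exact: smooth_bound_le SG.
exact: smooth_bound_le SF.
Qed.

Lemma smooth_boundZ q U b c F : smooth_bound q U b F ->
  smooth_bound q U (fun n => `|c| * b n) (fun x => c * F x).
Proof.
elim: q b F => [|q IH] b F [F0 FS]; split=> //.
- by move=> x Ux; rewrite normrM ler_wpM2l // F0.
- by move=> x Ux; rewrite normrM ler_wpM2l // F0.
- move=> i; have [G FG GS] := FS i; exists (fun x => c * G x); last exact: IH.
  move=> x Ux; apply: (is_ld_eq (is_ldM (is_ld_cst _ _ _) (FG x Ux))).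
  by rewrite mul0r add0r.
Qed.

Definition unif_smooth (J : Type) q U (F : J -> V -> R) :=
  exists b, forall j, smooth_bound q U b (F j).

Lemma unif_smooth_intro (J : Type) q U (F : J -> V -> R) C :
  (forall j x, U x -> `|F j x| <= C) ->
  (forall i, exists2 G : J -> V -> R, forall j x, U x -> is_ld (v i) (F j) x (G j x) & unif_smooth q U G) ->
  unif_smooth q.+1 U F.
Proof.
move=> FC H; have H' i : exists b, exists2 G : J -> V -> R, forall j x, U x -> is_ld (v i) (F j) x (G j x)
    & forall j, smooth_bound q U b (G j).
  by have [G G1 [b G2]] := H i; exists b, G.
have [b bP] := choice H'.
exists (fun n => if n is n'.+1 then \sum_i `|b i n'| else C) => j; split=> [x|i]; first exact: FC.
have [G G1 G2] := bP i; exists (G j); first exact: G1.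
apply: smooth_boundW (G2 j) => // n _; rewrite /shiftb (bigD1 i) //=.
by apply: le_trans (ler_norm _) _; rewrite lerDl sumr_ge0.
Qed.

Lemma unif_smooth_le (J : Type) q q' U (F : J -> V -> R) : (q' <= q)%N ->
  unif_smooth q U F -> unif_smooth q' U F.
Proof. by move=> qq [b H]; exists b => j; exact: smooth_bound_le (H j). Qed.

(** One order at a time: the derivative of 1 / F is - F' / F^2, in which the reciprocal occurs with
    one order less. *)
Lemma unif_smoothV (J : Type) q U (F : J -> V -> R) e : line_open U -> 0 < e ->
  (forall j x, U x -> e <= F j x) -> unif_smooth q U F -> unif_smooth q U (fun j x => (F j x)^-1).
Proof.
move=> lo e0 Fe; have Fb j x : U x -> `|(F j x)^-1| <= e^-1.
  move=> Ux; have F0 := lt_le_trans e0 (Fe j x Ux).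
  by rewrite ger0_norm ?invr_ge0 ?(ltW F0) // lef_pV2 ?posrE // Fe.
elim: q => [|q IH] HF; first by exists (fun=> e^-1) => j; split=> // x; exact: Fb.
have [bV HV] := IH (unif_smooth_le (leqnSn q) HF); have [b HF'] := HF.
apply: (unif_smooth_intro Fb) => i.
exists (fun j x => - ld (v i) (F j) x * ((F j x)^-1 * (F j x)^-1)).
  move=> j x Ux; have [H1 _] := smooth_bound_ld i lo (HF' j).
  apply: is_ldV; last exact: H1.
  by rewrite gt_eqF // (lt_le_trans e0) // Fe.
eexists => j; have [_ H2] := smooth_bound_ld i lo (HF' j).
have := smooth_boundM (smooth_boundZ (-1) H2) (smooth_boundM (HV j) (HV j)).
by apply: smooth_bound_ext => // x _; rewrite mulN1r.
Qed.

Lemma unif_smooth_ln (J : Type) q U (F : J -> V -> R) e : line_open U -> 0 < e ->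
  (forall j x, U x -> e <= F j x) -> unif_smooth q U F -> unif_smooth q U (fun j x => ln (F j x)).
Proof.
move=> lo e0 Fe HF; have [b HF'] := HF; have F0 j x Ux := lt_le_trans e0 (Fe j x Ux).
have Fb j x : U x -> `|ln (F j x)| <= `|ln e| + b 0.
  move=> Ux; have h1 : ln e <= ln (F j x) by rewrite ler_ln ?posrE ?Fe // F0.
  have h2 : ln (F j x) <= b 0.
    have b0 : F j x <= b 0.
      by apply: le_trans (ler_norm _) _; case: (q) (HF' j) => [|q'] [H _]; exact: H.
    apply: le_trans (_ : F j x - 1 <= _); last by lra.
    have := @le_ln1Dx R (F j x - 1); rewrite (addrC 1) subrK; apply.
    by rewrite ltrBrDl subrr F0.
  have b0 : 0 <= b 0.
    by apply: le_trans (normr_ge0 (F j x)) _; case: (q) (HF' j) => [|q'] [H _]; exact: H.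
  rewrite ler_norml; have := ler_norm (- ln e); rewrite normrN.
  have := normr_ge0 (ln e); lra.
case: q HF HF' => [|q] HF HF'; first by exists (fun=> `|ln e| + b 0) => j; split=> // x; exact: Fb.
apply: (unif_smooth_intro Fb) => i.
exists (fun j x => ld (v i) (F j) x * (F j x)^-1).
  move=> j x Ux; have [H1 _] := smooth_bound_ld i lo (HF' j).
  by apply: is_ld_ln; [exact: F0|exact: H1].
have [bV HV] := unif_smoothV lo e0 Fe (unif_smooth_le (leqnSn q) HF).
eexists => j; have [_ H2] := smooth_bound_ld i lo (HF' j).
exact: smooth_boundM H2 (HV j).
Qed.

Definition rising (x : nat) n : R := \prod_(j < n) (x + j)%:R.

Lemma risingS x n : rising x n.+1 = x%:R * rising x.+1 n.
Proof.
rewrite /rising big_ord_recl addn0; congr (_ * _); apply: eq_bigr => j _.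
by rewrite lift0 addSnnS.
Qed.

(** A derivative of the determinant is a sum over the row that it hits. Hitting row c raises [m c]
    by one and multiplies Hadamard's bound by (m c + 1) rho; the sum over c gives the factor \sum_a
    m a + k, and iteration a rising factorial. Hence the arbitrary [m] in the induction; the growth
    in n stays that of an analytic function. *)
Lemma smooth_bound_det q U k (E : 'I_k -> 'I_k -> V -> R) (m : 'I_k -> nat) (w : 'I_k -> R) (C rho : R) :
  line_open U -> 0 <= C -> 0 <= rho -> (forall a, 0 < w a) ->
  (forall a b : 'I_k, smooth_bound q U (fun n => (m a + n)`!%:R * rho ^+ (m a + n) * C * (w a * w b)) (E a b)) ->
  smooth_bound q U (fun n => had k * (\prod_a ((m a)`!%:R * rho ^+ m a * C)) * (\prod_a w a ^+ 2) *
     (rho ^+ n * rising (\sum_a m a + k) n)) (fun x => \det (\matrix_(a, b) E a b x)).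
Proof.
move=> lo C0 r0 w0.
have base q' (m' : 'I_k -> nat) (E' : 'I_k -> 'I_k -> V -> R) x : U x ->
  (forall a b : 'I_k, smooth_bound q' U (fun n => (m' a + n)`!%:R * rho ^+ (m' a + n) * C * (w a * w b)) (E' a b)) ->
  `|\det (\matrix_(a, b) E' a b x)| <= had k * (\prod_a ((m' a)`!%:R * rho ^+ m' a * C)) * (\prod_a w a ^+ 2) *
     (rho ^+ 0 * rising (\sum_a m' a + k) 0).
  move=> Ux H; rewrite /rising big_ord0 expr0 !mulr1.
  apply: hadamard_weighted => // [a|a b]; first by rewrite !mulr_ge0 // exprn_ge0.
  by rewrite mxE; case: q' H => [|q'] /(_ a b) [/(_ x Ux) + _]; rewrite addn0.
elim: q m E => [|q IH] m E H; first by split=> // x Ux; exact: base H.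
split=> [x Ux|i]; first exact: base H.
pose E1 (c a b : 'I_k) : V -> R := if a == c then ld (v i) (E a b) else E a b.
exists (fun x => \sum_c \det (\matrix_(a, b) E1 c a b x)).
  move=> x Ux; rewrite /is_ld.
  apply: (@drv_eq _ _ (\sum_c \det (\matrix_(a, b) if a == c then
     (\matrix_(a, b) ld (v i) (E a b) x) a b else (\matrix_(a, b) E a b (x + 0 *: v i)) a b))).
    apply: drv_det => a b; rewrite mxE.
    have [/(_ x Ux) + _] := smooth_bound_ld i lo (H a b).
    by apply: drv_ext => t; rewrite mxE.
  apply: eq_bigr => c _; congr (\det _); apply/matrixP => a b; rewrite !mxE /E1.
  by case: eqP; rewrite ?scale0r ?addr0.
pose m1 (c a : 'I_k) := (m a + (a == c))%N.
have E1S c : smooth_bound q U (fun n => had k * (\prod_a ((m1 c a)`!%:R * rho ^+ m1 c a * C)) *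
    (\prod_a w a ^+ 2) * (rho ^+ n * rising (\sum_a m1 c a + k) n))
    (fun x => \det (\matrix_(a, b) E1 c a b x)).
  apply: IH => a b; rewrite /E1 /m1; case: eqP => _.
    have [_] := smooth_bound_ld i lo (H a b).
    by apply: smooth_boundW => // n _; rewrite /shiftb addn1 addSnnS.
  by rewrite addn0; exact: smooth_bound_le (H a b).
apply: smooth_boundW (smooth_bound_sum (index_enum 'I_k) (fun c _ => E1S c)) => // n _.
rewrite /shiftb risingS exprS.
set W := \prod_a w a ^+ 2; set P := \prod_a _.
have Q c : (\sum_a m1 c a + k)%N = (\sum_a m a + k).+1.
  rewrite /m1 big_split /= (_ : \sum_(a < k) (a == c) = 1)%N ?addn1 ?addSn //.
  by rewrite (bigD1 c) //= eqxx big1 // => a /negbTE ->.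
have Pc c : \prod_a ((m1 c a)`!%:R * rho ^+ m1 c a * C) = (m c).+1%:R * rho * P.
  rewrite /P (bigD1 c) //= [X in _ = _ * X](bigD1 c) //= /m1 eqxx addn1 factS natrM exprS.
  rewrite [X in _ * X = _](eq_bigr (fun a => (m a)`!%:R * rho ^+ m a * C)); last first.
    by move=> a /negbTE ->; rewrite addn0.
  by move: (\prod_(_ < _ | _) _) => Z; ring.
set r1 := rising (\sum_a m a + k).+1 n.
apply: (@le_trans _ _ (\sum_(c < k) (m c).+1%:R * (rho * P * had k * W * rho ^+ n * r1))).
  by apply: ler_sum => c _; rewrite Pc Q le_eqVlt; apply/orP; left; apply/eqP; rewrite -/r1; ring.
rewrite -mulr_suml -natr_sum (_ : \sum_(c < k) (m c).+1 = (\sum_a m a + k))%N; last first.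
  transitivity (\sum_(c < k) (m c + 1))%N; first by apply: eq_bigr => c _; rewrite addn1.
  by rewrite big_split /= sum_nat_const card_ord muln1.
by rewrite le_eqVlt; apply/orP; left; apply/eqP; ring.
Qed.
End SmoothBounds.


(** * Limits of uniformly smooth sequences *)

Section SmoothConvergence.
Context {R : realType}.

Lemma mvt_bound (f f' : R -> R) B (t : R) :
  (forall s : R, `|s| <= `|t| -> is_derive s 1 f (f' s)) ->
  (forall s, `|s| <= `|t| -> `|f' s| <= B) -> `|f t - f 0| <= B * `|t|.
Proof.
move=> df fB.
have inI a b x : a <= 0 <= b -> `|a| <= `|t| -> `|b| <= `|t| -> x \in `[a, b] -> `|x| <= `|t|.
  rewrite in_itv /= => /andP[a0 b0]; rewrite (ler0_norm a0) (ger0_norm b0) => a1 b1 /andP[ax xb].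
  by rewrite ler_norml; apply/andP; split; lra.
have cnt a b : a <= 0 <= b -> `|a| <= `|t| -> `|b| <= `|t| -> {within `[a, b], continuous f}.
  move=> ab a1 b1; apply: derivable_within_continuous => x xab.
  by have := df x (inI _ _ _ ab a1 b1 xab) => ?; exact: ex_derive.
have [t0|t0] := leP 0 t.
  have H x : x \in `]0, t[ -> is_derive x 1 f (f' x).
    by move=> xt; apply: df; apply: (inI 0 t); rewrite ?normr0 ?lexx //; exact: subset_itv_oo_cc.
  have C : {within `[0, t], continuous f} by apply: cnt; rewrite ?normr0 ?lexx.
  have [c ct ->] := MVT_segment t0 H C.
  rewrite subr0 normrM ler_wpM2r // fB //.
  by apply: (inI 0 t); rewrite ?normr0 ?lexx.
have H x : x \in `]t, 0[ -> is_derive x 1 f (f' x).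
  by move=> xt; apply: df; apply: (inI t 0); rewrite ?normr0 ?lexx ?(ltW t0) //; exact: subset_itv_oo_cc.
have C : {within `[t, 0], continuous f} by apply: cnt; rewrite ?normr0 ?lexx ?(ltW t0).
have [c ct E] := MVT_segment (ltW t0) H C.
rewrite -normrN opprB E sub0r normrM normrN ler_wpM2r // fB //.
by apply: (inI t 0); rewrite ?normr0 ?lexx ?(ltW t0).
Qed.

Lemma is_derive_quotient (f : R -> R) (l B e : R) : 0 < e -> 0 <= B ->
  (forall t, 0 < `|t| < e -> `|(f t - f 0) / t - l| <= B * `|t|) ->
  is_derive (0 : R) 1 f l.
Proof.
move=> e0 B0 H.
have cv : h^-1 *: (f (h *: 1 + 0) - f 0) @[h --> (0 : R)^'] --> l.
  apply/cvgrPdist_le => eps eps0; near=> h.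
  have hn0 : h != 0 by near: h; exact: nbhs_dnbhs_neq.
  have he : `|h| < Num.min e (eps / (B + 1)).
    near: h; apply: dnbhs0_lt; rewrite lt_min e0 divr_gt0 //; lra.
  move: he; rewrite lt_min => /andP[h1 h2].
  rewrite distrC addr0 /GRing.scale /= mulr1 mulrC.
  apply: le_trans (H h _) _; first by rewrite normr_gt0 hn0.
  have B1 : 0 < B + 1 by lra.
  move: h2; rewrite ltr_pdivlMr // => h2.
  by apply: le_trans (ltW h2); rewrite mulrC ler_wpM2l //; lra.
apply: DeriveDef; first by apply/cvg_ex; exists l.
exact: cvg_lim cv.
Unshelve. all: by end_near. Qed.

(** A bound on second derivatives replaces uniform convergence: the difference quotient at t is
    within B |t| of [f' N 0] for all N, and at fixed t the quotients converge, so [f' N 0] is a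
    Cauchy sequence. *)
Lemma derive_limit (f f' f'' : nat -> R -> R) (g : R -> R) B e : 0 < e ->
  (forall N (s : R), `|s| < e -> is_derive s 1 (f N) (f' N s)) ->
  (forall N (s : R), `|s| < e -> is_derive s 1 (f' N) (f'' N s)) ->
  (forall N s, `|s| < e -> `|f'' N s| <= B) ->
  (forall s, `|s| < e -> f N s @[N --> \oo] --> g s) ->
  exists2 l, f' N 0 @[N --> \oo] --> l & is_derive (0 : R) 1 g l.
Proof.
move=> e0 df df' fB fg.
have B0 : 0 <= B by apply: le_trans (fB 0%N 0 _); rewrite ?normr0.
have quot N t : 0 < `|t| < e -> `|(f N t - f N 0) / t - f' N 0| <= B * `|t|.
  move=> /andP[t0 te]; have tn0 : t != 0 by rewrite -normr_gt0.
  have := @mvt_bound (fun s => f N s - s * f' N 0) (fun s => f' N s - f' N 0) (B * `|t|) t.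
  rewrite mul0r subr0 => H.
  have : `|f N t - t * f' N 0 - f N 0| <= B * `|t| * `|t|.
    apply: H => s st; have se := le_lt_trans st te.
      have := df N s se => D.
      apply: (drv_eq (drvD D (drvN (drvM (drv_id s) (drv_cst (f' N 0) s))))).
      by rewrite mulr0 addr0 mul1r.
    apply: le_trans (_ : B * `|s| <= _); last by rewrite ler_wpM2l.
    apply: mvt_bound => x xs; [apply: df'|apply: fB]; exact: le_lt_trans xs se.
  have -> : f N t - t * f' N 0 - f N 0 = ((f N t - f N 0) / t - f' N 0) * t by field.
  by rewrite normrM ler_pM2r.
have qcv t : 0 < `|t| < e -> (f N t - f N 0) / t @[N --> \oo] --> (g t - g 0) / t.
  move=> /andP[_ te]; apply: cvgMl; apply: cvgB; apply: fg => //.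
  by rewrite normr0.
have cf : cvgn (fun N => f' N 0).
  apply: cauchy_cvg; apply: cauchy_exP => eps eps0.
  pose t := Num.min (e / 2) (eps / (2 * (B + 1))).
  have B1 : 0 < B + 1 by lra.
  have t0 : 0 < t by rewrite lt_min !divr_gt0 // mulr_gt0.
  have te : t < e by rewrite gt_min; apply/orP; left; lra.
  have tt : 0 < `|t| < e by rewrite gtr0_norm // t0.
  have tB : B * `|t| < eps / 2.
    apply: le_lt_trans (_ : (B + 1) * t - t < _); first by rewrite gtr0_norm //; lra.
    have : t <= eps / (2 * (B + 1)) by rewrite ge_min lexx orbT.
    rewrite ler_pdivlMr ?mulr_gt0 //; lra.
  have e2 : 0 < eps / 2 by rewrite divr_gt0.
  exists ((g t - g 0) / t).
  have /cvgrPdist_lt /(_ _ e2) := qcv t tt; apply: filterS => N h.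
  rewrite /ball /= -(subrKA ((f N t - f N 0) / t)).
  apply: le_lt_trans (ler_normD _ _) _; have := quot N t tt; lra.
move: cf => /cvg_ex [l fl]; exists l => //.
apply: (is_derive_quotient e0 B0) => t tt.
have H : ((f N t - f N 0) / t - f' N 0) @[N --> \oo] --> (g t - g 0) / t - l.
  by apply: cvgB; [exact: qcv|exact: fl].
by apply: (cvgn_le_norm H); near=> N; exact: quot.
Unshelve. all: by end_near. Qed.

Context {V : lmodType R} {I : finType} (v : I -> V).

Lemma smooth_bound_lt0 q U b (F : V -> R) x : U x -> smooth_bound v q U b F -> `|F x| <= b 0.
Proof. by move=> Ux; case: q => [|q] [+ _]; apply. Qed.

Lemma smooth_cvg_derive q U b (F : nat -> V -> R) (F0 : V -> R) i : line_open v U ->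
  (forall N, smooth_bound v q.+2 U b (F N)) ->
  (forall x, U x -> F N x @[N --> \oo] --> F0 x) ->
  forall x, U x -> is_ld (v i) F0 x (ld (v i) F0 x) /\
    ld (v i) (F N) x @[N --> \oo] --> ld (v i) F0 x.
Proof.
move=> lo FS FF x Ux.
have [e /= e0 He] := lo x i Ux.
have Ut t : `|t| < e -> U (x + t *: v i).
  by move=> te; apply: He; rewrite /ball /= sub0r normrN.
have S1 N := smooth_bound_ld i lo (FS N).
have S2 N := smooth_bound_ld i lo (S1 N).2.
have [l l1 l2] := @derive_limit (fun N t => F N (x + t *: v i))
  (fun N t => ld (v i) (F N) (x + t *: v i))
  (fun N t => ld (v i) (ld (v i) (F N)) (x + t *: v i)) (fun t => F0 (x + t *: v i)) (b 2) e e0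
  (fun N t te => (is_ld_at _ _ _ _ _).1 ((S1 N).1 _ (Ut t te)))
  (fun N t te => (is_ld_at _ _ _ _ _).1 ((S2 N).1 _ (Ut t te)))
  (fun N t te => smooth_bound_lt0 (Ut t te) (S2 N).2)
  (fun t te => FF _ (Ut t te)).
rewrite (is_ldE l2); split=> //.
by move: l1; rewrite scale0r addr0.
Qed.

Lemma smooth_bound_limit q U b (F : nat -> V -> R) (F0 : V -> R) : line_open v U ->
  (forall N, smooth_bound v q.+1 U b (F N)) ->
  (forall x, U x -> F N x @[N --> \oo] --> F0 x) -> smooth_bound v q U b F0.
Proof.
move=> lo; elim: q b F F0 => [|q IH] b F F0 FS FF.
  split=> // x Ux; apply: (cvgn_le_norm (FF x Ux)); near=> N.
  exact: smooth_bound_lt0 Ux (FS N).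
split=> [x Ux|i].
  by apply: (cvgn_le_norm (FF x Ux)); near=> N; exact: smooth_bound_lt0 Ux (FS N).
have D := smooth_cvg_derive i lo FS FF.
exists (ld (v i) F0); first by move=> x /D[].
apply: (IH _ (fun N => ld (v i) (F N))) => [N|x Ux]; last by have [] := D x Ux.
exact: (smooth_bound_ld i lo (FS N)).2.
Unshelve. all: by end_near. Qed.

Fixpoint lds (l : seq I) (F : V -> R) : V -> R :=
  if l is i :: l' then ld (v i) (lds l' F) else F.

Lemma smooth_cvg_lds U b (F : nat -> V -> R) (F0 : V -> R) q l : line_open v U ->
  (forall N, smooth_bound v ((size l).+1 + q) U b (F N)) ->
  (forall x, U x -> F N x @[N --> \oo] --> F0 x) ->
  (forall N, smooth_bound v q.+1 U (fun n => b (n + size l)%N) (lds l (F N))) /\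
  forall x, U x -> lds l (F N) x @[N --> \oo] --> lds l F0 x.
Proof.
move=> lo; elim: l q => [|i l IH] q FS FF /=.
  by split=> // N; apply: smooth_boundW (FS N) => // n _; rewrite addn0.
have [|H1 H2] := IH q.+1 _ FF; first by move=> N; rewrite addnS; exact: FS.
split=> [N|x Ux].
  have [_] := smooth_bound_ld i lo (H1 N).
  by apply: smooth_boundW => // n _; rewrite /shiftb addSnnS.
by have [] := smooth_cvg_derive i lo H1 H2 Ux.
Qed.

Definition plane_open U := forall x i j, U x -> exists2 e : R, 0 < e &
  forall s t, `|s| < e -> `|t| < e -> U (x + s *: v i + t *: v j).

Lemma second_difference q U b (F : V -> R) i j x e t : line_open v U ->
  smooth_bound v q.+3 U b F ->
  (forall s t, `|s| < e -> `|t| < e -> U (x + s *: v i + t *: v j)) -> `|t| < e ->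
  `|F (x + t *: v i + t *: v j) - F (x + t *: v i) - F (x + t *: v j) + F x
    - t * t * ld (v j) (ld (v i) F) x| <= 2 * b 3 * `|t| * `|t| * `|t|.
Proof.
move=> lo FS HU te; have e0 : 0 < e by apply: le_lt_trans te.
have U1 s : `|s| < e -> U (x + s *: v i).
  by move=> se; have := HU s 0 se; rewrite normr0 scale0r addr0; apply.
have Ux : U x by have := U1 0; rewrite normr0 scale0r addr0; apply.
have Si := smooth_bound_ld i lo FS; have Sji := smooth_bound_ld j lo Si.2.
have Siji := smooth_bound_ld i lo Sji.2; have Sjji := smooth_bound_ld j lo Sji.2.
set d := ld (v j) (ld (v i) F) in Sji Siji Sjji *.
have b30 : 0 <= b 3 by apply: le_trans (smooth_bound_lt0 Ux Siji.2).
have d1 s tau : `|s| <= `|t| -> `|tau| <= `|t| -> `|d (x + s *: v i + tau *: v j) - d x| <= 2 * b 3 * `|t|.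
  move=> st tt; have se := le_lt_trans st te; have tte := le_lt_trans tt te.
  have h1 : `|d (x + s *: v i + tau *: v j) - d (x + s *: v i + 0 *: v j)| <= b 3 * `|tau|.
    apply: (@mvt_bound (fun tau => d (x + s *: v i + tau *: v j))
      (fun tau => ld (v j) d (x + s *: v i + tau *: v j))) => y yt; have ye := le_lt_trans yt tte.
      exact: ((is_ld_at (v j) d (x + s *: v i) y _).1 (Sjji.1 _ (HU s y se ye))).
    exact: smooth_bound_lt0 (HU _ _ se ye) Sjji.2.
  have h2 : `|d (x + s *: v i) - d (x + 0 *: v i)| <= b 3 * `|s|.
    apply: (@mvt_bound (fun s => d (x + s *: v i)) (fun s => ld (v i) d (x + s *: v i))) => y yt;
      have ye := le_lt_trans yt se.
      exact: ((is_ld_at (v i) d x y _).1 (Siji.1 _ (U1 y ye))).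
    exact: smooth_bound_lt0 (U1 _ ye) Siji.2.
  rewrite !scale0r !addr0 in h1 h2.
  rewrite -(subrKA (d (x + s *: v i))); apply: le_trans (ler_normD _ _) _.
  apply: le_trans (lerD h1 h2) _; rewrite -mulrA mulrDl mul1r.
  by apply: lerD; apply: ler_wpM2l.
have g1 s : `|s| <= `|t| -> `|ld (v i) F (x + s *: v i + t *: v j) - ld (v i) F (x + s *: v i) - t * d x|
    <= 2 * b 3 * `|t| * `|t|.
  move=> st; have se := le_lt_trans st te.
  have := @mvt_bound (fun tau => ld (v i) F (x + s *: v i + tau *: v j) - tau * d x)
    (fun tau => d (x + s *: v i + tau *: v j) - d x) (2 * b 3 * `|t|) t.
  rewrite scale0r addr0 mul0r subr0 => H.
  rewrite addrAC; apply: H => y yt; last exact: d1.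
  have D := (is_ld_at (v j) (ld (v i) F) (x + s *: v i) y _).1 (Sji.1 _ (HU s y se (le_lt_trans yt te))).
  by apply: (drv_eq (drvD D (drvN (drvM (drv_id y) (drv_cst (d x) y))))); rewrite mulr0 addr0 mul1r.
have := @mvt_bound (fun s => F (x + s *: v i + t *: v j) - F (x + s *: v i) - s * (t * d x))
  (fun s => ld (v i) F (x + s *: v i + t *: v j) - ld (v i) F (x + s *: v i) - t * d x)
  (2 * b 3 * `|t| * `|t|) t.
rewrite scale0r addr0 mul0r subr0 => H.
have -> : F (x + t *: v i + t *: v j) - F (x + t *: v i) - F (x + t *: v j) + F x - t * t * d x =
  F (x + t *: v i + t *: v j) - F (x + t *: v i) - t * (t * d x) - (F (x + t *: v j) - F x) by ring.
apply: H => // s st; have se := le_lt_trans st te.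
have D1 : is_derive s 1 (fun s => F (x + s *: v i + t *: v j)) (ld (v i) F (x + s *: v i + t *: v j)).
  have := Si.1 _ (HU s t se te); rewrite addrAC => D.
  apply: drv_ext ((is_ld_at (v i) F (x + t *: v j) s _).1 D) => y.
  by rewrite addrAC.
have D2 := (is_ld_at (v i) F x s _).1 (Si.1 _ (U1 s se)).
by apply: (drv_eq (drvD (drvD D1 (drvN D2)) (drvN (drvM (drv_id s) (drv_cst (t * d x) s)))));
  rewrite mulr0 addr0 mul1r.
Qed.

(** The second difference over a small square is symmetric in i and j and equals t^2 times either
    mixed derivative up to O (t^3); so the two differ by O (t). *)
Lemma schwarz q U b (F : V -> R) i j x : line_open v U -> plane_open U -> smooth_bound v q.+3 U b F ->
  U x -> ld (v i) (ld (v j) F) x = ld (v j) (ld (v i) F) x.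
Proof.
move=> lo po FS Ux; have [e e0 HU] := po x i j Ux.
have HU' s t : `|s| < e -> `|t| < e -> U (x + s *: v j + t *: v i).
  by move=> se te; rewrite addrAC; exact: HU.
set d1 := LHS; set d2 := RHS; apply/eqP; rewrite -subr_eq0 -normr_eq0; apply/eqP.
have b30 : 0 <= b 3.
  have := (smooth_bound_ld i lo (smooth_bound_ld i lo (smooth_bound_ld i lo FS).2).2).2.
  by move=> /(smooth_bound_lt0 Ux); apply: le_trans.
have key t : 0 < t < e -> `|d1 - d2| <= 4 * b 3 * t.
  move=> /andP[t0 te]; have t1 : `|t| < e by rewrite gtr0_norm.
  have := second_difference lo FS HU t1; have := second_difference lo FS HU' t1.
  rewrite -/d1 -/d2 !(gtr0_norm t0) [x + t *: v j + t *: v i]addrAC.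
  set A := F _; set B := F (_ + t *: v i); set C := F (_ + t *: v j); set D := F x => h1 h2.
  have h3 : `|t * t * (d1 - d2)| <= t * t * (4 * b 3 * t).
    have -> : t * t * (d1 - d2) = (A - B - C + D - t * t * d2) - (A - C - B + D - t * t * d1) by ring.
    apply: le_trans (ler_normB _ _) _; apply: le_trans (lerD h2 h1) _.
    by rewrite le_eqVlt; apply/orP; left; apply/eqP; move: (b 3); clear => b3; ring.
  move: h3; rewrite normrM gtr0_norm ?mulr_gt0 // ler_pM2l ?mulr_gt0 //.
apply/eqP; rewrite eq_le normr_ge0 andbT; apply/ler_addgt0Pl => eps eps0; rewrite addr0.
pose t := Num.min (e / 2) (eps / (4 * b 3 + 1)).
have B1 : 0 < 4 * b 3 + 1 by lra.
have t0 : 0 < t by rewrite lt_min !divr_gt0.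
have te : t < e by rewrite gt_min; apply/orP; left; lra.
apply: le_trans (key t _) _; first by rewrite t0.
have : t <= eps / (4 * b 3 + 1) by rewrite ge_min lexx orbT.
rewrite ler_pdivlMr //; lra.
Qed.
End SmoothConvergence.

(** * The bilinear identity for the discretized determinants *)

Section Derivations.
Context {R : realType} {V : lmodType R} {I : finType} (v : I -> V) (U : V -> Prop).
Hypothesis lo : line_open v U.
Implicit Types (c : I -> V -> R) (F G : V -> R).

Definition vop c F x : R := \sum_i c i x * ld (v i) F x.

Definition diffb F := forall x i, U x -> is_ld (v i) F x (ld (v i) F x).

(** Differentiability is bundled with the value, so that the rules of derivation compose without
    side conditions. *)
Definition isV c F G := diffb F /\ forall x, U x -> vop c F x = G x.

Lemma isV_intro c F G (g : I -> V -> R) : (forall i x, U x -> is_ld (v i) F x (g i x)) ->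
  (forall x, U x -> \sum_i c i x * g i x = G x) -> isV c F G.
Proof.
move=> H E; split=> [x i Ux|x Ux]; first exact: is_ld_ld (H i x Ux).
by rewrite -E //; apply: eq_bigr => i _; rewrite (is_ldE (H i x Ux)).
Qed.

Lemma diffb_ext F G : (forall x, U x -> F x = G x) -> diffb F -> diffb G.
Proof.
move=> FG dF x i Ux; apply: is_ld_ld (_ : is_ld _ _ _ (ld (v i) F x)).
apply: is_ld_near (dF x i Ux); apply: filterS (lo i Ux) => t; exact: FG.
Qed.

Lemma vop_ext c F G x : (forall x, U x -> F x = G x) -> diffb F -> U x -> vop c F x = vop c G x.
Proof.
move=> FG dF Ux; apply: eq_bigr => i _; congr (_ * _).
apply/esym/is_ldE; apply: is_ld_near (dF x i Ux).
by apply: filterS (lo i Ux) => t; exact: FG.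
Qed.

Lemma isV_ext c F F' G G' : (forall x, U x -> F x = F' x) -> (forall x, U x -> G x = G' x) ->
  isV c F G -> isV c F' G'.
Proof.
move=> FF GG [dF E]; split; first exact: diffb_ext dF.
by move=> x Ux; rewrite -GG // -E //; apply/esym; exact: vop_ext.
Qed.

Lemma isVE c F G G' : isV c F G -> (forall x, U x -> G x = G' x) -> isV c F G'.
Proof. by move=> H E; exact: isV_ext H. Qed.

Lemma isV_vop c F : diffb F -> isV c F (vop c F).
Proof. by []. Qed.

Lemma isV_cst c k : isV c (fun=> k) (fun=> 0).
Proof.
apply: (isV_intro (g := fun _ _ => 0)) => [i x Ux|x Ux]; first exact: is_ld_cst.
by rewrite big1 // => i _; rewrite mulr0.
Qed.

Lemma isVD c F G F' G' : isV c F F' -> isV c G G' ->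
  isV c (fun x => F x + G x) (fun x => F' x + G' x).
Proof.
move=> [dF EF] [dG EG]; apply: (isV_intro (g := fun i x => ld (v i) F x + ld (v i) G x)).
  by move=> i x Ux; apply: is_ldD; [exact: dF|exact: dG].
move=> x Ux; rewrite -EF // -EG // /vop -big_split /=.
by apply: eq_bigr => i _; rewrite mulrDr.
Qed.

Lemma isVM c F G F' G' : isV c F F' -> isV c G G' ->
  isV c (fun x => F x * G x) (fun x => F' x * G x + F x * G' x).
Proof.
move=> [dF EF] [dG EG]; apply: (isV_intro (g := fun i x => ld (v i) F x * G x + F x * ld (v i) G x)).
  by move=> i x Ux; apply: is_ldM; [exact: dF|exact: dG].
move=> x Ux; rewrite -EF // -EG // /vop mulr_suml mulr_sumr -big_split /=.
by apply: eq_bigr => i _; ring.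
Qed.

Lemma isVZ c k F F' : isV c F F' -> isV c (fun x => k * F x) (fun x => k * F' x).
Proof.
by move=> H; apply: isVE (isVM (isV_cst c k) H) _ => x _; rewrite mul0r add0r.
Qed.

Lemma isV_sum c (J : finType) (F F' : J -> V -> R) : (forall j, isV c (F j) (F' j)) ->
  isV c (fun x => \sum_j F j x) (fun x => \sum_j F' j x).
Proof.
move=> H; apply: (isV_intro (g := fun i x => \sum_j ld (v i) (F j) x)).
  by move=> i x Ux; apply: is_ld_sum => j; have [dF _] := H j; exact: dF.
move=> x Ux; under eq_bigr do rewrite mulr_sumr.
rewrite exchange_big /=; apply: eq_bigr => j _; have [_ <- //] := H j.
Qed.

Definition isVm c m n (A A' : V -> 'M[R]_(m, n)) :=
  forall i j, isV c (fun x => A x i j) (fun x => A' x i j).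

Lemma isVm_mul c m n p (A A' : V -> 'M[R]_(m, n)) (B B' : V -> 'M[R]_(n, p)) :
  isVm c A A' -> isVm c B B' -> isVm c (fun x => A x *m B x) (fun x => A' x *m B x + A x *m B' x).
Proof.
move=> HA HB i j.
have := isV_sum (fun k => isVM (HA i k) (HB k j)).
apply: isV_ext => x Ux; first by rewrite mxE.
by rewrite !mxE -big_split.
Qed.

Lemma diffb_det n (M : V -> 'M[R]_n) : (forall i j, diffb (fun x => M x i j)) ->
  forall x i, U x -> is_ld (v i) (fun x => \det (M x)) x
    (\sum_a \det (\matrix_(k, l) if k == a then ld (v i) (fun x => M x k l) x else M x k l)).
Proof.
move=> H x i Ux; rewrite /is_ld.
apply: (@drv_eq _ _ (\sum_a \det (\matrix_(k, l) if k == a then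
   (\matrix_(k, l) ld (v i) (fun x => M x k l) x) k l else (M (x + 0 *: v i)) k l))).
  by apply: drv_det => k l; rewrite mxE; exact: H k l x i Ux.
apply: eq_bigr => a _; congr (\det _); apply/matrixP => k l; rewrite !mxE.
by rewrite scale0r addr0.
Qed.

Lemma isV_det c n (M M' : V -> 'M[R]_n) : isVm c M M' ->
  isV c (fun x => \det (M x)) (fun x => \tr (M' x *m \adj (M x))).
Proof.
move=> H; have dM i j : diffb (fun x => M x i j) by have [] := H i j.
apply: (isV_intro (fun i x Ux => diffb_det dM i Ux)) => x Ux.
have E i : \sum_a \det (\matrix_(k, l) if k == a then ld (v i) (fun x => M x k l) x else M x k l) =
   \sum_a \sum_b ld (v i) (fun x => M x a b) x * cofactor (M x) a b.
  apply: eq_bigr => a _; rewrite (expand_det_row _ a); apply: eq_bigr => b _.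
  rewrite mxE eqxx; congr (_ * _); rewrite /cofactor; congr (_ * \det _).
  by apply/matrixP => k l; rewrite !mxE eq_sym (negbTE (neq_lift _ _)).
under eq_bigr do rewrite E mulr_sumr.
rewrite exchange_big /mxtrace; apply: eq_bigr => a _ /=.
under eq_bigr do rewrite mulr_sumr.
rewrite exchange_big mxE; apply: eq_bigr => b _ /=.
have [_ /(_ x Ux) <-] := H a b; rewrite [\adj _ _ _]mxE /vop mulr_suml.
by apply: eq_bigr => i _; ring.
Qed.

Lemma diffb_inverse n (M : V -> 'M[R]_n) : (forall i j, diffb (fun x => M x i j)) ->
  (forall x, U x -> \det (M x) != 0) -> forall i j, diffb (fun x => invmx (M x) i j).
Proof.
move=> dM dn0 i j.
have dadj : diffb (fun x => \adj (M x) i j).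
  have : diffb (fun x => (-1) ^+ (j + i) * \det (row' j (col' i (M x)))).
    move=> x a Ux; apply: is_ld_ld; apply: is_ldM; first exact: is_ld_cst.
    by apply: diffb_det => // k l y b Uy; under eq_fun do rewrite !mxE; exact: dM.
  by apply: diffb_ext => x Ux; rewrite mxE.
have ddet : diffb (fun x => \det (M x)) by move=> x a Ux; exact: is_ld_ld (diffb_det dM a Ux).
have : diffb (fun x => (\det (M x))^-1 * \adj (M x) i j).
  move=> x a Ux; apply: is_ld_ld; apply: is_ldM; last exact: dadj.
  by apply: is_ldV; [exact: dn0|exact: ddet].
by apply: diffb_ext => x Ux; rewrite /invmx unitmxE unitfE dn0 //= [RHS]mxE.
Qed.

Lemma isVm_inverse c n (M M' : V -> 'M[R]_n) : isVm c M M' -> (forall x, U x -> \det (M x) != 0) ->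
  isVm c (fun x => invmx (M x)) (fun x => - (invmx (M x) *m M' x *m invmx (M x))).
Proof.
move=> H dn0; have dM i j : diffb (fun x => M x i j) by have [] := H i j.
have dI := diffb_inverse dM dn0.
pose R' x : 'M[R]_n := \matrix_(i, j) vop c (fun x => invmx (M x) i j) x.
have HR : isVm c (fun x => invmx (M x)) R'.
  by move=> i j; apply: isVE (isV_vop c (dI i j)) _ => x Ux; rewrite mxE.
move=> i j; apply: isVE (HR i j) _ => x Ux.
have uM : M x \in unitmx by rewrite unitmxE unitfE dn0.
suff -> : R' x = - (invmx (M x) *m M' x *m invmx (M x)) by [].
(* The entries of the inverse are differentiable by Cramer's rule, so the product rule applies to M
   M^-1 = 1. *)
have Z : M' x *m invmx (M x) + M x *m R' x = 0.
  apply/matrixP => a b; have [_ /(_ x Ux) <-] := isVm_mul H HR a b.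
  have [_ /(_ x Ux) E] := isV_cst c ((1%:M : 'M[R]_n) a b); rewrite mxE -[RHS]E.
  apply: vop_ext => //; last by have [] := isVm_mul H HR a b.
  by move=> y Uy; rewrite mulmxV // unitmxE unitfE dn0.
have := congr1 (mulmx (invmx (M x))) Z; rewrite mulmx0 mulmxDr !mulmxA mulVmx // mul1mx.
by move=> /eqP; rewrite addrC addr_eq0 => /eqP.
Qed.

Lemma isV_ln_det c n (M M' : V -> 'M[R]_n) : isVm c M M' -> (forall x, U x -> 0 < \det (M x)) ->
  isV c (fun x => ln (\det (M x))) (fun x => \tr (M' x *m invmx (M x))).
Proof.
move=> H dp; have [dd E] := isV_det H.
apply: (isV_intro (g := fun i x => ld (v i) (fun x => \det (M x)) x * (\det (M x))^-1)).
  by move=> i x Ux; apply: is_ld_ln; [exact: dp|exact: dd].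
move=> x Ux; under eq_bigr do rewrite mulrA.
rewrite -mulr_suml -/(vop c _ x) E // /invmx unitmxE unitfE gt_eqF ?dp //=.
by rewrite -scalemxAr mxtraceZ mulrC.
Qed.

(** * Bilinear identity for determinants with finite rank derivatives *)

Section KP.
Variables (n : nat) (cD cX cT : I -> V -> R) (h : V -> R) (M : V -> 'M[R]_n).
Variables (f : nat -> V -> 'cV[R]_n) (g : nat -> V -> 'rV[R]_n).
Hypothesis detM : forall x, U x -> 0 < \det (M x).
Hypothesis Dh : isV cD h (fun=> 0).
Hypothesis Xh : isV cX h (fun=> 0).
Hypothesis DM : isVm cD M (fun x => h x *: (f 0 x *m g 0 x)).
Hypothesis XM : isVm cX M (fun x => h x *: (f 0 x *m g 1 x - f 1 x *m g 0 x)).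
Hypothesis TM : isVm cT M
  (fun x => - (h x / 3) *: (f 2 x *m g 0 x - f 1 x *m g 1 x + f 0 x *m g 2 x)).
Hypothesis Df : forall j, isVm cD (f j) (f j.+1).
Hypothesis Dg : forall j, isVm cD (g j) (g j.+1).
Hypothesis Xf : forall j, isVm cX (f j) (fun x => - f j.+2 x).
Hypothesis Xg : forall j, isVm cX (g j) (g j.+2).

Let Rs x := invmx (M x).
(** D and X act on these numbers by index shifts and quadratic terms only ([kp_DS], [kp_XS]), so the
    derivatives of ln det M along D and X are polynomials in them. *)
Definition kpS i j x : R := h x * (g i x *m Rs x *m f j x) 0 0.
Definition kp_phi x : R := ln (\det (M x)).

Let mx11M (A B : 'M[R]_1) : (A *m B) 0 0 = A 0 0 * B 0 0.
Proof. by rewrite mxE big_ord1. Qed.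
Let mx11D (A B : 'M[R]_1) : (A + B) 0 0 = A 0 0 + B 0 0. Proof. by rewrite mxE. Qed.
Let mx11N (A : 'M[R]_1) : (- A) 0 0 = - A 0 0. Proof. by rewrite mxE. Qed.
Let mx11Z k (A : 'M[R]_1) : (k *: A) 0 0 = k * A 0 0. Proof. by rewrite mxE. Qed.
Let mx11E := (mx11D, mx11N, mx11Z, mx11M).

Lemma kpS_tr i j x : \tr (f j x *m g i x *m Rs x) = (g i x *m Rs x *m f j x) 0 0.
Proof. by rewrite -mulmxA mxtrace_mulC /mxtrace big_ord1. Qed.

Lemma kp_DS i j : isV cD (kpS i j)
  (fun x => kpS i.+1 j x + kpS i j.+1 x - kpS i 0 x * kpS 0 j x).
Proof.
have dn0 x : U x -> \det (M x) != 0 by move=> Ux; rewrite gt_eqF ?detM.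
have H := isVM Dh (isVm_mul (isVm_mul (Dg i) (isVm_inverse DM dn0)) (Df j) 0 0).
apply: isVE H _ => x Ux; rewrite mul0r add0r /kpS -/(Rs x).
rewrite mulmxDl mulmxN mulNmx -!scalemxAr -!scalemxAl -!scalemxAr -!scalemxAl.
have -> : g i x *m (Rs x *m (f 0 x *m g 0 x) *m Rs x) *m f j x =
   (g i x *m Rs x *m f 0 x) *m (g 0 x *m Rs x *m f j x) by rewrite !mulmxA.
rewrite !mx11E.
by move: ((_ *m _ *m _) 0 0) ((_ *m _ *m _) 0 0) ((_ *m _ *m _) 0 0) ((_ *m _ *m _) 0 0) => a b c d; ring.
Qed.

Lemma kp_XS i j : isV cX (kpS i j)
  (fun x => kpS i.+2 j x - kpS i j.+2 x - kpS i 0 x * kpS 1 j x + kpS i 1 x * kpS 0 j x).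
Proof.
have dn0 x : U x -> \det (M x) != 0 by move=> Ux; rewrite gt_eqF ?detM.
have H := isVM Xh (isVm_mul (isVm_mul (Xg i) (isVm_inverse XM dn0)) (Xf j) 0 0).
apply: isVE H _ => x Ux; rewrite mul0r add0r /kpS -/(Rs x).
rewrite mulmxN mulmxDl mulmxN mulNmx -!scalemxAr -!scalemxAl -!scalemxAr -!scalemxAl.
rewrite mulmxBr mulmxBl mulmxBr mulmxBl.
have E a b : g i x *m (Rs x *m (f a x *m g b x) *m Rs x) *m f j x =
   (g i x *m Rs x *m f a x) *m (g b x *m Rs x *m f j x) by rewrite !mulmxA.
rewrite !E !mx11E.
move: ((g i.+2 x *m Rs x *m f j x) 0 0) ((g i x *m Rs x *m f j.+2 x) 0 0)
  ((g i x *m Rs x *m f 0 x) 0 0) ((g i x *m Rs x *m f 1 x) 0 0)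
  ((g 1 x *m Rs x *m f j x) 0 0) ((g 0 x *m Rs x *m f j x) 0 0) => a b c d e k.
by ring.
Qed.

Lemma kp_Dphi : isV cD kp_phi (kpS 0 0).
Proof.
apply: isVE (isV_ln_det DM detM) _ => x Ux.
by rewrite -scalemxAl mxtraceZ kpS_tr.
Qed.

Lemma kp_Xphi : isV cX kp_phi (fun x => kpS 1 0 x - kpS 0 1 x).
Proof.
apply: isVE (isV_ln_det XM detM) _ => x Ux.
by rewrite -scalemxAl mxtraceZ mulmxBl linearB /= !kpS_tr /kpS mulrBr.
Qed.

Lemma kp_Tphi : isV cT kp_phi (fun x => - 3^-1 * (kpS 0 2 x - kpS 1 1 x + kpS 2 0 x)).
Proof.
apply: isVE (isV_ln_det TM detM) _ => x Ux.
rewrite -scalemxAl mxtraceZ mulmxDl mulmxBl linearD linearB /= !kpS_tr /kpS.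
move: ((_ *m _ *m _) 0 0) ((_ *m _ *m _) 0 0) ((_ *m _ *m _) 0 0) => a b c.
by ring.
Qed.

(** A twice integrated Kadomtsev-Petviashvili equation for D D phi, with D and X as space variables
    and T as time. T is applied to [kp_phi] first and D afterwards, so the action of T on [kpS]
    never enters; what remains is a polynomial identity. *)
Lemma kp_identity x : U x ->
  vop cD (vop cT kp_phi) x + 2^-1 * vop cD (vop cD kp_phi) x ^+ 2
  + 12^-1 * vop cD (vop cD (vop cD (vop cD kp_phi))) x
  + 4^-1 * vop cX (vop cX kp_phi) x = 0.
Proof.
move=> Ux.
have vE c F G : isV c F G -> forall y, U y -> vop c F y = G y by move=> [].
have chain c c' F G G' : isV c F G -> isV c' G G' -> isV c' (vop c F) G'.
  by move=> H1 H2; apply: (isV_ext (F := G)) H2 => // y Uy; rewrite (vE _ _ _ H1).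
have D1 := kp_Dphi.
have D2 := chain _ _ _ _ _ D1 (kp_DS 0 0).
have N1 (F G : V -> R) c : isV c F G -> isV c (fun x => - F x) (fun x => - G x).
  by move=> H; apply: isVE (isV_ext _ _ (isVZ (-1) H)) _ => y Uy; rewrite ?mulN1r.
have D3 := chain _ _ _ _ _ D2 (isVD (isVD (kp_DS 1 0) (kp_DS 0 1)) (N1 _ _ _ (isVM (kp_DS 0 0) (kp_DS 0 0)))).
have d i j := kp_DS i j.
have dd i j := isVD (isVD (d i.+1 j) (d i j.+1)) (N1 _ _ _ (isVM (d i 0) (d 0 j))).
have D4 := chain _ _ _ _ _ D3 (isVD (isVD (dd 1 0) (dd 0 1))
  (N1 _ _ _ (isVD (isVM (dd 0 0) (d 0 0)) (isVM (d 0 0) (dd 0 0))))).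
have X1 := kp_Xphi; have X2 := chain _ _ _ _ _ X1 (isVD (kp_XS 1 0) (N1 _ _ _ (kp_XS 0 1))).
have T1 := chain _ _ _ _ _ kp_Tphi (isVZ (- 3^-1) (isVD (isVD (d 0 2) (N1 _ _ _ (d 1 1))) (d 2 0))).
rewrite (vE _ _ _ T1 x Ux) (vE _ _ _ D2 x Ux) (vE _ _ _ D4 x Ux) (vE _ _ _ X2 x Ux).
move: (kpS 0 0 x) (kpS 1 0 x) (kpS 0 1 x) (kpS 2 0 x) (kpS 1 1 x) (kpS 0 2 x)
  (kpS 3 0 x) (kpS 2 1 x) (kpS 1 2 x) (kpS 0 3 x).
by move=> s00 s10 s01 s20 s11 s02 s30 s21 s12 s03; field.
Qed.
End KP.
End Derivations.


#[global] Opaque airyK.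

(** * Finite rank derivatives of the Airy kernel *)

Section AiryRecurrence.
Context {R : realType}.

Lemma airyD_rec j (x : R) : airyD j.+2 x = x * airyD j x + j%:R * airyD j.-1 x.
Proof.
elim: j x => [|j IH] x; first by rewrite airyD2 mul0r addr0.
have d3 := airyD_derive j.+2 x.
have E : airyD j.+2 = (fun x => x * airyD j x + j%:R * airyD j.-1 x) :> (R -> R).
  by apply/funext => y; exact: IH.
rewrite E in d3; have d := airyD_derive j x; have d' := airyD_derive j.-1 x.
have d4 := drvD (drvM (drv_id x) d) (drvM (drv_cst (j%:R : R) x) d').
rewrite -(@derive_val _ _ _ _ _ _ _ d3) (@derive_val _ _ _ _ _ _ _ d4) mul1r mul0r add0r.
case: j {IH d3 E d d' d4} => [|j]; first by rewrite !mul0r addr0 mul1r addrC.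
by rewrite /= -[j.+2]addn1 natrD; ring.
Qed.

(** The u-derivative of [airyK_ode2l]. *)
Lemma airyK_ode3l s q (dl u v : R) : airyK_ok s dl ->
  airyK s 0 3 q dl u v = airyK s 0 0 q dl u v + u * airyK s 0 1 q dl u v + airyK s 1 1 q dl u v.
Proof.
move=> ok; have H t : airyK_ok s (dl + t * 0) by rewrite mulr0 addr0.
have D := @airyK_derive R s 0 2 q dl u v 0 1 0 ok.
have D0 := @airyK_derive R s 0 0 q dl u v 0 1 0 ok.
have D1 := @airyK_derive R s 1 0 q dl u v 0 1 0 ok.
have U0 : is_derive (0 : R) 1 (fun t : R => u + t * 1) 1.
  by apply: (drv_eq (drvD (drv_cst u _) (drvM (drv_id _) (drv_cst 1 _)))); rewrite mulr0 addr0 add0r mul1r.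
have E := drvD (drvM U0 D0) D1.
have X t : (u + t * 1) * airyK s 0 0 q (dl + t * 0) (u + t * 1) (v + t * 0) + airyK s 1 0 q (dl + t * 0) (u + t * 1) (v + t * 0) =
    airyK s 0 2 q (dl + t * 0) (u + t * 1) (v + t * 0).
  by rewrite (airyK_ode2l _ _ _ (H t)) mul1r.
have {}E := drv_ext X E.
have := @derive_val _ _ _ _ _ _ _ D; rewrite (@derive_val _ _ _ _ _ _ _ E).
have e1 : dl + 0 * 0 = dl by rewrite mul0r addr0.
have e2 z : z + 0 * 0 = z :> R by rewrite mul0r addr0.
have e3 z : z + 0 * 1 = z :> R by rewrite mul0r addr0.
rewrite !(e1, e2, e3) => D2; apply/esym; move: D2; move: (airyK s) => Z D2.
by apply: etrans (etrans D2 _); ring.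
Qed.

Lemma airyK_ode3r s p (dl u v : R) : airyK_ok s dl ->
  airyK s 0 p 3 dl u v = airyK s 0 p 0 dl u v + v * airyK s 0 p 1 dl u v + airyK s 1 p 1 dl u v.
Proof.
move=> ok; have H t : airyK_ok s (dl + t * 0) by rewrite mulr0 addr0.
have D := @airyK_derive R s 0 p 2 dl u v 0 0 1 ok.
have D0 := @airyK_derive R s 0 p 0 dl u v 0 0 1 ok.
have D1 := @airyK_derive R s 1 p 0 dl u v 0 0 1 ok.
have U0 : is_derive (0 : R) 1 (fun t : R => v + t * 1) 1.
  by apply: (drv_eq (drvD (drv_cst v _) (drvM (drv_id _) (drv_cst 1 _)))); rewrite mulr0 addr0 add0r mul1r.
have E := drvD (drvM U0 D0) D1.
have X t : (v + t * 1) * airyK s 0 p 0 (dl + t * 0) (u + t * 0) (v + t * 1) + airyK s 1 p 0 (dl + t * 0) (u + t * 0) (v + t * 1) =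
    airyK s 0 p 2 (dl + t * 0) (u + t * 0) (v + t * 1).
  by rewrite (airyK_ode2r _ _ _ (H t)) mul1r.
have {}E := drv_ext X E.
have := @derive_val _ _ _ _ _ _ _ D; rewrite (@derive_val _ _ _ _ _ _ _ E).
have e1 : dl + 0 * 0 = dl by rewrite mul0r addr0.
have e2 z : z + 0 * 0 = z :> R by rewrite mul0r addr0.
have e3 z : z + 0 * 1 = z :> R by rewrite mul0r addr0.
rewrite !(e1, e2, e3) => D2; apply/esym; move: D2; move: (airyK s) => Z D2.
by apply: etrans (etrans D2 _); ring.
Qed.

(** The left side is X applied to the conjugated kernel, without the conjugating factors: u and v
    move at speeds 2 y and 2 y', the time difference stays, and the first coefficient is the
    logarithmic derivative of the conjugation. *)
Lemma airyK_X s (y y' u v : R) : airyK_ok s (y - y') ->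
  let J a p q := airyK s a p q (y - y') u v in
  (- (u + y ^+ 2) + (v + y' ^+ 2)) * J 0 0 0 + 2 * y * J 0 1 0 + 2 * y' * J 0 0 1 =
  - (airyD 0 u * (y' * airyD 0 v + airyD 1 v) - (- y * airyD 0 u + airyD 1 u) * airyD 0 v).
Proof.
move=> ok J.
have e1 := airyK_ode2l 0 u v ok; have e2 := airyK_ode2r 0 u v ok.
have e3 := airyK_FTC 0 1 0 u v ok; have e4 := airyK_FTC 0 0 1 u v ok.
have e5 := airyK_FTC 0 0 0 u v ok; move: e1 e2 e3 e4 e5; rewrite /= -/(J 0 0 0) -/(J 0 1 0)
  -/(J 0 0 1) -/(J 0 2 0) -/(J 0 0 2) -/(J 0 1 1) -/(J 1 0 0).
move: (J 0 0 0) (J 0 1 0) (J 0 0 1) (J 0 2 0) (J 0 0 2) (J 0 1 1) (J 1 0 0) => j00 j10 j01 j20 j02 j11 k00.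
move: (airyD 0 u) (airyD 1 u) (airyD 0 v) (airyD 1 v) => a a' b b' e1 e2 e3 e4 e5.
apply/eqP; rewrite -subr_eq0; apply/eqP.
(* Every bracket is one of the relations between the moments; the coefficients are those that
   eliminate the moments absent from the statement. *)
transitivity ((j20 - (u * j00 + 1 * k00)) - (j02 - (v * j00 + 1 * k00))
  - (0 * j10 - (y - y') * j10 + j20 + j11 - - (1 * a' * b))
  + (0 * j01 - (y - y') * j01 + j11 + j02 - - (1 * a * b'))
  + (y + y') * (0 * j00 - (y - y') * j00 + j10 + j01 - - (1 * a * b))); first by ring.
by rewrite e3 e4 e5 e1 e2; ring.
Qed.

(** The same for T. The term - J / 3 comes from the step h, which T multiplies by - 1 / 3, and 2 / 3
    (y - y') from the change of the time difference. Third derivatives of the Airy factors are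
    removed by [airyK_ode3l] and [airyK_ode3r]. *)
Lemma airyK_T s (y y' u v : R) : airyK_ok s (y - y') ->
  let J a p q := airyK s a p q (y - y') u v in
  - 3^-1 * J 0 0 0 + ((y * u + y ^+ 3 / 3) - (y' * v + y' ^+ 3 / 3)) * J 0 0 0
  + 2 / 3 * (y - y') * J 1 0 0 - (u / 3 + y ^+ 2) * J 0 1 0 - (v / 3 + y' ^+ 2) * J 0 0 1 =
  3^-1 * ((y ^+ 2 * airyD 0 u - 2 * y * airyD 1 u + airyD 2 u) * airyD 0 v
    - (- y * airyD 0 u + airyD 1 u) * (y' * airyD 0 v + airyD 1 v)
    + airyD 0 u * (y' ^+ 2 * airyD 0 v + 2 * y' * airyD 1 v + airyD 2 v)).
Proof.
move=> ok J.
have e1 := airyK_ode2l 0 u v ok; have e2 := airyK_ode2r 0 u v ok.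
have e3 := airyK_FTC 0 1 0 u v ok; have e4 := airyK_FTC 0 0 1 u v ok.
have e5 := airyK_FTC 0 0 0 u v ok; have e6 := airyK_ode3l 0 u v ok; have e7 := airyK_ode3r 0 u v ok.
have e8 := airyK_FTC 1 0 0 u v ok; have e9 := airyK_FTC 0 2 0 u v ok.
have e10 := airyK_FTC 0 1 1 u v ok; have e11 := airyK_FTC 0 0 2 u v ok.
move: e1 e2 e3 e4 e5 e6 e7 e8 e9 e10 e11; rewrite /= -/(J 0 0 0) -/(J 0 1 0)
  -/(J 0 0 1) -/(J 0 2 0) -/(J 0 0 2) -/(J 0 1 1) -/(J 1 0 0) -/(J 0 3 0) -/(J 0 0 3)
  -/(J 0 2 1) -/(J 0 1 2) -/(J 1 1 0) -/(J 1 0 1).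
move: (J 0 0 0) (J 0 1 0) (J 0 0 1) (J 0 2 0) (J 0 0 2) (J 0 1 1) (J 1 0 0) (J 0 3 0) (J 0 0 3)
  (J 0 2 1) (J 0 1 2) (J 1 1 0) (J 1 0 1) => j00 j10 j01 j20 j02 j11 k00 j30 j03 j21 j12 k10 k01.
move: (airyD 0 u) (airyD 1 u) (airyD 2 u) (airyD 0 v) (airyD 1 v) (airyD 2 v) => a a' a'' b b' b''.
move=> e1 e2 e3 e4 e5 e6 e7 e8 e9 e10 e11.
apply/eqP; rewrite -subr_eq0; apply/eqP.
transitivity (3^-1 * (j30 - (j00 + u * j10 + k10)) + 3^-1 * (j03 - (j00 + v * j01 + k01))
  + 3^-1 * (1 * j00 - (y - y') * k00 + k10 + k01 - - (0 * a * b))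
  - y * (j20 - (u * j00 + 1 * k00)) + y' * (j02 - (v * j00 + 1 * k00))
  - 3^-1 * (0 * j20 - (y - y') * j20 + j30 + j21 - - (1 * a'' * b))
  - 3^-1 * (0 * j02 - (y - y') * j02 + j12 + j03 - - (1 * a * b''))
  + 3^-1 * (0 * j11 - (y - y') * j11 + j21 + j12 - - (1 * a' * b'))
  + (y - (y - y') / 3) * (0 * j10 - (y - y') * j10 + j20 + j11 - - (1 * a' * b))
  + (- y' - (y - y') / 3) * (0 * j01 - (y - y') * j01 + j11 + j02 - - (1 * a * b'))
  + (- (y * y') - (y - y') ^+ 2 / 3) * (0 * j00 - (y - y') * j00 + j10 + j01 - - (1 * a * b)));
  first by field.
by rewrite e8 e9 e10 e11 e3 e4 e5 e6 e7 e1 e2; ring.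
Qed.
End AiryRecurrence.

Section Coordinates.
Context {R : realType} (n : nat).

(** Times, levels and the mesh parameter kappa; in [coord] the index [None] stands for kappa. *)
Definition space : lmodType R := ('rV[R]_n * 'rV[R]_n * R^o)%type.
Definition coord : finType := option ('I_n + 'I_n).
Implicit Types (x w : space).

Definition yc (a : 'I_n) x : R := x.1.1 0 a.
Definition rc (a : 'I_n) x : R := x.1.2 0 a.
Definition kc x : R := x.2.

Definition dir (i : coord) : space := match i with
  | Some (inl a) => (delta_mx 0 a, 0, 0)
  | Some (inr a) => (0, delta_mx 0 a, 0)
  | None => (0, 0, 1)
  end.

Lemma ycE a x (t : R) w : yc a (x + t *: w) = yc a x + t * yc a w.
Proof. by rewrite /yc !mxE. Qed.
Lemma rcE a x (t : R) w : rc a (x + t *: w) = rc a x + t * rc a w.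
Proof. by rewrite /rc !mxE. Qed.
Lemma kcE x (t : R) w : kc (x + t *: w) = kc x + t * kc w.
Proof. by []. Qed.

Lemma yc_dir a i : yc a (dir i) = (i == Some (inl a))%:R.
Proof. by case: i => [[b|b]|]; rewrite /yc /= mxE ?eqxx //= eq_sym. Qed.

Lemma rc_dir a i : rc a (dir i) = (i == Some (inr a))%:R.
Proof. by case: i => [[b|b]|]; rewrite /rc /= mxE ?eqxx //= eq_sym. Qed.

Lemma kc_dir i : kc (dir i) = (i == None)%:R.
Proof. by case: i => [[b|b]|]. Qed.

Lemma sum_pick (c : coord -> R) j : \sum_i c i * (i == j)%:R = c j.
Proof.
rewrite (bigD1 j) //= eqxx mulr1 big1 ?addr0 // => i /negbTE ->.
by rewrite mulr0.
Qed.

Lemma sum_yc c a : \sum_i c i * yc a (dir i) = c (Some (inl a)).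
Proof. by rewrite -[RHS]sum_pick; apply: eq_bigr => i _; rewrite yc_dir. Qed.

Lemma sum_rc c a : \sum_i c i * rc a (dir i) = c (Some (inr a)).
Proof. by rewrite -[RHS]sum_pick; apply: eq_bigr => i _; rewrite rc_dir. Qed.

Lemma sum_kc c : \sum_i c i * kc (dir i) = c None.
Proof. by rewrite -[RHS]sum_pick; apply: eq_bigr => i _; rewrite kc_dir. Qed.
End Coordinates.

(** * Derivatives of the discretized kernel *)

Section Entries.
Context {R : realType} (n L : nat) (N : nat) (U : space (R := R) n -> Prop) (s : 'I_n -> 'I_n -> R).
Notation V := (space (R := R) n).
Hypothesis lo : line_open (@dir R n) U.
Hypothesis sOK : forall x a b, U x -> airyK_ok (s a b) (yc a x - yc b x).
Notation isV := (isV (@dir R n) U).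
Implicit Types (x w : V) (c : coord n -> V -> R).

Lemma isV_yc c a : isV c (yc a) (c (Some (inl a))).
Proof.
apply: (isV_intro (g := fun i _ => yc a (dir i))) => [i x _|x _]; last first.
  exact: sum_yc (fun i => c i x) a.
apply: (@drv_ext R (fun t => yc a x + t * yc a (dir i))); first by move=> t; rewrite ycE.
by apply: (drv_eq (drvD (drv_cst _ _) (drvM (drv_id _) (drv_cst _ _)))); rewrite mulr0 addr0 add0r mul1r.
Qed.

Lemma isV_rc c a : isV c (rc a) (c (Some (inr a))).
Proof.
apply: (isV_intro (g := fun i _ => rc a (dir i))) => [i x _|x _]; last first.
  exact: sum_rc (fun i => c i x) a.
apply: (@drv_ext R (fun t => rc a x + t * rc a (dir i))); first by move=> t; rewrite rcE.
by apply: (drv_eq (drvD (drv_cst _ _) (drvM (drv_id _) (drv_cst _ _)))); rewrite mulr0 addr0 add0r mul1r.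
Qed.

Lemma isV_kc c : isV c (@kc R n) (c None).
Proof.
apply: (isV_intro (g := fun i _ => kc (dir i))) => [i x _|x _]; last first.
  exact: sum_kc (fun i => c i x).
apply: (@drv_ext R (fun t => kc x + t * kc (dir i))); first by move=> t; rewrite kcE.
by apply: (drv_eq (drvD (drv_cst _ _) (drvM (drv_id _) (drv_cst _ _)))); rewrite mulr0 addr0 add0r mul1r.
Qed.

Definition step_size x : R := kc x / N.+1%:R.
Definition pos (g : grid n L) x : R := rc g.1 x + (g.2 : nat)%:R * step_size x.

Lemma isV_step c : isV c step_size (fun x => c None x / N.+1%:R).
Proof.
apply: (isVE lo (isVM (isV_kc c) (isV_cst (@dir R n) U c (N.+1%:R^-1)))) => x _.
by rewrite mulr0 addr0.
Qed.

Lemma isV_pos c g : isV c (pos g)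
  (fun x => c (Some (inr g.1)) x + (g.2 : nat)%:R * (c None x / N.+1%:R)).
Proof. exact: isVD (isV_rc c g.1) (isVZ lo _ (isV_step c)). Qed.

Opaque yc rc kc.

Lemma isV_comp c (phi phi' : R -> R) F F' : (forall y : R, is_derive y 1 phi (phi' y)) -> isV c F F' ->
  isV c (fun x => phi (F x)) (fun x => phi' (F x) * F' x).
Proof.
move=> dphi [dF E]; apply: (isV_intro (g := fun i x => phi' (F x) * ld (dir i) F x)).
  move=> i x Ux; have D := dphi (F (x + 0 *: dir i)).
  apply: (drv_eq (drv_comp (dF x i Ux) D)); by rewrite scale0r addr0.
move=> x Ux; rewrite -E // /vop mulr_sumr; apply: eq_bigr => i _; by rewrite mulrCA.
Qed.

(** The branch [s] of the kernel is a parameter instead of being read off from the order of the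
    times: a fixed branch is smooth in x, and it is the true one as long as the order of the times
    does not change. *)
Definition entryJ a p q (g g' : grid n L) x : R :=
  airyK (s g.1 g'.1) a p q (yc g.1 x - yc g'.1 x) (pos g x) (pos g' x).

Lemma pos_linear g x (t : R) w : pos g (x + t *: w) = pos g x + t * pos g w.
Proof. by rewrite /pos /step_size rcE kcE; ring. Qed.

Lemma entryJ_ld a p q g g' x w : U x -> is_ld w (entryJ a p q g g') x
  (- (yc g.1 w - yc g'.1 w) * entryJ a.+1 p q g g' x + pos g w * entryJ a p.+1 q g g' x
   + pos g' w * entryJ a p q.+1 g g' x).
Proof.
move=> Ux; have D := airyK_derive a p q (pos g x) (pos g' x) (yc g.1 w - yc g'.1 w)
  (pos g w) (pos g' w) (sOK g.1 g'.1 Ux).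
apply: drv_ext D => t; rewrite /entryJ !pos_linear !ycE; 
by have -> : yc g.1 x + t * yc g.1 w - (yc g'.1 x + t * yc g'.1 w) =
  yc g.1 x - yc g'.1 x + t * (yc g.1 w - yc g'.1 w) by rewrite mulrBr opprD addrACA.
Qed.

Lemma isV_entryJ c a p q g g' P P' : isV c (pos g) P -> isV c (pos g') P' ->
  isV c (entryJ a p q g g') (fun x =>
   - (c (Some (inl g.1)) x - c (Some (inl g'.1)) x) * entryJ a.+1 p q g g' x
   + P x * entryJ a p.+1 q g g' x + P' x * entryJ a p q.+1 g g' x).
Proof.
move=> HP HP'; apply: (isV_intro (fun i x Ux => entryJ_ld a p q g g' (dir i) Ux)) => x Ux.
have posV h Q : isV c (pos h) Q -> \sum_i c i x * pos h (dir i) = Q x.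
  move=> [_ /(_ x Ux) <-]; apply: eq_bigr => i _; congr (_ * _); apply/esym/is_ldE.
  apply: (@drv_ext R (fun t => pos h x + t * pos h (dir i))); first by move=> t; rewrite pos_linear.
  by apply: (drv_eq (drvD (drv_cst _ _) (drvM (drv_id _) (drv_cst _ _)))); rewrite mulr0 addr0 add0r mul1r.
rewrite -(posV _ _ HP) -(posV _ _ HP') -!(sum_yc (fun i => c i x)).
rewrite -sumrB -sumrN !mulr_suml -!big_split /=; apply: eq_bigr => i _.
move: (c i x) (yc _ _) (yc _ _) (pos _ _) (pos _ _) (entryJ _ _ _ _ _ _) (entryJ _ _ _ _ _ _) (entryJ _ _ _ _ _ _).
by move=> *; ring.
Qed.

(* Conjugating the kernel by [conj_exp] makes its derivative along all r a rank one matrix. *)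
Definition conj_exp (e : R) (g : grid n L) x : R := expR (e * (yc g.1 x * pos g x - yc g.1 x ^+ 3 / 3)).

(** (e y + d/du)^k applied to the j-th derivative of Ai; thus [conj_airy e k] is the k-th derivative
    along D of [conj_exp e] times Ai. *)
Fixpoint conj_poly (e : R) k j (g : grid n L) x : R :=
  if k is k'.+1 then e * yc g.1 x * conj_poly e k' j g x + conj_poly e k' j.+1 g x
  else airyD j (pos g x).

Definition conj_airy e k g x : R := conj_exp e g x * conj_poly e k 0 g x.

Lemma isV_conj_exp c e g Y P : isV c (yc g.1) Y -> isV c (pos g) P -> isV c (conj_exp e g)
  (fun x => conj_exp e g x * (e * (Y x * pos g x + yc g.1 x * P x - yc g.1 x ^+ 2 * Y x))).
Proof.
move=> HY HP; have H3 := isVM HY (isVM HY HY).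
have := isV_comp (@is_derive_expR R) (isVZ lo e (isVD (isVM HY HP) (isVZ lo (- 3^-1) H3))).
apply: (isV_ext lo) => x Ux; first by rewrite /conj_exp; congr (expR (_ * _)); ring.
rewrite /conj_exp; set E1 := expR _; set E2 := expR _.
have -> : E1 = E2 by rewrite /E1 /E2; congr (expR (_ * _)); ring.
by field.
Qed.

Definition cD : coord n -> V -> R := fun i _ => if i is Some (inr _) then 1 else 0.
Definition cX : coord n -> V -> R := fun i x => match i with
  | Some (inl _) => 1 | Some (inr a) => 2 * yc a x | None => 0 end.
Definition cT : coord n -> V -> R := fun i x => match i with
  | Some (inl a) => - (2 / 3) * yc a x | Some (inr a) => - (rc a x / 3) - yc a x ^+ 2
  | None => - (kc x / 3) end.

Lemma D_pos g : isV cD (pos g) (fun=> 1).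
Proof. by apply: (isVE lo (isV_pos cD g)) => x _; rewrite /= mul0r mulr0 addr0. Qed.

Lemma X_pos g : isV cX (pos g) (fun x => 2 * yc g.1 x).
Proof. by apply: (isVE lo (isV_pos cX g)) => x _; rewrite /= mul0r mulr0 addr0. Qed.

(** This is why T has a kappa component: levels and spacing shrink together, so that every grid
    point, and not only the first of each half-line, moves as a level does. *)
Lemma T_pos g : isV cT (pos g) (fun x => - (pos g x / 3) - yc g.1 x ^+ 2).
Proof. by apply: (isVE lo (isV_pos cT g)) => x _; rewrite /= /pos /step_size; ring. Qed.

Lemma entryJ_FTC g g' x : U x -> - (yc g.1 x - yc g'.1 x) * entryJ 0 0 0 g g' x
  + entryJ 0 1 0 g g' x + entryJ 0 0 1 g g' x = - (airyD 0 (pos g x) * airyD 0 (pos g' x)).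
Proof.
move=> Ux; have := airyK_FTC 0 0 0 (pos g x) (pos g' x) (sOK g.1 g'.1 Ux).
by rewrite /= mul0r sub0r mul1r -mulNr.
Qed.

Definition entryJ_X g g' x (Ux : U x) := airyK_X (pos g x) (pos g' x) (sOK g.1 g'.1 Ux)
 : (- (pos g x + yc g.1 x ^+ 2) + (pos g' x + yc g'.1 x ^+ 2)) * entryJ 0 0 0 g g' x
   + 2 * yc g.1 x * entryJ 0 1 0 g g' x + 2 * yc g'.1 x * entryJ 0 0 1 g g' x = _.

Definition entryJ_T g g' x (Ux : U x) := airyK_T (pos g x) (pos g' x) (sOK g.1 g'.1 Ux)
 : - 3^-1 * entryJ 0 0 0 g g' x + ((yc g.1 x * pos g x + yc g.1 x ^+ 3 / 3)
     - (yc g'.1 x * pos g' x + yc g'.1 x ^+ 3 / 3)) * entryJ 0 0 0 g g' x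
   + 2 / 3 * (yc g.1 x - yc g'.1 x) * entryJ 1 0 0 g g' x
   - (pos g x / 3 + yc g.1 x ^+ 2) * entryJ 0 1 0 g g' x
   - (pos g' x / 3 + yc g'.1 x ^+ 2) * entryJ 0 0 1 g g' x = _.

Lemma step_third x : - (kc x / 3) / N.+1%:R = - (step_size x / 3).
Proof. by rewrite /step_size mulNr mulrAC. Qed.

Lemma conj_expK g x : conj_exp (-1) g x * conj_exp 1 g x = 1.
Proof. by rewrite /conj_exp -expRD -mulrDl addNr mul0r expR0. Qed.

Opaque pos entryJ conj_exp step_size.

Lemma D_conj_poly e k j g : isV cD (conj_poly e k j g) (conj_poly e k j.+1 g).
Proof.
elim: k j => [|k IH] j /=.
  by apply: (isVE lo (isV_comp (airyD_derive j) (D_pos g))) => x _; rewrite mulr1.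
apply: (isVE lo (isVD (isVM (isVZ lo e (isV_yc cD g.1)) (IH j)) (IH j.+1))) => x _ /=.
by rewrite mulr0 mul0r add0r.
Qed.

Lemma D_conj_airy e k g : isV cD (conj_airy e k g) (conj_airy e k.+1 g).
Proof.
apply: (isVE lo (isVM (isV_conj_exp e (isV_yc cD g.1) (D_pos g)) (D_conj_poly e k 0 g))) => x _ /=.
by rewrite /conj_airy /=; ring.
Qed.

Lemma X_conj_poly e k j g : isV cX (conj_poly e k j g)
  (fun x => k%:R * e * conj_poly e k.-1 j g x + 2 * yc g.1 x * conj_poly e k j.+1 g x).
Proof.
elim: k j => [|k IH] j /=.
  apply: (isVE lo (isV_comp (airyD_derive j) (X_pos g))) => x _; ring.
apply: (isVE lo (isVD (isVM (isVZ lo e (isV_yc cX g.1)) (IH j)) (IH j.+1))) => x _ /=.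
case: k {IH} => [|k] /=; first by rewrite !mul0r; ring.
by rewrite -[k.+2]addn1 natrD; ring.
Qed.

Lemma conj_poly_rec e k j g x : conj_poly e k j.+2 g x =
  pos g x * conj_poly e k j g x + j%:R * conj_poly e k j.-1 g x + k%:R * conj_poly e k.-1 j g x.
Proof.
elim: k j => [|k IH] j /=; first by rewrite airyD_rec mul0r addr0.
rewrite !IH; case: j => [|j] /=; case: k {IH} => [|k] /=.
- by rewrite !mul0r; ring.
- by rewrite -[k.+2]addn1 natrD; ring.
- by rewrite -[j.+2]addn1 natrD !mul0r; ring.
- by rewrite -[k.+2]addn1 -[j.+2]addn1 !natrD; ring.
Qed.

(** Since D D shifts [k] by two, these are heat equations, forward for e = 1 and backward for e =
    -1; behind them is the Airy equation in [conj_poly_rec]. *)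
Lemma X_conj_airy e k g : e * e = 1 -> isV cX (conj_airy e k g) (fun x => e * conj_airy e k.+2 g x).
Proof.
move=> ee.
apply: (isVE lo (isVM (isV_conj_exp e (isV_yc cX g.1) (X_pos g)) (X_conj_poly e k 0 g))) => x _ /=.
have := conj_poly_rec e k 0 g x; rewrite mul0r addr0 => E.
rewrite /conj_airy /= E.
transitivity (conj_exp e g x * (e * (pos g x * conj_poly e k 0 g x + k%:R * conj_poly e k.-1 0 g x)
  + e * yc g.1 x ^+ 2 * conj_poly e k 0 g x + 2 * yc g.1 x * conj_poly e k 1 g x)); first by ring.
apply/eqP; rewrite -subr_eq0; apply/eqP.
transitivity (conj_exp e g x * (1 - e * e) *
  (e * yc g.1 x ^+ 2 * conj_poly e k 0 g x + 2 * yc g.1 x * conj_poly e k 1 g x)); first by ring.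
by rewrite ee subrr mulr0 mul0r.
Qed.

Definition conj_entry (g g' : grid n L) x : R :=
  (g == g')%:R - step_size x * (conj_exp (-1) g x * conj_exp 1 g' x * entryJ 0 0 0 g g' x).

Lemma isV_conj_entry c g g' P P' : isV c (pos g) P -> isV c (pos g') P' -> isV c (conj_entry g g')
  (fun x => - conj_exp (-1) g x * conj_exp 1 g' x * (c None x / N.+1%:R * entryJ 0 0 0 g g' x +
   step_size x * ((- (c (Some (inl g.1)) x * pos g x + yc g.1 x * P x - yc g.1 x ^+ 2 * c (Some (inl g.1)) x)
    + (c (Some (inl g'.1)) x * pos g' x + yc g'.1 x * P' x - yc g'.1 x ^+ 2 * c (Some (inl g'.1)) x))
      * entryJ 0 0 0 g g' x
    + (- (c (Some (inl g.1)) x - c (Some (inl g'.1)) x) * entryJ 1 0 0 g g' x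
    + P x * entryJ 0 1 0 g g' x + P' x * entryJ 0 0 1 g g' x)))).
Proof.
move=> HP HP'.
have H := isVD (isV_cst (@dir R n) U c ((g == g')%:R : R))
  (isVZ lo (-1) (isVM (isV_step c) (isVM (isVM (isV_conj_exp (-1) (isV_yc c g.1) HP)
    (isV_conj_exp 1 (isV_yc c g'.1) HP')) (isV_entryJ 0 0 0 HP HP')))).
apply: (isV_ext lo) H => x _; first by rewrite /conj_entry mulN1r.
move: (conj_exp _ _ _) (conj_exp _ _ _) (entryJ _ _ _ _ _ _) (entryJ _ _ _ _ _ _) (entryJ _ _ _ _ _ _) (entryJ _ _ _ _ _ _).
move: (step_size x) (pos g x) (pos g' x) (yc _ _) (yc _ _) (c _ _) (c _ _) (c _ _) (P x) (P' x) (N.+1%:R^-1).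
by move=> *; ring.
Qed.

Lemma D_entry g g' : isV cD (conj_entry g g')
  (fun x => step_size x * (conj_airy (-1) 0 g x * conj_airy 1 0 g' x)).
Proof.
apply: (isVE lo (isV_conj_entry (D_pos g) (D_pos g'))) => x Ux /=.
have := entryJ_FTC g g' Ux; rewrite /conj_airy /=.
move: (airyD 0 (pos g x)) (airyD 1 (pos g x)) (airyD 2 (pos g x)) (airyD 0 (pos g' x))
  (airyD 1 (pos g' x)) (airyD 2 (pos g' x)).
move: (entryJ 0 0 0 g g' x) (entryJ 1 0 0 g g' x) (entryJ 0 1 0 g g' x) (entryJ 0 0 1 g g' x).
move: (conj_exp (-1) g x) (conj_exp 1 g' x) (step_size x) (pos g x) (pos g' x) (yc g.1 x) (yc g'.1 x).
move=> E1 E2 h u u' y y' j k j10 j01 a a' a'' b b' b'' E.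
transitivity (- E1 * E2 * (h * (- (y - y') * j + j10 + j01))); first by ring.
by rewrite E; ring.
Qed.

Lemma X_entry g g' : isV cX (conj_entry g g')
  (fun x => step_size x * (conj_airy (-1) 0 g x * conj_airy 1 1 g' x - conj_airy (-1) 1 g x * conj_airy 1 0 g' x)).
Proof.
apply: (isVE lo (isV_conj_entry (X_pos g) (X_pos g'))) => x Ux /=.
have := entryJ_X g g' Ux; rewrite /conj_airy /=.
move: (airyD 0 (pos g x)) (airyD 1 (pos g x)) (airyD 2 (pos g x)) (airyD 0 (pos g' x))
  (airyD 1 (pos g' x)) (airyD 2 (pos g' x)).
move: (entryJ 0 0 0 g g' x) (entryJ 1 0 0 g g' x) (entryJ 0 1 0 g g' x) (entryJ 0 0 1 g g' x).
move: (conj_exp (-1) g x) (conj_exp 1 g' x) (step_size x) (pos g x) (pos g' x) (yc g.1 x) (yc g'.1 x).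
move=> E1 E2 h u u' y y' j k j10 j01 a a' a'' b b' b'' E.
transitivity (- E1 * E2 * (h * ((- (u + y ^+ 2) + (u' + y' ^+ 2)) * j + 2 * y * j10 + 2 * y' * j01))).
  by ring.
by rewrite E; ring.
Qed.

Lemma T_entry g g' : isV cT (conj_entry g g')
  (fun x => - (step_size x / 3) * (conj_airy (-1) 2 g x * conj_airy 1 0 g' x
     - conj_airy (-1) 1 g x * conj_airy 1 1 g' x + conj_airy (-1) 0 g x * conj_airy 1 2 g' x)).
Proof.
apply: (isVE lo (isV_conj_entry (T_pos g) (T_pos g'))) => x Ux /=.
have := entryJ_T g g' Ux; rewrite /conj_airy step_third /=.
move: (airyD 0 (pos g x)) (airyD 1 (pos g x)) (airyD 2 (pos g x)) (airyD 0 (pos g' x))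
  (airyD 1 (pos g' x)) (airyD 2 (pos g' x)).
move: (entryJ 0 0 0 g g' x) (entryJ 1 0 0 g g' x) (entryJ 0 1 0 g g' x) (entryJ 0 0 1 g g' x).
move: (conj_exp (-1) g x) (conj_exp 1 g' x) (step_size x) (pos g x) (pos g' x) (yc g.1 x) (yc g'.1 x).
move=> E1 E2 h u u' y y' j k j10 j01 a a' a'' b b' b'' E.
transitivity (- E1 * E2 * (h * (- 3^-1 * j + ((y * u + y ^+ 3 / 3) - (y' * u' + y' ^+ 3 / 3)) * j
   + 2 / 3 * (y - y') * k - (u / 3 + y ^+ 2) * j10 - (u' / 3 + y' ^+ 2) * j01))); first by field.
by rewrite E; field.
Qed.

Definition entry_mx x : 'M[R]_#|grid n L| :=
  1%:M + (- step_size x) *: \matrix_(a, b) entryJ 0 0 0 (enum_val a) (enum_val b) x.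

Definition conj_mx x : 'M[R]_#|grid n L| := \matrix_(a, b) conj_entry (enum_val a) (enum_val b) x.

(** The two diagonal matrices of the conjugation are inverse to each other. *)
Lemma det_entry_mx x : \det (conj_mx x) = \det (entry_mx x).
Proof.
pose D1 := diag_mx (\row_a conj_exp (-1) (enum_val a) x) : 'M[R]_#|grid n L|.
pose D2 := diag_mx (\row_a conj_exp 1 (enum_val a) x) : 'M[R]_#|grid n L|.
have ee g := conj_expK g x.
have -> : conj_mx x = D1 *m entry_mx x *m D2.
  apply/matrixP => a b; rewrite mul_mx_diag mxE mul_diag_mx !mxE /conj_entry (inj_eq enum_val_inj).
  case: (eqVneq a b) => [->|_] /=; last by rewrite !mulr0n; ring.
  rewrite !mulr1n; have := ee (enum_val b); move: (conj_exp _ _ _) (conj_exp _ _ _) => e1 e2 E.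
  by rewrite -[in LHS]E; ring.
rewrite !det_mulmx mulrAC -det_mulmx.
suff -> : D1 *m D2 = 1%:M by rewrite det1 mul1r.
apply/matrixP => a b; rewrite mul_mx_diag !mxE.
by case: (eqVneq a b) => [->|_]; rewrite ?mulr0n ?mul0r // mulr1n ee.
Qed.

Lemma entry_KP x : (forall x, U x -> 0 < \det (entry_mx x)) -> U x ->
  let phi x := ln (\det (entry_mx x)) in let vop := vop (@dir R n) in
  vop cD (vop cT phi) x + 2^-1 * vop cD (vop cD phi) x ^+ 2
  + 12^-1 * vop cD (vop cD (vop cD (vop cD phi))) x + 4^-1 * vop cX (vop cX phi) x = 0.
Proof.
move=> dp Ux phi vop'.
pose f j x : 'cV[R]_#|grid n L| := \col_a conj_airy (-1) j (enum_val a) x.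
pose g j x : 'rV[R]_#|grid n L| := \row_a conj_airy 1 j (enum_val a) x.
have -> : phi = kp_phi conj_mx by apply/funext => y; rewrite /phi /kp_phi -det_entry_mx.
apply: (@kp_identity R _ _ (@dir R n) U lo _ cD cX cT step_size conj_mx f g) => //.
- by move=> y Uy; rewrite det_entry_mx; exact: dp.
- by apply: (isVE lo (isV_step cD)) => y _ /=; rewrite mul0r.
- by apply: (isVE lo (isV_step cX)) => y _ /=; rewrite mul0r.
- move=> a b; apply: (isV_ext lo) (D_entry (enum_val a) (enum_val b)) => y Uy; first by rewrite mxE.
  by rewrite !mxE big_ord1 !mxE.
- move=> a b; apply: (isV_ext lo) (X_entry (enum_val a) (enum_val b)) => y Uy; first by rewrite mxE.
  by rewrite !mxE !big_ord1 !mxE.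
- move=> a b; apply: (isV_ext lo) (T_entry (enum_val a) (enum_val b)) => y Uy; first by rewrite mxE.
  by rewrite !mxE !big_ord1 !mxE.
- by move=> j a b; apply: (isV_ext lo) (D_conj_airy (-1) j (enum_val a)) => y Uy; rewrite mxE.
- by move=> j a b; apply: (isV_ext lo) (D_conj_airy 1 j (enum_val b)) => y Uy; rewrite mxE.
- move=> j a b; apply: (isV_ext lo) (X_conj_airy j (enum_val a) (_ : -1 * -1 = 1)) => [y Uy|y Uy|].
  + by rewrite mxE.
  + by rewrite !mxE mulN1r.
  + by rewrite mulrNN mulr1.
- move=> j a b; apply: (isV_ext lo) (X_conj_airy j (enum_val b) (_ : 1 * 1 = 1)) => [y Uy|y Uy|].
  + by rewrite mxE.
  + by rewrite !mxE mul1r.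
  + by rewrite mulr1.
Qed.

Definition cY : coord n -> V -> R := fun i _ => if i is Some (inl _) then 1 else 0.

(** Only differences of times occur in the entries. *)
Lemma entry_Y x : U x -> vop (@dir R n) cY (fun x => \det (entry_mx x)) x = 0.
Proof.
move=> Ux.
have Ypos g : isV cY (pos g) (fun=> 0).
  by apply: (isVE lo (isV_pos cY g)) => y _ /=; rewrite mul0r mulr0 addr0.
have H : isVm (@dir R n) U cY entry_mx (fun=> 0).
  move=> a b.
  have := isVD (isV_cst (@dir R n) U cY ((a == b)%:R : R))
    (isVZ lo (-1) (isVM (isV_step cY) (isV_entryJ 0 0 0 (Ypos (enum_val a)) (Ypos (enum_val b))))).
  apply: (isV_ext lo) => y Uy; first by rewrite !mxE mulN1r mulNr.
  rewrite [RHS]mxE; move: (entryJ _ _ _ _ _ y) (entryJ _ _ _ _ _ y) (entryJ _ _ _ _ _ y) (step_size y).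
  by move=> j1 j2 j3 h; rewrite /cY /=; ring.
have [_ /(_ x Ux) ->] := isV_det H.
by rewrite mul0mx mxtrace0.
Qed.
End Entries.

(** * Passage to the limit *)

Section EntryBounds.
Context {R : realType} (n : nat) (I : finType) (v : I -> space (R := R) n) (U : space (R := R) n -> Prop).
Variables (s : 'I_n -> 'I_n -> R) (rlo : 'I_n -> R) (eta c kap1 : R).
Hypothesis eta0 : 0 < eta.
Hypothesis c0 : 0 < c.
Hypothesis kap01 : 0 <= kap1 <= 1.
Hypothesis lo : line_open v U.
Hypothesis sU : forall x a b, U x -> s a b * s a b = 1 /\ c <= s a b * (yc a x - yc b x + 2 * eta).
Hypothesis rU : forall x a, U x -> rlo a <= rc a x.
Hypothesis kU : forall x, U x -> 2^-1 <= kc x <= 2.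
Hypothesis vy : forall i a, `|yc a (v i)| <= 1.
Hypothesis vr : forall i a, `|rc a (v i)| <= 1.
Hypothesis vk : forall i, `|kc (v i)| <= kap1.

(** [kap1] bounds the kappa component of the directions. Kappa moves the grid point at offset o with
    speed o, and [growth] bounds the speed that results; [decay] is the exponential bound at that
    offset when kappa is at least 1 / 2. *)
Definition ofs N L (g : grid n L) : R := (g.2 : nat)%:R / N.+1%:R.
Definition growth N L (g : grid n L) : R := 1 + kap1 * ofs N g.
Definition decay N L (g : grid n L) : R := expR (- eta * (rlo g.1 + ofs N g / 2)).
(** The factor kappa of the step is moved into the entry because it is differentiated as well; the
    flag is false in the term where the derivative has hit it. *)
Definition scaled_entry N L (e : bool) a p q (g g' : grid n L) x : R :=
  (if e then kc x else 1) * entryJ N s a p q g g' x.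

Lemma ofs_ge0 N L (g : grid n L) : 0 <= ofs N g.
Proof. by rewrite /ofs divr_ge0. Qed.

Lemma growth_ge1 N L (g : grid n L) : 1 <= growth N g.
Proof. by rewrite /growth lerDl mulr_ge0 ?ofs_ge0 //; case/andP: kap01. Qed.

Lemma posE N L (g : grid n L) x : pos N g x = rc g.1 x + ofs N g * kc x.
Proof. by rewrite /pos /step_size /ofs mulrA mulrAC. Qed.

Lemma pos_lower N L (g : grid n L) x : U x -> rlo g.1 + ofs N g / 2 <= pos N g x.
Proof.
move=> Ux; rewrite posE; have := rU g.1 Ux; have /andP[h _] := kU Ux.
by have := ler_wpM2l (ofs_ge0 N g) h; move: (ofs N g) (rc _ _) => o r; lra.
Qed.

Lemma pos_dir N L (g : grid n L) i : `|pos N g (v i)| <= growth N g.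
Proof.
rewrite posE (le_trans (ler_normD _ _)) // /growth lerD //.
by rewrite normrM (ger0_norm (ofs_ge0 N g)) mulrC ler_wpM2r // ofs_ge0.
Qed.

Definition entry_bound C sg N L m (g g' : grid n L) k : R :=
  C * (m + k)`!%:R * sg ^+ (m + k) * (8 * (growth N g * growth N g')) ^+ k * (decay N g * decay N g').

Lemma entry_boundS C sg N L m (g g' : grid n L) k : shiftb (entry_bound C sg N m g g') k =
  8 * (growth N g * growth N g') * entry_bound C sg N m.+1 g g' k.
Proof. by rewrite /shiftb /entry_bound addnS addSn !exprS; ring. Qed.

Lemma fact3_le a p q : (a`! * p`! * q`! <= (a + p + q)`!)%N.
Proof.
have H x y : (x`! * y`! <= (x + y)`!)%N.
  rewrite -(bin_fact (leq_addr y x)) addKn -[leqLHS]mul1n leq_mul2r bin_gt0 leq_addr orbT //.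
by apply: leq_trans (H _ _); rewrite leq_mul2r H orbT.
Qed.

Lemma scaled_entry_smooth : exists2 C, 0 <= C & exists2 sg, 1 <= sg &
  forall N L q e a p p' (g g' : grid n L),
    smooth_bound v q U (entry_bound C sg N (a + p + p') g g') (scaled_entry N e a p p' g g').
Proof.
have [C0 C00 HC] := airyK_bound eta0.
have c20 : 0 <= 2 / c by rewrite divr_ge0 // ltW.
pose sg : R := 1 + 2 / c; have sg1 : 1 <= sg by rewrite /sg; lra.
have K0 : 0 <= 2 * C0 * (2 / c) by rewrite mulr_ge0 // mulr_ge0.
(* The leading 2 bounds the factor kappa. *)
exists (2 * C0 * (2 / c)) => //.
exists sg => // N L q e a p p' g g'.
have pt e' a' p1 p2 x : U x ->
  `|scaled_entry N e' a' p1 p2 g g' x| <= entry_bound (2 * C0 * (2 / c)) sg N (a' + p1 + p2) g g' 0.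
  move=> Ux; have [ss cs] := sU g.1 g'.1 Ux.
  have := HC (s g.1 g'.1) a' p1 p2 c _ (pos N g x) (pos N g' x) ss c0 cs.
  have /andP[k1 k2] := kU Ux.
  have ke : `|if e' then kc x else 1| <= 2 by case: (e'); rewrite ger0_norm //; lra.
  move=> H; rewrite normrM (le_trans (ler_pM (normr_ge0 _) (normr_ge0 _) ke H)) //.
  rewrite /entry_bound addn0 expr0 mulr1 /airyK_const.
  have E1 : expR (- eta * (pos N g x + pos N g' x)) <= decay N g * decay N g'.
    rewrite /decay -expRD ler_expR -mulrDr !mulNr lerN2 ler_pM2l // lerD // pos_lower //.
  have E2 : (a'`!%:R * p1`!%:R * p2`!%:R : R) <= (a' + p1 + p2)`!%:R by rewrite -!natrM ler_nat fact3_le.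
  have E3 : (2 / c) ^+ a' <= sg ^+ (a' + p1 + p2).
    apply: le_trans (_ : sg ^+ a' <= _); first by rewrite lerXn2r ?nnegrE // /sg; lra.
    by rewrite ler_weXn2l // -addnA leq_addr.
  have ge0 : 0 <= (2 / c) ^+ a' by rewrite exprn_ge0.
  move: E1 E2 E3 ge0; move: (expR _) (decay N g * decay N g') (expR_ge0 (- eta * (pos N g x + pos N g' x))) => e1 d e10.
  move: (sg ^+ _) ((2 / c) ^+ a') => S A E1 E2 E3 A0.
  have -> : 2 * (C0 * (a'`!%:R * A) * (2 / c) * p1`!%:R * p2`!%:R * e1) =
    2 * C0 * (2 / c) * (a'`!%:R * p1`!%:R * p2`!%:R) * A * e1 by ring.
  move: (2 * C0 * (2 / c)) K0 => K K0.
  apply: ler_pM => //; first by rewrite !mulr_ge0.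
  apply: ler_pM => //; first by rewrite !mulr_ge0.
  by apply: ler_wpM2l.
have mono m k : entry_bound (2 * C0 * (2 / c)) sg N m g g' k <= entry_bound (2 * C0 * (2 / c)) sg N m.+1 g g' k.
  rewrite /entry_bound ler_wpM2r ?mulr_ge0 ?expR_ge0 // ler_wpM2r //.
    by rewrite exprn_ge0 // !mulr_ge0 // (le_trans ler01) // growth_ge1.
  apply: ler_pM; [by rewrite mulr_ge0|by rewrite exprn_ge0 // (le_trans ler01)| |].
    by rewrite ler_wpM2l // ler_nat addSn factS leq_pmull.
  by rewrite ler_weXn2l // leq_add2r.
have eb0 m k : 0 <= entry_bound (2 * C0 * (2 / c)) sg N m g g' k.
  rewrite /entry_bound; do ! (apply: mulr_ge0 || apply: exprn_ge0 || apply: expR_ge0) => //.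
  - exact: le_trans sg1.
  - by rewrite (le_trans ler01) // growth_ge1.
  - by rewrite (le_trans ler01) // growth_ge1.
elim: q e a p p' => [|q IH] e a p p'; first by split=> // x; exact: pt.
split=> [x|i]; first exact: pt.
exists (fun x => (if e then kc (v i) else 0) * scaled_entry N false a p p' g g' x +
  (- (yc g.1 (v i) - yc g'.1 (v i)) * scaled_entry N e a.+1 p p' g g' x
   + pos N g (v i) * scaled_entry N e a p.+1 p' g g' x
   + pos N g' (v i) * scaled_entry N e a p p'.+1 g g' x)).
  move=> x Ux.
  have sOK x' a' b : U x' -> airyK_ok (s a' b) (yc a' x' - yc b x').
    move=> Ux'; have [ss cs] := sU a' b Ux'; split=> //; exists eta => //; exact: lt_le_trans cs.
  have D := entryJ_ld N sOK a p p' g g' (v i) Ux.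
  have Dk : is_ld (v i) (fun x => if e then kc x else 1) x (if e then kc (v i) else 0).
    case: e; last exact: is_ld_cst.
    apply: (@drv_ext R (fun t => kc x + t * kc (v i))); first by move=> t; rewrite kcE.
    by apply: (drv_eq (drvD (drv_cst _ _) (drvM (drv_id _) (drv_cst _ _)))); rewrite mulr0 addr0 add0r mul1r.
  apply: (is_ld_eq (is_ldM Dk D)); rewrite /scaled_entry.
  move: (if e then _ else _) (if e then _ else _) (entryJ _ _ _ _ _ _ _ _) (entryJ _ _ _ _ _ _ _ _) (entryJ _ _ _ _ _ _ _ _) (entryJ _ _ _ _ _ _ _ _).
  by move: (yc _ _) (yc _ _) (pos _ _ _) (pos _ _ _) => *; ring.
have H1 := smooth_boundZ (if e then kc (v i) else 0) (IH false a p p').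
have H2 := smooth_boundZ (- (yc g.1 (v i) - yc g'.1 (v i))) (IH e a.+1 p p').
have H3 := smooth_boundZ (pos N g (v i)) (IH e a p.+1 p').
have H4 := smooth_boundZ (pos N g' (v i)) (IH e a p p'.+1).
(* The four terms of the derivative contribute 1, 2, 1 and 1 times [w * B], which the factor 8 in
   [entry_bound] covers. *)
apply: (smooth_boundW _ _ (smooth_boundD H1 (smooth_boundD (smooth_boundD H2 H3) H4))) => // k _.
rewrite entry_boundS !addnS !addSn.
have o1 := growth_ge1 N g; have o2 := growth_ge1 N g'.
set w := growth N g * growth N g'; set B := entry_bound _ _ _ _.+1 _ _ _.
have w1 : 1 <= w by rewrite -[leLHS]mulr1 ler_pM.
have wg : growth N g <= w by rewrite ler_peMr // (le_trans ler01).
have wg' : growth N g' <= w by rewrite ler_peMl // (le_trans ler01).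
have B0 : 0 <= B := eb0 _ _.
have b1 : `|if e then kc (v i) else 0| * entry_bound (2 * C0 * (2 / c)) sg N (a + p + p') g g' k <= w * B.
  apply: ler_pM (normr_ge0 _) (eb0 _ _) _ (mono _ _).
  case: (e); rewrite ?normr0; last by rewrite (le_trans ler01).
  by rewrite (le_trans (vk i)) // (le_trans _ w1) //; case/andP: kap01.
have b2 : `|- (yc g.1 (v i) - yc g'.1 (v i))| * B <= 2 * w * B.
  rewrite ler_wpM2r // normrN (le_trans (ler_normB _ _)) // (le_trans (lerD (vy _ _) (vy _ _))) //.
  by move: w1; move: (w) => w'; lra.
have b3 : `|pos N g (v i)| * B <= w * B by rewrite ler_wpM2r // (le_trans (pos_dir _ _ _)).
have b4 : `|pos N g' (v i)| * B <= w * B by rewrite ler_wpM2r // (le_trans (pos_dir _ _ _)).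
have wB : 0 <= w * B by rewrite mulr_ge0 // (le_trans ler01).
move: b1 b2 b3 b4 wB; rewrite -!mulrA; move: (w * B) => wB.
move: (`| _ | * _) (`| _ | * _) (`| _ | * _) (`| _ | * _) => z1 z2 z3 z4; lra.
Qed.


Variables (W eta1 : R).
Hypothesis W0 : 0 < W.
Hypothesis eta10 : 0 < eta1.
(* For kap1 = 0 this holds for all Q with the same W, for kap1 = 1 the constant W depends on Q. *)
Definition growth_decay Q := forall (t : R) k, 0 <= t -> (k <= Q)%N ->
  (1 + kap1 * t) ^+ k * expR (- eta * (t / 2)) <= W * expR (- eta1 * t).

Definition entry_weight N L (g : grid n L) : R :=
  W * expR (- eta * rlo g.1) * expR (- eta1 * ofs N g).

Lemma growth_decay_le Q N L (g : grid n L) k : growth_decay Q -> (k <= Q)%N ->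
  growth N g ^+ k * decay N g <= entry_weight N g.
Proof.
move=> gd kQ; rewrite /decay mulrDr expRD /entry_weight /growth [leRHS]mulrAC mulrCA [leRHS]mulrC.
by rewrite ler_wpM2l ?expR_ge0 // gd // ofs_ge0.
Qed.

Lemma entry_mass N L : (0 < N)%N ->
  N%:R^-1 * \sum_(g : grid n L) entry_weight N.-1 g ^+ 2
    <= \sum_(i < n) W ^+ 2 * expR (- eta * rlo i) ^+ 2 * ((2 * eta1)^-1 + 1).
Proof.
move=> N0; rewrite -(pair_bigA _ (fun i o => entry_weight N.-1 ((i, o) : grid n L) ^+ 2)) /= mulr_sumr.
apply: ler_sum => i _; rewrite /entry_weight /ofs /= prednK //.
have H := @exp_riemann_bound R 0 (2 * eta1) N%:R^-1 L.
have N1 : 0 < (N%:R^-1 : R) by rewrite invr_gt0 ltr0n.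
have {H} := H _ N1; rewrite mulr0 expR0 mul1r => H.
have {}H := H (mulr_gt0 (ltr0Sn _ 1) eta10).
have -> : N%:R^-1 * \sum_(j < L) (W * expR (- eta * rlo i) * expR (- eta1 * (j%:R / N%:R))) ^+ 2 =
  W ^+ 2 * expR (- eta * rlo i) ^+ 2 * (N%:R^-1 * \sum_(j < L) expR (- (2 * eta1) * (0 + j%:R * N%:R^-1))).
  rewrite mulrCA; congr (_ * _); rewrite mulr_sumr; apply: eq_bigr => j _.
  rewrite !exprMn; congr (_ * _); rewrite -expRM_natl add0r; congr expR.
  by rewrite -mulr_natl; ring.
rewrite ler_wpM2l ?mulr_ge0 ?exprn_ge0 ?expR_ge0 ?(ltW W0) // (le_trans H) // lerD2l.
by rewrite invf_le1 ?ltr0n // ler1n.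
Qed.

Lemma rising_le x k : rising x k <= k`!%:R * 2 ^+ (x + k) :> R.
Proof.
have bin2 m j : ('C(m, j) <= 2 ^ m)%N.
  elim: m j => [|m IH] [|j] //; first by rewrite bin0 expn_gt0.
  by rewrite binS expnS mul2n -addnn leq_add.
have E : rising x k = (k`! * 'C((x + k).-1, k))%:R :> R.
  elim: k => [|k IH]; first by rewrite /rising big_ord0 bin0.
  rewrite /rising big_ord_recr /= -/(rising x k) IH -natrM addnS /=.
  congr (_%:R); rewrite -mulnA [('C(_, k) * _)%N]mulnC; case E : (x + k)%N => [|m] /=.
    by rewrite mul0n muln0 bin_small ?muln0.
  by rewrite mul_bin_diag mulnA factS [(k`! * _)%N]mulnC.
rewrite E natrM -natrX ler_wpM2l // ler_nat (leq_trans (bin2 _ _)) // leq_pexp2l //; exact: leq_pred.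
Qed.

(** Von Koch's expansion, with [smooth_bound_det] for each minor: summing the products of squared
    weights over all k-tuples of grid points gives the k-th power of a Riemann sum bounded
    independently of N and L. [S] and [rho] are chosen before [Q]; hence one analytic bound serves
    all orders whenever [growth_decay] holds for all [Q] with the same [W]. *)
Lemma det_entry_smooth : exists2 S, 0 <= S & exists2 rho, 0 <= rho & forall Q, growth_decay Q -> forall N L,
  smooth_bound v Q U (fun k => S * k`!%:R * rho ^+ k) (fun x => \det (entry_mx L N s x)).
Proof.
have [C C0 [sg sg1 H]] := scaled_entry_smooth.
pose Y := \sum_(i < n) W ^+ 2 * expR (- eta * rlo i) ^+ 2 * ((2 * eta1)^-1 + 1).
have Y0 : 0 <= Y.
  apply: sumr_ge0 => i _; rewrite mulr_ge0 ?mulr_ge0 ?exprn_ge0 ?expR_ge0 ?(ltW W0) //.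
  by rewrite addr_ge0 // invr_ge0 mulr_ge0 // ltW.
(* The factor 2 pays for the 2^k in [rising_le]; [Y] bounds the mass of the squared weights. *)
have [M sM HM] := @had_summable R (2 * (C * Y)) (mulr_ge0 (ler0n _ 2) (mulr_ge0 C0 Y0)).
have M0 k : 0 <= M k by apply: le_trans (HM k); rewrite divr_ge0 // mulr_ge0 ?had_ge0 // exprn_ge0 // !mulr_ge0.
have sg0 : 0 <= sg := le_trans ler01 sg1.
exists (limn (series M)).
  by apply: limr_ge => //; apply: nearW => k; rewrite /series /=; apply: sumr_ge0.
exists (2 * (8 * sg)); first by rewrite !mulr_ge0.
move=> Q gd N L.
pose w (a : 'I_#|grid n L|) := entry_weight N (enum_val a).
have w0 a : 0 < w a by rewrite /w /entry_weight !mulr_gt0 ?expR_gt0.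
pose E (a b : 'I_#|grid n L|) := scaled_entry N true 0 0 0 (enum_val a) (enum_val b).
have HE a b : smooth_bound v Q U (fun k => (0 + k)`!%:R * (8 * sg) ^+ (0 + k) * C * (w a * w b)) (E a b).
  apply: (smooth_boundW _ _ (H N L Q true 0 0 0 (enum_val a) (enum_val b))) => // k kQ.
  rewrite /entry_bound add0n !exprMn /w.
  have g1 := growth_decay_le N (enum_val a) gd kQ; have g2 := growth_decay_le N (enum_val b) gd kQ.
  have G := ler_pM (mulr_ge0 (exprn_ge0 k (le_trans ler01 (growth_ge1 N (enum_val a)))) (expR_ge0 _))
    (mulr_ge0 (exprn_ge0 k (le_trans ler01 (growth_ge1 N (enum_val b)))) (expR_ge0 _)) g1 g2.
  move: G; rewrite -/(decay N (enum_val a)) -/(decay N (enum_val b)).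
  move: (growth N (enum_val a) ^+ k) (growth N (enum_val b) ^+ k) (decay N (enum_val a)) (decay N (enum_val b)) => z1 z2 z3 z4 G.
  have -> : C * k`!%:R * sg ^+ k * (8 ^+ k * (z1 * z2)) * (z3 * z4) =
     k`!%:R * (8 ^+ k * sg ^+ k) * C * (z1 * z3 * (z2 * z4)) by ring.
  by rewrite ler_wpM2l // !mulr_ge0 // exprn_ge0.
have FE x : \sum_(k < (#|grid n L|).+1) (k`!%:R)^-1 *
    \sum_(z : {ffun 'I_k -> 'I_#|grid n L|}) (- N.+1%:R^-1) ^+ k * \det (\matrix_(a, b) E (z a) (z b) x)
    = \det (entry_mx L N s x).
  rewrite /entry_mx (@von_Koch R _ _ (#|grid n L|).+1) //; apply: eq_bigr => k _; congr (_ * _).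
  apply: eq_bigr => z _; rewrite -detZ; congr (\det _); apply/matrixP => a b; rewrite !mxE.
  by rewrite /E /scaled_entry /step_size; move: (entryJ _ _ _ _ _ _ _ _) (kc x) => j kk; ring.
apply: (smooth_bound_ext lo (fun x _ => FE x)).
have HS := smooth_bound_sum (index_enum 'I_(#|grid n L|).+1) (P := xpredT)
  (fun (k : 'I_(#|grid n L|).+1) _ => smooth_boundZ (k`!%:R^-1)
   (smooth_bound_sum (index_enum {ffun 'I_k -> 'I_#|grid n L|}) (P := xpredT)
     (fun z _ => smooth_boundZ ((- N.+1%:R^-1) ^+ k)
      (@smooth_bound_det R _ _ v Q U k (fun a b => E (z a) (z b)) (fun=> 0) (fun a => w (z a)) C (8 * sg)
        lo C0 (mulr_ge0 (ler0n _ 8) sg0) (fun a => w0 (z a)) (fun a b => HE (z a) (z b)))))).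
apply: (smooth_boundW _ _ HS) => // j jQ.
rewrite -[leRHS]mulrA [leRHS]mulrC; apply: le_trans (_ : _ <= (j`!%:R * (2 * (8 * sg)) ^+ j) * (series M (#|grid n L|).+1)) _;
  last first.
  rewrite ler_wpM2l ?mulr_ge0 ?exprn_ge0 ?mulr_ge0 //.
  by apply: (nondecreasing_cvgn_le _ sM); apply: nondecreasing_series => *; exact: M0.
rewrite /series /= big_mkord mulr_sumr; apply: ler_sum => k _.
have mass := @entry_mass N.+1 L (ltn0Sn _); rewrite succnK in mass.
set mm := N.+1%:R^-1 * _ in mass.
have mm0 : 0 <= mm by rewrite mulr_ge0 // sumr_ge0 // => g _; rewrite exprn_ge0 // !mulr_ge0 ?expR_ge0 // ltW.
have Ez : \sum_(z : {ffun 'I_k -> 'I_#|grid n L|}) \prod_a w (z a) ^+ 2 =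
    (\sum_(g : grid n L) entry_weight N g ^+ 2) ^+ k.
  rewrite -(bigA_distr_bigA (fun (_ : 'I_k) g => w g ^+ 2)) prodr_const card_ord; congr (_ ^+ _).
  by rewrite (big_enum_val (fun g => entry_weight N g ^+ 2)) /= /w; apply: eq_big.
have -> : \sum_(z : {ffun 'I_k -> 'I_#|grid n L|}) `|(- N.+1%:R^-1) ^+ k| *
    (had k * (\prod_(a < k) (0`!%:R * (8 * sg) ^+ 0 * C)) * (\prod_a w (z a) ^+ 2) *
     ((8 * sg) ^+ j * rising (\sum_(a < k) 0 + k) j)) =
   had k * C ^+ k * ((8 * sg) ^+ j * rising k j) * mm ^+ k.
  rewrite [mm ^+ k]exprMn -Ez !mulr_sumr; apply: eq_bigr => z _.
  have -> : (\sum_(a < k) 0 + k)%N = k by rewrite big1.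
  rewrite normrX normrN ger0_norm // fact0 expr0 !mul1r prodr_const card_ord.
  by ring.
rewrite ger0_norm // -/Y in mass *.
have b1 : rising k j <= j`!%:R * 2 ^+ (k + j) :> R := rising_le k j.
have b2 : mm ^+ k <= Y ^+ k by rewrite lerXn2r ?nnegrE.
have b3 := HM k.
have hk := had_ge0 (R := R) k.
have Ck := exprn_ge0 k C0.
apply: le_trans (_ : k`!%:R^-1 * (had k * C ^+ k * ((8 * sg) ^+ j * (j`!%:R * 2 ^+ (k + j))) * Y ^+ k) <= _).
  rewrite ler_wpM2l // ler_pM ?exprn_ge0 //.
    rewrite !mulr_ge0 ?exprn_ge0 ?mulr_ge0 //; rewrite /rising; exact: prodr_ge0.
  by rewrite ler_wpM2l ?mulr_ge0 // ler_wpM2l // exprn_ge0 // mulr_ge0.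
have -> : k`!%:R^-1 * (had k * C ^+ k * ((8 * sg) ^+ j * (j`!%:R * 2 ^+ (k + j))) * Y ^+ k) =
  j`!%:R * (2 * (8 * sg)) ^+ j * (had k * (2 * (C * Y)) ^+ k / k`!%:R).
  by rewrite exprD !exprMn; ring.
by rewrite ler_wpM2l // mulr_ge0 // exprn_ge0 // !mulr_ge0.
Qed.

End EntryBounds.


Section EntryLimit.
Context {R : realType}.

(** A Lipschitz bound from the first derivatives, along the segment between the two points. *)
Lemma airyK_cvg s a p q (dl u v : R) (us vs : nat -> R) : airyK_ok s dl ->
  us N @[N --> \oo] --> u -> vs N @[N --> \oo] --> v ->
  airyK s a p q dl (us N) (vs N) @[N --> \oo] --> airyK s a p q dl u v.
Proof.
move=> ok cu cv; have [ss [eta eta0 c0]] := ok.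
have [C C0 HC] := airyK_bound eta0.
pose c := s * (dl + 2 * eta); have cp : 0 < c := c0.
pose B p q := C * airyK_const a c * (2 / c) * p`!%:R * q`!%:R * expR (- eta * (u + v - 2)).
have ac0 : 0 <= airyK_const a c by rewrite /airyK_const mulr_ge0 // exprn_ge0 // mulr_ge0 // invr_ge0 ltW.
have c20 : 0 <= 2 / c by rewrite mulr_ge0 // invr_ge0 ltW.
have B0 p' q' : 0 <= B p' q' by do ! (apply: mulr_ge0 => //); exact: expR_ge0.
have HB p' q' u' v' : `|u' - u| <= 1 -> `|v' - v| <= 1 -> `|airyK s a p' q' dl u' v'| <= B p' q'.
  move=> hu hv; apply: le_trans (HC s a p' q' c dl u' v' ss cp _) _; first by [].
  rewrite /B ler_wpM2l //; first by do ! (apply: mulr_ge0 => //).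
  rewrite ler_expR !mulNr lerN2 ler_pM2l //.
  by move: hu hv; rewrite !ler_distl => /andP[? ?] /andP[? ?]; lra.
pose BB := B p.+1 q + B p q.+1 + 1.
have BB0 : 0 < BB by rewrite /BB ltr_wpDl // addr_ge0.
have lip u' v' : `|u' - u| <= 1 -> `|v' - v| <= 1 ->
  `|airyK s a p q dl u' v' - airyK s a p q dl u v| <= BB * (`|u' - u| + `|v' - v|).
  move=> hu hv; set du := u' - u in hu *; set dv := v' - v in hv *.
  pose f t := airyK s a p q dl (u + t * du) (v + t * dv).
  pose f' t := du * airyK s a p.+1 q dl (u + t * du) (v + t * dv) + dv * airyK s a p q.+1 dl (u + t * du) (v + t * dv).
  have df (t : R) : is_derive t 1 f (f' t).
    have D := @airyK_derive R s a p q dl (u + t * du) (v + t * dv) 0 du dv ok.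
    have Ds : is_derive t 1 (fun x : R => x - t) 1.
      by apply: (drv_eq (drvD (drv_id _) (drv_cst (- t) _))); rewrite addr0.
    have D' : is_derive (t - t : R) 1 (fun t0 => airyK s a p q dl (u + t * du + t0 * du) (v + t * dv + t0 * dv)) (f' t).
      rewrite subrr; apply: (drv_eq (drv_ext _ D)); last by rewrite /f' oppr0 mul0r add0r.
      by move=> x; rewrite mulr0 addr0.
    apply: (drv_eq (drv_ext _ (drv_comp Ds D'))); last by rewrite mulr1.
    by move=> x; rewrite /f -!addrA -!mulrDl [t + _]addrC subrK.
  have fB (t : R) : `|t| <= `|1 : R| -> `|f' t| <= BB * (`|du| + `|dv|).
    rewrite normr1 => t1.
    have n1 (w : R) : `|w| <= 1 -> `|t * w| <= 1.
      by move=> w1; rewrite normrM -[leRHS]mulr1 ler_pM.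
    have E w x : w + t * x - w = t * x :> R by ring.
    have h1 := HB p.+1 q (u + t * du) (v + t * dv); have h2 := HB p q.+1 (u + t * du) (v + t * dv).
    have {}h1 := h1 (eq_ind_r (fun z => `|z| <= 1) (n1 _ hu) (E u du)) (eq_ind_r (fun z => `|z| <= 1) (n1 _ hv) (E v dv)).
    have {}h2 := h2 (eq_ind_r (fun z => `|z| <= 1) (n1 _ hu) (E u du)) (eq_ind_r (fun z => `|z| <= 1) (n1 _ hv) (E v dv)).
    rewrite mulrDr (le_trans (ler_normD _ _)) // lerD // normrM mulrC ler_wpM2r // /BB.
      by rewrite (le_trans h1) // -addrA lerDl addr_ge0.
    by rewrite (le_trans h2) // [B p.+1 q + _]addrC -addrA lerDl addr_ge0.
  have := mvt_bound (fun t _ => df t) fB.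
  rewrite normr1 mulr1 /f !mul0r !mul1r !addr0.
  have -> : u + du = u' by rewrite /du addrC subrK.
  by have -> : v + dv = v' by rewrite /dv addrC subrK.
apply/cvgrPdist_le => e e0; have e2 : 0 < Num.min 1 (e / (2 * BB)) by rewrite lt_min ltr01 divr_gt0 // mulr_gt0.
near=> N.
have hu : `|us N - u| <= Num.min 1 (e / (2 * BB)).
  by near: N; move/cvgrPdist_le: cu => /(_ _ e2); apply: filterS => N; rewrite distrC.
have hv : `|vs N - v| <= Num.min 1 (e / (2 * BB)).
  by near: N; move/cvgrPdist_le: cv => /(_ _ e2); apply: filterS => N; rewrite distrC.
move: hu hv; rewrite !le_min => /andP[u1 u2] /andP[v1 v2].
rewrite distrC (le_trans (lip _ _ u1 v1)) //.
have := lerD u2 v2; have -> : e / (2 * BB) + e / (2 * BB) = e / BB by field; rewrite gt_eqF.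
by rewrite ler_pdivlMr // mulrC.
Unshelve. all: by end_near.
Qed.

Context (n : nat).
Notation V := (space (R := R) n).

Definition sgn_mx (y : 'I_n -> R) (a b : 'I_n) : R := if y b <= y a then 1 else -1.

(** Kappa does not occur: it is a parameter of the approximation only. *)
Definition fredholm_airy (x : V) : R :=
  fredholm_det (fun i => rc i x) (fun i u j v => ext_airy_kernel (yc i x) u (yc j x) v).

Lemma det_entry_cvg (x : V) eta c : 0 < eta -> 0 < c -> 0 < kc x ->
  (forall a b, c <= sgn_mx (fun i => yc i x) a b * (yc a x - yc b x + 2 * eta)) ->
  \det (entry_mx (N.+1 ^ 2) N (sgn_mx (fun i => yc i x)) x) @[N --> \oo] --> fredholm_airy x.
Proof.
move=> eta0 c0 kx cs.
have ss a b : sgn_mx (fun i => yc i x) a b * sgn_mx (fun i => yc i x) a b = 1.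
  by rewrite /sgn_mx; case: ifP => _; rewrite ?mulrNN mulr1.
have [C C0 HC] := airyK_bound eta0.
have := @fredholm_discrete R n (fun i => rc i x) (fun i u j v => ext_airy_kernel (yc i x) u (yc j x) v)
  eta (C * airyK_const 0 c * (2 / c)) (kc x) eta0 kx _ _ _.
have -> : (fun N => \det (1%:M + (- mesh (kc x) N) *: grid_kernel (fun i => rc i x) (mesh (kc x) N) (N.+1 ^ 2)
     (fun i u j v => ext_airy_kernel (yc i x) u (yc j x) v))) =
  (fun N => \det (entry_mx (N.+1 ^ 2) N (sgn_mx (fun i => yc i x)) x)).
  apply/funext => N; congr (\det (_ + _ *: _)); apply/matrixP => a b; rewrite !mxE.
  by cbv zeta; rewrite ext_airy_kernelE.
apply.
- by rewrite /airyK_const expr0 mulr1 !mulr_ge0 // invr_ge0 ltW.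
- move=> i u j v _ _; rewrite ext_airy_kernelE -/(sgn_mx (fun i => yc i x) i j).
  apply: le_trans (HC _ 0%N 0%N 0%N c _ u v (ss i j) c0 (cs i j)) _.
  by rewrite !mulr1 -expRD -mulrDr.
- move=> i j u v us vs cu cv; rewrite ext_airy_kernelE.
  under eq_fun do rewrite ext_airy_kernelE.
  apply: airyK_cvg => //; split; first exact: ss.
  by exists eta => //; apply: lt_le_trans (cs i j).
Qed.
End EntryLimit.


Lemma finite_lower_bound (R : realType) (J : finType) (f : J -> R) : (forall j, 0 < f j) ->
  exists2 e : R, 0 < e & forall j, e <= f j.
Proof.
move=> f0; exists (\big[Num.min/1]_j f j).
  by elim/big_ind: _ => // x y x0 y0; rewrite lt_min x0 y0.
by move=> j; rewrite (bigD1 j) //= ge_min lexx.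
Qed.

Section Cube.
Context {R : realType} (n : nat).
Notation V := (space (R := R) n).
Implicit Types (x w : V) (i j : coord n) (e : R).

Definition cc i x : R := match i with
  | Some (inl a) => yc a x | Some (inr a) => rc a x | None => kc x end.

Lemma ccE i x (t : R) w : cc i (x + t *: w) = cc i x + t * cc i w.
Proof. by case: i => [[a|a]|] /=; rewrite ?ycE ?rcE ?kcE. Qed.

Lemma cc_dir i j : cc i (dir j) = (j == i)%:R.
Proof. by case: i => [[a|a]|] /=; rewrite ?yc_dir ?rc_dir ?kc_dir. Qed.

Lemma cc_inj x w : (forall i, cc i x = cc i w) -> x = w.
Proof.
case: x w => [[y r] k] [[y' r'] k'] H; congr (_, _, _).
- by apply/rowP => a; have := H (Some (inl a)).
- by apply/rowP => a; have := H (Some (inr a)).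
- exact: H None.
Qed.

Definition cube x0 e x := forall i, `|cc i x - cc i x0| < e.

Lemma cube_center x0 e : 0 < e -> cube x0 e x0.
Proof. by move=> e0 i; rewrite subrr normr0. Qed.

Lemma cube_sub x0 e e' x : e <= e' -> cube x0 e x -> cube x0 e' x.
Proof. by move=> ee xe i; apply: lt_le_trans (xe i) ee. Qed.

Lemma cube_recenter x0 e x : cube x0 e x -> exists2 e', 0 < e' & forall x', cube x e' x' -> cube x0 e x'.
Proof.
move=> xe; have [|d d0 H] := @finite_lower_bound R _ (fun i => e - `|cc i x - cc i x0|).
  by move=> i; rewrite subr_gt0.
exists d => // x' xx' i; have := xx' i; have := H i.
have := ler_normD (cc i x' - cc i x) (cc i x - cc i x0); rewrite addrA subrK.
by move: (`| _ |) (`| _ |) (`| _ |) => p q r; lra.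
Qed.

Lemma cube_plane_open (I : finType) (v : I -> V) x0 e : (forall (i : I) j, `|cc j (v i)| <= 1) ->
  plane_open v (cube x0 e).
Proof.
move=> v1 x i j xe; have [d d0 H] := cube_recenter xe.
exists (d / 2); first by rewrite divr_gt0.
move=> s t sd td; apply: H => k; rewrite !ccE.
have -> : cc k x + s * cc k (v i) + t * cc k (v j) - cc k x = s * cc k (v i) + t * cc k (v j) by ring.
apply: le_lt_trans (ler_normD _ _) _; rewrite !normrM.
have := ler_wpM2l (normr_ge0 s) (v1 i k); have := ler_wpM2l (normr_ge0 t) (v1 j k).
by move: (`|s| * _) (`|t| * _) => p q; move: sd td; move: (`|s|) (`|t|) => S T; lra.
Qed.

Lemma plane_line_open (I : finType) (v : I -> V) U : plane_open v U -> line_open v U.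
Proof.
move=> po x i Ux; have [e e0 H] := po x i i Ux.
apply/nbhs_ballP; exists e => // t; rewrite /ball /= sub0r normrN => te.
by have := H t 0 te; rewrite normr0 scale0r addr0; apply.
Qed.

Lemma dir_cc1 i j : `|cc j (dir i : V)| <= 1.
Proof. by rewrite cc_dir; case: (i == j); rewrite ?normr1 ?normr0. Qed.

(** The coordinates are changed one at a time, and the intermediate points stay in the cube. *)
Lemma cube_mean_value q b (F : V -> R) x0 e x : smooth_bound (@dir R n) q.+1 (cube x0 e) b F -> 0 < e ->
  cube x0 e x -> `|F x - F x0| <= b 1%N * \sum_i `|cc i x - cc i x0|.
Proof.
move=> sb e0 xe; pose d i := cc i x - cc i x0.
pose p (l : seq (coord n)) : V := x0 + \sum_(i <- l) d i *: dir i.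
have ccp l j : uniq l -> cc j (p l) - cc j x0 = if j \in l then d j else 0.
  elim: l => [|i l IH]; first by rewrite /p big_nil addr0 subrr.
  rewrite cons_uniq => /andP[il ul].
  have -> : p (i :: l) = p l + d i *: dir i by rewrite /p big_cons addrCA addrC.
  rewrite ccE cc_dir addrAC IH // in_cons [i == j]eq_sym.
  case: (eqVneq j i) => [->|_] /=; first by rewrite (negbTE il) add0r mulr1.
  by rewrite mulr0 addr0.
have H l : uniq l -> `|F (p l) - F x0| <= b 1%N * \sum_(i <- l) `|d i|.
  elim: l => [|i l IH]; first by rewrite /p !big_nil addr0 subrr normr0 mulr0.
  rewrite cons_uniq => /andP[il ul].
  have -> : p (i :: l) = p l + d i *: dir i by rewrite /p big_cons addrCA addrC.
  have inU (s : R) : `|s| <= `|d i| -> cube x0 e (p l + s *: dir i).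
    move=> sd j; rewrite ccE cc_dir addrAC ccp // [i == j]eq_sym.
    case: (eqVneq j i) => [->|_]; first by rewrite (negbTE il) add0r mulr1 (le_lt_trans sd) // xe.
    by rewrite mulr0 addr0; case: ifP => _; rewrite ?normr0 // xe.
  move: sb => /= [_ /(_ i)[G dG sG]].
  have := @mvt_bound R (fun s => F (p l + s *: dir i)) (fun s => G (p l + s *: dir i)) (b 1%N) (d i).
  have drv (s : R) : `|s| <= `|d i| -> is_derive s 1 (fun s0 : R => F (p l + s0 *: dir i)) (G (p l + s *: dir i)).
    by move=> sd; have /(@is_ld_at _ _ (dir i) F (p l) s) := dG _ (inU s sd).
  move=> /(_ drv); have bd (s : R) : `|s| <= `|d i| -> `|G (p l + s *: dir i)| <= b 1%N.
    by move=> sd; exact: (smooth_bound_lt0 (inU s sd) sG).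
  move=> /(_ bd); rewrite scale0r addr0 big_cons mulrDr => h.
  have -> : F (p l + d i *: dir i) - F x0 = (F (p l + d i *: dir i) - F (p l)) + (F (p l) - F x0) by ring.
  by rewrite (le_trans (ler_normD _ _)) // lerD // IH.
have xE : x = p (index_enum (coord n)).
  apply: cc_inj => j; have := ccp _ j (index_enum_uniq _); rewrite mem_index_enum /d => E.
  by apply: (addIr (- cc j x0)).
by have := H _ (index_enum_uniq _); rewrite -xE.
Qed.
End Cube.

(** * Local convergence of the approximations *)

Section LocalLimit.
Context {R : realType} (n : nat).
Notation V := (space (R := R) n).
Implicit Types (x w : V).

Definition distinct x := forall a b : 'I_n, a != b -> yc a x != yc b x.

Lemma gap_bound x0 : distinct x0 -> exists2 e : R, 0 < e <= 4^-1 & exists2 eta : R, 0 < eta & exists2 c : R, 0 < c &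
  forall x a b, cube x0 e x -> sgn_mx (fun i => yc i x) a b = sgn_mx (fun i => yc i x0) a b /\
    c <= sgn_mx (fun i => yc i x0) a b * (yc a x - yc b x + 2 * eta).
Proof.
move=> inj.
have [|g g0 H] := @finite_lower_bound R ('I_n * 'I_n)%type
   (fun p => if p.1 == p.2 then 1 else `|yc p.1 x0 - yc p.2 x0|).
  by case=> a b /=; case: eqVneq => // /inj; rewrite normr_gt0 subr_eq0.
(* Differences of times move by less than g / 8, so distinct times keep their order and a distance
   above 7 g / 8. With eta = g / 8 the rate s (dl + 2 eta) exceeds 5 g / 8 for distinct indices and
   equals g / 4 for equal ones. The bound 1 / 4 keeps kappa between 1 / 2 and 2 around the value
   1. *)
exists (Num.min 4^-1 (g / 16)).
  rewrite lt_min ge_min lexx /= andbT; apply/andP; split; lra.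
exists (g / 8); first by lra.
exists (g / 4); first by lra.
move=> x a b xe; have := H (a, b) => /=.
have := xe (Some (inl a)); have := xe (Some (inl b)).
rewrite /= !lt_min => /andP[_ h1] /andP[_ h2].
case: eqVneq => [->|_]; first by rewrite /sgn_mx !lexx subrr => _; split=> //; lra.
move=> gab; move: h1 h2; rewrite !ltr_distl => /andP[h1 h2] /andP[h3 h4].
rewrite /sgn_mx; case: (leP (yc b x0) (yc a x0)) gab => h0.
  rewrite ger0_norm ?subr_ge0 // => gab; have -> : yc b x <= yc a x by lra.
  by split => //; lra.
rewrite ltr0_norm ?subr_lt0 // => gab; have -> : (yc b x <= yc a x) = false by apply/negbTE; rewrite -ltNge; lra.
by split => //; lra.
Qed.

Definition det_approx N x : R := \det (entry_mx (N.+1 ^ 2) N (sgn_mx (fun i => yc i x)) x).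

Lemma growth_decay0 (eta : R) Q : growth_decay eta 0 1 (eta / 2) Q.
Proof.
move=> t k t0 _; rewrite mul0r addr0 expr1n !mul1r ler_expR.
by rewrite !mulNr lerN2 mulrAC mulrA.
Qed.

Lemma growth_decay1 (eta : R) Q : 0 < eta ->
  growth_decay eta 1 (Q`!%:R * (4 / eta) ^+ Q * expR (eta / 4)) (eta / 4) Q.
Proof.
move=> e0 t k t0 kQ; rewrite mul1r.
have h : (1 + t) ^+ k <= Q`!%:R * (4 / eta) ^+ Q * expR (eta / 4) * expR (eta / 4 * t).
  apply: le_trans (_ : (1 + t) ^+ Q <= _); first by rewrite ler_weXn2l //; lra.
  have z0 : 0 <= eta / 4 * (1 + t) by rewrite mulr_ge0 //; lra.
  have := expR_ge_pow Q z0.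
  have p0 : 0 < (4 / eta) ^+ Q by rewrite exprn_gt0 // divr_gt0.
  move=> /(ler_wpM2l (ltW p0)).
  have -> : (4 / eta) ^+ Q * (eta / 4 * (1 + t)) ^+ Q = (1 + t) ^+ Q.
    by rewrite -exprMn; congr (_ ^+ Q); field; rewrite gt_eqF.
  by move=> /le_trans; apply; rewrite mulrDr mulr1 expRD !mulrA [Q`!%:R * _]mulrC.
apply: le_trans (ler_wpM2r (expR_ge0 _) h) _.
rewrite -[leLHS]mulrA -expRD; have -> : eta / 4 * t + - eta * (t / 2) = - (eta / 4) * t by field.
by [].
Qed.

(* Derivatives in directions that do not move the mesh parameter are bounded as for an analytic function. *)
Lemma local_limit x0 : distinct x0 -> kc x0 = 1 -> exists2 e : R, 0 < e &
  [/\ forall Q, exists b, forall N, smooth_bound (@dir R n) Q (cube x0 e) b (det_approx N),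
      forall (I : finType) (v : I -> V), (forall i j, `|cc j (v i)| <= 1) -> (forall i, kc (v i) = 0) ->
        exists2 S, 0 <= S & exists2 rho, 0 <= rho & forall Q N,
        smooth_bound v Q (cube x0 e) (fun k => S * k`!%:R * rho ^+ k) (det_approx N),
      forall x a b, cube x0 e x -> sgn_mx (fun i => yc i x) a b = sgn_mx (fun i => yc i x0) a b /\
        airyK_ok (sgn_mx (fun i => yc i x0) a b) (yc a x - yc b x)
    & forall x, cube x0 e x -> det_approx N x @[N --> \oo] --> fredholm_airy x].
Proof.
move=> inj k1; have [e /andP[e0 e4] [eta eta0 [c c0 H]]] := gap_bound inj.
have kx x : cube x0 e x -> 2^-1 <= kc x <= 2.
  by move=> /(_ None); rewrite /= k1 ltr_distl => /andP[? ?]; apply/andP; split; lra.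
pose s := sgn_mx (fun i => yc i x0).
have sU x a b : cube x0 e x -> s a b * s a b = 1 /\ c <= s a b * (yc a x - yc b x + 2 * eta).
  move=> xe; split; last by case: (H x a b xe).
  by rewrite /s /sgn_mx; case: ifP; rewrite ?mulrNN mulr1.
have rU x a : cube x0 e x -> rc a x0 - 1 <= rc a x.
  by move=> /(_ (Some (inr a))); rewrite /= ltr_distl => /andP[? ?]; lra.
have dE x N : cube x0 e x -> \det (entry_mx (N.+1 ^ 2) N s x) = det_approx N x.
  move=> xe; suff -> : s = sgn_mx (fun i => yc i x) by [].
  by apply/funext => a; apply/funext => b; case: (H x a b xe).
have lo (I : finType) (v : I -> V) : (forall i j, `|cc j (v i)| <= 1) -> line_open v (cube x0 e).
  by move=> v1; apply: plane_line_open; exact: cube_plane_open.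
exists e => //; split.
- move=> Q; have dl := lo _ _ (@dir_cc1 R n).
  have W0 : 0 < Q`!%:R * (4 / eta) ^+ Q * expR (eta / 4).
    by rewrite !mulr_gt0 ?expR_gt0 ?exprn_gt0 ?divr_gt0 // ltr0n fact_gt0.
  have [|S S0 [rho rho0 D]] := det_entry_smooth eta0 c0 _ dl sU rU kx
    (fun i a => @dir_cc1 R n i (Some (inl a))) (fun i a => @dir_cc1 R n i (Some (inr a)))
    (fun i => @dir_cc1 R n i None) W0 (divr_gt0 eta0 (ltr0n _ 4)); first by rewrite ler01 lexx.
  exists (fun k => S * k`!%:R * rho ^+ k) => N.
  have h := D Q (@growth_decay1 eta Q eta0) N (N.+1 ^ 2)%N; exact: (smooth_bound_ext dl (fun x xe => dE x N xe) h).
- move=> I v v1 vk; have dl := lo _ _ v1.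
  have [|i|S S0 [rho rho0 D]] := det_entry_smooth (kap1 := 0) eta0 c0 _ dl sU rU kx
    (fun i a => v1 i (Some (inl a))) (fun i a => v1 i (Some (inr a)))
    _ ltr01 (divr_gt0 eta0 (ltr0n _ 2)); [by rewrite ler01 lexx|by rewrite vk normr0|].
  exists S => //; exists rho => // Q N.
  have h := D Q (@growth_decay0 eta Q) N (N.+1 ^ 2)%N; exact: (smooth_bound_ext dl (fun x xe => dE x N xe) h).
- move=> x a b xe; split; first by case: (H x a b xe).
  by have [ss cs] := sU x a b xe; split=> //; exists eta => //; exact: lt_le_trans cs.
- move=> x xe; rewrite /det_approx; apply: (det_entry_cvg eta0 c0).
    by have /andP[+ _] := kx x xe; apply: lt_le_trans; rewrite invr_gt0.
  by move=> a b; have [-> ?] := H x a b xe.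
Qed.
End LocalLimit.


Section SmoothFamilies.
Context {R : realType} {V : lmodType R} {I : finType} (v : I -> V) (U : V -> Prop).
Hypothesis lo : line_open v U.

Lemma unif_smoothD (J : Type) q (F G : J -> V -> R) : unif_smooth v q U F -> unif_smooth v q U G ->
  unif_smooth v q U (fun j x => F j x + G j x).
Proof. by move=> [b Fb] [b' Gb]; eexists => j; exact: smooth_boundD (Fb j) (Gb j). Qed.

Lemma unif_smoothM (J : Type) q (F G : J -> V -> R) : unif_smooth v q U F -> unif_smooth v q U G ->
  unif_smooth v q U (fun j x => F j x * G j x).
Proof. by move=> [b Fb] [b' Gb]; eexists => j; exact: smooth_boundM (Fb j) (Gb j). Qed.

Lemma unif_smooth_cst (J : Type) q k : unif_smooth v q U (fun (_ : J) _ => k).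
Proof. by eexists => j; exact: smooth_bound_cst. Qed.

Lemma unif_smooth_sum (J : Type) (K : finType) q (F : K -> J -> V -> R) :
  (forall k, unif_smooth v q U (F k)) -> unif_smooth v q U (fun j x => \sum_k F k j x).
Proof.
move=> H; have [b Hb] := choice H; exists (fun n => \sum_k b k n) => j.
exact: (smooth_bound_sum (index_enum K) (P := xpredT) (fun k _ => Hb k j)).
Qed.

(** A constant sequence, so that the closure properties of [unif_smooth] apply. *)
Definition smooth (F : V -> R) := forall q, unif_smooth v q U (fun _ : nat => F).

Lemma smooth_diffb F : smooth F -> diffb v U F.
Proof. by move=> /(_ 1)[b /(_ 0)Fb] x i Ux; have [H _] := smooth_bound_ld i lo Fb; exact: H. Qed.

Lemma smooth_ld F i : smooth F -> smooth (ld (v i) F).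
Proof. by move=> sF q; have [b Fb] := sF q.+1; eexists => j; exact: (smooth_bound_ld i lo (Fb j)).2. Qed.

Lemma smoothD F G : smooth F -> smooth G -> smooth (fun x => F x + G x).
Proof. by move=> sF sG q; exact: unif_smoothD. Qed.
Lemma smoothM F G : smooth F -> smooth G -> smooth (fun x => F x * G x).
Proof. by move=> sF sG q; exact: unif_smoothM. Qed.
Lemma smooth_cst k : smooth (fun=> k).
Proof. by move=> q; exact: unif_smooth_cst. Qed.
Lemma smooth_sum (K : finType) (F : K -> V -> R) : (forall k, smooth (F k)) -> smooth (fun x => \sum_k F k x).
Proof. by move=> H q; apply: unif_smooth_sum => k; exact: H. Qed.
Lemma smooth_vop c F : (forall i, smooth (c i)) -> smooth F -> smooth (vop v c F).
Proof. by move=> sc sF; apply: smooth_sum => i; apply: smoothM => //; exact: smooth_ld. Qed.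

Lemma smooth_swap F i j x : plane_open v U -> smooth F -> U x ->
  ld (v i) (ld (v j) F) x = ld (v j) (ld (v i) F) x.
Proof. by move=> po sF Ux; have [b /(_ 0)Fb] := sF 3; exact: (schwarz i j lo po Fb Ux). Qed.

Definition smooth_cvg (F : nat -> V -> R) (F0 : V -> R) :=
  (forall q, unif_smooth v q U F) /\ forall x, U x -> F N x @[N --> \oo] --> F0 x.

Lemma smooth_cvg_cst F : smooth F -> smooth_cvg (fun=> F) F.
Proof. by split=> // x _; exact: cvg_cst. Qed.

Lemma smooth_cvg_limit F F0 : smooth_cvg F F0 -> smooth F0.
Proof.
by move=> [sF cF] q; have [b Fb] := sF q.+1; exists b => _; exact: smooth_bound_limit lo Fb cF.
Qed.

Lemma smooth_cvg_ld F F0 i : smooth_cvg F F0 -> smooth_cvg (fun N => ld (v i) (F N)) (ld (v i) F0).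
Proof.
move=> [sF cF]; split=> [q|x Ux].
  by have [b Fb] := sF q.+1; eexists => j; exact: (smooth_bound_ld i lo (Fb j)).2.
by have [b Fb] := sF 2; exact: (smooth_cvg_derive i lo Fb cF Ux).2.
Qed.

Lemma smooth_cvgD F F0 G G0 : smooth_cvg F F0 -> smooth_cvg G G0 ->
  smooth_cvg (fun N x => F N x + G N x) (fun x => F0 x + G0 x).
Proof.
move=> [sF cF] [sG cG]; split=> [q|x Ux]; first exact: unif_smoothD.
by apply: cvgD; [exact: cF|exact: cG].
Qed.

Lemma smooth_cvgM F F0 G G0 : smooth_cvg F F0 -> smooth_cvg G G0 ->
  smooth_cvg (fun N x => F N x * G N x) (fun x => F0 x * G0 x).
Proof.
move=> [sF cF] [sG cG]; split=> [q|x Ux]; first exact: unif_smoothM.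
by apply: cvgM; [exact: cF|exact: cG].
Qed.

Lemma smooth_cvg_sum (K : finType) (F : K -> nat -> V -> R) F0 : (forall k, smooth_cvg (F k) (F0 k)) ->
  smooth_cvg (fun N x => \sum_k F k N x) (fun x => \sum_k F0 k x).
Proof.
move=> H; split=> [q|x Ux]; first by apply: unif_smooth_sum => k; case: (H k).
by apply: cvgn_sum => k; have [_] := H k; apply.
Qed.

Lemma smooth_cvg_vop c F F0 : (forall i, smooth (c i)) -> smooth_cvg F F0 ->
  smooth_cvg (fun N => vop v c (F N)) (vop v c F0).
Proof.
move=> sc cF; apply: (smooth_cvg_sum (F := fun i N x => c i x * ld (v i) (F N) x)
  (F0 := fun i x => c i x * ld (v i) F0 x)) => i.
by apply: smooth_cvgM; [exact: smooth_cvg_cst|exact: smooth_cvg_ld].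
Qed.

End SmoothFamilies.

Section LimitEquation.
Context {R : realType} (n : nat).
Notation V := (space (R := R) n).
Notation vop := (vop (@dir R n)).
Implicit Types (x w : V).

Lemma smooth_cc x0 e i : smooth (@dir R n) (cube x0 e) (cc i).
Proof.
have lo : line_open (@dir R n) (cube x0 e) by apply: plane_line_open; exact: cube_plane_open (@dir_cc1 R n).
have L j x : is_ld (dir j) (cc i) x (j == i)%:R.
  apply: (@drv_ext R (fun t => cc i x + t * cc i (dir j))); first by move=> t; rewrite ccE.
  apply: (drv_eq (drvD (drv_cst _ _) (drvM (drv_id _) (drv_cst _ _)))).
  by rewrite mulr0 addr0 add0r mul1r cc_dir.
case=> [|q]; last first.
  apply: (unif_smooth_intro (C := `|cc i x0| + e)) => [_ x xe|j]; last first.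
    by exists (fun _ _ => (j == i)%:R) => [_ x _|]; [exact: L|exact: unif_smooth_cst].
  rewrite -[cc i x](subrK (cc i x0)) addrC (le_trans (ler_normD _ _)) // lerD2l ltW //; exact: xe.
exists (fun=> `|cc i x0| + e) => _; split=> // x xe.
rewrite -[cc i x](subrK (cc i x0)) addrC (le_trans (ler_normD _ _)) // lerD2l ltW //; exact: xe.
Qed.

Lemma smooth_coefs x0 e : let sm := smooth (@dir R n) (cube x0 e) in
  [/\ forall i, sm (@cD R n i), forall i, sm (@cX R n i), forall i, sm (@cT R n i) & forall i, sm (@cY R n i)].
Proof.
have C := @smooth_cst R V _ (@dir R n) (cube x0 e).
have L i := @smooth_cc x0 e i.
split=> -[[a|a]|]; rewrite /cD /cX /cT /cY; try exact: C.
- by apply: smoothM (L (Some (inl a))); exact: C.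
- by apply: smoothM (L (Some (inl a))); exact: C.
- have := smoothD (smoothM (C (- 3^-1)) (L (Some (inr a))))
    (smoothM (C (-1)) (smoothM (L (Some (inl a))) (L (Some (inl a))))).
  move=> H q; have [b Hb] := H q; exists b => j.
  apply: (smooth_bound_ext _ _ (Hb j)); first by apply: plane_line_open; exact: cube_plane_open (@dir_cc1 R n).
  by move=> x _ /=; rewrite expr2; ring.
- have := smoothM (C (- 3^-1)) (L None).
  move=> H q; have [b Hb] := H q; exists b => j.
  apply: (smooth_bound_ext _ _ (Hb j)); first by apply: plane_line_open; exact: cube_plane_open (@dir_cc1 R n).
  by move=> x _ /=; ring.
Qed.

Definition log_fredholm x : R := ln (fredholm_airy x).

Definition kp_form (phi : V -> R) x : R := vop (@cD R n) (vop (@cT R n) phi) x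
  + 2^-1 * vop (@cD R n) (vop (@cD R n) phi) x ^+ 2
  + 12^-1 * vop (@cD R n) (vop (@cD R n) (vop (@cD R n) (vop (@cD R n) phi))) x
  + 4^-1 * vop (@cX R n) (vop (@cX R n) phi) x.

Lemma kp_form_cvg x0 e (phi : nat -> V -> R) (phi0 : V -> R) x :
  smooth_cvg (@dir R n) (cube x0 e) phi phi0 -> cube x0 e x ->
  kp_form (phi N) x @[N --> \oo] --> kp_form phi0 x.
Proof.
move=> cphi xe; have [scD scX scT _] := smooth_coefs x0 e.
have lo : line_open (@dir R n) (cube x0 e) by apply: plane_line_open; exact: cube_plane_open (@dir_cc1 R n).
have cV c G G0 := @smooth_cvg_vop R V _ (@dir R n) (cube x0 e) lo c G G0.
have C k : smooth_cvg (@dir R n) (cube x0 e) (fun _ _ => k) (fun=> k) by apply: smooth_cvg_cst; exact: smooth_cst.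
have DT := cV _ _ _ scD (cV _ _ _ scT cphi); have DD := cV _ _ _ scD (cV _ _ _ scD cphi).
have DDDD := cV _ _ _ scD (cV _ _ _ scD DD); have XX := cV _ _ _ scX (cV _ _ _ scX cphi).
have [_ /(_ x xe)] := smooth_cvgD (smooth_cvgD (smooth_cvgD DT (smooth_cvgM (C 2^-1) (smooth_cvgM DD DD)))
    (smooth_cvgM (C 12^-1) DDDD)) (smooth_cvgM (C 4^-1) XX).
rewrite /kp_form; under [in X in _ -> X]eq_fun do rewrite expr2.
by rewrite expr2.
Qed.

Lemma cvgn_eq0 (u : nat -> R) l : (forall N, u N = 0) -> u N @[N --> \oo] --> l -> l = 0.
Proof.
move=> u0 cu; rewrite -(cvg_lim (@Rhausdorff R) cu).
by rewrite (_ : (fun N => u N) = fun=> 0) ?lim_cst //; apply/funext => N; rewrite u0.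
Qed.

Lemma log_limit x0 : distinct x0 -> kc x0 = 1 -> 0 < fredholm_airy x0 -> exists2 e : R, 0 < e &
  [/\ smooth (@dir R n) (cube x0 e) log_fredholm,
    forall x, cube x0 e x -> 0 < fredholm_airy x,
    forall x, cube x0 e x -> kp_form log_fredholm x = 0
    & forall x, cube x0 e x -> vop (@cY R n) log_fredholm x = 0].
Proof.
have ar (p q r z : R) : r / 2 <= q -> - (p - q) <= z -> z <= r / 4 -> r / 4 <= p by move=> *; lra.
move=> dist k1 pos; have [e1 e10 [sm _ sgnE cv]] := local_limit dist k1.
have [b Hb] := sm 1.
pose f := fredholm_airy x0.
(* In a cube of radius f / (4 B) each approximation varies by at most f / 4. From the index [N0] on
   they are at least f / 2 at the centre, hence at least f / 4 in the whole cube, and their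
   logarithms are uniformly smooth. *)
pose B := `|b 1%N| * #|coord n|%:R + 1.
have B0 : 0 < B by rewrite /B ltr_wpDl // mulr_ge0.
pose e := Num.min e1 (f / (4 * B)).
have e0 : 0 < e by rewrite lt_min e10 divr_gt0 // mulr_gt0.
have ee1 : e <= e1 by rewrite ge_min lexx.
have eB : e <= f / (4 * B) by rewrite ge_min lexx orbT.
have f2 : f / 2 < f by rewrite ltr_pdivrMr //; move: pos; rewrite -/f; lra.
have [N0 _ HN0] : \forall N \near \oo, f / 2 <= det_approx N x0.
  by apply: (cvgr_ge _ (cv x0 (cube_center x0 e10))).
have sub x : cube x0 e x -> cube x0 e1 x by exact: cube_sub.
pose s := sgn_mx (fun i => yc i x0).
pose F N x := \det (entry_mx ((N + N0).+1 ^ 2) (N + N0) s x).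
have FE N x : cube x0 e x -> det_approx (N + N0) x = F N x.
  move=> xe; rewrite /F; suff -> : s = sgn_mx (fun i => yc i x) by [].
  by apply/funext => i; apply/funext => j; case: (sgnE x i j (sub x xe)).
have sOK x i j : cube x0 e x -> airyK_ok (s i j) (yc i x - yc j x) by move=> /sub /sgnE H; case: (H i j).
have lo : line_open (@dir R n) (cube x0 e) by apply: plane_line_open; exact: cube_plane_open (@dir_cc1 R n).
have f4 : 0 < f / 4 by rewrite divr_gt0.
have low N x : cube x0 e x -> f / 4 <= F N x.
  move=> xe; have h1 := HN0 (N + N0)%N (leq_addl _ _).
  have h2 := cube_mean_value (Hb (N + N0)%N) e10 (sub _ xe).
  have h3 : b 1%N * (\sum_i `|cc i x - cc i x0|) <= f / 4.
    apply: le_trans (_ : `|b 1%N| * (\sum_i `|cc i x - cc i x0|) <= _).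
      by rewrite ler_wpM2r ?ler_norm // sumr_ge0.
    apply: le_trans (_ : `|b 1%N| * (#|coord n|%:R * e) <= _).
      rewrite ler_wpM2l // mulr_natl -sumr_const; apply: ler_sum => i _; exact/ltW/xe.
    apply: le_trans (_ : B * e <= _); first by rewrite mulrA /B mulrDl lerDl mul1r ltW.
    by move: eB; rewrite invfM mulrA ler_pdivlMr // mulrC.
  move: h1 h2 h3; rewrite -(FE N x xe); move=> h1 /ler_normlP[h2 _]; exact: ar h1 h2.
have cF : smooth_cvg (@dir R n) (cube x0 e) F (@fredholm_airy R n).
  split=> [q|x xe].
    have [b' Hb'] := sm q; exists b' => N.
    apply: (smooth_bound_ext lo (FE N)).
    exact: (smooth_boundW sub (fun k _ => lexx _) (Hb' (N + N0)%N)).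
  have -> : (F ^~ x) = (fun N => det_approx (N + N0) x) by apply/funext => N; rewrite -FE.
  exact: (cvg_comp _ _ (cvg_addnr N0) (cv x (sub x xe))).
have posF x : cube x0 e x -> 0 < fredholm_airy x.
  move=> xe; apply: lt_le_trans f4 _; rewrite -(cvg_lim (@Rhausdorff R) (cF.2 x xe)).
  apply: limr_ge; first by apply/cvg_ex; exists (fredholm_airy x); exact: cF.2.
  by apply: nearW => N; exact: low.
pose phi N x := ln (F N x).
have cphi : smooth_cvg (@dir R n) (cube x0 e) phi log_fredholm.
  split=> [q|x xe]; first exact: unif_smooth_ln lo f4 low (cF.1 q).
  by apply: (continuous_cvg _ (continuous_ln (posF x xe))); exact: cF.2.
have [_ _ _ scY] := smooth_coefs x0 e.
have cV c G G0 := @smooth_cvg_vop R V _ (@dir R n) (cube x0 e) lo c G G0.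
exists e => //; split=> // [|x xe|x xe].
- by move=> q; have := @smooth_cvg_limit _ _ _ _ _ lo phi log_fredholm cphi q.
- apply: cvgn_eq0 (kp_form_cvg cphi xe) => N.
  apply: (entry_KP lo sOK _ xe) => y ye; exact: lt_le_trans f4 (low N y ye).
- have E0 : vop (@cY R n) (@fredholm_airy R n) x = 0.
    by apply: cvgn_eq0 ((cV _ _ _ scY cF).2 x xe) => N; exact: (entry_Y _ _ lo sOK xe).
  have dF := smooth_diffb lo (smooth_cvg_limit lo cF).
  transitivity (vop (@cY R n) (@fredholm_airy R n) x * (fredholm_airy x)^-1); last by rewrite E0 mul0r.
  rewrite /vop mulr_suml; apply: eq_bigr => i _; rewrite -mulrA; congr (_ * _).
  by apply: is_ldE; apply: is_ld_ln; [exact: posF|exact: dF].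
Qed.
End LimitEquation.


Section Commutation.
Context {R : realType} {V : lmodType R} {I : finType} (v : I -> V) (U : V -> Prop).
Hypothesis lo : line_open v U.
Hypothesis po : plane_open v U.
Notation smooth := (smooth v U).
Notation vop := (vop v).

Lemma vop_ld_comm (e : I -> R) (F : V -> R) i x : smooth F -> U x ->
  vop (fun i _ => e i) (ld (v i) F) x = ld (v i) (vop (fun i _ => e i) F) x.
Proof.
move=> sF Ux; apply/esym/is_ldE.
have H := @is_ld_sum R V (v i) I (index_enum I) (fun j y => e j * ld (v j) F y)
  (fun j => 0 * ld (v j) F x + e j * ld (v i) (ld (v j) F) x) x.
apply: is_ld_eq (H _) _ => [j|].
  by apply: is_ldM; [exact: is_ld_cst|exact: (smooth_diffb lo (smooth_ld lo j sF))].
by apply: eq_bigr => j _; rewrite mul0r add0r (smooth_swap lo j i po sF Ux).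
Qed.

(** Second derivatives cancel by Schwarz, so only the derivatives of the coefficients remain in the
    commutator. *)
Lemma vop_comm (e : I -> R) (c : I -> V -> R) (F : V -> R) x : (forall i, smooth (c i)) -> smooth F -> U x ->
  vop (fun i _ => e i) (vop c F) x =
  \sum_i vop (fun i _ => e i) (c i) x * ld (v i) F x + vop c (vop (fun i _ => e i) F) x.
Proof.
move=> sc sF Ux.
have [_ /(_ x Ux) ->] := isV_sum (fun i => isVM (isV_vop (fun i _ => e i) (smooth_diffb lo (sc i)))
  (isV_vop (fun i _ => e i) (smooth_diffb lo (smooth_ld lo i sF)))).
rewrite /= big_split /=; congr (_ + _).
by apply: eq_bigr => i _; rewrite vop_ld_comm.
Qed.
End Commutation.

Section CoordinateSums.
Context {R : realType} (n : nat).

Lemma sum_coord (f : coord n -> R) :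
  \sum_i f i = f None + (\sum_a f (Some (inl a)) + \sum_a f (Some (inr a))).
Proof.
rewrite (bigD1 None) //=; congr (_ + _); rewrite (reindex_omap Some id) /=; last by case.
by rewrite (eq_bigl xpredT) ?big_sumType // => i; rewrite eqxx.
Qed.

Definition dr a (F : space (R := R) n -> R) := ld (dir (Some (inr a))) F.
Definition dy a (F : space (R := R) n -> R) := ld (dir (Some (inl a))) F.
Definition drsum F (x : space (R := R) n) : R := \sum_a dr a F x.

Lemma vop_sum c F x : vop (@dir R n) c F x = c None x * ld (dir None) F x +
  (\sum_a c (Some (inl a)) x * dy a F x + \sum_a c (Some (inr a)) x * dr a F x).
Proof. exact: sum_coord. Qed.
End CoordinateSums.

Opaque vop ld.

(** * From the bilinear identity to the equation *)

Section LimitPDE.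
Context {R : realType} (n : nat).
Notation V := (space (R := R) n).
Notation vop := (vop (@dir R n)).
Implicit Types (x w : V) (F : V -> R).

Definition eD (i : coord n) : R := if i is Some (inr _) then 1 else 0.
Definition eY (i : coord n) : R := if i is Some (inl _) then 1 else 0.
(** X is the sum of Y, the translation of the times, and of 2 Z. As phi is invariant under Y, only Z
    and the commutator of Y and Z, which is D, are left in X X phi. *)
Definition cZ (i : coord n) x : R := if i is Some (inr a) then yc a x else 0.

Lemma cDE : @cD R n = (fun i _ => eD i).
Proof. by apply/funext => -[[a|a]|]. Qed.
Lemma cYE : @cY R n = (fun i _ => eY i).
Proof. by apply/funext => -[[a|a]|]. Qed.

Let sum_eq0 (f g : 'I_n -> R) : (forall a, f a = 0) -> \sum_a f a * g a = 0.
Proof. by move=> f0; apply: big1 => a _; rewrite f0 mul0r. Qed.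

Let sum_left (k l : R) (f1 f2 g1 g2 : 'I_n -> R) : k = 0 -> (forall a, f1 a = 0) ->
  k * l + (\sum_a f1 a * g1 a + \sum_a f2 a * g2 a) = \sum_a f2 a * g2 a.
Proof. by move=> -> f0; rewrite sum_eq0 // mul0r !add0r. Qed.

Let sum_right (k l : R) (f1 f2 g1 g2 : 'I_n -> R) : k = 0 -> (forall a, f2 a = 0) ->
  k * l + (\sum_a f1 a * g1 a + \sum_a f2 a * g2 a) = \sum_a f1 a * g1 a.
Proof. by move=> -> f0; rewrite [X in _ + (_ + X)]sum_eq0 // mul0r add0r addr0. Qed.

Lemma vop_r c F x : c None x = 0 -> (forall a, c (Some (inl a)) x = 0) ->
  vop c F x = \sum_a c (Some (inr a)) x * dr a F x.
Proof.
move=> c0 c1; rewrite vop_sum.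
exact: (sum_left _ (fun a => c (Some (inr a)) x) (fun a => dy a F x) (fun a => dr a F x) c0 c1).
Qed.

Lemma vop_y c F x : c None x = 0 -> (forall a, c (Some (inr a)) x = 0) ->
  vop c F x = \sum_a c (Some (inl a)) x * dy a F x.
Proof.
move=> c0 c1; rewrite vop_sum.
exact: (sum_right _ (fun a => c (Some (inl a)) x) (fun a => dy a F x) (fun a => dr a F x) c0 c1).
Qed.

Lemma vop_D F x : vop (@cD R n) F x = drsum F x.
Proof. by rewrite vop_r //; apply: eq_bigr => a _; rewrite mul1r. Qed.

Lemma vop_DE F : vop (@cD R n) F = drsum F.
Proof. by apply/funext => x; exact: vop_D. Qed.

Lemma vop_yc c a x : vop c (yc a) x = c (Some (inl a)) x.
Proof.
have [_ ->] // := @isV_yc R n (fun _ => True) c a.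
Qed.
Lemma vop_rc c a x : vop c (rc a) x = c (Some (inr a)) x.
Proof. by have [_ ->] // := @isV_rc R n (fun _ => True) c a. Qed.
Lemma vop_kc c x : vop c (@kc R n) x = c None x.
Proof. by have [_ ->] // := @isV_kc R n (fun _ => True) c. Qed.

Variables (x0 : V) (e : R).
Notation U := (cube x0 e).
Notation smooth := (smooth (@dir R n) U).

Let po : plane_open (@dir R n) U.
Proof. exact: cube_plane_open (@dir_cc1 R n). Qed.
Let lo : line_open (@dir R n) U := plane_line_open po.

Lemma smooth_drsum F : smooth F -> smooth (drsum F).
Proof. by move=> sF; rewrite -vop_DE; apply: smooth_vop => //; case: (smooth_coefs x0 e). Qed.

Lemma vop_ext2 c F G x : (forall x, U x -> F x = G x) -> smooth F -> U x -> vop c F x = vop c G x.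
Proof. by move=> FG sF Ux; apply: (vop_ext lo _ FG (smooth_diffb lo sF) Ux). Qed.

Lemma smooth_cZ i : smooth (cZ i).
Proof.
have C := @smooth_cst R V _ (@dir R n) U.
by case: i => [[a|a]|]; rewrite /cZ; [exact: C|exact: (smooth_cc x0 e (Some (inl a)))|exact: C].
Qed.

Let vopZ c k F x : smooth F -> U x -> vop c (fun y => k * F y) x = k * vop c F x.
Proof. by move=> sF Ux; have [_ /(_ x Ux)] := isVZ lo k (isV_vop c (smooth_diffb lo sF)). Qed.

Let vop_cst c k x : U x -> vop c (fun=> k) x = 0.
Proof. by move=> Ux; have [_ /(_ x Ux)] := isV_cst (@dir R n) U c k. Qed.

Let vop_eq c F G x : F =1 G -> vop c F x = vop c G x.
Proof. by move=> /funext ->. Qed.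

Let vop_comm_r eps c F x : (forall i, smooth (c i)) -> smooth F -> U x ->
  vop (fun i _ => eps i) (c None) x = 0 -> (forall a, vop (fun i _ => eps i) (c (Some (inl a))) x = 0) ->
  vop (fun i _ => eps i) (vop c F) x =
   \sum_a vop (fun i _ => eps i) (c (Some (inr a))) x * dr a F x + vop c (vop (fun i _ => eps i) F) x.
Proof.
move=> sc sF Ux c0 c1; rewrite (vop_comm lo po eps sc sF Ux) sum_coord; congr (_ + _).
exact: (sum_left (ld (dir None) F x) (fun a => vop (fun i _ => eps i) (c (Some (inr a))) x)
  (fun a => dy a F x) (fun a => dr a F x) c0 c1).
Qed.

Lemma D_T F x : smooth F -> U x ->
  drsum (vop (@cT R n) F) x = vop (@cT R n) (drsum F) x - 3^-1 * drsum F x.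
Proof.
move=> sF Ux; have [_ _ scT _] := smooth_coefs x0 e.
have sc := smooth_cc x0 e.
have T0 : vop (fun i _ => eD i) (@cT R n None) x = 0.
  rewrite (vop_eq _ _ (G := fun y => - 3^-1 * cc None y)) => [|y /=]; last by ring.
  by rewrite vopZ // vop_kc mulr0.
have T1 a : vop (fun i _ => eD i) (@cT R n (Some (inl a))) x = 0.
  transitivity (- (2 / 3) * vop (fun i _ => eD i) (yc a) x); last by rewrite vop_yc mulr0.
  exact: (vopZ _ _ (sc (Some (inl a))) Ux).
rewrite -!vop_DE cDE (vop_comm_r (eps := eD) scT sF Ux T0 T1) addrC; congr (_ + _).
rewrite -cDE vop_D /drsum mulr_sumr -sumrN; apply: eq_bigr => a _; rewrite -mulNr; congr (_ * _).
rewrite (vop_eq _ _ (G := fun y => - 3^-1 * cc (Some (inr a)) y + - 1 * (yc a y * yc a y))) => [|y /=]; last by ring.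
have isD i := isV_vop (@cD R n) (smooth_diffb lo (sc i)).
have [_ /(_ x Ux) E] := isVD (isVZ lo (- 3^-1) (isD (Some (inr a))))
  (isVZ lo (-1) (isVM (isD (Some (inl a))) (isD (Some (inl a))))).
by rewrite [LHS]E vop_rc !vop_yc /=; ring.
Qed.

Lemma D_X F x : smooth F -> U x -> drsum (vop (@cX R n) F) x = vop (@cX R n) (drsum F) x.
Proof.
move=> sF Ux; have [_ scX _ _] := smooth_coefs x0 e.
have T0 : vop (fun i _ => eD i) (@cX R n None) x = 0 by exact: vop_cst.
have T1 a : vop (fun i _ => eD i) (@cX R n (Some (inl a))) x = 0 by exact: vop_cst.
rewrite -!vop_DE cDE (vop_comm_r (eps := eD) scX sF Ux T0 T1) sum_eq0 ?add0r // => a.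
transitivity (2 * vop (fun i _ => eD i) (yc a) x); last by rewrite vop_yc mulr0.
exact: (vopZ _ _ (smooth_cc x0 e (Some (inl a))) Ux).
Qed.

Lemma Y_Z F x : smooth F -> U x ->
  vop (@cY R n) (vop cZ F) x = drsum F x + vop cZ (vop (@cY R n) F) x.
Proof.
move=> sF Ux.
have T0 : vop (fun i _ => eY i) (cZ None) x = 0 by exact: vop_cst.
have T1 a : vop (fun i _ => eY i) (cZ (Some (inl a))) x = 0 by exact: vop_cst.
rewrite cYE (vop_comm_r (eps := eY) smooth_cZ sF Ux T0 T1); congr (_ + _).
by apply: eq_bigr => a _; rewrite vop_yc mul1r.
Qed.

Lemma vop_ZE F x : vop cZ F x = \sum_a yc a x * dr a F x.
Proof. exact: vop_r. Qed.

Lemma vop_YE F x : vop (@cY R n) F x = \sum_a dy a F x.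
Proof. by rewrite vop_y //; apply: eq_bigr => a _; rewrite mul1r. Qed.

Lemma vop_X F x : vop (@cX R n) F x = vop (@cY R n) F x + 2 * vop cZ F x.
Proof.
rewrite vop_ZE vop_YE vop_sum mulr_sumr [cX None x]/cX mul0r add0r; congr (_ + _); apply: eq_bigr => a _.
  by rewrite mul1r.
by rewrite mulrA.
Qed.

Lemma vop_TE F x : vop (@cT R n) F x = - (kc x / 3) * ld (dir None) F x - 2 / 3 * (\sum_a yc a x * dy a F x)
  - 3^-1 * (\sum_a rc a x * dr a F x) - \sum_a yc a x ^+ 2 * dr a F x.
Proof.
have alg (k l : R) (y r f g : 'I_n -> R) :
    - (k / 3) * l + (\sum_a - (2 / 3) * y a * f a + \sum_a (- (r a / 3) - y a ^+ 2) * g a) =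
    - (k / 3) * l - 2 / 3 * (\sum_a y a * f a) - 3^-1 * (\sum_a r a * g a) - \sum_a y a ^+ 2 * g a.
  rewrite -!addrA !mulr_sumr -!sumrN -!big_split /=.
  by congr (_ + _); apply: eq_bigr => a _; ring.
by rewrite vop_sum; exact: (alg _ _ (fun a => yc a x) (fun a => rc a x) (fun a => dy a F x) (fun a => dr a F x)).
Qed.

Lemma Z_Z F x : smooth F -> U x ->
  vop cZ (vop cZ F) x = \sum_b \sum_a yc b x * yc a x * dr b (dr a F) x.
Proof.
move=> sF Ux; rewrite vop_ZE; apply: eq_bigr => b _.
under eq_bigr do rewrite -mulrA; rewrite -mulr_sumr; congr (_ * _).
have H := @is_ld_sum R V (dir (Some (inr b))) 'I_n (index_enum 'I_n) (fun a y => yc a y * dr a F y)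
  (fun a => 0 * dr a F x + yc a x * dr b (dr a F) x) x.
have E : vop cZ F = (fun y => \sum_a yc a y * dr a F y) by apply/funext => y; exact: vop_ZE.
rewrite E /dr; transitivity (\sum_a (0 * dr a F x + yc a x * dr b (dr a F) x)); last first.
  by apply: eq_bigr => a _; rewrite mul0r add0r.
apply: is_ldE; apply: H => a; apply: is_ldM; last exact: (smooth_diffb lo (smooth_ld lo (Some (inr a)) sF)).
apply: (@drv_ext R (fun t => yc a x + t * yc a (dir (Some (inr b))))); first by move=> t; rewrite ycE.
apply: (drv_eq (drvD (drv_cst _ _) (drvM (drv_id _) (drv_cst _ _)))).
by rewrite yc_dir (_ : (Some (inr b) == Some (inl a)) = false) // mulr0n; ring.
Qed.

Let vop_zero c F x : smooth F -> (forall x, U x -> F x = 0) -> U x -> vop c F x = 0.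
Proof. by move=> sF F0 Ux; rewrite (vop_ext2 c F0 sF Ux); exact: vop_cst. Qed.

Lemma Y_drsum F x : smooth F -> U x -> vop (@cY R n) (drsum F) x = drsum (vop (@cY R n) F) x.
Proof.
move=> sF Ux; have [scD _ _ _] := smooth_coefs x0 e.
have T0 : vop (fun i _ => eY i) (@cD R n None) x = 0 by exact: vop_cst.
have T1 a : vop (fun i _ => eY i) (@cD R n (Some (inl a))) x = 0 by exact: vop_cst.
rewrite -!vop_DE cYE (vop_comm_r (eps := eY) scD sF Ux T0 T1) sum_eq0 ?add0r // => a.
exact: vop_cst.
Qed.

Lemma kc_drsum F x : smooth F -> U x -> ld (dir None) (drsum F) x = drsum (ld (dir None) F) x.
Proof.
move=> sF Ux; rewrite -!vop_DE cDE; exact/esym/(vop_ld_comm lo po eD None sF Ux).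
Qed.

Variable phi : V -> R.
Hypothesis sphi : smooth phi.
Hypothesis Kphi : forall x, U x -> kp_form phi x = 0.
Hypothesis Yphi : forall x, U x -> vop (@cY R n) phi x = 0.
Hypothesis kphi : forall x, U x -> ld (dir None) phi x = 0.
Let Ps := drsum phi.
Let ps := drsum Ps.

Let scX : forall i, smooth (@cX R n i). Proof. by case: (smooth_coefs x0 e). Qed.
Let scY : forall i, smooth (@cY R n i). Proof. by case: (smooth_coefs x0 e). Qed.
Let scT : forall i, smooth (@cT R n i). Proof. by case: (smooth_coefs x0 e). Qed.
Let sPs : smooth Ps := smooth_drsum sphi.
Let sps : smooth ps := smooth_drsum sPs.

Let Y0 x : U x -> vop (@cY R n) Ps x = 0.
Proof.
move=> Ux; rewrite Y_drsum // -vop_D; apply: vop_zero => //.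
exact: smooth_vop scY sphi.
Qed.

Let k0 x : U x -> ld (dir None) ps x = 0.
Proof.
move=> Ux; rewrite kc_drsum // -vop_D; apply: vop_zero => // [|y Uy]; first exact: smooth_ld.
by rewrite kc_drsum // -vop_D; apply: vop_zero => //; exact: smooth_ld.
Qed.

Let XX x : U x -> drsum (vop (@cX R n) (vop (@cX R n) phi)) x =
  2 * ps x + 4 * \sum_b \sum_a yc b x * yc a x * dr b (dr a Ps) x.
Proof.
move=> Ux; have sX := smooth_vop lo scX sphi; have sZ := smooth_vop lo smooth_cZ sPs.
rewrite D_X // (vop_ext2 _ (G := vop (@cX R n) Ps)) //; last 2 first.
- by move=> y Uy; rewrite D_X.
- exact: smooth_drsum.
rewrite (vop_ext2 _ (G := fun y => 2 * vop cZ Ps y)) //; last 2 first.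
- by move=> y Uy; rewrite vop_X Y0 // add0r.
- exact: smooth_vop scX sPs.
rewrite vopZ // vop_X Y_Z // (vop_zero cZ (smooth_vop lo scY sPs) Y0 Ux).
by rewrite addr0 Z_Z // -/ps; move: (ps x) (\sum_b _) => p q; ring.
Qed.

(** The coefficient - 1 / 6 of [ps] is the sum of 1 / 2, which is 4^-1 * 2 from [XX], and of - 1 / 3
    taken twice, from commuting D past T two times by [D_T]. *)
Lemma limit_pde x : U x ->
  - 6^-1 * ps x + 2^-1 * drsum (fun y => ps y ^+ 2) x + 12^-1 * drsum (drsum (drsum ps)) x
  - 3^-1 * (\sum_a rc a x * dr a ps x) - 2 / 3 * (\sum_a yc a x * dy a ps x)
  - \sum_a yc a x ^+ 2 * dr a ps x
  + \sum_b \sum_a yc b x * yc a x * dr b (dr a Ps) x = 0.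
Proof.
move=> Ux.
have isD F (sF : smooth F) := isV_vop (@cD R n) (smooth_diffb lo sF).
have sT := smooth_vop lo scT sPs.
have sX := smooth_vop lo scX (smooth_vop lo scX sphi).
have s4 := smooth_drsum (smooth_drsum sps).
have [dK /(_ x Ux) E] := isVD (isVD (isVD (isVD (isD _ sT) (isVZ lo (- 3^-1) (isD _ sPs)))
  (isVZ lo 2^-1 (isD _ (smoothM sps sps)))) (isVZ lo 12^-1 (isD _ (smooth_drsum (smooth_drsum sps)))))
  (isVZ lo 4^-1 (isD _ sX)).
have Z0 : vop (@cD R n) (fun=> 0) x = 0 by exact: vop_cst.
rewrite (vop_ext lo _ (G := fun=> 0) _ dK Ux) ?Z0 in E; last first.
  move=> y Uy; rewrite -(Kphi Uy) /kp_form !vop_DE D_T // -/Ps -/ps expr2.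
  by move: (vop (@cT R n) Ps y) (vop (@cX R n) _ y) (drsum _ y) (Ps y) (ps y) => a b c d f; ring.
move: E; rewrite !vop_D D_T // XX // -/ps vop_TE k0 // mulr0 sub0r.
have -> : (fun y => ps y ^+ 2) = (fun y => ps y * ps y) by apply/funext => y; rewrite expr2.
move: (drsum (fun y => ps y * ps y) x) (drsum (drsum (drsum ps)) x) (ps x).
have alg (A B C D P Q p : R) :
    0 = - (2 / 3 * A) - 3^-1 * B - C - 3^-1 * p + - 3^-1 * p + 2^-1 * P + 12^-1 * Q + 4^-1 * (2 * p + 4 * D) ->
    - 6^-1 * p + 2^-1 * P + 12^-1 * Q - 3^-1 * B - 2 / 3 * A - C + D = 0 by move=> ->; field.
by move=> P Q p; exact: alg.
Qed.
End LimitPDE.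

(** * Positivity *)

Section AnalyticContinuation.
Context {R : realType}.

(** The bound on the derivative of order j + k is integrated j times from [s0], where every [g k]
    vanishes. *)
Lemma taylor_bound (g : nat -> R -> R) (B : nat -> R) s0 d :
  (forall k (s : R), is_derive s 1 (g k) (g k.+1 s)) -> (forall k, g k s0 = 0) ->
  (forall k u, s0 <= u <= s0 + d -> `|g k u| <= B k) ->
  forall j k u, s0 <= u <= s0 + d -> `|g k u| <= B (j + k)%N * (u - s0) ^+ j / j`!%:R.
Proof.
move=> dg g0 gB; elim=> [|j IH] k u ud; first by rewrite add0n mulr1 divr1; exact: gB.
have /andP[s0u ue] := ud.
pose h u := B (j.+1 + k)%N * (u - s0) ^+ j.+1 / (j.+1)`!%:R.
have dh (x : R) : is_derive x 1 h (B (j + k.+1)%N * (x - s0) ^+ j / j`!%:R).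
  have D := drvM (drvM (drv_cst (B (j.+1 + k)%N) _) (drvX j (drvD (drv_id x) (drv_cst (- s0) _))))
    (drv_cst ((j.+1)`!%:R^-1) x).
  apply: (drv_eq D); rewrite addnS addSn factS natrM invfM /=.
  have j0 : (j.+1%:R : R) != 0 by rewrite pnatr_eq0.
  move: (B _) ((x - s0) ^+ j) (j`!%:R^-1) => b p q.
  by field.
have le' x : s0 <= x <= u -> `|g k.+1 x| <= B (j + k.+1)%N * (x - s0) ^+ j / j`!%:R.
  by move=> /andP[sx xu]; apply: IH; rewrite sx (le_trans xu).
have := derive_le s0u (dg k) dh le'.
by rewrite g0 subr0 /h subrr expr0n /= mulr0 mul0r subr0.
Qed.

(** Otherwise let s0 be the supremum of the zeros. By monotonicity g vanishes to the left of s0, so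
    all derivatives vanish there and, by continuity, at s0. The analytic bounds then make g vanish
    at a point to the right of s0, a contradiction. *)
Lemma analytic_monotone_pos (g : nat -> R -> R) : (forall k (s : R), is_derive s 1 (g k) (g k.+1 s)) ->
  (forall s, exists2 e : R, 0 < e & exists2 S, 0 <= S & exists2 rho, 0 <= rho & forall k u, `|u - s| < e ->
     `|g k u| <= S * k`!%:R * rho ^+ k) ->
  (forall s, 0 <= g 0%N s) -> (forall s t, s <= t -> g 0%N s <= g 0%N t) -> (exists s, 0 < g 0%N s) ->
  forall s, 0 < g 0%N s.
Proof.
move=> dg loc g_ge0 mon [s2 g2] s1; rewrite lt0r g_ge0 andbT; apply/negP => /eqP g1.
pose Z := [set s | g 0%N s = 0].
have supZ : has_sup Z.
  split; first by exists s1.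
  exists s2 => s Zs; rewrite leNgt; apply/negP => /ltW /mon; rewrite Zs leNgt g2 //.
pose s0 := sup Z.
have Zlt s : s < s0 -> g 0%N s = 0.
  move=> ss0; have [|z Zz sz] := sup_adherent _ supZ (eps := s0 - s); first by rewrite subr_gt0.
  have szz : s <= z by move: sz; rewrite -/s0 opprB addrCA subrr addr0 => /ltW.
  by apply/eqP; rewrite eq_le g_ge0 andbT; have := mon _ _ szz; rewrite Zz.
have Zk k s : s < s0 -> g k s = 0.
  elim: k s => [|k IH] s ss0; first exact: Zlt.
  have D := dg k s; rewrite -(@derive_val _ _ _ _ _ _ _ D).
  have D0 : is_derive s 1 (g k) 0.
    apply: near_eq_is_derive (drv_cst (0 : R) s).
    by near=> t; apply/esym/IH; near: t; exact: lt_nbhsl.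
  by rewrite (@derive_val _ _ _ _ _ _ _ D0).
have Zk0 k : g k s0 = 0.
  have ct := drv_continuous (dg k s0).
  have c1 := cvg_at_left_filter ct.
  apply: (cvg_unique (@Rhausdorff R) c1); apply: cvg_near_cst.
  by near=> t; apply/Zk; near: t; exact: nbhs_left_lt.
have [e e0 [S S0 [rho rho0 H]]] := loc s0.
(* Chosen so that d rho <= 1 / 2: Taylor's bound at s0 + d becomes S 2^-j, for every j. *)
pose d := Num.min (e / 2) (2 * (rho + 1))^-1.
have d0 : 0 < d by rewrite lt_min divr_gt0 //= invr_gt0; lra.
have de : d <= e / 2 by rewrite ge_min lexx.
have dr : d * (rho + 1) <= 2^-1.
  by rewrite -ler_pdivlMr ?ltr_wpDl // -invfM ge_min lexx orbT.
have T := @taylor_bound g (fun k => S * k`!%:R * rho ^+ k) s0 d dg Zk0 _.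
have {}T j : g 0%N (s0 + d) <= S * 2^-1 ^+ j.
  apply: le_trans (ler_norm _) (le_trans (T _ j 0%N (s0 + d) _) _).
  - move=> k u /andP[u1 u2]; apply: H; rewrite ger0_norm ?subr_ge0 //; lra.
  - by rewrite lexx lerDl ltW.
  rewrite addn0 [s0 + d]addrC addrK.
  have -> : S * j`!%:R * rho ^+ j * d ^+ j / j`!%:R = S * (d * rho) ^+ j.
    by rewrite exprMn; field; rewrite pnatr_eq0 -lt0n fact_gt0.
  rewrite ler_wpM2l // lerXn2r ?nnegrE ?invr_ge0 ?mulr_ge0 ?(ltW d0) //.
  by apply: le_trans dr; rewrite ler_wpM2l ?(ltW d0) //; lra.
have gd : g 0%N (s0 + d) = 0.
  apply/eqP; rewrite eq_le g_ge0 andbT leNgt; apply/negP => gp.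
  pose j := (Num.truncn (S / g 0%N (s0 + d))).+1.
  have h1 : S / g 0%N (s0 + d) < j%:R by rewrite -truncn_lt_nat // divr_ge0 // ltW.
  have h2 : (j%:R : R) <= 2 ^+ j by rewrite -natrX ler_nat ltnW // ltn_expl.
  have := T j; rewrite exprVn ler_pdivlMr ?exprn_gt0 //.
  rewrite leNgt => /negP; apply; move: h1; rewrite ltr_pdivrMr // => /lt_le_trans; apply.
  by rewrite mulrC ler_wpM2l // ltW.
have := ub_le_sup supZ.2 (gd : Z _); rewrite -/s0; lra.
Unshelve. all: by end_near.
Qed.
End AnalyticContinuation.


(** * Invariance under relabelling of the half-lines *)

Section Reindexing.
Context {R : realType} (n : nat) (sg : 'I_n -> 'I_n).
Hypothesis sg_inj : injective sg.

Definition relabel k (z : k.-tuple ('I_n * R)) : k.-tuple ('I_n * R) :=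
  map_tuple (fun p => (sg p.1, p.2)) z.

Lemma iter_integral_ext m (r : 'I_m -> R) k (F G : k.-tuple ('I_m * R) -> R) : F =1 G ->
  iter_integral r F = iter_integral r G.
Proof. by move=> /funext ->. Qed.

Lemma iter_integral_relabel (r : 'I_n -> R) k (F : k.-tuple ('I_n * R) -> R) :
  iter_integral (r \o sg) (F \o @relabel k) = iter_integral r F.
Proof.
elim: k F => [|k IH] F /=; first by congr F; apply: val_inj.
rewrite [RHS](reindex_inj sg_inj); apply: eq_bigr => i _ /=.
apply: eq_Rintegral => u _; rewrite -IH; apply: iter_integral_ext => z /=.
by congr F; apply: val_inj.
Qed.

Lemma fredholm_det_relabel (r : 'I_n -> R) (K : 'I_n -> R -> 'I_n -> R -> R) :
  fredholm_det (r \o sg) (fun i u j v => K (sg i) u (sg j) v) = fredholm_det r K.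
Proof.
rewrite /fredholm_det; congr (limn (series _)); apply/funext => k; congr (_ * _).
rewrite -(iter_integral_relabel r); apply: iter_integral_ext => z /=; congr (\det _).
by apply/matrixP => a b; rewrite !mxE !tnth_map.
Qed.
End Reindexing.

(** [is_airy2] describes the law at increasing times only, whereas the y_a come in any order;
    sorting them relabels the half-lines, under which the Fredholm determinant is invariant. *)
Lemma increasing_relabel (R : realType) n (y : 'I_n -> R) : injective y ->
  exists2 sg : 'I_n -> 'I_n, injective sg & forall i j : 'I_n, (i < j)%N -> y (sg i) < y (sg j).
Proof.
move=> y_inj; pose s := sort (fun a b => y a <= y b) (enum 'I_n).
have sz : size s = n by rewrite size_sort size_enum_ord.
have us : uniq s by rewrite sort_uniq enum_uniq.
have lt (i : 'I_n) : (i < size s)%N by rewrite sz.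
pose sg (i : 'I_n) := nth i s i.
have sg_inj : injective sg.
  move=> i j; rewrite /sg (set_nth_default j) // => /eqP.
  by rewrite nth_uniq // => /eqP /val_inj.
exists sg => // i j ij.
have tr : transitive (fun a b => y a <= y b) by move=> a b c; exact: le_trans.
have so : sorted (fun a b => y a <= y b) s by apply: sort_sorted => a b; exact: le_total.
have := sorted_ltn_nth tr i so i j (lt i) (lt j) ij.
have E : nth j s j = nth i s j by apply: set_nth_default.
rewrite /sg E le_eqVlt => /orP[/eqP /y_inj /eqP|//].
by rewrite nth_uniq // => /eqP ee; rewrite ee ltnn in ij.
Qed.

Section JointLaw.
Context {R : realType} {d : measure_display} {T : measurableType d} {P : probability T R}.
Variable A : R -> {RV P >-> R}.
Hypothesis hA : is_airy2 A.

Definition diag n : space (R := R) n := (0, const_mx 1, 0).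

Definition below n (y r : 'I_n -> R) : set T := [set w | forall i, A (y i) w <= r i].

Lemma measurable_below n (y r : 'I_n -> R) : measurable (below y r).
Proof.
have -> : below y r = \bigcap_(i in [set: 'I_n]) (A (y i) @^-1` `]-oo, r i]).
  apply/seteqP; split=> [w H i _|w H i] /=; first by rewrite in_itv /=; exact: H.
  by have := H i I; rewrite /= in_itv.
apply: fin_bigcap_measurable => // i _.
by rewrite -[X in measurable X]setTI; exact: measurable_funP.
Qed.

Lemma law_below n (x : space (R := R) n.+1) : distinct x ->
  P (below (fun i => yc i x) (fun i => rc i x)) = (fredholm_airy x)%:E.
Proof.
move=> dx.
have y_inj : injective (fun i => yc i x).
  by move=> i j E; apply/eqP; apply: contraTT (eqxx (yc i x)) => /dx; rewrite E.
have [sg sg_inj lt] := increasing_relabel y_inj.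
have := hA (fun i => rc (sg i) x) lt.
rewrite (fredholm_det_relabel sg_inj (fun i => rc i x) (fun i u j v => ext_airy_kernel (yc i x) u (yc j x) v)).
move=> <-; congr (P _); apply/seteqP; split=> w H i /=; first exact: H.
by have := H (invF sg_inj i) => /=; rewrite f_invF.
Qed.

Lemma diag_cc n (i : coord n) : `|cc i (diag n)| <= 1.
Proof. by case: i => [[a|a]|]; rewrite /= /yc /rc /kc /diag /= ?mxE ?normr0 ?normr1. Qed.

Lemma distinct_line n (x w : space (R := R) n) t : (forall i, yc i w = 0) -> distinct x -> distinct (x + t *: w).
Proof. by move=> w0 dx a b ab; rewrite !ycE !w0 mulr0 !addr0; exact: dx. Qed.

Lemma fredholm_airy_pos n (x : space (R := R) n.+1) : distinct x -> kc x = 1 -> 0 < fredholm_airy x.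
Proof.
move=> dx k1; pose v (_ : unit) := diag n.+1.
pose F := @fredholm_airy R n.+1.
pose pt s := x + s *: diag n.+1.
have y0 i : yc i (diag n.+1) = 0 by rewrite /yc mxE.
have dpt s : distinct (pt s) by exact: distinct_line.
have kpt s : kc (pt s) = 1 by rewrite kcE mulr0 addr0.
have law s : P (below (fun i => yc i (pt s)) (fun i => rc i (pt s))) = (F (pt s))%:E := law_below (dpt s).
have loc s : exists2 e : R, 0 < e & exists2 S, 0 <= S & exists2 rho, 0 <= rho &
    forall Q, smooth_bound v Q (cube (pt s) e) (fun k => S * k`!%:R * rho ^+ k) F.
  (* The diagonal direction fixes kappa, so the bounds hold with [S] and [rho] independent of the
     order, and they pass to the limit. *)
  have [e e0 [_ H _ cv]] := local_limit (dpt s) (kpt s).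
  have v1 (i : unit) j : `|cc j (v i)| <= 1 by exact: diag_cc.
  have [|S S0 [rho rho0 HS]] := H _ v v1; first by [].
  exists e => //; exists S => //; exists rho => // Q.
  by apply: (smooth_bound_limit (plane_line_open (cube_plane_open v1)) (HS Q.+1)).
have pt0 : pt 0 = x by rewrite /pt scale0r addr0.
pose g k s := lds v (nseq k tt) F (pt s).
have lo s e : line_open v (cube (pt s) e).
  by apply: plane_line_open; apply: cube_plane_open => i j; exact: diag_cc.
have bound s e S rho : (forall Q, smooth_bound v Q (cube (pt s) e) (fun k => S * k`!%:R * rho ^+ k) F) ->
    forall k Q, smooth_bound v Q (cube (pt s) e) (fun j => S * (j + k)`!%:R * rho ^+ (j + k)) (lds v (nseq k tt) F).
  move=> H; elim=> [|k IH] Q; first by apply: (smooth_boundW _ _ (H Q)) => // j _; rewrite addn0.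
  have := (smooth_bound_ld tt (lo s e) (IH Q.+1)).2.
  by apply: smooth_boundW => // j _; rewrite /shiftb addnS.
have := @analytic_monotone_pos R g _ _ _ _ _ 0; rewrite /g pt0 /=; apply.
- move=> k s; have [e e0 [S S0 [rho rho0 H]]] := loc s.
  have := (smooth_bound_ld tt (lo s e) (bound _ _ _ _ H k 1)).1 (pt s) (cube_center (pt s) e0).
  by move=> /(is_ld_at _ _ x s).
- move=> s; have [e e0 [S S0 [rho rho0 H]]] := loc s.
  exists e => //; exists S => //; exists rho => // k u us.
  have := smooth_bound_lt0 (x := pt u) _ (bound _ _ _ _ H k 0); apply.
  move=> i; rewrite !ccE opprD addrACA subrr add0r -mulrBl normrM.
  by apply: le_lt_trans us; rewrite ler_piMr // diag_cc.
- by move=> s; rewrite -lee_fin -law.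
- move=> s t st.
  have aux (a b : \bar R) (u w : R) : a = u%:E -> b = w%:E -> (a <= b)%E -> u <= w by move=> -> ->; rewrite lee_fin.
  apply: (aux _ _ _ _ (law s) (law t)); apply: le_measure; rewrite ?inE; try exact: measurable_below.
  move=> w H i; have := H i; rewrite /pt !ycE !rcE y0 !mulr0 => /le_trans; apply.
  by rewrite lerD2l /diag /rc /= mxE !mulr1.
(* If the function vanished on the whole diagonal, the events with all levels raised by k would be
   null for every k; but they increase to the whole space. *)
apply: contrapT => Hn.
have Z s : F (pt s) = 0.
  apply/eqP; rewrite eq_le -[X in _ && X]lee_fin -law measure_ge0 andbT.
  by rewrite leNgt; apply/negP => p; apply: Hn; exists s.
pose E k := below (fun i => yc i x) (fun i => rc i x + k%:R).
have cE : P (E k) @[k --> \oo] --> P (\bigcup_k E k).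
  apply: nondecreasing_cvg_mu.
  - by move=> k; exact: measurable_below.
  - by apply: bigcup_measurable => k _; exact: measurable_below.
  - apply/nondecreasing_seqP => k; apply/subsetPset => w H i; apply: le_trans (H i) _.
    by rewrite lerD2l ler_nat.
have E0 k : P (E k) = 0%E.
  suff -> : E k = below (fun i => yc i (pt k%:R)) (fun i => rc i (pt k%:R)) by have := law k%:R; rewrite Z.
  by apply/seteqP; split=> w H i; have := H i; rewrite /pt ycE y0 mulr0 addr0 rcE /diag /rc /= mxE mulr1.
have UT : \bigcup_k E k = setT.
  rewrite -subTset => w _.
  pose M := \sum_i `|A (yc i x) w - rc i x|.
  exists (Num.truncn M).+1 => // i /=.
  rewrite addrC -lerBlDr (le_trans (ler_norm _)) //.
  apply: le_trans (_ : M <= _); first by rewrite /M (bigD1 i) //= lerDl sumr_ge0.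
  by rewrite ltW // -truncn_lt_nat // sumr_ge0.
have c0 : P (E k) @[k --> \oo] --> 0%E by under eq_fun do rewrite E0; exact: cvg_cst.
have e0 : P (\bigcup_k E k) = 0%E by apply: (cvg_unique (@ereal_hausdorff R) cE c0).
by move: e0; rewrite UT probability_setT => -[] /eqP; rewrite oner_eq0.
Qed.

(** Equal times are merged and all levels are lowered to a common [rho]; the smaller event has
    distinct times, and its probability is positive by [fredholm_airy_pos]. *)
Lemma below_pos n (y r : 'I_n -> R) : (0 < P (below y r))%E.
Proof.
pose s := undup (codom y).
have us : uniq s by exact: undup_uniq.
have ys i : y i \in s by rewrite mem_undup codom_f.
pose rho := - \sum_i `|r i|.
have rr i : rho <= r i.
  rewrite /rho lerNl (le_trans (ler_norm _)) // normrN (bigD1 i) //= lerDl.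
  exact: sumr_ge0.
case E : (size s) => [|q].
  have -> : below y r = setT.
    rewrite -subTset => w _ i; have := ys i.
    by move/eqP: E; rewrite size_eq0 => /eqP ->.
  by rewrite probability_setT lte_fin.
pose x : space (R := R) q.+1 := (\row_i nth 0 s i, const_mx rho, 1).
have yE i : yc i x = nth 0 s i by rewrite /yc mxE.
have rE i : rc i x = rho by rewrite /rc mxE.
have dx : distinct x.
  by move=> a b ab; rewrite !yE nth_uniq ?E.
have := fredholm_airy_pos dx (erefl _); rewrite -lte_fin -law_below // => /lt_le_trans; apply.
apply: le_measure; rewrite ?inE; try exact: measurable_below.
move=> w H i; have ii : (index (y i) s < q.+1)%N by rewrite -E index_mem.
by have := H (Ordinal ii); rewrite yE rE nth_index // => /le_trans; apply.
Qed.
End JointLaw.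

(** * The equation for the joint distribution *)

Section LineDerivatives.
Context {R : realType} {k : nat}.
Implicit Types (f : 'rV[R]_k -> R) (r u : 'rV[R]_k).

Let quotientE f r u : (fun h : R => h^-1 *: (f (h *: u + r) - f r)) =
  (fun h => h^-1 *: (f (r + (h *: (1 : R) + 0) *: u) - f (r + 0 *: u))).
Proof. by apply/funext => h; rewrite scale0r !addr0 [h *: u + r]addrC [h *: (1 : R)]mulr1. Qed.

Lemma derive_line f r u : 'D_u f r = 'D_1 (fun t : R => f (r + t *: u)) 0.
Proof. by rewrite /derive /= quotientE. Qed.

Lemma derivable_line f r u : derivable f r u <-> derivable (fun t : R => f (r + t *: u)) 0 1.
Proof. by rewrite /derivable /= quotientE. Qed.

(** Equality is asked only near t = 0: when a time is varied, the Fredholm formula is available as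
    long as the times stay distinct. *)
Lemma is_ld_line {V : lmodType R} (F : V -> R) x w dF f r u :
  (\forall t \near (0 : R), F (x + t *: w) = f (r + t *: u)) -> is_ld w F x dF ->
  derivable f r u /\ 'D_u f r = dF.
Proof.
move=> E D; have D' : is_derive (0 : R) 1 (fun t => f (r + t *: u)) dF.
  by apply: near_eq_is_derive D.
split; first by apply/derivable_line; exact: ex_derive.
by rewrite derive_line (@derive_val _ _ _ _ _ _ _ D').
Qed.
End LineDerivatives.

(** On the right the terms Y_a^2 G a a occur once with each sign and cancel; rows and weights of
    index 0 drop out because Y 0 = 0. *)
Lemma off_diagonal (R : realType) m (Y : 'I_m.+1 -> R) (G : 'I_m.+1 -> 'I_m.+1 -> R) : Y ord0 = 0 ->
  - (\sum_(a < m) \sum_(b < m.+1 | b != lift ord0 a) Y (lift ord0 a) ^+ 2 * G (lift ord0 a) b)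
  + \sum_(a < m) \sum_(b < m | b != a) Y (lift ord0 a) * Y (lift ord0 b) * G (lift ord0 a) (lift ord0 b) =
  - (\sum_a Y a ^+ 2 * \sum_b G a b) + \sum_b \sum_a Y b * Y a * G b a.
Proof.
move=> Y0; rewrite [\sum_a Y a ^+ 2 * _]big_ord_recl Y0 expr0n mul0r add0r.
rewrite [\sum_b \sum_a Y b * _ * _]big_ord_recl Y0 [X in _ = _ + (X + _)]big1 => [|a _]; last by rewrite !mul0r.
rewrite add0r -!sumrN -!big_split /=; apply: eq_bigr => a _.
rewrite [\sum_b G _ b](bigD1 (lift ord0 a)) //= [X in _ = _ + X]big_ord_recl Y0 mulr0 mul0r add0r.
rewrite [X in _ = _ + X](bigD1 a) //= -mulr_sumr mulrDr expr2.
by rewrite opprD addrACA addNr add0r.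
Qed.

Section JointEquation.
Context {R : realType} {d : measure_display} {T : measurableType d} {P : probability T R}.
Variables (A : R -> {RV P >-> R}) (m : nat).
Hypothesis hA : is_airy2 A.
Notation V := (space (R := R) m.+1).

(** The time 0 becomes the coordinate of index 0, and kappa is set to 1. The derivative in y_0 has
    no counterpart in the equation, but its coefficient y_0 is 0. *)
Definition emb (y : 'rV[R]_m) (r : 'rV[R]_m.+1) : V :=
  (\row_i (if unlift ord0 i is Some a then y 0 a else 0), r, 1).

Lemma yc_emb0 y r : yc ord0 (emb y r) = 0.
Proof. by rewrite /yc mxE unlift_none. Qed.
Lemma yc_embS y r a : yc (lift ord0 a) (emb y r) = y 0 a.
Proof. by rewrite /yc mxE liftK. Qed.
Lemma emb_r y r a (t : R) : emb y (r + t *: delta_mx 0 a) = emb y r + t *: dir (Some (inr a)).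
Proof.
by apply: cc_inj => -[[b|b]|] /=; rewrite ?ycE ?rcE ?kcE /yc /rc /kc /= ?mxE ?mulr0 ?addr0 ?scaler0 ?addr0.
Qed.

Lemma emb_y y r a (t : R) :
  emb (y + t *: delta_mx 0 a) r = emb y r + t *: dir (Some (inl (lift ord0 a))).
Proof.
apply: cc_inj => -[[b|b]|] /=; rewrite ?ycE ?rcE ?kcE /yc /rc /kc /= ?mxE ?mulr0 ?addr0 ?scaler0 ?addr0 //.
case: unliftP => [c ->|->]; first by rewrite !mxE (inj_eq (@lift_inj _ _)).
by rewrite (negbTE (neq_lift _ _)) andbF mulr0 addr0.
Qed.

Lemma joint_cdfE y r : joint_cdf A y r = fine (P (below A (fun i => yc i (emb y r)) (fun i => r 0 i))).
Proof.
congr (fine (P _)); apply/seteqP; split=> w /=.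
  by move=> [w0 wS] i; case: (unliftP ord0 i) => [a ->|->]; rewrite ?yc_embS ?yc_emb0.
by move=> H; split=> [|a]; [have := H ord0; rewrite yc_emb0|have := H (lift ord0 a); rewrite yc_embS].
Qed.

Lemma joint_cdf_pos (y : 'rV[R]_m) r : 0 < joint_cdf A y r.
Proof.
rewrite joint_cdfE; apply: fine_gt0; rewrite below_pos //=.
by rewrite ltey_eq fin_num_measure //; exact: measurable_below.
Qed.

Lemma log_cdfE y r : distinct (emb y r) -> log_cdf A y r = log_fredholm (emb y r).
Proof.
move=> dx; rewrite /log_cdf joint_cdfE; congr ln.
by have := law_below hA dx => /= ->.
Qed.

Definition distinct_times (y : 'rV[R]_m) := (forall a, y 0 a != 0) /\ (forall a b, a != b -> y 0 a != y 0 b).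

Lemma distinct_emb y r : distinct_times y -> distinct (emb y r).
Proof.
move=> [y0 yy] a b; case: (unliftP ord0 a) => [a' ->|->]; case: (unliftP ord0 b) => [b' ->|->].
- by rewrite (inj_eq (@lift_inj _ _)) !yc_embS; exact: yy.
- by rewrite yc_embS yc_emb0 => _; exact: y0.
- by move=> _; rewrite yc_embS yc_emb0 eq_sym; exact: y0.
- by rewrite eqxx.
Qed.

Transparent ld.

Lemma partial_ld (F : V -> R) y r a :
  partial a (fun r => F (emb y r)) r = ld (dir (Some (inr a))) F (emb y r).
Proof.
rewrite /partial derive_line /ld; congr (derive _ _ _); apply/funext => t.
by rewrite emb_r.
Qed.

Opaque ld.

Lemma Psi_drsum y : distinct_times y -> Psi A y = (fun r => drsum (@log_fredholm R m.+1) (emb y r)).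
Proof.
move=> hy; rewrite /Psi /Dr (_ : log_cdf A y = fun r => log_fredholm (emb y r)); last first.
  by apply/funext => r; apply: log_cdfE; exact: distinct_emb.
by apply/funext => r; apply: eq_bigr => a _; rewrite partial_ld.
Qed.

Lemma Dr_drsum y (f : 'rV[R]_m.+1 -> R) (F : V -> R) : f = (fun r => F (emb y r)) ->
  Dr f = (fun r => drsum F (emb y r)).
Proof. by move=> ->; apply/funext => r; apply: eq_bigr => a _; rewrite partial_ld. Qed.

Notation LF := (@log_fredholm R m.+1).

Lemma psi_drsum y : distinct_times y -> psi A y = (fun r => drsum (drsum LF) (emb y r)).
Proof. by move=> hy; exact: Dr_drsum (Psi_drsum hy). Qed.

Lemma Dr_psi y : distinct_times y -> Dr (psi A y) = (fun r => drsum (drsum (drsum LF)) (emb y r)).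
Proof. by move=> hy; exact: Dr_drsum (psi_drsum hy). Qed.

Lemma Dr2_psi y : distinct_times y ->
  Dr (Dr (psi A y)) = (fun r => drsum (drsum (drsum (drsum LF))) (emb y r)).
Proof. by move=> hy; exact: Dr_drsum (Dr_psi hy). Qed.

Lemma distinct_near (x w : V) : (forall i j, `|yc i w - yc j w| <= 1) -> distinct x ->
  \forall t \near (0 : R), distinct (x + t *: w).
Proof.
move=> w1 dx; have [|e e0 H] := @finite_lower_bound R ('I_m.+1 * 'I_m.+1)%type
   (fun p => if p.1 == p.2 then 1 else `|yc p.1 x - yc p.2 x|).
  by case=> a b /=; case: eqVneq => // /dx; rewrite normr_gt0 subr_eq0.
apply/nbhs_ballP; exists e => // t; rewrite /ball /= sub0r normrN => te a b ab.
have := H (a, b); rewrite /= (negbTE ab) => gab; rewrite -subr_eq0 !ycE.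
have -> : yc a x + t * yc a w - (yc b x + t * yc b w) = (yc a x - yc b x) + t * (yc a w - yc b w) by ring.
apply/eqP => /eqP; rewrite addr_eq0 => /eqP E.
move: gab; rewrite E normrN normrM leNgt => /negP; apply; apply: le_lt_trans te.
by rewrite ler_piMr.
Qed.

Lemma distinct_times_near y a : distinct_times y ->
  \forall t \near (0 : R), distinct_times (y + t *: delta_mx 0 a).
Proof.
move=> hy; have := distinct_near (w := dir (Some (inl (lift ord0 a)))) _ (distinct_emb 0 hy).
have h i j : `|yc i (dir (Some (inl (lift ord0 a))) : V) - yc j (dir (Some (inl (lift ord0 a))))| <= 1.
  rewrite !yc_dir; case: (_ == _); case: (_ == _); rewrite ?subrr ?subr0 ?sub0r ?normrN ?normr0 ?normr1 //.
move=> /(_ h); apply: filterS => t; rewrite -emb_y => dt; split=> [b|b c bc].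
  by have := dt (lift ord0 b) ord0; rewrite yc_embS yc_emb0 eq_sym => /(_ (neq_lift _ _)).
by have := dt (lift ord0 b) (lift ord0 c); rewrite !yc_embS (inj_eq (@lift_inj _ _)); apply.
Qed.

Lemma log_fredholm_kc (x : V) : ld (dir None) LF x = 0.
Proof.
apply: is_ldE; apply: (@drv_ext R (fun=> LF x)) => t.
rewrite /log_fredholm /fredholm_airy.
have -> : (fun i => rc i (x + t *: dir None)) = (fun i => rc i x).
  by apply/funext => i; rewrite rcE rc_dir mulr0 addr0.
have yE i : yc i (x + t *: dir None) = yc i x by rewrite ycE yc_dir mulr0 addr0.
have -> // : (fun i u j v => ext_airy_kernel (yc i (x + t *: dir None)) u (yc j (x + t *: dir None)) v) =
  (fun i u j v => ext_airy_kernel (yc i x) u (yc j x) v).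
by apply/funext => i; apply/funext => u; apply/funext => j; apply/funext => w; rewrite !yE.
Qed.

Lemma local_smooth y r : distinct_times y -> exists2 e : R, 0 < e &
  smooth (@dir R m.+1) (cube (emb y r) e) LF /\
  - 6^-1 * drsum (drsum LF) (emb y r) + 2^-1 * drsum (fun y => drsum (drsum LF) y ^+ 2) (emb y r)
  + 12^-1 * drsum (drsum (drsum (drsum (drsum LF)))) (emb y r)
  - 3^-1 * (\sum_a rc a (emb y r) * dr a (drsum (drsum LF)) (emb y r))
  - 2 / 3 * (\sum_a yc a (emb y r) * dy a (drsum (drsum LF)) (emb y r))
  - \sum_a yc a (emb y r) ^+ 2 * dr a (drsum (drsum LF)) (emb y r)
  + \sum_b \sum_a yc b (emb y r) * yc a (emb y r) * dr b (dr a (drsum LF)) (emb y r) = 0.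
Proof.
move=> hy; have dx := distinct_emb r hy.
have [|e e0 [sm pos K Y]] := log_limit dx (erefl _); first exact: (fredholm_airy_pos hA).
exists e => //; split=> //.
by apply: (limit_pde sm K Y _ (cube_center _ e0)) => x _; exact: log_fredholm_kc.
Qed.

Lemma has_partial_r (F : V -> R) y r a e : 0 < e -> smooth (@dir R m.+1) (cube (emb y r) e) F ->
  has_partial a (fun r => F (emb y r)) r.
Proof.
move=> e0 sF; have lo : line_open (@dir R m.+1) (cube (emb y r) e).
  by apply: plane_line_open; exact: cube_plane_open (@dir_cc1 R m.+1).
have D := smooth_diffb lo sF (Some (inr a)) (cube_center (emb y r) e0).
have E : \forall t \near (0 : R), F (emb y r + t *: dir (Some (inr a))) = F (emb y (r + t *: delta_mx 0 a)).
  by apply/nbhs_ballP; exists (1 : R) => [|t _]; [exact: ltr01|rewrite emb_r].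
exact: (is_ld_line (f := fun r => F (emb y r)) E D).1.
Qed.

Lemma partial_y y r a : distinct_times y ->
  has_partial a (fun y' => psi A y' r) y /\
  partial a (fun y' => psi A y' r) y = dy (lift ord0 a) (drsum (drsum LF)) (emb y r).
Proof.
move=> hy; have [e e0 [sm _]] := local_smooth r hy.
have lo : line_open (@dir R m.+1) (cube (emb y r) e).
  by apply: plane_line_open; exact: cube_plane_open (@dir_cc1 R m.+1).
have sps := smooth_drsum (smooth_drsum sm).
have D := smooth_diffb lo sps (Some (inl (lift ord0 a))) (cube_center (emb y r) e0).
apply: (is_ld_line _ D); have := distinct_times_near a hy.
by apply: filterS => t dt; rewrite (psi_drsum dt) emb_y.
Qed.

Lemma joint_pde y : distinct_times y -> has_pde_derivatives A y /\ forall r : 'rV[R]_m.+1,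
  - 6^-1 * psi A y r + 2^-1 * Dr (fun s => psi A y s ^+ 2) r + 12^-1 * Dr (Dr (Dr (psi A y))) r
  - 3^-1 * \sum_(a < m.+1) r 0 a * partial a (psi A y) r
  - 2 / 3 * \sum_(a < m) y 0 a * partial a (fun y' => psi A y' r) y
  - \sum_(a < m) \sum_(b < m.+1 | b != lift ord0 a)
      y 0 a ^+ 2 * partial (lift ord0 a) (partial b (Psi A y)) r
  + \sum_(a < m) \sum_(b < m | b != a)
      y 0 a * y 0 b * partial (lift ord0 a) (partial (lift ord0 b) (Psi A y)) r = 0.
Proof.
move=> hy; split=> r.
  have [e e0 [sm _]] := local_smooth r hy.
  have lo : line_open (@dir R m.+1) (cube (emb y r) e).
    by apply: plane_line_open; exact: cube_plane_open (@dir_cc1 R m.+1).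
  have sPs := smooth_drsum sm; have sps := smooth_drsum sPs.
  have E b : partial b (Psi A y) = (fun r => ld (dir (Some (inr b))) (drsum LF) (emb y r)).
    by rewrite (Psi_drsum hy); apply/funext => r'; exact: partial_ld.
  split=> a; last by have [] := partial_y r a hy.
  - split=> [||b].
    + rewrite (_ : log_cdf A y = fun r => LF (emb y r)); last first.
        by apply/funext => r'; apply: log_cdfE; exact: distinct_emb.
      exact: has_partial_r e0 sm.
    + by rewrite (Psi_drsum hy); exact: has_partial_r e0 sPs.
    + by rewrite E; apply: has_partial_r e0 _; exact: smooth_ld.
  - split.
    + by rewrite (psi_drsum hy); exact: has_partial_r e0 sps.
    + by rewrite (Dr_psi hy); exact: has_partial_r e0 (smooth_drsum sps).
    + by rewrite (Dr2_psi hy); exact: has_partial_r e0 (smooth_drsum (smooth_drsum sps)).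
have [e e0 [sm]] := local_smooth r hy.
have lo : line_open (@dir R m.+1) (cube (emb y r) e).
  by apply: plane_line_open; exact: cube_plane_open (@dir_cc1 R m.+1).
have sPs := smooth_drsum sm; have sps := smooth_drsum sPs.
pose G a b := dr a (dr b (drsum LF)) (emb y r).
have psG a : dr a (drsum (drsum LF)) (emb y r) = \sum_b G a b.
  apply: is_ldE; apply: is_ld_sum => b.
  exact: (smooth_diffb lo (smooth_ld lo (Some (inr b)) sPs) (Some (inr a)) (cube_center _ e0)).
have EG a b : partial a (partial b (Psi A y)) r = G a b.
  rewrite (_ : partial b (Psi A y) = (fun r => dr b (drsum LF) (emb y r))); last first.
    by rewrite (Psi_drsum hy); apply/funext => r'; exact: partial_ld.
  by rewrite partial_ld.
have -> : Dr (fun s => psi A y s ^+ 2) r = drsum (fun y => drsum (drsum LF) y ^+ 2) (emb y r).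
  have E : (fun s => psi A y s ^+ 2) = (fun r => drsum (drsum LF) (emb y r) ^+ 2) by rewrite (psi_drsum hy).
  by rewrite (Dr_drsum (F := fun x => drsum (drsum LF) x ^+ 2) E).
have Ea a : partial a (psi A y) r = dr a (drsum (drsum LF)) (emb y r).
  by rewrite (psi_drsum hy); exact: partial_ld.
have S1 : \sum_(a < m.+1) r 0 a * partial a (psi A y) r =
    \sum_a rc a (emb y r) * dr a (drsum (drsum LF)) (emb y r).
  by apply: eq_bigr => a _; rewrite Ea.
have S2 : \sum_(a < m) y 0 a * partial a (fun y' => psi A y' r) y =
    \sum_a yc a (emb y r) * dy a (drsum (drsum LF)) (emb y r).
  rewrite [RHS]big_ord_recl yc_emb0 mul0r add0r; apply: eq_bigr => a _.
  by rewrite yc_embS (partial_y r a hy).2.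
have S3 : - (\sum_(a < m) \sum_(b < m.+1 | b != lift ord0 a)
      y 0 a ^+ 2 * partial (lift ord0 a) (partial b (Psi A y)) r)
  + \sum_(a < m) \sum_(b < m | b != a)
      y 0 a * y 0 b * partial (lift ord0 a) (partial (lift ord0 b) (Psi A y)) r =
   - (\sum_a yc a (emb y r) ^+ 2 * dr a (drsum (drsum LF)) (emb y r))
   + \sum_b \sum_a yc b (emb y r) * yc a (emb y r) * G b a.
  under [\sum_a _ * dr _ _ _]eq_bigr do rewrite psG.
  have L1 : \sum_(a < m) \sum_(b < m.+1 | b != lift ord0 a) y 0 a ^+ 2 * partial (lift ord0 a) (partial b (Psi A y)) r =
      \sum_(a < m) \sum_(b < m.+1 | b != lift ord0 a) yc (lift ord0 a) (emb y r) ^+ 2 * G (lift ord0 a) b.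
    by apply: eq_bigr => a _; apply: eq_bigr => b _; rewrite EG yc_embS.
  have L2 : \sum_(a < m) \sum_(b < m | b != a)
        y 0 a * y 0 b * partial (lift ord0 a) (partial (lift ord0 b) (Psi A y)) r =
      \sum_(a < m) \sum_(b < m | b != a)
        yc (lift ord0 a) (emb y r) * yc (lift ord0 b) (emb y r) * G (lift ord0 a) (lift ord0 b).
    by apply: eq_bigr => a _; apply: eq_bigr => b _; rewrite EG !yc_embS.
  rewrite L1 L2; exact: (off_diagonal G (yc_emb0 y r)).
have S4 : Dr (Dr (Dr (psi A y))) r = drsum (drsum (drsum (drsum (drsum LF)))) (emb y r).
  by rewrite (Dr_drsum (Dr2_psi hy)).
have S5 : psi A y r = drsum (drsum LF) (emb y r) := congr1 (fun f => f r) (psi_drsum hy).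
have transfer (p p' q w w' s1 s1' s2 s2' u1 u2 v1 v2 : R) : p' = p -> w' = w -> s1' = s1 -> s2' = s2 ->
    - u1 + u2 = - v1 + v2 ->
    - 6^-1 * p + 2^-1 * q + 12^-1 * w - 3^-1 * s1 - 2 / 3 * s2 - v1 + v2 = 0 ->
    - 6^-1 * p' + 2^-1 * q + 12^-1 * w' - 3^-1 * s1' - 2 / 3 * s2' - u1 + u2 = 0.
  by move=> -> -> -> -> E; rewrite -!addrA E.
exact: transfer S5 S4 S1 S2 S3.
Qed.
End JointEquation.

(** * One-point asymptotics *)

Section HalfLine.
Context {R : realType}.

Lemma halfline_nondecreasing (f f' : R -> R) (a : R) : (forall s : R, a <= s -> is_derive s 1 f (f' s)) ->
  (forall s, a <= s -> 0 <= f' s) -> forall s t, a <= s -> s <= t -> f s <= f t.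
Proof.
move=> df f0 s t as_ st.
have inI x : x \in `[s, t] -> a <= x by rewrite in_itv /= => /andP[sx _]; exact: le_trans sx.
have H x : x \in `]s, t[ -> is_derive x 1 f (f' x) by move=> /subset_itv_oo_cc xi; apply/df/inI.
have C : {within `[s, t], continuous f}.
  by apply: derivable_within_continuous => x xi; have := df x (inI x xi) => ?; exact: ex_derive.
have [c ci E] := MVT_segment st H C.
by rewrite -subr_ge0 E mulr_ge0 ?subr_ge0 // f0 // inI.
Qed.

Lemma halfline_nonincreasing (f f' : R -> R) (a : R) : (forall s : R, a <= s -> is_derive s 1 f (f' s)) ->
  (forall s, a <= s -> f' s <= 0) -> forall s t, a <= s -> s <= t -> f t <= f s.
Proof.
move=> df f0 s t as_ st; rewrite -lerN2.
apply: (@halfline_nondecreasing (fun s => - f s) (fun s => - f' s) a) => // x ax; first exact: drvN (df x ax).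
by rewrite oppr_ge0 f0.
Qed.

Lemma le0_exp_decay (x C s : R) : (forall t, s <= t -> x <= C * expR (- t)) -> x <= 0.
Proof.
move=> H; rewrite leNgt; apply/negP => x0.
have := H (Num.max s (C / x)); rewrite le_max lexx => /(_ isT).
set t := Num.max _ _; have h : C <= x * t.
  by rewrite mulrC -ler_pdivrMr // /t le_max lexx orbT.
rewrite expRN ler_pdivlMr ?expR_gt0 // => h2.
have := expR_ge1Dx t => h3; have := ler_wpM2l (ltW x0) h3; nra.
Qed.
End HalfLine.

(** * Decay of the Airy function *)

Section AiryDecay.
Context {R : realType} (sg R0 : R).
Hypothesis sgsg : sg * sg = 1.
(** The sign of Ai near +oo is left open: [sg] is 1 or -1, chosen in [hastings_mcleod_sign] so that
    [sg * Ai] is positive there. It drops out in the end, where q enters through its square. *)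
Definition sairy k (s : R) : R := sg * airyD k s.
Hypothesis R04 : 4 <= R0.
Hypothesis sairy_pos : forall s, R0 <= s -> 0 < sairy 0 s.

Lemma sairy_derive k (s : R) : is_derive s 1 (sairy k) (sairy k.+1 s).
Proof.
by apply: (drv_eq (drvM (drv_cst sg s) (airyD_derive k s))); rewrite mul0r add0r.
Qed.

Lemma sairy2 s : sairy 2 s = s * sairy 0 s.
Proof. by rewrite /sairy airyD2 mulrCA. Qed.

Lemma sairy_bound eta : 0 < eta -> exists2 C, 0 <= C & forall k s, `|sairy k s| <= C * k`!%:R * expR (- eta * s).
Proof.
move=> e0; have [C C0 H] := airyD_bound e0; exists C => // k s.
have sg1 : `|sg| = 1 by apply/eqP; rewrite -(@eqrXn2 _ 2) // -normrX expr2 sgsg normr1 expr1n.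
rewrite normrM sg1 mul1r; apply: le_trans (H k s) _.
by rewrite mulNr.
Qed.

(** The derivative of [G] carries the factor t - eta^2 >= 0 and the positive function [sg * Ai], so
    [G] is nondecreasing; it tends to 0 at +oo and is therefore at most 0. The assumption 4 <= R0
    makes the rate eta = 2 available. *)
Lemma sairy_logder eta s : 0 <= eta -> eta ^+ 2 <= R0 -> R0 <= s -> sairy 1 s <= - eta * sairy 0 s.
Proof.
move=> e0 eR Rs; have [C C0 H] := sairy_bound (@ltr01 R).
pose G (s : R) := expR (- eta * s) * (sairy 1 s + eta * sairy 0 s).
have dG (t : R) : is_derive t 1 G (expR (- eta * t) * ((t - eta ^+ 2) * sairy 0 t)).
  have D := drvM (drv_exp (drvM (drv_cst (- eta) t) (drv_id t)))
    (drvD (sairy_derive 1 t) (drvM (drv_cst eta t) (sairy_derive 0 t))).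
  by apply: (drv_eq D); rewrite sairy2; ring.
have G0 : G s <= 0.
  apply: (@le0_exp_decay _ _ (C + eta * C) s) => t st.
  apply: le_trans (_ : G t <= _).
    apply: (@halfline_nondecreasing _ _ _ R0 (fun t _ => dG t)) => // u Ru.
    rewrite mulr_ge0 ?expR_ge0 // mulr_ge0 ?subr_ge0 ?(le_trans eR) //; exact/ltW/sairy_pos.
  have t0 : 0 <= t by move: R04 Rs st; lra.
  have h1 : expR (- eta * t) <= 1 by rewrite -expR0 ler_expR mulNr oppr_le0 mulr_ge0.
  have h2 := H 0%N t; have h3 := H 1%N t; move: h2 h3; rewrite fact0 !mulr1 mulN1r => h2 h3.
  apply: le_trans (ler_norm _) _; rewrite normrM ger0_norm ?expR_ge0 //.
  rewrite -[leRHS]mul1r ler_pM ?expR_ge0 // mulrDl (le_trans (ler_normD _ _)) // lerD //.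
  by rewrite normrM ger0_norm // -mulrA ler_wpM2l.
by move: G0; rewrite /G pmulr_rle0 ?expR_gt0 // mulNr; move: (sairy 1 s) (eta * _) => x y; lra.
Qed.

Lemma sairy_decay eta s x : 0 <= eta -> eta ^+ 2 <= R0 -> R0 <= s -> 0 <= x ->
  sairy 0 (s + x) <= sairy 0 s * expR (- eta * x).
Proof.
move=> e0 eR Rs x0; pose G (s : R) := expR (eta * s) * sairy 0 s.
have dG (t : R) : is_derive t 1 G (expR (eta * t) * (sairy 1 t + eta * sairy 0 t)).
  have D := drvM (drv_exp (drvM (drv_cst eta t) (drv_id t))) (sairy_derive 0 t).
  by apply: (drv_eq D); ring.
have sx : s <= s + x by rewrite lerDl.
have := @halfline_nonincreasing _ _ _ R0 (fun t _ => dG t) _ s (s + x) Rs sx.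
rewrite /G mulrDr expRD => H.
have {}H : expR (eta * s) * expR (eta * x) * sairy 0 (s + x) <= expR (eta * s) * sairy 0 s.
  apply: H => t Rt; rewrite pmulr_rle0 ?expR_gt0 //.
  by have := sairy_logder e0 eR Rt; rewrite mulNr; move: (sairy 1 t) (eta * _) => y z; lra.
by move: H; rewrite -mulrA ler_pM2l ?expR_gt0 // mulNr expRN ler_pdivlMr ?expR_gt0 // mulrC.
Qed.

(** Here [G] is nonincreasing, by the bound with eta = 1, and tends to 0, hence it is nonnegative;
    the sign of the first derivative is known from the same bound. *)
Lemma sairy1_bound s : R0 <= s -> `|sairy 1 s| <= (s + 1) * sairy 0 s.
Proof.
move=> Rs; have [C C0 H] := sairy_bound (@ltr0Sn R 1).
have s0 t : s <= t -> 0 <= t by move: R04 Rs; lra.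
have R1 : (1 : R) ^+ 2 <= R0 by rewrite expr1n; move: R04; lra.
have l1 t (Rt : R0 <= t) := sairy_logder ler01 R1 Rt.
have a1 : sairy 1 s <= 0.
  by apply: le_trans (l1 s Rs) _; rewrite mulN1r oppr_le0 ltW // sairy_pos.
rewrite ler0_norm //.
pose G (s : R) := sairy 1 s + (s + 1) * sairy 0 s.
have dG (t : R) : is_derive t 1 G ((t + 1) * (sairy 0 t + sairy 1 t)).
  have D := drvD (sairy_derive 1 t) (drvM (drvD (drv_id t) (drv_cst 1 t)) (sairy_derive 0 t)).
  by apply: (drv_eq D); rewrite sairy2; ring.
have G0 : - G s <= 0.
  apply: (@le0_exp_decay _ _ (C + C) s) => t st; have t0 := s0 t st.
  apply: le_trans (_ : - G t <= _).
    rewrite lerN2; apply: (@halfline_nonincreasing _ _ _ R0 (fun t _ => dG t)) => // u Ru.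
    rewrite pmulr_rle0; first by have := l1 u Ru; rewrite mulN1r; move: (sairy 0 u) (sairy 1 u) => y z; lra.
    by move: R04 Ru; lra.
  have e2 : expR (- 2 * t) = expR (- t) * expR (- t) by rewrite -expRD; congr expR; ring.
  have h2 := H 0%N t; have h3 := H 1%N t; move: h2 h3; rewrite fact0 !mulr1 e2 => h2 h3.
  have e1 : expR (- t) <= 1 by rewrite -expR0 ler_expR oppr_le0.
  have te : (t + 1) * expR (- t) <= 1 by rewrite expRN ler_pdivrMr ?expR_gt0 // mul1r addrC expR_ge1Dx.
  apply: le_trans (ler_norm _) _; rewrite normrN (le_trans (ler_normD _ _)) // [(C + C) * _]mulrDl lerD //.
    by rewrite (le_trans h3) // mulrA -[leRHS]mulr1 ler_wpM2l // mulr_ge0 // expR_ge0.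
  rewrite normrM ger0_norm ?addr_ge0 //.
  apply: le_trans (ler_wpM2l _ h2) _; first by rewrite addr_ge0.
  have -> : (t + 1) * (C * (expR (- t) * expR (- t))) = C * expR (- t) * ((t + 1) * expR (- t)) by ring.
  by rewrite -[leRHS]mulr1 ler_wpM2l // mulr_ge0 // expR_ge0.
by move: G0; rewrite /G; move: (sairy 1 s) (_ * _) => x y; lra.
Qed.
End AiryDecay.


(** * Trace and remainder of the one-point determinant *)

Section OnePointTerms.
Context {R : realType}.

Lemma det_trace_split n (X : 'M[R]_n) : \det (1%:M + X) = 1 + \tr X +
  \sum_(k < n) ((k.+2)`!%:R)^-1 * \sum_(z : {ffun 'I_k.+2 -> 'I_n}) \det (\matrix_(a, b) X (z a) (z b)).
Proof.
rewrite (@von_Koch R n X n.+2) // big_ord_recl /= big_ord_recl /= addrA; congr (_ + _ + _).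
  rewrite (eq_bigr (fun=> 1)) => [|z _]; last by rewrite det_mx00.
  by rewrite sumr_const card_ffun !card_ord expn0 fact0 invr1 mul1r.
have -> : (bump 0 0)`! = 1%N by [].
have <- : \sum_(z : {ffun 'I_1 -> 'I_n}) \prod_(i < 1) X (z i) (z i) = \tr X.
  by rewrite -(bigA_distr_bigA (fun (_ : 'I_1) a => X a a)) big_ord1.
by rewrite invr1 mul1r; apply: eq_bigr => z _; rewrite big_ord1 det_mx11 mxE.
Qed.

Variables (sg R0 : R).
Hypothesis sgsg : sg * sg = 1.
Notation a := (sairy sg).
Hypothesis R04 : 4 <= R0.
Hypothesis a_pos : forall s, R0 <= s -> 0 < a 0 s.

Notation V := (space (R := R) 1).
Definition rdir (_ : unit) : V := dir (Some (inr ord0)).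
(** The bounds have to show the decay at +oo, hence an unbounded set of levels instead of a cube. *)
Definition above r (x : V) : Prop := kc x = 1 /\ r < rc ord0 x.
Definition one_sign (_ _ : 'I_1) : R := 1.
(** Bounds the kernel and, up to a factor 2, its first two derivatives above [r]. The factor r + 2
    comes from [sairy1_bound]. *)
Definition weight_sq r : R := (r + 2) * a 0 r ^+ 2.

Lemma above_open r : line_open rdir (above r).
Proof.
move=> x [] [k1 rx]; apply/nbhs_ballP; exists (rc ord0 x - r); first by rewrite /= subr_gt0.
move=> t; rewrite /ball /= sub0r normrN => tr; split.
  by rewrite kcE kc_dir mulr0 addr0.
rewrite rcE rc_dir eqxx mulr1; move: tr; rewrite ltr_norml => /andP[]; lra.
Qed.

Lemma rc1 (i : 'I_1) (x : V) : rc i x = rc ord0 x.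
Proof. by rewrite ord1. Qed.

Lemma pos_above N L (g : grid 1 L) r x : above r x -> r + ofs N g <= pos N g x /\ r < pos N g x.
Proof.
move=> [k1 rx]; rewrite posE k1 mulr1 rc1; have := ofs_ge0 (R := R) N g.
by move: (ofs N g) (rc ord0 x) rx => o u ru o0; split; lra.
Qed.

Lemma pos_rdir N L (g : grid 1 L) i : pos N g (rdir i) = 1.
Proof. by rewrite posE rc1 rc_dir eqxx kc_dir mulr0 addr0. Qed.

Lemma airyD_sairy p q u w : airyD p u * airyD q w = a p u * a q w.
Proof.
by rewrite /sairy [RHS]mulrACA sgsg mul1r.
Qed.

Opaque sairy.

Lemma a0_decay r u : R0 <= r -> r <= u -> a 0 u <= a 0 r * expR (- 2 * (u - r)).
Proof.
move=> Rr ru; have := @sairy_decay R sg R0 sgsg R04 a_pos 2 r (u - r) _ _ Rr.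
rewrite [r + _]addrC subrK; apply; rewrite ?subr_ge0 //; move: R04; lra.
Qed.

Lemma a0_ge0 u : R0 <= u -> 0 <= a 0 u.
Proof. by move=> /a_pos /ltW. Qed.

Lemma a0_weight r u o : R0 <= r -> r < u -> r + o <= u -> a 0 u <= a 0 r * expR (- 2 * o).
Proof.
move=> Rr ru ou; apply: le_trans (a0_decay Rr (ltW ru)) _.
by rewrite ler_wpM2l ?a0_ge0 // ler_expR !mulNr lerN2 ler_pM2l //; lra.
Qed.

Lemma a1_weight r u o : R0 <= r -> r < u -> r + o <= u -> `|a 1 u| <= (r + 2) * a 0 r * expR (- o).
Proof.
move=> Rr ru ou; have Ru : R0 <= u by rewrite (le_trans Rr) // ltW.
apply: le_trans (sairy1_bound sgsg R04 a_pos Ru) _.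
have u1 : 0 <= u + 1 by move: R04; lra.
apply: le_trans (ler_wpM2l u1 (a0_decay Rr (ltW ru))) _.
set t := u - r; have t0 : 0 <= t by rewrite subr_ge0 ltW.
have -> : - 2 * t = - t + - t by ring.
rewrite expRD.
have h1 : expR (- t) <= expR (- o) by rewrite ler_expR lerN2 /t; lra.
have h2 : (u + 1) * expR (- t) <= r + 2.
  have -> : u = r + t by rewrite /t; ring.
  rewrite expRN ler_pdivrMr ?expR_gt0 //; have := expR_ge1Dx t.
  have r0 : 0 <= r by move: R04 Rr; lra.
  by move: (expR t) => E hE; nra.
have -> : (u + 1) * (a 0 r * (expR (- t) * expR (- t))) = ((u + 1) * expR (- t)) * a 0 r * expR (- t) by ring.
apply: ler_pM => //; rewrite ?expR_ge0 //.
  by rewrite mulr_ge0 ?a0_ge0 // mulr_ge0 // expR_ge0.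
by rewrite ler_wpM2r ?a0_ge0.
Qed.

Definition entry N L (g g' : grid 1 L) x := entryJ N one_sign 0 0 0 g g' x.

Let ok1 r (x : V) (i j : 'I_1) : above r x -> airyK_ok (one_sign i j) (yc i x - yc j x).
Proof. by move=> _; exact: airyK_ok1. Qed.

Lemma entry_ld N L (g g' : grid 1 L) r i x : above r x ->
  is_ld (rdir i) (entry N g g') x (- (a 0 (pos N g x) * a 0 (pos N g' x))).
Proof.
move=> ux; apply: is_ld_eq (entryJ_ld N (@ok1 r) 0 0 0 g g' (rdir i) ux) _.
rewrite !pos_rdir -airyD_sairy -(entryJ_FTC N (@ok1 r) g g' ux).
have -> : g'.1 = g.1 by rewrite [g.1]ord1 [g'.1]ord1.
by rewrite !subrr !mul1r oppr0 !mul0r.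
Qed.

Lemma pos_ld N L (g : grid 1 L) k i x : is_ld (rdir i) (fun x => a k (pos N g x)) x (a k.+1 (pos N g x)).
Proof.
have D := drvD (drv_cst (pos N g x) 0) (drvM (drv_id (0 : R)) (drv_cst 1 0)).
have Dk : is_derive (pos N g x + 0 * 1) 1 (a k) (a k.+1 (pos N g x)).
  by rewrite mul0r addr0; exact: sairy_derive.
apply: (drv_eq (drv_ext _ (drv_comp D Dk))); last by ring.
by move=> t /=; rewrite pos_linear pos_rdir.
Qed.

Lemma prod_ld N L (g g' : grid 1 L) i x :
  is_ld (rdir i) (fun x => a 0 (pos N g x) * a 0 (pos N g' x)) x
   (a 1 (pos N g x) * a 0 (pos N g' x) + a 0 (pos N g x) * a 1 (pos N g' x)).
Proof. exact: is_ldM (pos_ld N g 0 i x) (pos_ld N g' 0 i x). Qed.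

Definition wt N L (g : grid 1 L) : R := expR (- ofs N g).

Lemma weight_sq_ge0 r : R0 <= r -> 0 <= weight_sq r.
Proof. by move=> Rr; rewrite mulr_ge0 ?exprn_ge0 ?a0_ge0 //; move: R04 Rr; lra. Qed.

Section Bounds.
Variables (N L : nat) (g g' : grid 1 L) (r : R) (x : V).
Hypothesis Rr : R0 <= r.
Hypothesis ux : above r x.

Let e2 (h : grid 1 L) : expR (- 2 * ofs N h) <= wt N h.
Proof. by rewrite ler_expR; have := ofs_ge0 (R := R) N h; lra. Qed.

Let pR (h : grid 1 L) : R0 <= pos N h x.
Proof. by have [_ /ltW] := @pos_above N L h r x ux; exact: le_trans. Qed.

Let ap (h : grid 1 L) : a 0 (pos N h x) <= a 0 r * wt N h.
Proof.
have [p1 p2] := @pos_above N L h r x ux.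
by apply: le_trans (a0_weight Rr p2 p1) _; rewrite ler_wpM2l ?a0_ge0 ?e2.
Qed.

Let a2 (h h' : grid 1 L) : a 0 (pos N h x) * a 0 (pos N h' x) <= a 0 r ^+ 2 * (wt N h * wt N h').
Proof. rewrite expr2 [leRHS]mulrACA.
by apply: ler_pM; rewrite ?a0_ge0 ?pR.
 Qed.

Let sq : a 0 r ^+ 2 <= weight_sq r.
Proof. by rewrite /weight_sq ler_peMl ?exprn_ge0 ?a0_ge0 //; move: R04 Rr; lra. Qed.

Let ww (h h' : grid 1 L) : 0 <= wt N h * wt N h'. Proof. by rewrite mulr_ge0 ?expR_ge0. Qed.

Lemma prod_bound : `|a 0 (pos N g x) * a 0 (pos N g' x)| <= weight_sq r * (wt N g * wt N g').
Proof.
rewrite ger0_norm; last by rewrite mulr_ge0 // a0_ge0.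
by apply: le_trans (a2 g g') _; rewrite ler_wpM2r.
Qed.

Lemma prod1_bound : `|a 1 (pos N g x) * a 0 (pos N g' x) + a 0 (pos N g x) * a 1 (pos N g' x)|
  <= 2 * weight_sq r * (wt N g * wt N g').
Proof.
have a1p (h : grid 1 L) : `|a 1 (pos N h x)| <= (r + 2) * a 0 r * wt N h.
  by have [p1 p2] := @pos_above N L h r x ux; exact: a1_weight.
have H (h h' : grid 1 L) : `|a 1 (pos N h x) * a 0 (pos N h' x)| <= weight_sq r * (wt N h * wt N h').
  rewrite normrM [`|a 0 _|]ger0_norm ?a0_ge0 //.
  apply: le_trans (ler_pM (normr_ge0 _) (a0_ge0 (pR h')) (a1p h) (ap h')) _.
  by rewrite /weight_sq expr2 le_eqVlt; apply/orP; left; apply/eqP; ring.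
have H2 : `|a 0 (pos N g x) * a 1 (pos N g' x)| <= weight_sq r * (wt N g * wt N g').
  by rewrite mulrC [wt N g * _]mulrC; exact: H.
apply: le_trans (ler_normD _ _) (le_trans (lerD (H g g') H2) _).
by rewrite -mulrA mulr_natl mulr2n.
Qed.

Transparent airyK.
Lemma entry_bound1 : `|entry N g g' x| <= weight_sq r * (wt N g * wt N g').
Proof.
have [p1 p2] := @pos_above N L g r x ux; have [p1' p2'] := @pos_above N L g' r x ux.
rewrite /entry /entryJ [g.1]ord1 [g'.1]ord1 subrr /airyK /one_sign mul1r.
set u := pos N g x in p1 p2 *; set w := pos N g' x in p1' p2' *.
have dom : exp_dominated 0 4 (a 0 r ^+ 2 * (wt N g * wt N g')) (airyK_integrand 1 0 0 0 0 u w).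
  split=> [|l l0]; first by apply: airyK_integrand_continuous; rewrite mulr1.
  rewrite /airyK_integrand !mul1r ?expr0 mulr0 oppr0 expR0 !mul1r airyD_sairy.
  have Ru : R0 <= u + l by apply: le_trans (pR g) _; rewrite lerDl.
  have Rw : R0 <= w + l by apply: le_trans (pR g') _; rewrite lerDl.
  rewrite ger0_norm; last by rewrite mulr_ge0 // a0_ge0.
  have aw (h : grid 1 L) l' : 0 <= l' -> a 0 (pos N h x + l') <= a 0 r * wt N h * expR (- 2 * l').
    move=> l0'; apply: le_trans (_ : a 0 (pos N h x) * expR (- 2 * l') <= _).
      have := a0_decay (pR h) (_ : pos N h x <= pos N h x + l'); rewrite lerDl [_ + l' - _]addrAC subrr add0r.
      exact.
    by rewrite ler_wpM2r ?expR_ge0.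
  apply: le_trans (ler_pM (a0_ge0 Ru) (a0_ge0 Rw) (aw g l l0) (aw g' l l0)) _.
  have -> : - 4 * l = - 2 * l + - 2 * l by ring.
  by rewrite expRD expr2 le_eqVlt; apply/orP; left; apply/eqP; ring.
apply: le_trans (exp_dominated_bound _ dom) _; first by [].
rewrite mulr0 expR0 mulr1 ler_pdivrMr //; apply: le_trans (ler_wpM2r (ww g g') sq) _.
by rewrite ler_peMr ?ler1n // mulr_ge0 // weight_sq_ge0.
Qed.
Opaque airyK.
End Bounds.

(** Written in the shape that [smooth_bound_det] expects, with m = 0 and rho = 1. *)
Lemma entry_smooth r N L (g g' : grid 1 L) : R0 <= r ->
  smooth_bound rdir 2 (above r)
    (fun n => (0 + n)`!%:R * 1 ^+ (0 + n) * weight_sq r * (wt N g * wt N g')) (entry N g g').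
Proof.
move=> Rr; split=> [x ux|i]; first by rewrite /= expr1n !mul1r; exact: entry_bound1.
exists (fun x => - (a 0 (pos N g x) * a 0 (pos N g' x))) => [x ux|]; first exact: entry_ld ux.
split=> [x ux|j]; first by rewrite normrN /shiftb /= expr1n !mul1r; exact: prod_bound.
exists (fun x => - (a 1 (pos N g x) * a 0 (pos N g' x) + a 0 (pos N g x) * a 1 (pos N g' x))).
  by move=> x ux; apply: is_ldN; exact: prod_ld.
split=> // x ux; rewrite normrN /shiftb expr1n mulr1; exact: prod1_bound.
Qed.
End OnePointTerms.


Section OnePointAsymptotics.
Context {R : realType}.
Variables (sg R0 : R).
Hypothesis sgsg : sg * sg = 1.
Notation a := (sairy sg).
Hypothesis R04 : 4 <= R0.
Hypothesis a_pos : forall s, R0 <= s -> 0 < a 0 s.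
Notation V := (space (R := R) 1).
Notation wsq := (weight_sq sg).

Lemma wt_mass N L : (0 < N)%N -> N%:R^-1 * \sum_(g : grid 1 L) wt N.-1 g ^+ 2 <= 2 :> R.
Proof.
move=> N0; rewrite -(pair_bigA _ (fun i o => wt N.-1 ((i, o) : grid 1 L) ^+ 2)) /= big_ord1.
rewrite /wt /ofs /= prednK //.
have N1 : 0 < (N%:R^-1 : R) by rewrite invr_gt0 ltr0n.
have := @exp_riemann_bound R 0 2 N%:R^-1 L (ltr0Sn _ 1) N1.
rewrite mulr0 expR0 mul1r => H.
rewrite (eq_bigr (fun j : 'I_L => expR (- 2 * (0 + j%:R * N%:R^-1)))) => [|j _]; last first.
  by rewrite -expRM_natl add0r; congr expR; rewrite -mulr_natl; ring.
apply: le_trans H _; have : N%:R^-1 <= (1 : R) by rewrite invf_le1 ?ltr0n // ler1n.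
by move: (N%:R^-1) => n; lra.
Qed.

Lemma wt_ge0 N L (g : grid 1 L) : 0 <= wt N g :> R.
Proof. exact: expR_ge0. Qed.

(** The terms of order at least 2 in von Koch's expansion; being at least quadratic in the kernel,
    they are negligible against the trace at +oo. *)
Definition remainder N L (x : V) : R := \sum_(k < #|grid 1 L|) ((k.+2)`!%:R)^-1 *
  \sum_(z : {ffun 'I_k.+2 -> 'I_#|grid 1 L|}) (- N.+1%:R^-1) ^+ k.+2 *
    \det (\matrix_(i, j) entry N (enum_val (z i)) (enum_val (z j)) x).

Definition trace_term N L (x : V) : R := - (N.+1%:R^-1 * \sum_(g : grid 1 L) entry N g g x).

Lemma det_decomposition N L (x : V) : kc x = 1 ->
  \det (entry_mx L N one_sign x) = 1 + trace_term N L x + remainder N L x.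
Proof.
move=> k1; rewrite /entry_mx det_trace_split; congr (_ + _ + _).
  rewrite /mxtrace /trace_term (big_enum_val (fun g => entry N g g x)) /= mulr_sumr -sumrN.
  by apply: eq_bigr => i _; rewrite !mxE /step_size k1 mul1r mulNr.
apply: eq_bigr => k _; congr (_ * _); apply: eq_bigr => z _; rewrite -detZ; congr (\det _).
by apply/matrixP => i j; rewrite !mxE /step_size k1 mul1r.
Qed.

Lemma remainder_smooth : exists2 S, 0 <= S & forall r N L, R0 <= r -> wsq r <= 1 ->
  smooth_bound rdir 2 (above r) (fun _ => S * wsq r ^+ 2) (remainder N L).
Proof.
(* One factor 2 is for the mass of the weights, one for [rising_le]. The 8 below is the largest j!
   2^j with j <= 2. *)
have [M sM HM] := @had_summable R 4 (ler0n _ 4).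
have M0 k : 0 <= M k by apply: le_trans (HM k); rewrite divr_ge0 // mulr_ge0 ?had_ge0 // exprn_ge0.
have lM : 0 <= limn (series M).
  by apply: limr_ge => //; apply: nearW => k; rewrite /series /=; apply: sumr_ge0.
exists (8 * limn (series M)); first by rewrite mulr_ge0.
move=> r N L Rr w1; set C := wsq r.
have C0 : 0 <= C by exact: (weight_sq_ge0 R04 a_pos).
pose w (i : 'I_#|grid 1 L|) : R := wt N (enum_val i).
have w0 i : 0 < w i by exact: expR_gt0.
have HE (i j : 'I_#|grid 1 L|) : smooth_bound rdir 2 (above r)
    (fun n => (0 + n)`!%:R * 1 ^+ (0 + n) * C * (w i * w j)) (entry N (enum_val i) (enum_val j)).
  exact: (entry_smooth sgsg R04 a_pos _ _ _ Rr).
have lo := @above_open R r.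
have HS := smooth_bound_sum (index_enum 'I_#|grid 1 L|) (P := xpredT)
  (fun (k : 'I_#|grid 1 L|) _ => smooth_boundZ ((k.+2)`!%:R^-1)
   (smooth_bound_sum (index_enum {ffun 'I_k.+2 -> 'I_#|grid 1 L|}) (P := xpredT)
     (fun z _ => smooth_boundZ ((- N.+1%:R^-1) ^+ k.+2)
      (@smooth_bound_det R _ _ rdir 2 (above r) k.+2 (fun i j => entry N (enum_val (z i)) (enum_val (z j)))
        (fun=> 0) (fun i => w (z i)) C 1 lo C0 ler01 (fun i => w0 (z i)) (fun i j => HE (z i) (z j)))))).
apply: (smooth_boundW _ _ HS) => // j jQ.
apply: le_trans (_ : _ <= \sum_(k < #|grid 1 L|) (8 * C ^+ 2 * M k.+2)) _; last first.
  rewrite -mulr_sumr mulrAC ler_wpM2r ?exprn_ge0 // ler_wpM2l //.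
  apply: le_trans (_ : series M #|grid 1 L|.+2 <= _).
    rewrite /series /= big_mkord big_ord_recl big_ord_recl addrA lerDr.
    by rewrite addr_ge0.
  by apply: (nondecreasing_cvgn_le _ sM); apply: nondecreasing_series => *; exact: M0.
apply: ler_sum => k _.
have mass := @wt_mass N.+1 L (ltn0Sn _); rewrite succnK in mass.
set mm := N.+1%:R^-1 * _ in mass.
have mm0 : 0 <= mm by rewrite mulr_ge0 // sumr_ge0 // => g _; rewrite exprn_ge0 // wt_ge0.
have Ez : \sum_(z : {ffun 'I_k.+2 -> 'I_#|grid 1 L|}) \prod_i w (z i) ^+ 2 =
    (\sum_(g : grid 1 L) wt N g ^+ 2) ^+ k.+2.
  rewrite -(bigA_distr_bigA (fun (_ : 'I_k.+2) g => w g ^+ 2)) prodr_const card_ord; congr (_ ^+ _).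
  by rewrite (big_enum_val (fun g => wt N g ^+ 2)) /= /w; apply: eq_big.
have -> : \sum_(z : {ffun 'I_k.+2 -> 'I_#|grid 1 L|}) `|(- N.+1%:R^-1) ^+ k.+2| *
    (had k.+2 * (\prod_(i < k.+2) (0`!%:R * 1 ^+ 0 * C)) * (\prod_i w (z i) ^+ 2) *
     (1 ^+ j * rising (\sum_(i < k.+2) 0 + k.+2) j)) =
   had k.+2 * C ^+ k.+2 * rising k.+2 j * mm ^+ k.+2.
  rewrite [mm ^+ k.+2]exprMn -Ez !mulr_sumr; apply: eq_bigr => z _.
  have -> : (\sum_(i < k.+2) 0 + k.+2)%N = k.+2 by rewrite big1.
  rewrite normrX normrN ger0_norm // fact0 expr0 !mul1r prodr_const card_ord expr1n mul1r.
  by ring.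
rewrite ger0_norm //.
have b1 : rising k.+2 j <= 8 * 2 ^+ k.+2 :> R.
  apply: le_trans (rising_le _ _) _; rewrite exprD mulrCA mulrC ler_wpM2r ?exprn_ge0 //.
  have : (j`! * 2 ^ j <= 8)%N by case: j jQ => [|[|[|j]]].
  by rewrite -(ler_nat R) natrM natrX.
have b2 : mm ^+ k.+2 <= 2 ^+ k.+2 by rewrite lerXn2r ?nnegrE.
have b4 : C ^+ k.+2 <= C ^+ 2 by rewrite ler_wiXn2l.
have hk := had_ge0 (R := R) k.+2.
have rg : 0 <= rising k.+2 j :> R by rewrite /rising; apply: prodr_ge0.
apply: le_trans (_ : (k.+2)`!%:R^-1 * (had k.+2 * C ^+ 2 * (8 * 2 ^+ k.+2) * 2 ^+ k.+2) <= _).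
  rewrite ler_wpM2l // ler_pM ?exprn_ge0 //.
    by rewrite mulr_ge0 // mulr_ge0 // exprn_ge0.
  apply: ler_pM => //; first by rewrite mulr_ge0 // exprn_ge0.
  by rewrite ler_wpM2l.
have -> : (k.+2)`!%:R^-1 * (had k.+2 * C ^+ 2 * (8 * 2 ^+ k.+2) * 2 ^+ k.+2) =
  8 * C ^+ 2 * (had k.+2 * 4 ^+ k.+2 / (k.+2)`!%:R).
  by rewrite (_ : 4 = 2 * 2 :> R) ?exprMn; ring.
by rewrite ler_wpM2l // mulr_ge0 // exprn_ge0.
Qed.

Definition trace_term1 N L (x : V) : R := N.+1%:R^-1 * \sum_(g : grid 1 L) (a 0 (pos N g x) * a 0 (pos N g x)).
Definition trace_term2 N L (x : V) : R := N.+1%:R^-1 *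
  \sum_(g : grid 1 L) (a 1 (pos N g x) * a 0 (pos N g x) + a 0 (pos N g x) * a 1 (pos N g x)).

Lemma trace_ld N L r i x : above r x -> is_ld (rdir i) (trace_term N L) x (trace_term1 N L x).
Proof.
move=> ux; have H := is_ldN (is_ldM (is_ld_cst (rdir i) (N.+1%:R^-1) x)
  (is_ld_sum (index_enum (grid 1 L)) (fun g => entry_ld sgsg N g g i ux))).
by apply: is_ld_eq H _; rewrite mul0r add0r sumrN mulrN opprK.
Qed.

Lemma trace1_ld N L i x : is_ld (rdir i) (trace_term1 N L) x (trace_term2 N L x).
Proof.
have H := is_ldM (is_ld_cst (rdir i) (N.+1%:R^-1) x)
  (is_ld_sum (index_enum (grid 1 L)) (fun g => prod_ld sg N g g i x)).
by apply: is_ld_eq H _; rewrite mul0r add0r.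
Qed.

Lemma trace_bounds N L r x : R0 <= r -> above r x ->
  `|trace_term N L x| <= 2 * wsq r /\ `|trace_term1 N L x| <= 2 * wsq r.
Proof.
move=> Rr ux; have mass := @wt_mass N.+1 L (ltn0Sn _); rewrite succnK in mass.
have C0 : 0 <= wsq r by exact: (weight_sq_ge0 R04 a_pos).
have H (f : grid 1 L -> R) : (forall g, `|f g| <= wsq r * (wt N g * wt N g)) ->
    `|N.+1%:R^-1 * \sum_g f g| <= 2 * wsq r.
  move=> fb; rewrite normrM ger0_norm //.
  apply: le_trans (_ : N.+1%:R^-1 * \sum_g (wsq r * (wt N g * wt N g)) <= _).
    by rewrite ler_wpM2l // (le_trans (ler_norm_sum _ _ _)) //; apply: ler_sum.
  have E : \sum_(g : grid 1 L) wt N g * wt N g = \sum_(g : grid 1 L) wt N g ^+ 2 :> R.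
    by apply: eq_bigr => g _; rewrite expr2.
  by rewrite -mulr_sumr E mulrCA mulrC ler_wpM2r.
split; first by rewrite normrN; apply: (H (fun g => entry N g g x)) => g; exact: (entry_bound1 sgsg R04 a_pos N g g Rr ux).
by apply: (H (fun g => a 0 (pos N g x) * a 0 (pos N g x))) => g; exact: (prod_bound sgsg R04 a_pos N g g Rr ux).
Qed.

Definition pt (s : R) : V := (0, const_mx s, 1).

Lemma pt_above r s : r < s -> above r (pt s).
Proof. by move=> rs; split=> //; rewrite /rc mxE. Qed.

Lemma det_approx1 N r x : above r x ->
  det_approx N x = 1 + trace_term N (N.+1 ^ 2) x + remainder N (N.+1 ^ 2) x.
Proof.
move=> [k1 _]; rewrite /det_approx -(det_decomposition _ _ k1).
have -> // : sgn_mx (fun i => yc i x) = one_sign.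
by apply/funext => i; apply/funext => j; rewrite /sgn_mx [i]ord1 [j]ord1 lexx.
Qed.

(** The second derivative of the trace is a Riemann sum for the integral of (a^2)' over the
    half-line above s; this produces the leading term. *)
Lemma trace2_cvg s : R0 <= s ->
  trace_term2 N (N.+1 ^ 2) (pt s) @[N --> \oo] --> - a 0 s ^+ 2.
Proof.
move=> Rs; have [C C0 HC] := sairy_bound sgsg (@ltr01 R).
pose f u := a 1 u * a 0 u + a 0 u * a 1 u.
have ct k u : {for u, continuous (a k)} by exact: drv_continuous (sairy_derive sg k u).
have cf : continuous f by move=> u; apply: cvgD; apply: cvgM; exact: ct.
have fb u : `|f u| <= 2 * (C * C) * expR (- 2 * u).
  have h0 := HC 0%N u; have h1 := HC 1%N u; move: h0 h1; rewrite fact0 !mulr1 => h0 h1.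
  have e2 : expR (- 2 * u) = expR (- 1 * u) * expR (- 1 * u) by rewrite -expRD; congr expR; ring.
  have h01 := ler_pM (normr_ge0 _) (normr_ge0 _) h1 h0.
  apply: le_trans (ler_normD _ _) _; rewrite [a 0 u * a 1 u]mulrC normrM e2.
  have -> : 2 * (C * C) * (expR (-1 * u) * expR (-1 * u)) =
    C * expR (-1 * u) * (C * expR (-1 * u)) + C * expR (-1 * u) * (C * expR (-1 * u)) by ring.
  exact: lerD.
have H := @riemann_sum_cvg R (fun=> f) f s 1 2 (2 * (C * C)) ltr01 (ltr0Sn _ 1) (fun _ u _ => fb u).
have := H _; have -> : \int[lebesgue_measure]_(u in `[s, +oo[) f u = - a 0 s ^+ 2.
  apply: (@half_line_FTC R s 2 (2 * (C * C)) f (fun u => a 0 u ^+ 2)) => //.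
  - move=> u; apply: (drv_eq (drvM (sairy_derive sg 0 u) (sairy_derive sg 0 u))).
    by rewrite /f.
  - have d0 := @exp_dominated_cvg0 R 0 1 C (a 0) ltr01 _.
    rewrite -[0](mulr0 (0 : R)); apply: cvgM; apply: d0; split=> // [u|u _]; try exact: ct.
    by have := HC 0%N u; rewrite fact0 mulr1.
    by have := HC 0%N u; rewrite fact0 mulr1.
move=> HH; have {}HH := HH (fun u v _ _ cv => cvg_comp _ _ cv (cf u)).
apply: cvg_trans HH; rewrite (_ : (fun N => trace_term2 N _ (pt s)) =
  (fun N => mesh 1 N * \sum_(j < N.+1 ^ 2) f (s + j%:R * mesh 1 N))) //.
apply/funext => N; rewrite /trace_term2 /mesh mul1r; congr (_ * _).
rewrite -(pair_bigA _ (fun i o => f (pos N ((i, o) : grid 1 _) (pt s)))) /= big_ord1.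
apply: eq_bigr => j _; rewrite posE /ofs /= /pt /kc /rc /= mxE mulr1.
by congr f; congr (_ + _); rewrite mulrC mulrC.
Qed.

Lemma wsq_bound : exists2 K, 0 <= K & forall r, R0 <= r ->
  wsq r <= K * expR (- r) /\ (r + 2) * wsq r <= K * expR (- r).
Proof.
have [C C0 HC] := sairy_bound sgsg (@ltr0Sn R 1).
exists (4 * C ^+ 2); first by rewrite mulr_ge0 // exprn_ge0.
move=> r Rr; have r0 : 0 <= r by move: R04 Rr; lra.
have h := HC 0%N r; rewrite fact0 mulr1 ger0_norm ?(ltW (a_pos Rr)) // in h.
have h2 : (r + 2) * wsq r <= 4 * C ^+ 2 * expR (- r).
  have e1 := expR_ge1Dx r; have E0 := expR_gt0 (- r).
  have rE : (r + 2) * expR (- r) <= 2.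
    by rewrite expRN ler_pdivrMr ?expR_gt0 //; move: (expR r) e1 => E e1; lra.
  have e1' : expR (- r) <= 1 by rewrite -expR0 ler_expR oppr_le0.
  have e2 : expR (- 2 * r) = expR (- r) * expR (- r) by rewrite -expRD; congr expR; ring.
  have aE : (r + 2) * a 0 r <= 2 * C * expR (- r).
    apply: le_trans (ler_wpM2l _ h) _; first by rewrite addr_ge0.
    rewrite e2; have -> : (r + 2) * (C * (expR (- r) * expR (- r))) = (r + 2) * expR (- r) * (C * expR (- r)) by ring.
    by rewrite -[leRHS]mulrA ler_wpM2r // mulr_ge0 // ltW.
  have rA0 : 0 <= (r + 2) * a 0 r by rewrite mulr_ge0 ?addr_ge0 // ltW // a_pos.
  rewrite /weight_sq; have -> : (r + 2) * ((r + 2) * a 0 r ^+ 2) = ((r + 2) * a 0 r) * ((r + 2) * a 0 r) by ring.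
  apply: le_trans (ler_pM rA0 rA0 aE aE) _.
  have -> : 2 * C * expR (- r) * (2 * C * expR (- r)) = 4 * C ^+ 2 * expR (- r) * expR (- r) by ring.
  by rewrite -[leRHS]mulr1 ler_wpM2l // !mulr_ge0 ?exprn_ge0 // ltW.
split=> //; apply: le_trans h2; rewrite ler_peMl //; last by lra.
exact: (weight_sq_ge0 R04 a_pos).
Qed.

Lemma left_limit_le (f : R -> R) (x s r0 : R) : r0 < s -> {for s, continuous f} ->
  (forall r, r0 <= r -> r < s -> x <= f r) -> x <= f s.
Proof.
move=> rs cf H; have c1 := cvg_at_left_filter cf.
rewrite -(cvg_lim (@Rhausdorff R) c1); apply: limr_ge; first by apply/cvg_ex; exists (f s).
near=> r; apply: H; last by near: r; exact: nbhs_left_lt.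
by near: r; apply: nbhs_left_ge.
Unshelve. all: by end_near.
Qed.
End OnePointAsymptotics.


Section OnePointDerivatives.
Context {R : realType}.
Variables (sg R0 : R).
Hypothesis sgsg : sg * sg = 1.
Notation a := (sairy sg).
Hypothesis R04 : 4 <= R0.
Hypothesis a_pos : forall s, R0 <= s -> 0 < a 0 s.
Notation V := (space (R := R) 1).
Notation wsq := (weight_sq sg).
Notation D := (ld (@rdir R tt)).

Lemma det_ld S r N x : R0 <= r -> wsq r <= 1 -> above r x ->
  smooth_bound rdir 2 (above r) (fun _ => S * wsq r ^+ 2) (remainder N (N.+1 ^ 2)) ->
  D (det_approx N) x = trace_term1 sg N (N.+1 ^ 2) x + D (remainder N (N.+1 ^ 2)) x.
Proof.
move=> Rr w1 ux sb; have lo := @above_open R r; have [dR _] := smooth_bound_ld tt lo sb.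
apply: is_ldE; apply: is_ld_near (_ : is_ld _ (fun x => 1 + trace_term N (N.+1 ^ 2) x + remainder N (N.+1 ^ 2) x) _ _).
  have := lo x tt ux; apply: filterS => t ut; exact/esym/(det_approx1 N ut).
apply: is_ld_eq (is_ldD (is_ldD (is_ld_cst _ _ _) (trace_ld sgsg N _ tt ux)) (dR _ ux)) _.
by rewrite add0r.
Qed.

Lemma det_ld2 S r N x : R0 <= r -> wsq r <= 1 -> above r x ->
  smooth_bound rdir 2 (above r) (fun _ => S * wsq r ^+ 2) (remainder N (N.+1 ^ 2)) ->
  D (D (det_approx N)) x = trace_term2 sg N (N.+1 ^ 2) x + D (D (remainder N (N.+1 ^ 2))) x.
Proof.
move=> Rr w1 ux sb; have lo := @above_open R r; have [_ sb1] := smooth_bound_ld tt lo sb.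
have [dR _] := smooth_bound_ld tt lo sb1.
apply: is_ldE; apply: is_ld_near (_ : is_ld _ (fun x => trace_term1 sg N (N.+1 ^ 2) x + D (remainder N (N.+1 ^ 2)) x) _ _).
  have := lo x tt ux; apply: filterS => t ut; exact/esym/(det_ld Rr w1 ut sb).
exact: (is_ldD (trace1_ld sg N _ tt x) (dR _ ux)).
Qed.

Notation F := (@fredholm_airy R 1).

Lemma distinct1 (x : V) : distinct x.
Proof. by move=> i j; rewrite [i]ord1 [j]ord1 eqxx. Qed.

(** The local theory shows that the derivatives of the approximations converge; their size is read
    off at finite N from the bounds on trace and remainder. *)
Lemma fredholm_near_infinity : exists2 S, 0 <= S & forall r s, R0 <= r -> wsq r <= 1 -> r < s ->
  [/\ `|F (pt s) - 1| <= S * wsq r, `|D F (pt s)| <= S * wsq r &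
      `|D (D F) (pt s) + a 0 s ^+ 2| <= S * wsq r ^+ 2].
Proof.
have [S S0 HS] := remainder_smooth sgsg R04 a_pos.
exists (2 + S); first by rewrite addr_ge0.
move=> r s Rr w1 rs.
have ux := pt_above rs; have lo := @above_open R r.
have w0 : 0 <= wsq r by exact: (weight_sq_ge0 R04 a_pos).
have sb N := HS r N (N.+1 ^ 2)%N Rr w1.
have ww : wsq r ^+ 2 <= wsq r by rewrite expr2 ler_piMl.
have [e e0 [_ HA _ HC]] := local_limit (@distinct1 (pt s)) (erefl _).
have rc1 (i : unit) j : `|cc j (@rdir R i)| <= 1 by exact: dir_cc1.
have rk (i : unit) : kc (@rdir R i) = 0 by rewrite kc_dir.
have [S' _ [rho _ sbA]] := HA _ (@rdir R) rc1 rk.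
have lc := plane_line_open (cube_plane_open (x0 := pt s) (e := e) rc1).
have lim0 := HC _ (cube_center (pt s) e0).
have lim1 := (smooth_cvg_lds (q := 0) (l := [:: tt]) lc (fun N => sbA _ N) HC).2 _ (cube_center (pt s) e0).
have lim2 := (smooth_cvg_lds (q := 0) (l := [:: tt; tt]) lc (fun N => sbA _ N) HC).2 _ (cube_center (pt s) e0).
have ar1 (p q w w' : R) : `|p| <= 2 * w -> `|q| <= S * w' -> w' <= w -> `|p + q| <= (2 + S) * w.
  move=> h1 h2 h3; apply: le_trans (ler_normD _ _) _; rewrite mulrDl lerD //.
  by apply: le_trans h2 _; exact: ler_wpM2l.
have sb1 N := (smooth_bound_ld tt lo (sb N)).2.
have sb2 N := (smooth_bound_ld tt lo (sb1 N)).2.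
split.
- apply: (cvgn_le_norm (cvgB lim0 (cvg_cst (1 : R)))); apply: nearW => N.
  have E : det_approx N (pt s) - 1 = trace_term N (N.+1 ^ 2) (pt s) + remainder N (N.+1 ^ 2) (pt s).
    by rewrite (det_approx1 N ux) addrAC [1 + _]addrC addrK.
  apply: le_trans (_ : `|det_approx N (pt s) - 1| <= _); first by [].
  rewrite E; apply: ar1 (trace_bounds sgsg R04 a_pos N _ Rr ux).1 _ ww.
  exact: (smooth_bound_lt0 ux (sb N)).
- apply: (cvgn_le_norm lim1); apply: nearW => N.
  rewrite /lds (det_ld Rr w1 ux (sb N)).
  apply: ar1 (trace_bounds sgsg R04 a_pos N _ Rr ux).2 _ ww.
  exact: (smooth_bound_lt0 ux (sb1 N)).
- have t2 := trace2_cvg sgsg (le_trans Rr (ltW rs)).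
  have H : (lds rdir [:: tt; tt] (det_approx N) (pt s) - trace_term2 sg N (N.+1 ^ 2) (pt s)) @[N --> \oo] -->
      D (D F) (pt s) + a 0 s ^+ 2.
    by rewrite -[a 0 s ^+ 2]opprK; exact: cvgB lim2 t2.
  apply: (cvgn_le_norm H); apply: nearW => N.
  rewrite /lds (det_ld2 Rr w1 ux (sb N)) addrAC subrr add0r.
  apply: le_trans (_ : S * wsq r ^+ 2 <= _); first exact: (smooth_bound_lt0 ux (sb2 N)).
  by rewrite ler_wpM2r ?exprn_ge0 // lerDr.
Qed.

Lemma wsq_continuous s : {for s, continuous wsq}.
Proof.
have d := sairy_derive sg 0 s.
have ca : {for s, continuous (a 0)} := drv_continuous d.
have c2 : {for s, continuous (fun r : R => r + 2)} by apply: cvgD; [exact: cvg_id|exact: cvg_cst].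
by apply: cvgM c2 _; rewrite expr2; apply: cvgM.
Qed.

Lemma one_point_asymptotics : exists2 S, 0 <= S & exists2 R1, R0 <= R1 & forall s, R1 < s ->
  [/\ `|F (pt s) - 1| <= S * expR (- s), `|D F (pt s)| <= S * expR (- s),
      `|D F (pt s)| <= S * ((s + 2) * a 0 s ^+ 2),
      `|D (D F) (pt s) + a 0 s ^+ 2| <= S * a 0 s ^+ 2 * expR (- s) &
      (s + 2) * ((s + 2) * a 0 s ^+ 2) <= S * expR (- s)].
Proof.
have [S S0 H] := fredholm_near_infinity; have [K K0 HK] := wsq_bound sgsg R04 a_pos.
exists (S + S * K + K); first by rewrite !addr_ge0 // mulr_ge0.
exists (Num.max R0 (ln (K + 1))); first by rewrite le_max lexx.
move=> s; rewrite gt_max => /andP[Rs Ks].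
have Kw r : R0 <= r -> ln (K + 1) <= r -> wsq r <= 1.
  move=> Rr Kr; apply: le_trans (HK r Rr).1 _; rewrite expRN ler_pdivrMr ?expR_gt0 // mul1r.
  apply: le_trans (_ : K + 1 <= _); first by lra.
  by rewrite -(@lnK _ (K + 1)) ?ler_expR // posrE; lra.
have cw := @wsq_continuous s; set r0 := Num.max R0 (ln (K + 1)).
have r0s : r0 < s by rewrite gt_max Rs.
have rr r : r0 <= r -> R0 <= r /\ wsq r <= 1 by rewrite ge_max => /andP[? ?]; split=> //; exact: Kw.
have c1 : {for s, continuous (fun r => S * wsq r)} by apply: cvgM cw; exact: cvg_cst.
have c2 : {for s, continuous (fun r => S * wsq r ^+ 2)}.
  by apply: cvgM; [exact: cvg_cst|rewrite expr2; exact: cvgM].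
(* The bounds are available for r < s, since [above r] is open; continuity of the weight lets r tend
   to s. *)
have G0 : `|F (pt s) - 1| <= S * wsq s.
  by apply: (left_limit_le r0s c1) => r /rr[h1 h2] h3; have [] := H r s h1 h2 h3.
have G1 : `|D F (pt s)| <= S * wsq s.
  by apply: (left_limit_le r0s c1) => r /rr[h1 h2] h3; have [] := H r s h1 h2 h3.
have G2 : `|D (D F) (pt s) + a 0 s ^+ 2| <= S * wsq s ^+ 2.
  by apply: (left_limit_le r0s c2) => r /rr[h1 h2] h3; have [] := H r s h1 h2 h3.
have [k1 k2] := HK s (ltW Rs); have E0 := expR_gt0 (- s).
have w0 : 0 <= wsq s by exact: (weight_sq_ge0 R04 a_pos (ltW Rs)).
have a2 : 0 <= a 0 s ^+ 2 by rewrite sqr_ge0.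
have SK : S * K <= S + S * K + K by lra.
have Sl : S <= S + S * K + K by rewrite -addrA lerDl addr_ge0 // mulr_ge0.
have Kl : K <= S + S * K + K by rewrite lerDr addr_ge0 // mulr_ge0.
have Sw : S * wsq s <= (S + S * K + K) * expR (- s).
  apply: le_trans (_ : S * K * expR (- s) <= _); first by rewrite -[leRHS]mulrA ler_wpM2l.
  by rewrite ler_wpM2r // ltW.
split.
- exact: le_trans Sw.
- exact: le_trans Sw.
- by apply: le_trans G1 _; rewrite ler_wpM2r.
- apply: le_trans G2 _; rewrite {1}[wsq s ^+ 2]expr2 {1}/weight_sq.
  have -> : S * ((s + 2) * a 0 s ^+ 2 * wsq s) = S * a 0 s ^+ 2 * ((s + 2) * wsq s) by ring.
  apply: le_trans (_ : S * a 0 s ^+ 2 * (K * expR (- s)) <= _).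
    by rewrite ler_wpM2l // mulr_ge0.
  have -> : S * a 0 s ^+ 2 * (K * expR (- s)) = S * K * (a 0 s ^+ 2 * expR (- s)) by ring.
  by rewrite -[leRHS]mulrA ler_wpM2r // mulr_ge0 // ltW.
- by apply: le_trans k2 _; rewrite ler_wpM2r // ltW.
Qed.
End OnePointDerivatives.

(** * Painleve II near infinity *)

Section PainleveAtInfinity.
Context {R : realType}.

Lemma large_exp_small (K e : R) : 0 < e -> exists M : R, forall s, M <= s -> K * expR (- s) <= e.
Proof.
move=> e0; exists (ln ((`|K| + 1) / e)) => s Ms.
have K1 : 0 < (`|K| + 1) / e by rewrite divr_gt0 // ltr_wpDl.
rewrite expRN ler_pdivrMr ?expR_gt0 //; apply: le_trans (_ : e * ((`|K| + 1) / e) <= _).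
  by rewrite mulrCA mulfV ?gt_eqF // mulr1; have := ler_norm K; lra.
by rewrite ler_pM2l // -[X in X <= _](@lnK _ ((`|K| + 1) / e)) ?posrE // ler_expR.
Qed.

(** The equation multiplied by p / 2 is an exact derivative. *)
Lemma first_integral (p p1 p2 : R -> R) :
  (forall s : R, is_derive s 1 p (p1 s)) -> (forall s : R, is_derive s 1 p1 (p2 s)) ->
  (forall s : R, is_derive s 1 p2 (12 * p s * p1 s + 4 * s * p1 s + 2 * p s)) ->
  exists c, forall s, p s * p2 s / 2 - p1 s ^+ 2 / 4 = c + s * p s ^+ 2 + 2 * p s ^+ 3.
Proof.
move=> d0 d1 d2.
pose f s := p s * p2 s * 2^-1 - p1 s * p1 s * 4^-1 - s * (p s * p s) - 2 * (p s * p s * p s).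
have df (x : R) : is_derive x 1 f 0.
  rewrite /f; have E0 := d0 x; have E1 := d1 x; have E2 := d2 x.
  by der; move: (p x) (p1 x) (p2 x) => a b c; field.
by exists (f 0) => s; rewrite (is_derive_0_is_cst 0 s df) /f; field.
Qed.

Lemma quad_derive (k l m f' t : R) (f : R -> R) : is_derive t 1 f f' ->
  is_derive t 1 (fun s => k * f s - l * (s - m) - (s - m) * (s - m) * 2^-1) (k * f' - l - (t - m)).
Proof. by move=> E; der => /=; field. Qed.

(* The constant of integration vanishes: otherwise the second derivative of v would eventually have a fixed sign and
   stay away from 0, and v could not tend to 0. *)
Lemma sqrt_painleve (p p1 p2 : R -> R) (R1 K : R) : 0 <= R1 ->
  (forall s : R, is_derive s 1 p (p1 s)) -> (forall s : R, is_derive s 1 p1 (p2 s)) ->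
  (forall s : R, is_derive s 1 p2 (12 * p s * p1 s + 4 * s * p1 s + 2 * p s)) ->
  (forall s, R1 <= s -> 0 < p s) -> (forall s, R1 <= s -> (s + 2) ^+ 2 * p s <= K * expR (- s)) ->
  exists v v1 : R -> R, forall s : R, R1 <= s ->
    [/\ 0 < v s, v s ^+ 2 = p s, is_derive s 1 v (v1 s) & is_derive s 1 v1 (s * v s + 2 * v s ^+ 3)].
Proof.
move=> R10 d0 d1 d2 p0 pK; have [c Hc] := first_integral d0 d1 d2.
(* The square root of [p] where [p] is positive; the first integral turns into v'' = s v + 2 v^3 + c
   / v^3. *)
pose v s := expR (2^-1 * ln (p s)); pose v1 s := v s * (2^-1 * (p1 s * (p s)^-1)).
have v0 s : 0 < v s by exact: expR_gt0.
have v2 s : R1 <= s -> v s ^+ 2 = p s.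
  move=> Rs; rewrite /v expr2 -expRD -mulrDl -[X in expR X](_ : ln (p s) = _) ?lnK ?posrE ?p0 //.
  by rewrite [RHS](_ : _ = (2^-1 + 2^-1) * ln (p s)) //; field.
have dv (s : R) : R1 <= s -> is_derive s 1 v (v1 s).
  move=> Rs; have E0 := d0 s; have P0 := p0 s Rs.
  have dl : is_derive s 1 (fun s => ln (p s)) ((p s)^-1 * p1 s).
    exact: (drv_comp E0 (is_derive1_ln P0)).
  rewrite /v; der; rewrite /v1 /v; ring.
have dv1 (s : R) : R1 <= s -> is_derive s 1 v1 (s * v s + 2 * v s ^+ 3 + c / v s ^+ 3).
  move=> Rs; have E0 := dv s Rs; have P0 := p0 s Rs.
  have E1 := d0 s; have E2 := d1 s.
  have dV : is_derive s 1 (fun s => (p s)^-1) (- p1 s * ((p s)^-1 * (p s)^-1)).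
    apply: (drv_eq (is_deriveV (lt0r_neq0 P0) E1)); rewrite /GRing.scale /=.
    by rewrite expr2 invfM !mulNr mulrC.
  rewrite {1}/v1; der; have V0 := v0 s; have V2 := v2 s Rs; have C := Hc s.
  have C' : p2 s = (c + s * p s ^+ 2 + 2 * p s ^+ 3 + p1 s ^+ 2 / 4) * 2 / p s.
    by rewrite -C; field; rewrite gt_eqF.
  rewrite C' /v1 -V2; move: (p1 s) (v s) V0 => b V V0; field; rewrite gt_eqF //.
suff c0 : c = 0.
  by exists v, v1 => s Rs; split; [|exact: v2|exact: dv|]; have := dv1 s Rs; rewrite c0 mul0r addr0.
apply/eqP/negP => /negP cn; have ca : 0 < `|c| by rewrite normr_gt0.
have [M HM] := @large_exp_small K (Num.min 1 (`|c| / 2)) (ltac:(by rewrite lt_min ltr01 divr_gt0)).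
pose s1 := Num.max R1 (Num.max M 1); pose e := Num.sg c.
have ee : e * e = 1 by rewrite -expr2 sqr_sg cn.
have small s : s1 <= s -> [/\ R1 <= s, v s <= 1 & 1 <= e * (s * v s + 2 * v s ^+ 3 + c / v s ^+ 3)].
  rewrite !ge_max => /andP[Rs /andP[Ms s1']]; have := HM s Ms.
  have V2 := v2 s Rs; have := pK s Rs; have V0 := v0 s.
  rewrite le_min => k1 /andP[k2 k3].
  have q1 := le_trans k1 k2; have q2 := le_trans k1 k3; rewrite -V2 in q1 q2.
  have q3 : (s + 2) * v s <= 1.
    by rewrite -(@ler_pXn2r _ 2) ?nnegrE // ?mulr_ge0 ?addr_ge0 ?(ltW V0) ?(le_trans ler01 s1') // expr1n exprMn.
  have q4 : v s <= 1 by nra.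
  split=> //; rewrite mulrDr [e * (c / _)]mulrA (_ : e * c = `|c|); last by rewrite /e normrEsg.
  have q5 : 2 <= `|c| / v s ^+ 3.
    rewrite ler_pdivlMr ?exprn_gt0 //.
    have : v s ^+ 3 <= (s + 2) ^+ 2 * v s ^+ 2 by rewrite exprS ler_wpM2r ?sqr_ge0 //; nra.
    by move: q2; move: `|c| (v s ^+ 3) (_ ^+ 2 * _) => x y z; lra.
  have q6 : `|e * (s * v s + 2 * v s ^+ 3)| <= 1.
    rewrite normrM (_ : `|e| = 1) ?mul1r; last by rewrite /e normr_sg cn.
    rewrite ger0_norm; last by rewrite addr_ge0 // ?mulr_ge0 ?exprn_ge0 ?(ltW V0) ?(le_trans ler01 s1').
    by move: q3 q4 V0; move: (v s) => V; nra.
  by move: q6; rewrite ler_norml => /andP[h _]; move: h q5; move: (e * _) (`|c| / _) => x y; lra.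
pose b := e * v1 s1.
have g1 s : s1 <= s -> b + (s - s1) <= e * v1 s.
  move=> ss.
  have H := @halfline_nondecreasing R (fun s => e * v1 s - (s - s1))
    (fun s => e * (s * v s + 2 * v s ^+ 3 + c / v s ^+ 3) - 1) s1 _ _ s1 s (lexx _) ss.
  have {}H := H _ _; rewrite -/b subrr subr0 in H.
  suff : b <= e * v1 s - (s - s1) by lra.
  apply: H => t st; have [Rt _ h] := small t st; last by lra.
  by apply: drv_eq (drvD (drvM (drv_cst e t) (dv1 t Rt)) (drvN (drvD (drv_id t) (drvN (drv_cst s1 t))))) _; ring.
have g0 s : s1 <= s -> e * v s1 + b * (s - s1) + (s - s1) * (s - s1) * 2^-1 <= e * v s.
  move=> ss.
  have H := @halfline_nondecreasing R (fun s => e * v s - b * (s - s1) - (s - s1) * (s - s1) * 2^-1)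
    (fun s => e * v1 s - b - (s - s1)) s1 _ _ s1 s (lexx _) ss.
  have {}H := H _ _; rewrite subrr !mulr0 !mul0r !subr0 in H.
  suff : e * v s1 <= e * v s - b * (s - s1) - (s - s1) * (s - s1) * 2^-1 by lra.
  apply: H => t st; last by have := g1 t st; lra.
  have [Rt _ h] := small t st.
  exact: quad_derive (dv t Rt).
have en : `|e| = 1 by rewrite /e normr_sg cn.
have ve s : s1 <= s -> `|e * v s| <= 1.
  by move=> ss; have [_ h _] := small s ss; rewrite normrM en mul1r gtr0_norm.
(* For this t one has t (t / 2 + b) >= 2 t >= 8, whereas the values of [e * v] at both ends are at
   most 1 in modulus. *)
pose t := 2 * `|b| + 4.
have t0 : s1 <= s1 + t by rewrite lerDl /t addr_ge0 // mulr_ge0.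
have := g0 _ t0; have := ve _ t0; have := ve _ (lexx s1).
rewrite [s1 + t]addrC addrK !ler_norml => /andP[h1 _] /andP[_ h2] h3.
have h4 : - `|b| <= b by rewrite lerNl ler_normr lexx orbT.
have b0 : 0 <= `|b| by [].
by move: h1 h2 h3; rewrite /t; move: (e * v s1) (e * _) => x y; move: `|b| b0 h4 => B b0 h4; nra.
Qed.

(** * Wronskian comparison of two Painleve II solutions *)

Section Uniqueness.
Variables (a a1 : R -> R) (R1 K : R).
Hypothesis R10 : 0 <= R1.
Hypothesis da : forall s : R, is_derive s 1 a (a1 s).
Hypothesis da1 : forall s : R, is_derive s 1 a1 (s * a s).
Hypothesis a0 : forall s, R1 <= s -> 0 < a s <= 1.
Hypothesis a10 : forall s, R1 <= s -> a1 s <= - 2 * a s.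
Hypothesis aK : forall s, R1 <= s -> a s ^+ 2 <= K * expR (- s).

Definition painleve_branch (u u1 : R -> R) := forall s : R, R1 <= s ->
  [/\ 0 < u s <= 2 * a s, is_derive s 1 u (u1 s) & is_derive s 1 u1 (s * u s + 2 * u s ^+ 3)].

(** Closeness is relative to [a], that is to Ai: solutions asymptotic to different multiples of Ai
    all approach each other in the absolute sense. *)
Definition close_branches (u v : R -> R) := forall e, 0 < e -> exists M, forall s, M <= s -> `|u s - v s| <= e * a s.

Let B (u v : R -> R) s := u s ^+ 2 + u s * v s + v s ^+ 2.
(** The Wronskian of a and u - v. As a'' = s a, the linear terms cancel and only 2 B a (u - v) is
    left in its derivative; divided by a^2, it is the derivative of (u - v) / a. *)
Let W (u u1 v v1 : R -> R) s := (u1 s - v1 s) * a s - (u s - v s) * a1 s.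

Let inv_a_derive (s : R) : R1 <= s -> is_derive s 1 (fun s => (a s)^-1) (- a1 s * ((a s)^-1 * (a s)^-1)).
Proof.
move=> Rs; have /andP[A0 _] := a0 Rs.
apply: (drv_eq (is_deriveV (lt0r_neq0 A0) (da s))); rewrite /GRing.scale /=.
by rewrite expr2 invfM !mulNr mulrC.
Qed.

Section TwoBranches.
Variables u u1 v v1 : R -> R.
Hypothesis hu : painleve_branch u u1.
Hypothesis hv : painleve_branch v v1.
Hypothesis uv : close_branches u v.
Notation g s := ((u s - v s) * (a s)^-1).
Notation w := (W u u1 v v1).

Let B_bound s : R1 <= s -> 0 <= B u v s <= 12 * a s ^+ 2.
Proof.
move=> Rs; have [/andP[u0 u2] _ _] := hu Rs; have [/andP[v0 v2] _ _] := hv Rs.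
rewrite /B; move: (u s) (v s) (a s) u0 u2 v0 v2 => U V A u0 u2 v0 v2; apply/andP; split; nra.
Qed.

Let dW (s : R) : R1 <= s -> is_derive s 1 w (2 * B u v s * a s * (u s - v s)).
Proof.
move=> Rs; have [_ E1 E2] := hu Rs; have [_ E3 E4] := hv Rs; have E5 := da s; have E6 := da1 s.
rewrite /W /B; der; move: (u s) (v s) (a s) (u1 s) (v1 s) (a1 s) => U V A U1 V1 A1; ring.
Qed.

Let dg (s : R) : R1 <= s -> is_derive s 1 (fun s => g s) (w s * ((a s)^-1 * (a s)^-1)).
Proof.
move=> Rs; have [_ E1 _] := hu Rs; have [_ E3 _] := hv Rs; have E5 := inv_a_derive Rs.
have /andP[A0 _] := a0 Rs.
der; rewrite /W; move: (u s) (v s) (a s) A0 (u1 s) (v1 s) (a1 s) => U V A A0 U1 V1 A1; field.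
by rewrite gt_eqF.
Qed.

Let inv_a2 s : R1 <= s -> 1 <= (a s)^-1 * (a s)^-1.
Proof.
by move=> Rs; have /andP[A0 A1] := a0 Rs; rewrite -expr2 exprn_ege1 // invf_ge1.
Qed.

Let g_cvg0 e s0 : 0 < e -> exists2 s, s0 <= s /\ R1 <= s & `|g s| <= e.
Proof.
move=> e0; have [M HM] := uv e0; pose s := Num.max (Num.max s0 R1) M.
exists s; first by split; rewrite /s !le_max lexx ?orbT.
have Rs : R1 <= s by rewrite /s !le_max lexx orbT.
have /andP[A0 _] := a0 Rs; rewrite normrM [`|_^-1|]gtr0_norm ?invr_gt0 // ler_pdivrMr //.
by apply: HM; rewrite /s le_max lexx orbT.
Qed.

(** Write g = (u - v) / a and w for the Wronskian. The derivative of g w is w^2 / a^2 + 2 B (u -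
    v)^2 >= 0. Were g w positive somewhere, g^2 would grow at least linearly from there, although g
    comes arbitrarily close to 0; so g w <= 0, which is the sign of (g^2)'. *)
Lemma gap_square_nonincreasing x y : R1 <= x -> x <= y -> g y ^+ 2 <= g x ^+ 2.
Proof.
have dZ (s : R) : R1 <= s -> is_derive s 1 (fun s => g s * w s)
    (w s * ((a s)^-1 * (a s)^-1) * w s + g s * (2 * B u v s * a s * (u s - v s))).
  by move=> Rs; exact: drvM (dg Rs) (dW Rs).
have Z0 s' : R1 <= s' ->
    0 <= w s' * ((a s')^-1 * (a s')^-1) * w s' + g s' * (2 * B u v s' * a s' * (u s' - v s')).
  move=> Rs; have /andP[A0 _] := a0 Rs; have /andP[B0 _] := B_bound Rs.
  have -> : g s' * (2 * B u v s' * a s' * (u s' - v s')) = 2 * B u v s' * (u s' - v s') ^+ 2.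
    by field; rewrite gt_eqF.
  apply: addr_ge0; last by apply: mulr_ge0; [exact: mulr_ge0|exact: sqr_ge0].
  have i1 := le_trans ler01 (inv_a2 Rs).
  by rewrite mulrAC -expr2; apply: mulr_ge0 => //; exact: sqr_ge0.
have dg2 (s : R) : R1 <= s -> is_derive s 1 (fun s => g s * g s) (2 * (g s * w s) * ((a s)^-1 * (a s)^-1)).
  by move=> Rs; apply: drv_eq (drvM (dg Rs) (dg Rs)) _; ring.
have Zle s' : R1 <= s' -> g s' * w s' <= 0.
  move=> Rs; rewrite leNgt; apply/negP => z0; set z := g s' * w s' in z0.
  have [r [sr Rr]] := @g_cvg0 1 (s' + z^-1) ltr01.
  have H := @halfline_nondecreasing R (fun s => g s * g s - 2 * z * (s - s'))
    (fun s => 2 * (g s * w s) * ((a s)^-1 * (a s)^-1) - 2 * z) s' _ _ s' r (lexx _) _.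
  have {}H := H _ _ _; rewrite subrr mulr0 subr0 in H.
  have zr : s' <= r by apply: le_trans sr; rewrite lerDl invr_ge0 ltW.
  have q1 : g s' * g s' <= g r * g r - 2 * z * (r - s').
    apply: H => // {}x sx; have Rx := le_trans Rs sx.
      have E := dg2 x Rx; have E2 : is_derive x 1 (fun s => 2 * z * (s - s')) (2 * z) by der => /=; ring.
      exact: drvD E (drvN E2).
    rewrite subr_ge0; have zx : z <= g x * w x by exact: (halfline_nondecreasing dZ Z0).
    have := inv_a2 Rx; move: (_ * w x) zx => Z zx; move: (_^-1 * _) => i i1; nra.
  move=> q2; have q3 : 2 <= 2 * z * (r - s').
    rewrite -mulrA ler_peMr // mulrC -ler_pdivrMr // mul1r; lra.
  have q4 : g r * g r <= 1.
    by rewrite -expr2 -real_normK ?num_real // expr_le1.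
  by have := sqr_ge0 (g s'); rewrite expr2; move: (g s' * g s') (g r * g r) (2 * z * _) q1 q3 q4 => x1 x2 x3; lra.
move=> Rs st; rewrite !expr2.
apply: (halfline_nonincreasing dg2 _ Rs st) => {Rs st} {}x Rx.
rewrite mulr_le0_ge0 ?(le_trans ler01 (inv_a2 Rx)) // mulr_ge0_le0 // Zle //.
Qed.

(** A positive gap makes w nondecreasing, and w <= 0 since g tends to 0. On the other hand w is at
    least - 3 g a^4, so g' >= - 3 a^2 g; as a^2 is integrable, g cannot tend to 0. *)
Lemma no_positive_gap s1 : R1 <= s1 -> (forall s, s1 <= s -> v s < u s) -> False.
Proof.
move=> Rs1 gpos.
have g0 s : s1 <= s -> 0 < g s.
  move=> ss; have /andP[A0 _] := a0 (le_trans Rs1 ss).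
  by rewrite mulr_gt0 ?invr_gt0 // subr_gt0 gpos.
have Rx x : s1 <= x -> R1 <= x by exact: le_trans.
have W0 s : s1 <= s -> w s <= 0.
  move=> ss; rewrite leNgt; apply/negP => z0.
  have [r [sr Rr]] := @g_cvg0 (g s) s (g0 s ss).
  have [r' [sr' Rr']] := @g_cvg0 (g s / 2) (s + 1) (ltac:(by rewrite divr_gt0 // g0)).
  have s1r' : s <= r' by lra.
  have dws (x : R) : s <= x -> is_derive x 1 w (2 * B u v x * a x * (u x - v x)).
    by move=> sx; apply/dW/Rx/(le_trans ss).
  have mono : g s <= g r'.
    apply: (@halfline_nondecreasing R (fun s => g s) (fun s => w s * ((a s)^-1 * (a s)^-1)) s) => // x sx.
      by apply/dg/Rx/(le_trans ss).
    have s1x := le_trans ss sx; rewrite mulr_ge0 ?(le_trans ler01 (inv_a2 (Rx _ s1x))) //.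
    apply: le_trans (ltW z0) _; apply: (halfline_nondecreasing dws) => // y sy.
    have s1y := le_trans ss sy; have /andP[B0 _] := B_bound (Rx _ s1y); have /andP[A0 _] := a0 (Rx _ s1y).
    by rewrite !mulr_ge0 ?(ltW A0) // subr_ge0 ltW // gpos.
  rewrite !gtr0_norm ?g0 ?(le_trans ss) //; have := g0 s ss; move: mono; move: (g s) (g r') => x y; lra.
(* From u, v <= 2 a one gets w' <= 24 g a^4, and from a' <= - 2 a that (a^4)' <= - 8 a^4; the factor
   3 balances the two, and g' <= 0 has the right sign. *)
pose th s := w s + 3 * (g s * (a s * a s * a s * a s)).
have dth (s : R) : s1 <= s -> is_derive s 1 th (2 * B u v s * a s * (u s - v s) +
    3 * (w s * ((a s)^-1 * (a s)^-1) * (a s * a s * a s * a s) + g s * (4 * a s ^+ 3 * a1 s))).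
  move=> ss; have E1 := dW (Rx _ ss); have E2 := dg (Rx _ ss); have E3 := da s.
  rewrite /th; apply: drv_eq (drvD E1 (drvM (drv_cst 3 s) (drvM E2 (drvM (drvM (drvM E3 E3) E3) E3)))) _.
  by ring.
have th0 s : s1 <= s -> 2 * B u v s * a s * (u s - v s) +
    3 * (w s * ((a s)^-1 * (a s)^-1) * (a s * a s * a s * a s) + g s * (4 * a s ^+ 3 * a1 s)) <= 0.
  move=> ss; have Rs := Rx _ ss; have /andP[A0 _] := a0 Rs; have G0 := g0 s ss.
  have w0 := W0 s ss; have /andP[B0 B1] := B_bound Rs; have h1 := a10 Rs.
  have E : u s - v s = g s * a s by rewrite divfK // gt_eqF.
  rewrite [X in 2 * _ * _ * X + _]E.
  have -> : w s * ((a s)^-1 * (a s)^-1) * (a s * a s * a s * a s) = w s * a s ^+ 2.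
    by field; rewrite gt_eqF.
  have q1 : w s * a s ^+ 2 <= 0 by rewrite mulr_le0_ge0 // sqr_ge0.
  have q2 : 2 * B u v s * a s * (g s * a s) <= 24 * (g s * a s ^+ 4).
    have -> : 24 * (g s * a s ^+ 4) = 2 * (12 * a s ^+ 2) * a s * (g s * a s) by ring.
    apply: ler_wpM2r; first by rewrite mulr_ge0 // ltW.
    by apply: ler_wpM2r; [exact: ltW|rewrite ler_pM2l].
  have q3 : g s * (4 * a s ^+ 3 * a1 s) <= - 8 * (g s * a s ^+ 4).
    have -> : - 8 * (g s * a s ^+ 4) = g s * (4 * a s ^+ 3 * (- 2 * a s)) by ring.
    by rewrite ler_pM2l // ler_wpM2l // mulr_ge0 // exprn_ge0 // ltW.
  have ar (x1 x2 x3 x4 : R) : x1 <= 0 -> x2 <= 24 * x4 -> x3 <= - 8 * x4 -> x2 + 3 * (x1 + x3) <= 0 by lra.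
  exact: ar q1 q2 q3.
have th_ge0 s : s1 <= s -> 0 <= th s.
  move=> ss; rewrite leNgt; apply/negP => z0; set z := th s in z0.
  have wz x : s <= x -> w x <= z.
    move=> sx; have s1x := le_trans ss sx; apply: le_trans (halfline_nonincreasing dth th0 ss sx).
    have /andP[A0 _] := a0 (Rx _ s1x); rewrite lerDl.
    by rewrite mulr_ge0 // mulr_ge0 ?(ltW (g0 _ s1x)) // !mulr_ge0 // ltW.
  have G0 := g0 s ss; pose t := s - g s / z.
  have st : s <= t by rewrite lerDl oppr_ge0 mulr_ge0_le0 ?(ltW G0) // invr_le0 ltW.
  have H := @halfline_nonincreasing R (fun s' => g s' - z * (s' - s))
    (fun s => w s * ((a s)^-1 * (a s)^-1) - z) s _ _ s t (lexx _) st.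
  have {}H := H _ _; rewrite subrr mulr0 subr0 in H.
  have : g t - z * (t - s) <= g s.
    apply: H => x sx; have Rxx := Rx _ (le_trans ss sx).
      have E2 : is_derive x 1 (fun s' => z * (s' - s)) z by der => /=; ring.
      exact: drvD (dg Rxx) (drvN E2).
    by have := wz x sx; have := inv_a2 Rxx; move: (w x) (_^-1 * _) => y i; nra.
  have -> : z * (t - s) = - g s by rewrite /t [s - _]addrC addrK mulrN mulrCA mulfV ?mulr1 // lt_eqF.
  by have := g0 t (le_trans ss st); move: (g t) (g s) => x y; lra.
(* Integrating factor for g' >= - 3 K exp (- s) g. It is at most 1, so g stays above the positive
   value [ph s1]. *)
pose ph s := g s * expR (- (3 * K) * expR (- s)).
have dph (s : R) : s1 <= s -> is_derive s 1 ph (expR (- (3 * K) * expR (- s)) *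
    (w s * ((a s)^-1 * (a s)^-1) + 3 * (K * expR (- s)) * g s)).
  move=> ss; have E2 := dg (Rx _ ss).
  have E3 : is_derive s 1 (fun s => expR (- (3 * K) * expR (- s)))
      (expR (- (3 * K) * expR (- s)) * (3 * (K * expR (- s)))) by der => /=; ring.
  by apply: drv_eq (drvM E2 E3) _; ring.
have ph0 s : s1 <= s -> 0 <= expR (- (3 * K) * expR (- s)) *
    (w s * ((a s)^-1 * (a s)^-1) + 3 * (K * expR (- s)) * g s).
  move=> ss; have Rs := Rx _ ss; have /andP[A0 _] := a0 Rs; have G0 := g0 s ss.
  rewrite mulr_ge0 ?expR_ge0 //; have k := aK Rs; have := th_ge0 s ss; rewrite /th => h.
  have h2 : 0 <= w s * ((a s)^-1 * (a s)^-1) + 3 * (g s * a s ^+ 2).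
    have -> : w s * ((a s)^-1 * (a s)^-1) + 3 * (g s * a s ^+ 2) =
      (w s + 3 * (g s * (a s * a s * a s * a s))) * ((a s)^-1 * (a s)^-1) by field; rewrite gt_eqF.
    by rewrite mulr_ge0 // (le_trans ler01) // inv_a2.
  apply: le_trans h2 _; rewrite lerD2l -[leRHS]mulrA ler_pM2l // mulrC.
  by apply: ler_wpM2r => //; exact: ltW.
have K0 : 0 <= K.
  have := aK Rs1; have := expR_gt0 (- s1); have := sqr_ge0 (a s1).
  by move: (expR _) (_ ^+ 2) => x y y0 x0 h; rewrite -(pmulr_lge0 _ x0) (le_trans y0).
have phg s : s1 <= s -> ph s <= g s.
  move=> ss; rewrite /ph ler_piMr ?(ltW (g0 s ss)) // -expR0 ler_expR mulNr oppr_le0.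
  by rewrite !mulr_ge0 // expR_ge0.
have p0 : 0 < ph s1 by rewrite mulr_gt0 ?expR_gt0 // g0.
have [r [sr Rr]] := @g_cvg0 (ph s1 / 2) s1 (ltac:(by rewrite divr_gt0)).
rewrite gtr0_norm ?g0 // => h; have h1 := phg r sr.
have := halfline_nondecreasing dph ph0 (lexx _) sr.
by move: h h1 p0; move: (g r) (ph r) (ph s1) => x y z; lra.
Qed.
End TwoBranches.

Lemma close_sym u v : close_branches u v -> close_branches v u.
Proof. by move=> h e /h[M HM]; exists M => s /HM; rewrite distrC. Qed.

(** Equality at one point persists to the right, since ((u - v) / a)^2 does not increase. Without
    such a point the difference keeps its sign, which [no_positive_gap] excludes. *)
Lemma painleve_unique u u1 v v1 : painleve_branch u u1 -> painleve_branch v v1 -> close_branches u v ->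
  exists2 s1, R1 <= s1 & forall s, s1 <= s -> u s = v s.
Proof.
move=> hu hv uv; apply: contrapT => /forall2NP H.
have ne s : R1 <= s -> u s != v s.
  move=> Rs; apply/eqP => E; case: (H s) => // [[]] t st.
  have := gap_square_nonincreasing hu hv uv Rs st; rewrite E subrr mul0r expr0n /= => h.
  have : ((u t - v t) / a t) ^+ 2 == 0 by rewrite eq_le h sqr_ge0.
  have /andP[A0 _] := a0 (le_trans Rs st).
  by rewrite sqrf_eq0 mulf_eq0 invr_eq0 (gt_eqF A0) orbF subr_eq0 => /eqP.
have ct s t : R1 <= s -> {within `[s, t], continuous (fun x => u x - v x)}.
  move=> Rs; apply: derivable_within_continuous => x; rewrite in_itv /= => /andP[sx _].
  have [_ E1 _] := hu _ (le_trans Rs sx); have [_ E2 _] := hv _ (le_trans Rs sx).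
  have E : is_derive x 1 (fun x => u x - v x) (u1 x - v1 x) := drvD E1 (drvN E2).
  exact: ex_derive.
have root t : R1 <= t -> Num.min (u R1 - v R1) (u t - v t) <= 0 -> 0 <= Num.max (u R1 - v R1) (u t - v t) -> False.
  move=> Rt h1 h2; have := @IVT R _ R1 t 0 Rt (ct _ _ (lexx _)).
  rewrite h1 h2 => /(_ isT)[c]; rewrite in_itv /= => /andP[Rc _] /eqP; rewrite subr_eq0.
  exact/negP/ne.
case: (ltgtP (u R1) (v R1)) => h; last by have := ne R1 (lexx _); rewrite h eqxx.
- apply: (no_positive_gap hv hu (close_sym uv) (lexx R1)) => s Rs; rewrite ltNge; apply/negP => h2.
  by apply: (root s Rs); rewrite ?ge_min ?le_max; apply/orP; [left|right]; rewrite ?subr_le0 ?subr_ge0 // ltW.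
- apply: (no_positive_gap hu hv uv (lexx R1)) => s Rs; rewrite ltNge; apply/negP => h2.
  by apply: (root s Rs); rewrite ?ge_min ?le_max; apply/orP; [right|left]; rewrite ?subr_le0 ?subr_ge0 // ltW.
Qed.
End Uniqueness.

(** The difference and its first two derivatives solve a linear system with coefficients bounded on
    compact intervals. Their sum of squares V satisfies V' + L V >= 0, so exp (L x) V is
    nondecreasing; it is 0 at a point to the right, hence 0 before it. *)
Lemma third_order_unique (p p1 p2 q q1 q2 : R -> R) (s0 : R) :
  (forall s : R, is_derive s 1 p (p1 s)) -> (forall s : R, is_derive s 1 p1 (p2 s)) ->
  (forall s : R, is_derive s 1 p2 (12 * p s * p1 s + 4 * s * p1 s + 2 * p s)) ->
  (forall s : R, is_derive s 1 q (q1 s)) -> (forall s : R, is_derive s 1 q1 (q2 s)) ->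
  (forall s : R, is_derive s 1 q2 (12 * q s * q1 s + 4 * s * q1 s + 2 * q s)) ->
  (forall s, s0 <= s -> p s = q s) -> forall s, p s = q s.
Proof.
move=> dp dp1 dp2 dq dq1 dq2 pq s.
case: (leP s0 s) => [/pq //|ss0].
(* Strictly to the right of [s0], where the derivatives of the difference vanish too. *)
pose s2 := s0 + 1; have zero_der (f f' : R -> R) : (forall s : R, is_derive s 1 f (f' s)) ->
    (forall s, s0 < s -> f s = 0) -> forall s, s0 < s -> f' s = 0.
  move=> df f0 x sx; have E := df x.
  have : is_derive x 1 f 0.
    apply: near_eq_is_derive (is_derive_cst 0 x 1); rewrite ?oner_eq0 //.
    by near=> y; rewrite f0 //; near: y; exact: lt_nbhsr.
  by move=> E'; have := @derive_val _ _ _ _ _ _ _ E; rewrite (@derive_val _ _ _ _ _ _ _ E').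
pose e s := p s - q s; pose e1 s := p1 s - q1 s; pose e2 s := p2 s - q2 s.
have de (x : R) : is_derive x 1 e (e1 x) := drvD (dp x) (drvN (dq x)).
have de1 (x : R) : is_derive x 1 e1 (e2 x) := drvD (dp1 x) (drvN (dq1 x)).
have de2 (x : R) : is_derive x 1 e2 (12 * (p x * e1 x + e x * q1 x) + 4 * x * e1 x + 2 * e x).
  by apply: drv_eq (drvD (dp2 x) (drvN (dq2 x))) _; rewrite /e /e1; ring.
have z0 x : s0 < x -> e x = 0 by move=> sx; rewrite /e pq ?subrr // ltW.
have z1 := zero_der e e1 de z0; have z2 := zero_der e1 e2 de1 z1.
have bnd (f f' : R -> R) : (forall s : R, is_derive s 1 f (f' s)) ->
    exists2 M, 0 <= M & forall x, s <= x -> x <= s2 -> `|f x| <= M.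
  move=> df; have ss2 : s <= s2 by rewrite /s2; lra.
  have cf : {within `[s, s2], continuous (fun x => `|f x|)}.
    apply: continuous_subspaceT => x; apply: (cvg_norm (drv_continuous (df x))).
  by have [c _ H] := EVT_max ss2 cf; exists `|f c| => // x sx xs; apply: H; rewrite in_itv /= sx xs.
have [Mp Mp0 HMp] := bnd _ _ dp; have [Mq Mq0 HMq] := bnd _ _ dq1.
have [Ms Ms0 HMs] := bnd _ _ (fun x => drv_id x).
pose L := 12 * Mp + 12 * Mq + 4 * Ms + 4.
pose V x := e x * e x + e1 x * e1 x + e2 x * e2 x.
pose V' x := 2 * (e x * e1 x + e1 x * e2 x + e2 x * (12 * (p x * e1 x + e x * q1 x) + 4 * x * e1 x + 2 * e x)).
have dV (x : R) : is_derive x 1 V (V' x).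
  apply: drv_eq (drvD (drvD (drvM (de x) (de x)) (drvM (de1 x) (de1 x))) (drvM (de2 x) (de2 x))) _.
  by rewrite /V'; ring.
have cross (x y c m : R) : `|c| <= m -> - (m * (x * x + y * y)) <= 2 * (c * (x * y)).
  rewrite ler_norml => /andP[c1 c2].
  have h1 : 0 <= (m + c) * (x + y) ^+ 2 by rewrite mulr_ge0 ?sqr_ge0 //; move: c1; lra.
  have h2 : 0 <= (m - c) * (x - y) ^+ 2 by rewrite mulr_ge0 ?sqr_ge0 //; move: c2; lra.
  by move: h1 h2; clear; nra.
have VL x : s <= x -> x <= s2 -> 0 <= V' x + L * V x.
  move=> sx xs; have b1 := HMp x sx xs; have b2 := HMq x sx xs; have b3 := HMs x sx xs.
  have n1 : `|1 : R| <= 1 by rewrite normr1.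
  have k1 := cross (e2 x) (e1 x) _ _ b1; have k2 := cross (e2 x) (e x) _ _ b2.
  have k3 := cross (e2 x) (e1 x) _ _ b3; have k4 := cross (e2 x) (e x) _ _ n1.
  have k5 := cross (e1 x) (e2 x) _ _ n1; have k6 := cross (e x) (e1 x) _ _ n1.
  rewrite /V' /V /L; move: k1 k2 k3 k4 k5 k6.
  move: (e x) (e1 x) (e2 x) (p x) (q1 x) => E E1 E2 P Q k1 k2 k3 k4 k5 k6.
  have P0 := mulr_ge0 Mp0 (sqr_ge0 E); have Q0 := mulr_ge0 Mq0 (sqr_ge0 E1).
  have S0 := mulr_ge0 Ms0 (sqr_ge0 E); have e0 := sqr_ge0 E; have e10 := sqr_ge0 E1; have e20 := sqr_ge0 E2.
  by nra.
have dG (x : R) : is_derive x 1 (fun x => expR (L * x) * V x) (expR (L * x) * (V' x + L * V x)).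
  have E : is_derive x 1 (fun x => expR (L * x)) (expR (L * x) * L).
    by apply: drv_eq (drv_exp (drvM (drv_cst L x) (drv_id x))) _; rewrite mul0r add0r mulr1.
  by apply: drv_eq (drvM E (dV x)) _; ring.
have ss2 : s <= s2 by rewrite /s2; lra.
have GE : expR (L * s) * V s <= expR (L * s2) * V s2.
  have C : {within `[s, s2], continuous (fun x => expR (L * x) * V x)}.
    by apply: derivable_within_continuous => x _; have := dG x => ?; exact: ex_derive.
  have [c ci E] := MVT_segment ss2 (fun x _ => dG x) C.
  move: ci; rewrite in_itv /= => /andP[c1 c2].
  by rewrite -subr_ge0 E !mulr_ge0 ?expR_ge0 ?subr_ge0 // VL.
have s02 : s0 < s2 by rewrite /s2; lra.
move: GE; rewrite {2}/V z0 // z1 // z2 // !mulr0 !addr0 mulr0 pmulr_rle0 ?expR_gt0 // /V.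
have := sqr_ge0 (e1 s); have := sqr_ge0 (e2 s); rewrite !expr2 => h1 h2 h3.
have : e s * e s == 0 by rewrite eq_le -expr2 sqr_ge0 expr2 andbT; move: h1 h2 h3; lra.
by rewrite mulf_eq0 orbb subr_eq0 => /eqP.
Unshelve. all: by end_near.
Qed.
End PainleveAtInfinity.


Section HastingsMcLeod.
Context {R : realType}.

Lemma near_pinfty (Q : R -> Prop) : (\forall s \near +oo, Q s) -> exists M : R, forall s, M <= s -> Q s.
Proof.
by move=> [M [_ H]]; exists (M + 1) => s Ms; apply: H; apply: lt_le_trans Ms; rewrite ltrDl.
Qed.

Lemma hastings_mcleod_sign (q : R -> R) : is_hastings_mcleod q -> exists sg R0 : R,
  [/\ sg * sg = 1, 4 <= R0, forall s, R0 <= s -> 0 < sairy sg 0 s,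
    forall s, R0 <= s -> 0 < - (sg * q s) <= 2 * sairy sg 0 s
    & close_branches (sairy sg 0) (fun s => - (sg * q s)) (sairy sg 0)].
Proof.
move=> [_ _ lim].
have near1 e : 0 < e -> exists M : R, forall s, M <= s -> `|1 - q s / - airy s| <= e.
  by move=> e0; apply: near_pinfty; move/cvgrPdist_le : lim; exact.
have [M HM] := near1 2^-1 (ltac:(by [])).
pose R0 := Num.max 4 M; have R04 : 4 <= R0 by rewrite le_max lexx.
have MR s : R0 <= s -> M <= s by rewrite ge_max => /andP[].
(* At a zero of Ai the quotient would be 0, because the inverse of 0 is 0, and so at distance 1 from
   its limit. *)
have ne s : R0 <= s -> airy s != 0.
  move=> /MR Ms; apply/eqP => E; have := HM s Ms; rewrite E oppr0 invr0 mulr0 subr0 normr1; lra.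
pose sg := Num.sg (airy R0); have sgsg : sg * sg = 1 by rewrite -expr2 sqr_sg ne.
have aE s : sairy sg 0 s = sg * airy s by rewrite /sairy airyD0.
have pos s : R0 <= s -> 0 < sairy sg 0 s.
  move=> Rs; rewrite ltNge; apply/negP => h.
  have h0 : 0 < sairy sg 0 R0 by rewrite aE /sg -normrEsg normr_gt0 ne.
  have C : {within `[R0, s], continuous (sairy sg 0)}.
    by apply: derivable_within_continuous => x _; have := sairy_derive sg 0 x => ?; exact: ex_derive.
  have := @IVT R _ R0 s 0 Rs C; rewrite ge_min le_max h (ltW h0) orbT /= => /(_ isT)[c].
  rewrite in_itv /= => /andP[Rc _]; rewrite aE => /eqP; rewrite mulf_eq0 (negbTE (ne c Rc)) orbF.
  by rewrite /sg sgr_eq0 (negbTE (ne R0 (lexx _))).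
have uE s : R0 <= s -> - (sg * q s) = sairy sg 0 s * (q s / - airy s).
  by move=> Rs; rewrite aE; field; exact: ne.
exists sg, R0; split=> //.
- move=> s Rs; rewrite uE //; have := HM s (MR s Rs); rewrite ler_norml => /andP[h1 h2].
  have A0 := pos s Rs; move: h1 h2; move: (q s / _) => x h1 h2.
  rewrite mulr_gt0 //=; first by rewrite mulrC ler_pM2r //; lra.
  by lra.
- move=> e e0; have [M' HM'] := near1 e e0; exists (Num.max M' R0) => s; rewrite ge_max => /andP[Ms Rs].
  rewrite uE // -{2}[sairy sg 0 s]mulr1 -mulrBr normrM gtr0_norm ?pos // mulrC ler_pM2r ?pos //.
  by rewrite distrC HM'.
Qed.

Lemma square_derive3 (q : R -> R) : is_hastings_mcleod q -> exists q1 : R -> R,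
  [/\ forall s : R, is_derive s 1 q (q1 s), forall s : R, is_derive s 1 q1 (s * q s + 2 * q s ^+ 3)
   & let P1 s := 2 * q s * q1 s in let P2 s := 2 * q1 s ^+ 2 + 2 * q s * (s * q s + 2 * q s ^+ 3) in
  [/\ forall s : R, is_derive s 1 (fun s => q s ^+ 2) (P1 s), forall s : R, is_derive s 1 P1 (P2 s)
    & forall s : R, is_derive s 1 P2 (12 * q s ^+ 2 * P1 s + 4 * s * P1 s + 2 * q s ^+ 2)]].
Proof.
move=> [dq dq1 _]; exists (q^`())%classic.
have d0 (s : R) : is_derive s 1 q (q^`()%classic s) by rewrite derive1E; exact: derivableP.
split=> // P1 P2; split=> s; have E := d0 s; have E1 := dq1 s.
- by der => /=; rewrite /P1; ring.
- by rewrite /P1; der => /=; rewrite /P2; ring.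
- by rewrite /P2; der => /=; rewrite /P1; ring.
Qed.

(* The decay of p relative to Ai^2 singles out the Hastings-McLeod solution near +oo, and the third-order equation
   continues the identity to the whole line. *)
Lemma hastings_mcleod_identification (q p p1 p2 : R -> R) (sg R0 R1 C K : R) : is_hastings_mcleod q ->
  sg * sg = 1 -> 4 <= R0 -> R0 <= R1 -> (forall s, R0 <= s -> 0 < sairy sg 0 s) ->
  (forall s, R0 <= s -> 0 < - (sg * q s) <= 2 * sairy sg 0 s) ->
  close_branches (sairy sg 0) (fun s => - (sg * q s)) (sairy sg 0) ->
  (forall s : R, is_derive s 1 p (p1 s)) -> (forall s : R, is_derive s 1 p1 (p2 s)) ->
  (forall s : R, is_derive s 1 p2 (12 * p s * p1 s + 4 * s * p1 s + 2 * p s)) ->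
  (forall s, R1 < s -> `|p s - sairy sg 0 s ^+ 2| <= C * sairy sg 0 s ^+ 2 * expR (- s)) ->
  (forall s, R1 < s -> (s + 2) ^+ 2 * sairy sg 0 s ^+ 2 <= K * expR (- s)) ->
  forall s, p s = q s ^+ 2.
Proof.
move=> hm sgsg R04 R01 a0 uq uc dp dp1 dp2 pa aK; set a := sairy sg 0.
have [q1 [dq dq1 [dP dP1 dP2]]] := square_derive3 hm.
have [M1 HM1] := large_exp_small C (ltac:(by []) : 0 < 2^-1 :> R).
have [M2 HM2] := large_exp_small K (@ltr01 R).
pose R2 := Num.max (R1 + 1) (Num.max M1 M2).
have big s : R2 <= s -> [/\ R1 < s, R0 <= s, M1 <= s & M2 <= s].
  rewrite !ge_max => /andP[h /andP[h1 h2]]; have h3 : R1 < s by apply: lt_le_trans h; rewrite ltrDl.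
  by split=> //; rewrite (le_trans R01) // ltW.
clearbody R2; have s4 s : R2 <= s -> 4 <= s by move=> /big[_ h _ _]; exact: le_trans h.
have aKs s : R2 <= s -> (s + 2) ^+ 2 * a s ^+ 2 <= K * expR (- s) /\ (s + 2) ^+ 2 * a s ^+ 2 <= 1.
  by move=> /[dup] /big[h1 _ _ h2] Rs; have h := aK s h1; split=> //; exact: le_trans (HM2 s h2).
have s2 s : R2 <= s -> a s ^+ 2 <= (s + 2) ^+ 2 * a s ^+ 2.
  by move=> /s4 h; rewrite ler_peMl ?sqr_ge0 // exprn_ege1 //; lra.
have pb s : R2 <= s -> a s ^+ 2 / 2 <= p s <= 2 * a s ^+ 2.
  move=> /[dup] /big[h1 h0 h2 _] Rs; have := pa s h1; rewrite -/a => h.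
  have : `|p s - a s ^+ 2| <= a s ^+ 2 / 2.
    apply: le_trans h _; have -> : C * a s ^+ 2 * expR (- s) = a s ^+ 2 * (C * expR (- s)) by ring.
    by apply: ler_wpM2l; [exact: sqr_ge0|exact: HM1].
  by have := sqr_ge0 (a s); rewrite ler_norml; move: (a s ^+ 2) => A A0 /andP[]; move=> k1 k2; apply/andP; split; lra.
have a2 s : R2 <= s -> 0 < a s ^+ 2 by move=> /big[_ h _ _]; rewrite exprn_gt0 // a0.
have p0 s : R2 <= s -> 0 < p s.
  by move=> Rs; have /andP[h _] := pb s Rs; have := a2 s Rs; move: (a s ^+ 2) h => A; lra.
have pK s : R2 <= s -> (s + 2) ^+ 2 * p s <= (2 * K) * expR (- s).
  move=> Rs; have [h _] := aKs s Rs; have /andP[_ h2] := pb s Rs.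
  apply: le_trans (ler_wpM2l (sqr_ge0 _) h2) _; rewrite mulrCA -mulrA.
  by rewrite ler_pM2l.
have R20 : 0 <= R2 by have := s4 R2 (lexx _); lra.
have [v [v1 Hv]] := sqrt_painleve R20 dp dp1 dp2 p0 pK.
have da := sairy_derive sg 0; have da1 (s : R) : is_derive s 1 (sairy sg 1) (s * a s).
  by rewrite -sairy2; exact: sairy_derive.
have a01 s : R2 <= s -> 0 < a s <= 1.
  move=> Rs; have [_ h0 _ _] := big s Rs; rewrite a0 //=.
  by rewrite -(@expr_le1 _ 2) ?(ltW (a0 _ h0)) //; apply: le_trans (s2 s Rs) (aKs s Rs).2.
have a10 s : R2 <= s -> sairy sg 1 s <= - 2 * a s.
  move=> Rs; have [_ h0 _ _] := big s Rs; apply: (sairy_logder sgsg R04 a0) => //.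
  by apply: le_trans R04; rewrite expr2; lra.
have aKK s : R2 <= s -> a s ^+ 2 <= K * expR (- s).
  by move=> Rs; exact: le_trans (s2 s Rs) (aKs s Rs).1.
have hv : painleve_branch a R2 v v1.
  move=> s Rs; have [V0 V2 E1 E2] := Hv s Rs; split=> //; rewrite V0 /=.
  have /andP[A0 _] := a01 s Rs; have /andP[_ h2] := pb s Rs; rewrite leNgt; apply/negP => lt.
  by move: h2 V0 A0 lt; rewrite -V2; move: (v s) (a s) => x y; nra.
have hu : painleve_branch a R2 (fun s => - (sg * q s)) (fun s => - (sg * q1 s)).
  move=> s Rs; have [_ h0 _ _] := big s Rs; split; first exact: uq.
  - by apply: drv_eq (drvN (drvM (drv_cst sg s) (dq s))) _; rewrite mul0r add0r.
  - apply: drv_eq (drvN (drvM (drv_cst sg s) (dq1 s))) _.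
    have -> : (- (sg * q s)) ^+ 3 = - (sg * sg) * sg * q s ^+ 3 by ring.
    by rewrite sgsg; ring.
have vc : close_branches a (fun s => - (sg * q s)) v.
  move=> e e0; have e2 : 0 < e / 2 by rewrite divr_gt0.
  have [M3 HM3] := uc _ e2; have [M4 HM4] := large_exp_small C e2.
  exists (Num.max R2 (Num.max M3 M4)) => s; rewrite !ge_max => /andP[Rs /andP[h3 h4]].
  have h := HM3 s h3; have [V0 V2 _ _] := Hv s Rs; have /andP[A0 _] := a01 s Rs.
  have [h1 _ _ _] := big s Rs; have k := pa s h1; rewrite -/a -V2 in k.
  have k2 : `|a s - v s| <= e / 2 * a s.
    rewrite distrC -(ler_pM2r A0); apply: le_trans (_ : `|v s ^+ 2 - a s ^+ 2| <= _).
      rewrite subr_sqr normrM ler_wpM2l // ger0_norm ?addr_ge0 ?(ltW V0) ?(ltW A0) // lerDr ltW //.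
    apply: le_trans k _; have -> : C * a s ^+ 2 * expR (- s) = C * expR (- s) * (a s * a s) by ring.
    by rewrite -[leRHS]mulrA ler_wpM2r ?HM4 // mulr_ge0 // ltW.
  have -> : - (sg * q s) - v s = (- (sg * q s) - a s) + (a s - v s) by rewrite addrA subrK.
  apply: le_trans (ler_normD _ _) _; apply: le_trans (lerD h k2) _.
  by rewrite -mulrDl -splitr.
have [s1 _ H] := painleve_unique da da1 a01 a10 aKK hu hv vc.
apply: (third_order_unique (s0 := Num.max s1 R2) dp dp1 dp2 dP dP1 dP2) => s; rewrite ge_max => /andP[h1 h2].
have [_ <- _ _] := Hv s h2; rewrite -H // sqrrN exprMn [sg ^+ 2]expr2 sgsg mul1r //.
Qed.
End HastingsMcLeod.

(** * The boundary condition *)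

(** The equation for a single time at 0, solved for the highest derivative: [l2] stands for psi,
    [l5] for its third derivative and [q2] for the derivative of psi^2. *)
Lemma pde_single_point (R : realType) (l2 l5 q2 : R) (y r f f' : 'I_1 -> R) (g : 'I_1 -> 'I_1 -> R) :
  (forall a, y a = 0) ->
  - 6^-1 * l2 + 2^-1 * q2 + 12^-1 * l5 - 3^-1 * (\sum_a r a * f a) - 2 / 3 * (\sum_a y a * f' a)
  - \sum_a y a ^+ 2 * f a + \sum_b \sum_a y b * y a * g b a = 0 -> l5 = 2 * l2 - 6 * q2 + 4 * (r ord0 * f ord0).
Proof. by move=> y0; rewrite !big_ord1 !y0 !mul0r expr0n /= mul0r mulr0; lra. Qed.

Section OnePointEquation.
Context {R : realType} {d : measure_display} {T : measurableType d} {P : probability T R}.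
Variable A : R -> {RV P >-> R}.
Hypothesis hA : is_airy2 A.
Notation V := (space (R := R) 1).
Notation LF := (@log_fredholm R 1).
Notation F := (@fredholm_airy R 1).
Notation D := (ld (@rdir R tt)).

(** The k-th derivative of ln F_GUE, so that [log_tw 2] is psi^nw. *)
Definition log_tw k (s : R) : R := iter k D LF (pt s).

Let Fpos s : 0 < F (pt s) := fredholm_airy_pos hA (@distinct1 R (pt s)) (erefl _).

Let near_pt s := log_limit (@distinct1 R (pt s)) (erefl _) (Fpos s).

Let lo s e : line_open (@dir R 1) (cube (pt s) e) := plane_line_open (cube_plane_open (@dir_cc1 R 1)).

Lemma pt_line (s : R) : pt s = pt 0 + s *: rdir tt.
Proof.
apply: cc_inj => -[[i|i]|]; rewrite ccE cc_dir /= ?mulr0 ?addr0 //.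
by rewrite /rc /= !mxE [i]ord1 eqxx mulr1 add0r.
Qed.

Lemma log_tw_ld k s : is_ld (rdir tt) (iter k D LF) (pt s) (log_tw k.+1 s).
Proof.
have [e e0 [sm _ _ _]] := near_pt s.
have sk : smooth (@dir R 1) (cube (pt s) e) (iter k D LF).
  by elim: k => [|k IH] //=; exact: (smooth_ld (@lo s e) (Some (inr ord0)) IH).
exact: (smooth_diffb (@lo s e) sk (Some (inr ord0)) (cube_center (pt s) e0)).
Qed.

Lemma log_tw_derive k (s : R) : is_derive s 1 (log_tw k) (log_tw k.+1 s).
Proof.
have := log_tw_ld k s; rewrite pt_line => /is_ld_at; apply: drv_ext => t.
by rewrite -pt_line.
Qed.

Lemma log_tw_equation s : log_tw 5 s = 2 * log_tw 2 s - 12 * log_tw 2 s * log_tw 3 s + 4 * s * log_tw 3 s.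
Proof.
have [e e0 [sm _ K Y]] := near_pt s.
have E : @drsum R 1 = D by apply/funext => G; apply/funext => x; exact: big_ord1.
have sq : D (fun y => D (D LF) y ^+ 2) (pt s) = 2 * log_tw 2 s * log_tw 3 s.
  have -> : (fun y => D (D LF) y ^+ 2) = (fun y => D (D LF) y * D (D LF) y).
    by apply/funext => y; rewrite expr2.
  apply: is_ldE; have H := log_tw_ld 2 s; apply: is_ld_eq (is_ldM H H) _.
  have ar (x y : R) : y * x + x * y = 2 * x * y by ring.
  exact: ar.
have yc0 a : yc a (pt s) = 0 by rewrite /yc mxE.
have rcs : rc ord0 (pt s) = s by rewrite /rc mxE.
have := pde_single_point yc0 (limit_pde sm K Y (fun x _ => log_fredholm_kc x) (cube_center (pt s) e0)).
rewrite E => H.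
have ar2 (l2 l3 l5 q2 r : R) : l5 = 2 * l2 - 6 * q2 + 4 * (r * l3) -> q2 = 2 * l2 * l3 -> r = s ->
  l5 = 2 * l2 - 12 * l2 * l3 + 4 * s * l3.
  by move=> -> -> ->; ring.
exact: ar2 H sq rcs.
Qed.

Lemma log_tw_quotients s : log_tw 1 s * F (pt s) = D F (pt s) /\
  log_tw 2 s * F (pt s) = D (D F) (pt s) - D F (pt s) * log_tw 1 s.
Proof.
have [e e0 [sm pos _ _]] := near_pt s.
have s1 := smooth_ld (@lo s e) (Some (inr ord0)) sm.
have U := @lo s e.
have d0 x : cube (pt s) e x -> is_ld (rdir tt) LF x (D LF x).
  by move=> xe; exact: (smooth_diffb (@lo s e) sm (Some (inr ord0)) xe).
have FE x : cube (pt s) e x -> expR (LF x) = F x by move=> xe; rewrite /log_fredholm lnK // posrE pos.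
have dF x : cube (pt s) e x -> is_ld (rdir tt) F x (F x * D LF x).
  move=> xe; apply: is_ld_near (_ : is_ld _ (fun x => expR (LF x)) _ _).
    by have := U x (Some (inr ord0)) xe; apply: filterS => t te; exact: FE.
  by apply: is_ld_eq (drv_exp (d0 x xe)) _; rewrite scale0r addr0 FE.
have DFE x : cube (pt s) e x -> D F x = F x * D LF x by move=> xe; exact: is_ldE (dF x xe).
have c := cube_center (pt s) e0.
have dDF : D (D F) (pt s) = F (pt s) * D LF (pt s) * D LF (pt s) + F (pt s) * log_tw 2 s.
  apply: is_ldE; apply: is_ld_near (_ : is_ld _ (fun x => F x * D LF x) _ _).
    by have := U _ (Some (inr ord0)) c; apply: filterS => t te; rewrite DFE.
  exact: is_ldM (dF _ c) (log_tw_ld 1 s).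
have ar (f l f2 l2 : R) : f2 = f * l * l + f * l2 -> l2 * f = f2 - f * l * l by move=> ->; ring.
rewrite DFE //; split; first exact: mulrC.
exact: ar dDF.
Qed.

(** The error has to be small relative to Ai^2, since the solution is recognized by its ratio to Ai.
    Hence the separate bound on D F by a multiple of (s + 2) Ai^2, whose square is again Ai^2 times
    a decaying factor. *)
Lemma log_tw_asymptotics sg R0 : sg * sg = 1 -> 4 <= R0 -> (forall s, R0 <= s -> 0 < sairy sg 0 s) ->
  exists C K, exists2 R1, R0 <= R1 & forall s, R1 < s ->
  `|- log_tw 2 s - sairy sg 0 s ^+ 2| <= C * sairy sg 0 s ^+ 2 * expR (- s) /\
  (s + 2) ^+ 2 * sairy sg 0 s ^+ 2 <= K * expR (- s).
Proof.
move=> sgsg R04 a0; have [S S0 [R1 R01 H]] := one_point_asymptotics sgsg R04 a0.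
have [M HM] := large_exp_small S (ltac:(by []) : 0 < 2^-1 :> R).
exists (2 * (2 * S) + 4 * (S * S * S)), S, (Num.max R1 M); first by rewrite le_max R01.
move=> s; rewrite gt_max => /andP[Rs Ms]; have [h0 h1 h1' h2 h3] := H s Rs.
have [q1 q2] := log_tw_quotients s; have H1 := HM s (ltW Ms).
have s0 : 0 <= s + 2 by move: R04 R01 Rs; lra.
split; last by rewrite expr2 -mulrA.
have A0 : 0 <= sairy sg 0 s ^+ 2 by exact: sqr_ge0.
have E0 := expR_gt0 (- s).
move: h0 h1 h1' h2 h3 q1 q2 H1 E0; move: (F (pt s)) (D F (pt s)) (D (D F) (pt s)) (log_tw 1 s) (log_tw 2 s) => f f1 f2 l1 l2.
move: (sairy sg 0 s ^+ 2) A0 => a2 A0; move: (expR _) => E h0 h1 h1' h2 h3 q1 q2 E1 E0.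
have fge : 2^-1 <= f by move: h0; rewrite ler_norml => /andP[]; lra.
have f0 : 0 < f by lra.
have l1b : `|l1| <= 2 * `|f1|.
  rewrite -q1 normrM (gtr0_norm f0); have : 0 <= `|l1| by []; move: `|l1| => x x0; nra.
have f1l1 : `|f1 * l1| <= 2 * (S * S * S) * (a2 * E).
  rewrite normrM; apply: le_trans (ler_wpM2l (normr_ge0 _) l1b) _.
  have n0 : 0 <= `|f1| by [].
  have k := ler_pM n0 n0 h1' h1'.
  have k2 : (s + 2) * a2 * ((s + 2) * a2) <= S * E * a2.
    have -> : (s + 2) * a2 * ((s + 2) * a2) = (s + 2) * ((s + 2) * a2) * a2 by ring.
    exact: ler_wpM2r.
  have k3 := ler_wpM2l (mulr_ge0 S0 S0) k2.
  by move: k k3; move: `|f1| => x; lra.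
have num : `|f * (- l2 - a2)| <= (2 * S + 2 * (S * S * S)) * (a2 * E).
  have -> : f * (- l2 - a2) = - (f2 + a2) + (f1 * l1) + - (a2 * (f - 1)).
    have -> : f2 = l2 * f + f1 * l1 by rewrite q2 subrK.
    ring.
  apply: le_trans (ler_normD _ _) _; apply: le_trans (lerD (ler_normD _ _) (lexx _)) _.
  rewrite !normrN [`|a2 * _|]normrM (ger0_norm A0); have k := ler_wpM2l A0 h0.
  by move: h2 f1l1 k; move: `|f2 + a2| `|f1 * l1| (_ * `|f - 1|) => x y z; lra.
rewrite normrM (gtr0_norm f0) in num.
have aE : 0 <= a2 * E by rewrite mulr_ge0 // ltW.
have h : 2^-1 * `|- l2 - a2| <= f * `|- l2 - a2| by rewrite ler_wpM2r.
have ar (x z w : R) : x * z <= w -> 2^-1 * z <= x * z -> z <= 2 * w by lra.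
apply: le_trans (ar _ _ _ num h) _.
by rewrite le_eqVlt; apply/orP; left; apply/eqP; ring.
Qed.

Lemma log_tw2 q s : is_hastings_mcleod q -> log_tw 2 s = - q s ^+ 2.
Proof.
move=> hm; have [sg [R0 [sgsg R04 a0 uq uc]]] := hastings_mcleod_sign hm.
have [C [K [R1 R01 H]]] := log_tw_asymptotics sgsg R04 a0.
have dp k (t : R) : is_derive t 1 (fun s => - log_tw k s) (- log_tw k.+1 t) := drvN (log_tw_derive k t).
have dp2 (t : R) : is_derive t 1 (fun s => - log_tw 4 s)
   (12 * (- log_tw 2 t) * (- log_tw 3 t) + 4 * t * (- log_tw 3 t) + 2 * (- log_tw 2 t)).
  by apply: drv_eq (dp 4 t) _; rewrite log_tw_equation; move: (log_tw 2 t) (log_tw 3 t) => x y; ring.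
have := hastings_mcleod_identification hm sgsg R04 R01 a0 uq uc (dp 2) (dp 3) dp2
  (fun s hs => (H s hs).1) (fun s hs => (H s hs).2) s.
by move=> <-; rewrite opprK.
Qed.
End OnePointEquation.


Section Boundary.
Context {R : realType} {d : measure_display} {T : measurableType d} {P : probability T R}.
Variables (A : R -> {RV P >-> R}) (m : nat).
Hypothesis hA : is_airy2 A.
Implicit Types (r u : 'rV[R]_m.+1) (f : 'rV[R]_m.+1 -> R).
Notation "'\mn' r" := (\big[Order.min/r 0 ord0]_(a < m.+1) r 0 a) (at level 10, r at level 8).
Notation L := (@log_tw R).

Lemma row_min_le r a : \mn r <= r 0 a.
Proof. exact: bigmin_le_cond. Qed.

Lemma row_min_attained r : exists a, \mn r = r 0 a.
Proof.
elim/big_ind: _ => [|x y [a ->] [b ->]|a _]; [by exists ord0| |by exists a].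
by case: (leP (r 0 a) (r 0 b)); [exists a|exists b].
Qed.

Lemma le_row_min r x : x <= \mn r <-> forall a, x <= r 0 a.
Proof.
split=> [h a|h]; first exact: le_trans h (row_min_le r a).
by have [a ->] := row_min_attained r.
Qed.

Lemma row_min_unique r a : (forall b, r 0 a <= r 0 b) -> \mn r = r 0 a.
Proof. by move=> h; apply/eqP; rewrite eq_le row_min_le /=; apply/le_row_min. Qed.

(** At coinciding times the event says that one variable, [A 0], is at most every level. *)
Lemma log_cdf_boundary r : log_cdf A (0 : 'rV[R]_m) r = L 0 (\mn r).
Proof.
rewrite /log_cdf joint_cdfE /log_tw /= /log_fredholm; congr ln.
have -> : below A (fun i => yc i (emb (0 : 'rV[R]_m) r)) (fun i => r 0 i) =
    below A (fun i => yc i (pt (\mn r))) (fun i => rc i (pt (\mn r))).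
  have y0 i : yc i (emb (0 : 'rV[R]_m) r) = 0.
    by rewrite /yc mxE; case: unliftP => // j _; rewrite mxE.
  apply/seteqP; split => w /= h i; first by rewrite /yc /rc !mxE; apply/le_row_min => a; have := h a; rewrite y0.
  by rewrite y0; have := h ord0; rewrite /yc /rc !mxE => /le_row_min; exact.
by rewrite (law_below hA (@distinct1 R _)).
Qed.

Lemma log_tw_line k f r u s w : (\forall t \near (0 : R), L k (s + t * w) = f (r + t *: u)) ->
  derivable f r u /\ 'D_u f r = w * L k.+1 s.
Proof.
move=> H; apply: (@is_ld_line R m.+1 R^o (L k) s w) H _.
have E : is_derive (0 : R) 1 (fun t : R => s + t * w) w.
  by apply: drv_eq (drvD (drv_cst s 0) (drvM (drv_id 0) (drv_cst w 0))) _; rewrite mulr0 addr0 add0r mul1r.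
have E2 := log_tw_derive hA k (s + 0 * w); rewrite mulrC.
by have := drv_comp E E2; rewrite mul0r addr0.
Qed.

Lemma row_min_shift r t : \mn (r + t *: const_mx 1) = \mn r + t.
Proof.
have [a E] := row_min_attained r.
have -> : \mn (r + t *: const_mx 1) = (r + t *: const_mx 1) 0 a.
  by apply: row_min_unique => b; rewrite !mxE lerD2r -E row_min_le.
by rewrite !mxE mulr1 E.
Qed.

Lemma diagonal_derive k f r : (forall r, f r = L k (\mn r)) ->
  derivable f r (const_mx 1) /\ Ddiag f r = L k.+1 (\mn r).
Proof.
move=> H; rewrite -[L k.+1 _]mul1r; apply: log_tw_line; apply/nbhs_ballP; exists 1; [exact: ltr01|move=> t _].
by rewrite H row_min_shift mulr1.
Qed.

(** Near such a point only r_a matters, which makes the single partial derivatives available. *)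
Definition strict_min a r := forall b, b != a -> r 0 a < r 0 b.

Lemma strict_min_eq a r : strict_min a r -> \mn r = r 0 a.
Proof.
by move=> h; apply: row_min_unique => b; case: (eqVneq b a) => [->//|/h/ltW].
Qed.

Lemma strict_min_near a r c : strict_min a r -> \forall t \near (0 : R), strict_min a (r + t *: delta_mx 0 c).
Proof.
move=> h; have [|e e0 H] := @finite_lower_bound R _ (fun b => if b == a then 1 else r 0 b - r 0 a).
  by move=> b; case: eqVneq => // /h; rewrite subr_gt0.
apply/nbhs_ballP; exists e => // t; rewrite /ball /= sub0r normrN ltr_norml => /andP[t1 t2] b ba.
have := H b; rewrite (negbTE ba) !mxE !eqxx /=.
by case: (a == c); case: (b == c); rewrite ?mulr1 ?mulr0; lra.
Qed.

Lemma strict_partial k f a r c : (forall r, strict_min a r -> f r = L k (r 0 a)) -> strict_min a r ->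
  has_partial c f r /\ partial c f r = (c == a)%:R * L k.+1 (r 0 a).
Proof.
move=> H h; apply: log_tw_line; have := strict_min_near c h; apply: filterS => t ht.
by rewrite H // !mxE eqxx eq_sym.
Qed.

Lemma strict_Dr k f a r : (forall r, strict_min a r -> f r = L k (r 0 a)) -> strict_min a r ->
  Dr f r = L k.+1 (r 0 a).
Proof.
move=> H h; rewrite /Dr (bigD1 a) //= (strict_partial a H h).2 eqxx mul1r big1 ?addr0 // => c ca.
by rewrite (strict_partial c H h).2 (negbTE ca) mul0r.
Qed.

Lemma boundary q r : is_hastings_mcleod q ->
  [/\ derivable (log_cdf A 0) r (const_mx 1), derivable (Ddiag (log_cdf A 0)) r (const_mx 1),
      Ddiag (Ddiag (log_cdf A (0 : 'rV[R]_m))) r = - q (\mn r) ^+ 2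
    & forall a, strict_min a r ->
        [/\ forall c, has_partial c (log_cdf A 0) r, forall c, has_partial c (Psi A 0) r
          & psi A 0 r = - q (r 0 a) ^+ 2]].
Proof.
move=> hm; have D1 r' := diagonal_derive r' log_cdf_boundary.
have D2 := diagonal_derive r (fun r' => (D1 r').2).
rewrite -!(log_tw2 hA _ hm); split; [exact: (D1 r).1|exact: D2.1|exact: D2.2|move=> a h].
have S1 r' : strict_min a r' -> log_cdf A (0 : 'rV[R]_m) r' = L 0 (r' 0 a).
  by move=> h'; rewrite log_cdf_boundary (strict_min_eq h').
have S2 r' : strict_min a r' -> Psi A (0 : 'rV[R]_m) r' = L 1 (r' 0 a) by exact: strict_Dr.
split=> [c|c|]; [exact: (strict_partial c S1 h).1|exact: (strict_partial c S2 h).1|].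
by rewrite -(log_tw2 hA _ hm); exact: strict_Dr.
Qed.
End Boundary.

(** Positivity keeps [ln] within its domain, and [has_pde_derivatives] keeps the derivatives from
    being default values. The boundary condition is stated along the diagonal for all levels, and
    with [psi] itself where the minimum is attained once. *)
Theorem theorem2p5 (R : realType) (d : measure_display) (T : measurableType d)
    (P : probability T R) (A : R -> {RV P >-> R}) (hA : is_airy2 A)
    (m : nat) (hm : (1 <= m)%N) :
  [/\ forall (y : 'rV[R]_m) (r : 'rV[R]_m.+1), 0 < joint_cdf A y r,
      forall y : 'rV[R]_m,
        (forall a, y 0 a != 0) -> (forall a b, a != b -> y 0 a != y 0 b) ->
        has_pde_derivatives A y /\
        forall r : 'rV[R]_m.+1,
          - 6^-1 * psi A y r
          + 2^-1 * Dr (fun s => psi A y s ^+ 2) r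
          + 12^-1 * Dr (Dr (Dr (psi A y))) r
          - 3^-1 * \sum_(a < m.+1) r 0 a * partial a (psi A y) r
          - 2 / 3 * \sum_(a < m) y 0 a * partial a (fun y' => psi A y' r) y
          - \sum_(a < m) \sum_(b < m.+1 | b != lift ord0 a)
              y 0 a ^+ 2 * partial (lift ord0 a) (partial b (Psi A y)) r
          + \sum_(a < m) \sum_(b < m | b != a)
              y 0 a * y 0 b *
              partial (lift ord0 a) (partial (lift ord0 b) (Psi A y)) r
          = 0
    & forall q : R -> R, is_hastings_mcleod q ->
      forall r : 'rV[R]_m.+1,
        [/\ derivable (log_cdf A 0) r (const_mx 1),
            derivable (Ddiag (log_cdf A 0)) r (const_mx 1),
            Ddiag (Ddiag (log_cdf A (0 : 'rV[R]_m))) r =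
              - q (\big[Order.min/r 0 ord0]_(a < m.+1) r 0 a) ^+ 2
          & forall a, (forall b, b != a -> r 0 a < r 0 b) ->
              [/\ forall c, has_partial c (log_cdf A 0) r,
                  forall c, has_partial c (Psi A 0) r
                & psi A 0 r = - q (r 0 a) ^+ 2]]].
Proof.
split; first by move=> y r; exact: joint_cdf_pos.
  by move=> y y0 yy; exact: (joint_pde hA (conj y0 yy)).
by move=> q hq r; exact: boundary.
Qed.
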